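(* Let $n\ge 1$, let $F_2$ be the free group of rank $2$, and let $\Gamma=F_2^n$ be the $n$-fold direct product of copies of $F_2$. Then $\operatorname{obdim}(\Gamma)=\operatorname{updim}(\Gamma)=\operatorname{actdim}(\Gamma)=2n$, and all the inequalities in the chain $$\operatorname{obdim}(\Gamma)\leq \operatorname{updim}(\Gamma)\leq \operatorname{actdim}(\Gamma)\leq 2\operatorname{gdim}(\Gamma)$$ are equalities.
   Context: All (co)homology is with $\mathbb{Z}_2$ coefficients; simplicial complexes are identified with their geometric realizations. **Obstructor complexes.** Let $m\ge 0$ be an integer. A finite simplicial complex $K$ of dimension $\le m$ is an $m$-obstructor complex if: (1) there is a collection $\Sigma=\{\{\sigma_i,\tau_i\}\}_{i=1}^k$ of unordered pairs of disjoint simplices of $K$ with $\dim\sigma_i+\dim\tau_i=m$ which determines a cellular $m$-cycle over $\mathbb{Z}_2$ (the sum of the corresponding $m$-cells) in the cell complex $\bigl(\bigcup\{\sigma\times\tau\subset K\times K\mid \sigma\cap\tau=\emptyset\}\bigr)/\mathbb{Z}_2$, where $\mathbb{Z}_2$ acts by $(x,y)\mapsto(y,x)$; (2) for some (equivalently, any) general position map $f:K\to\mathbb{R}^m$ the finite number $\sum_{i=1}^k|f(\sigma_i)\cap f(\tau_i)|$ is odd; (3) for every $m$-simplex $\sigma$ of $K$ the number of vertices $v$ such that $\{\sigma,v\}\in\Sigma$ is even. (Here (1), (2), (3) refer to the same collection $\Sigma$.) **Cones and expanding maps.** For a finite complex $K$, $cone(K)=K\times[0,\infty)/K\times\{0\}$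 is the open cone. Triangulate $cone(K)$ so that $cone(\sigma)$ is a subcomplex for every simplex $\sigma$ of $K$, and give the vertex set $cone(K)^{(0)}$ the edge-path metric. A map is proper if preimages of compact sets are compact. Two maps $h_1:A_1\to B$, $h_2:A_2\to B$ into a metric space $B$ diverge if for every $D>0$ there are compact $C_i\subset A_i$ such that $h_1(A_1\setminus C_1)$ and $h_2(A_2\setminus C_2)$ are at distance $>D$. A proper map $h:cone(K)^{(0)}\to B$ is expanding if for all pairs of disjoint simplices $\sigma,\tau$ of $K$ the restrictions $h|cone(\sigma)^{(0)}$ and $h|cone(\tau)^{(0)}$ diverge. **Obstructor dimension.** Let $\Gamma$ be a finitely generated group with a word metric for some finite generating set. $\operatorname{obdim}(\Gamma)$ is $0$ if $\Gamma$ is finite, $1$ if $\Gamma$ is 2-ended, and otherwise $m+2$, where $m$ is the largest integer such that for some $m$-obstructor complex $K$ and some triangulation of $cone(K)$ in which $cone(\sigma)$ is a subcomplex for every simplex $\sigma$ of $K$ there exists a proper, Lipschitz, expanding map $cone(K)^{(0)}\to\Gamma$; if there is no largest such $m$, $\operatorname{obdim}(\Gamma)=\infty$. **Uniformly proper dimension.** A metric is proper if closed balls are compact. A proper map $h:A\to B$ between proper metric spaces is uniformly proper if there is a proper function $\phi:[0,\infty)\to[0,\infty)$ with $d_B(h(x),h(y))\ge\phi(d_A(x,y))$ for all $x,y\in A$. $\operatorname{updim}(\Gamma)$ is the smallest integer $n$ such that there is a contractible $n$-manifold $W$ equipped with a proper metric $d_W$, a Lipschitz, uniformly proper map $g:\Gamma\to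 W$, and a contractibility function $\rho:(0,\infty)\to(0,\infty)$ such that any ball of radius $r$ centered at a point of the image of $g$ is contractible in the ball of radius $\rho(r)$ centered at the same point. If no such $n$ exists, $\operatorname{updim}(\Gamma)=\infty$. **Action and geometric dimension.** $\operatorname{actdim}(\Gamma)$ is the smallest integer $n$ such that $\Gamma$ admits a properly discontinuous action on a contractible $n$-manifold ($\infty$ if no such $n$ exists). $\operatorname{gdim}(\Gamma)$ is the minimal $n$ such that $\Gamma$ admits a properly discontinuous action on a contractible $n$-complex. *)

(* Defs.v *)
From HB Require Import structures.
From mathcomp Require Import all_boot all_order all_algebra finmap.
From mathcomp Require Import all_classical all_reals all_analysis.

Set Implicit Arguments.
Unset Strict Implicit.
Unset Printing Implicit Defensive.

Import Order.TTheory GRing.Theory Num.Theory.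
Import numFieldTopology.Exports.

Local Open Scope classical_set_scope.
Local Open Scope ring_scope.
Local Open Scope quotient_scope.

(* A letter [(i, e)] is the generator number [i], inverted when [e] is [true]. *)
Definition letter : Type := (bool * bool)%type.
HB.instance Definition _ := Choice.on letter.

Definition linv (a : letter) : letter := (a.1, ~~ a.2).

Definition reduced (w : seq letter) : bool :=
  sorted (fun a b => b != linv a) w.

Definition push (a : letter) (w : seq letter) : seq letter :=
  if w is b :: w' then if b == linv a then w' else a :: w else [:: a].

Definition F2 : Type := {w : seq letter | reduced w}.
HB.instance Definition _ := Choice.on F2.

Lemma linvK : involutive linv.
Proof. by case=> a b; rewrite /linv /= negbK. Qed.

Lemma reduced_push a w : reduced w -> reduced (push a w).
Proof.
case: w => [|b w] //= rw; case: eqP => [_|/eqP nab]; first exact: path_sorted rw.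
by rewrite /reduced /= nab.
Qed.

Lemma reduced_foldr_push u w : reduced w -> reduced (foldr push w u).
Proof. by move=> rw; elim: u => //= a u IHu; apply: reduced_push. Qed.

Lemma pushK a w : reduced w -> push a (push (linv a) w) = w.
Proof.
case: w => [|b w] /=; first by rewrite eqxx.
rewrite linvK; case: eqP => [->|_] rw /=; last by rewrite eqxx.
by case: w rw => [|c w] //=; rewrite /reduced /= => /andP[/negPf -> _].
Qed.

Lemma foldr_push a u w : reduced w ->
  foldr push w (push a u) = push a (foldr push w u).
Proof.
move=> rw; case: u => [|b u] //=; case: eqP => [->|_] //=.
by rewrite pushK ?reduced_foldr_push.
Qed.

Lemma foldr_push_nil u : reduced u -> foldr push [::] u = u.
Proof.
elim: u => [|a u IHu] //= ru; rewrite IHu; last exact: path_sorted ru.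
by case: u ru {IHu} => [|b u] //=; rewrite /reduced /= => /andP[/negPf -> _].
Qed.

Lemma reduced_inv u : reduced u -> reduced (rev (map linv u)).
Proof.
move=> ru; rewrite /reduced rev_sorted sorted_map; apply: sub_sorted ru => a b /=.
by apply: contraNneq => ->; rewrite !linvK.
Qed.

Lemma foldr_push_inv u : reduced u -> foldr push u (rev (map linv u)) = [::].
Proof.
elim: u => [|a u IHu] //= ru.
by rewrite rev_cons -cats1 foldr_cat /= linvK eqxx IHu //; apply: path_sorted ru.
Qed.

Definition F2_one : F2 := exist _ [::] isT.
Definition F2_mul (u w : F2) : F2 :=
  exist _ (foldr push (val w) (val u)) (reduced_foldr_push _ (valP w)).
Definition F2_inv (u : F2) : F2 :=
  exist _ (rev (map linv (val u))) (reduced_inv (valP u)).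

Lemma F2_mulA : associative F2_mul.
Proof.
move=> u v w; apply: val_inj => /=; elim: (val u) => //= a s ->.
by rewrite foldr_push // (valP w).
Qed.

Lemma F2_mul1 : left_id F2_one F2_mul.
Proof. by move=> u; apply: val_inj. Qed.

Lemma F2_mulr1 : right_id F2_one F2_mul.
Proof. by move=> u; apply: val_inj; apply: foldr_push_nil (valP u). Qed.

Lemma F2_mulV : left_inverse F2_one F2_inv F2_mul.
Proof. by move=> u; apply: val_inj; apply: foldr_push_inv (valP u). Qed.

Lemma F2_invK : involutive F2_inv.
Proof.
move=> u; apply: val_inj; rewrite /= map_rev revK -map_comp.
by rewrite (eq_map (g := id)) ?map_id // => a; apply: linvK.
Qed.

Lemma F2_mulrV : right_inverse F2_one F2_inv F2_mul.
Proof. by move=> u; rewrite -{1}(F2_invK u) F2_mulV. Qed.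

HB.instance Definition _ :=
  isGroup.Build F2 F2_mulA F2_mul1 F2_mulr1 F2_mulV F2_mulrV.

Definition gpow (G : groupType) (n : nat) : Type := {ffun 'I_n -> G}.
HB.instance Definition _ G n := Choice.on (gpow G n).

Section PowerGroup.
Variables (G : groupType) (n : nat).
Implicit Types x y z : gpow G n.

Definition gpow_one : gpow G n := [ffun _ => 1%g].
Definition gpow_mul x y : gpow G n := [ffun i => (x i * y i)%g].
Definition gpow_inv x : gpow G n := [ffun i => (x i)^-1%g].

Lemma gpow_mulA : associative gpow_mul.
Proof. by move=> x y z; apply/ffunP => i; rewrite !ffunE mulgA. Qed.
Lemma gpow_mul1 : left_id gpow_one gpow_mul.
Proof. by move=> x; apply/ffunP => i; rewrite !ffunE mul1g. Qed.
Lemma gpow_mulr1 : right_id gpow_one gpow_mul.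
Proof. by move=> x; apply/ffunP => i; rewrite !ffunE mulg1. Qed.
Lemma gpow_mulV : left_inverse gpow_one gpow_inv gpow_mul.
Proof. by move=> x; apply/ffunP => i; rewrite !ffunE mulVg. Qed.
Lemma gpow_mulrV : right_inverse gpow_one gpow_inv gpow_mul.
Proof. by move=> x; apply/ffunP => i; rewrite !ffunE mulgV. Qed.

HB.instance Definition _ :=
  isGroup.Build (gpow G n) gpow_mulA gpow_mul1 gpow_mulr1 gpow_mulV gpow_mulrV.
End PowerGroup.

Fixpoint walk (A : Type) (e : A -> A -> Prop) (k : nat) (x y : A) : Prop :=
  if k is k'.+1 then exists2 z, e x z & walk e k' z y else x = y.

(* Least length of an [e]-path from [x] to [y]; the junk value 0 is only taken
   when there is no such path. *)
Definition path_dist (A : Type) (e : A -> A -> Prop) (x y : A) : nat :=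
  xget 0%N [set k | walk e k x y /\ forall l, walk e l x y -> (k <= l)%N].

Section WordMetric.
Variables (G : groupType) (S : seq G).

Definition generates : Prop :=
  forall H : set G, H 1%g -> (forall x y, H x -> H y -> H (x * y^-1)%g) ->
    (forall s, s \in S -> H s) -> H = setT.

Definition cayley (x y : G) : Prop :=
  exists2 s, s \in S & y = (x * s)%g \/ x = (y * s)%g.

Definition word_dist : G -> G -> nat := path_dist cayley.

Definition outside (r : nat) : set G := [set x | (r < word_dist 1%g x)%N].

Definition joined_outside (r : nat) (x y : G) : Prop :=
  exists k, walk (fun a b => [/\ cayley a b, outside r a & outside r b]) k x y.

(* Some ball has at least [k] infinite complementary components. *)
Definition at_least_ends (k : nat) : Prop :=
  exists (r : nat) (x : 'I_k -> G),
    (forall i, outside r (x i) /\ infinite_set [set y | joined_outside r (x i) y])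
    /\ (forall i j, i != j -> ~ joined_outside r (x i) (x j)).

Definition two_ended : Prop := at_least_ends 2 /\ ~ at_least_ends 3.

End WordMetric.

(* Every element of [V] is required to be a vertex, so that [V] is the vertex
   set of the complex; simplices are nonempty. *)
Record scomplex (V : choiceType) := SComplex {
  faces : set {fset V};
  faces_neq0 : forall s, faces s -> s != fset0;
  faces_sub : forall s t : {fset V},
    faces s -> (t `<=` s)%fset -> t != fset0 -> faces t;
  faces1 : forall v, faces [fset v]%fset }.

Section Realization.
Variables (R : realType) (V : choiceType) (K : scomplex V).

Definition bary : set (V -> R) :=
  [set x | exists2 s, faces K s &
    [/\ forall v, 0 <= x v, forall v, v \notin s -> x v = 0
      & \sum_(v <- s) x v = 1]].

Definition realization : Type := {x : V -> R | `[< bary x >]}.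
HB.instance Definition _ := gen_eqMixin realization.
HB.instance Definition _ := gen_choiceMixin realization.

Definition coord (x : realization) : V -> R := sval x.

Definition closed_face (s : {fset V}) : set realization :=
  [set x | forall v, v \notin s -> coord x v = 0].

(* The weak topology: a set is open iff it meets every closed simplex in an open
   subset of that simplex. *)
Definition realization_open (U : set realization) : Prop :=
  forall s, faces K s -> forall x, closed_face s x -> U x ->
    exists2 e : R, 0 < e &
      forall y, closed_face s y -> (forall v, `|coord y v - coord x v| < e) -> U y.

Lemma realization_openT : realization_open setT.
Proof. by move=> s _ x _ _; exists 1. Qed.

Lemma realization_openI A B :
  realization_open A -> realization_open B -> realization_open (A `&` B).
Proof.
move=> oA oB s Ks x sx [Ax Bx].
have [e e0 eA] := oA s Ks x sx Ax; have [d d0 dB] := oB s Ks x sx Bx.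
exists (Num.min e d); first by rewrite lt_min e0 d0.
move=> y sy yx; split; [apply: eA => // v | apply: dB => // v].
  by apply: lt_le_trans (yx v) _; rewrite ge_min lexx.
by apply: lt_le_trans (yx v) _; rewrite ge_min lexx orbT.
Qed.

Lemma realization_open_bigU (I : Type) (f : I -> set realization) :
  (forall i, realization_open (f i)) -> realization_open (\bigcup_i f i).
Proof.
move=> of_ s Ks x sx [i _ fix_]; have [e e0 ef] := of_ i s Ks x sx fix_.
by exists e => // y sy yx; exists i => //; apply: ef.
Qed.

HB.instance Definition _ := isOpenTopological.Build realization
  realization_openT realization_openI realization_open_bigU.

Lemma bary_vertex (v : V) : `[< bary (fun u => (u == v)%:R) >].
Proof.
apply/asboolP; exists [fset v]%fset; first exact: faces1.
split=> [u|u|]; first exact: ler0n.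
  by rewrite in_fset1 => /negPf ->.
by rewrite big_seq_fset1 eqxx.
Qed.

Definition vertex_pt (v : V) : realization :=
  exist (fun x => `[< bary x >]) _ (bary_vertex v).

Definition halfline : Type := set_type (`[0, +oo[ : set R).
HB.instance Definition _ := Topological.on halfline.

Definition cone_rel (p q : realization * halfline) : bool :=
  (p == q) || ((val p.2 == 0) && (val q.2 == 0)).

Lemma cone_rel_equiv : equiv_class_of cone_rel.
Proof.
split=> [p|p q|q p r].
- by rewrite /cone_rel eqxx.
- by rewrite /cone_rel eq_sym andbC.
- rewrite /cone_rel => /orP[/eqP ->//|/andP[p0 q0]] /orP[/eqP <-|/andP[_ r0]].
    by rewrite p0 q0 orbT.
  by rewrite p0 r0 orbT.
Qed.

Canonical cone_equiv := EquivRelPack cone_rel_equiv.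

(* |K| x [0, oo[ / |K| x {0} with the quotient topology. *)
Definition open_cone : Type := quotient_topology {eq_quot cone_equiv}.
HB.instance Definition _ := Topological.on open_cone.

Definition cone_pt (p : realization * halfline) : open_cone :=
  (\pi_{eq_quot cone_equiv} p)%qT.

Definition subcone (s : {fset V}) : set open_cone :=
  [set c | exists2 p, closed_face s p.1 & c = cone_pt p].

End Realization.

Definition homeomorphism (X Y : topologicalType) (f : X -> Y) : Prop :=
  continuous f /\
  exists g : Y -> X, [/\ continuous g, cancel f g & cancel g f].

(* [A] is contractible in [B]: the inclusion of [A] in [B] is homotopic, within
   [B], to a constant map. *)
Definition contractible_in (R : realType) (X : topologicalType) (A B : set X) :=
  exists (c : X) (H : X * R -> X),
    [/\ B c,
        {within A `*` `[0, 1], continuous H},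
        forall x t, A x -> 0 <= t <= 1 -> B (H (x, t))
      & forall x, A x -> H (x, 0) = x /\ H (x, 1) = c].

Definition contractible (R : realType) (X : topologicalType) :=
  @contractible_in R X setT setT.

Definition manifold (R : realType) (n : nat) (X : topologicalType) : Prop :=
  [/\ hausdorff_space X, @second_countable X &
    forall x : X, exists (U : set X) (O : set 'rV[R]_n),
      [/\ open U, U x, open O &
          exists f : set_type U -> set_type O, homeomorphism f]].

Section CW.
Variables (R : realType) (X : topologicalType).

Definition disc (k : nat) : set 'rV[R]_k :=
  [set x : 'rV[R]_k | \sum_i x 0 i ^+ 2 <= 1].
Definition open_disc (k : nat) : set 'rV[R]_k :=
  [set x : 'rV[R]_k | \sum_i x 0 i ^+ 2 < 1].
Definition sphere (k : nat) : set 'rV[R]_k :=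
  [set x : 'rV[R]_k | \sum_i x 0 i ^+ 2 = 1].

(* [cell_map e] is the characteristic map of the closed cell [e]; it is a
   homeomorphism from the open disc onto [open_cell e] because the closed disc is
   compact, [X] is Hausdorff and open cells are disjoint. *)
Record cw_structure := CWStructure {
  cell : Type;
  cell_dim : cell -> nat;
  cell_map : forall e, 'rV[R]_(cell_dim e) -> X;
  open_cell := fun e => @cell_map e @` @open_disc (cell_dim e);
  cw_hausdorff : hausdorff_space X;
  cell_map_continuous : forall e,
    {within @disc (cell_dim e), continuous (@cell_map e)};
  cell_map_inj : forall e,
    {in @open_disc (cell_dim e) &, injective (@cell_map e)};
  cells_partition : forall x, exists! e, open_cell e x;
  cells_closure_finite : forall e, exists F : set cell,
    [/\ finite_set F, forall f, F f -> (cell_dim f < cell_dim e)%N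
      & @cell_map e @` @sphere (cell_dim e) `<=` \bigcup_(f in F) open_cell f];
  cells_weak_topology : forall A : set X,
    (forall e, closed (@disc (cell_dim e) `&` @cell_map e @^-1` A)) -> closed A }.

Definition cw_dim (C : cw_structure) (n : nat) : Prop :=
  (forall e : cell C, (cell_dim e <= n)%N) /\ exists e : cell C, cell_dim e = n.

End CW.

Section Obstructor.
Variables (R : realType) (V : finType) (K : scomplex V).

Definition affine_map (m : nat) (p : V -> 'rV[R]_m) (x : realization R K) :
  'rV[R]_m := \sum_(v : V) coord x v *: p v.

(* Any at most m + 1 vertices have affinely independent images. *)
Definition general_position (m : nat) (p : V -> 'rV[R]_m) : Prop :=
  forall A : {set V}, (#|A| <= m.+1)%N -> forall c : V -> R,
    \sum_(v in A) c v = 0 -> \sum_(v in A) c v *: p v = 0 ->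
    forall v, v \in A -> c v = 0.

(* A cell of the deleted product modulo the involution is an unordered pair
   [fset s; t] of disjoint simplices. *)
Definition pair_cell (d : nat) (p : {fset {fset V}}) : Prop :=
  exists s t : {fset V},
    [/\ faces K s, faces K t, [disjoint s & t]%fset, p = [fset s; t]%fset
      & (#|` s|.-1 + #|` t|.-1)%N = d].

(* [q] is a codimension-one face of [p]; incidence numbers between such pairs
   are 0 or 1. *)
Definition pair_facet (q p : {fset {fset V}}) : Prop :=
  exists a s t : {fset V},
    [/\ q = [fset a; t]%fset, p = [fset s; t]%fset, (a `<=` s)%fset
      & #|` s| = #|` a|.+1].

Definition cellular_cycle (m : nat) (Sigma : {fset {fset {fset V}}}) : Prop :=
  (forall p, p \in Sigma -> pair_cell m p) /\
  (forall d q, d.+1 = m -> pair_cell d q ->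
     ~~ odd #|` [fset p in Sigma | `[< pair_facet q p >]]%fset|).

Definition image_meet (m : nat) (p : V -> 'rV[R]_m) (st : {fset {fset V}}) :
  set 'rV[R]_m :=
  \bigcap_(s in [set` st]) (affine_map p @` @closed_face R V K s).

(* Under [general_position] the sets [image_meet p st] below are finite (they
   have at most one point), so [fset_set] lists their points. *)
Definition obstructor (m : nat) : Prop :=
  (forall s, faces K s -> (#|` s|.-1 <= m)%N) /\
  exists Sigma : {fset {fset {fset V}}},
    [/\ cellular_cycle m Sigma,
        exists p : V -> 'rV[R]_m, general_position p /\
          odd (\sum_(st <- Sigma) #|` fset_set (image_meet p st)|)
      & forall s, faces K s -> #|` s|.-1 = m ->
          ~~ odd #|[set v : V | [fset s; [fset v]]%fset \in Sigma]|].

End Obstructor.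

Section Dimensions.
Variables (R : realType) (G : groupType) (S : seq G).

Definition cone_triangulation (V V' : choiceType) (K : scomplex V)
    (T : scomplex V') (phi : realization R T -> open_cone R K) : Prop :=
  homeomorphism phi /\
  forall s, faces K s -> exists L : set {fset V'},
    [/\ L `<=` faces T,
        forall t u : {fset V'}, L t -> (u `<=` t)%fset -> u != fset0 -> L u
      & phi @` (\bigcup_(t in L) @closed_face R V' T t) = @subcone R V K s].

Definition edge_dist (V' : choiceType) (T : scomplex V') : V' -> V' -> nat :=
  path_dist (fun u v => faces T [fset u; v]%fset).

(* Vertex sets and [G] are discrete, so their compact subsets are the finite
   ones; this is used in all the properness conditions below. *)
Definition diverge (A : Type) (A1 A2 : set A) (h : A -> G) : Prop :=
  forall D : R, 0 < D -> exists C1 C2 : set A,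
    [/\ finite_set C1, finite_set C2, C1 `<=` A1, C2 `<=` A2 &
        forall x y, (A1 `\` C1) x -> (A2 `\` C2) y ->
          D < (word_dist S (h x) (h y))%:R].

Definition proper_discrete (A : Type) (h : A -> G) : Prop :=
  forall C : set G, finite_set C -> finite_set (h @^-1` C).

Definition expanding (V V' : choiceType) (K : scomplex V) (T : scomplex V')
    (phi : realization R T -> open_cone R K) (h : V' -> G) : Prop :=
  let cone0 s := [set v | @subcone R V K s (phi (vertex_pt R T v))] in
  forall s t : {fset V}, faces K s -> faces K t -> [disjoint s & t]%fset ->
    diverge (cone0 s) (cone0 t) h.

Definition obstructor_maps_to (m : nat) : Prop :=
  exists (V : finType) (K : scomplex V) (V' : choiceType) (T : scomplex V')
    (phi : realization R T -> open_cone R K) (h : V' -> G),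
    [/\ obstructor R K m, cone_triangulation phi, proper_discrete h,
        exists L : R, forall u v,
          (word_dist S (h u) (h v))%:R <= L * (edge_dist T u v)%:R
      & expanding phi h].

Definition obdim : \bar R :=
  if `[< finite_set [set: G] >] then 0%E
  else if `[< two_ended S >] then 1%E
  else ereal_sup [set x | exists2 m, obstructor_maps_to m & x = (m.+2)%:R%:E].

Definition proper_metric (W : metricType R) : Prop :=
  forall (x : W) (r : R), compact [set y | mdist x y <= r].

Definition proper_fun (phi : R -> R) : Prop :=
  (forall t, 0 <= t -> 0 <= phi t) /\
  forall C : set R, C `<=` `[0, +oo[ -> compact C ->
    compact (`[0, +oo[ `&` phi @^-1` C).

Definition uniformly_proper (W : metricType R) (g : G -> W) : Prop :=
  (forall C : set W, compact C -> finite_set (g @^-1` C)) /\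
  exists2 phi, proper_fun phi &
    forall x y, phi (word_dist S x y)%:R <= mdist (g x) (g y).

Definition updim_le (n : nat) : Prop :=
  exists (W : metricType R) (g : G -> W) (rho : R -> R),
    [/\ manifold R n W /\ contractible R W,
        proper_metric W,
        exists L : R, forall x y,
          mdist (g x) (g y) <= L * (word_dist S x y)%:R,
        uniformly_proper g
      & forall r, 0 < r -> 0 < rho r /\
          forall x, contractible_in R (ball (g x) r) (ball (g x) (rho r))].

Definition updim : \bar R :=
  ereal_inf [set x | exists2 n, updim_le n & x = n%:R%:E].

Definition properly_discontinuous (X : topologicalType) (a : G -> X -> X) :=
  [/\ forall x, a 1%g x = x,
      forall g h x, a (g * h)%g x = a g (a h x),
      forall g, continuous (a g)
    & forall C : set X, compact C ->
        finite_set [set g | (a g @` C) `&` C !=set0]].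

Definition actdim : \bar R :=
  ereal_inf [set x | exists2 n,
    (exists (X : topologicalType) (a : G -> X -> X),
       [/\ manifold R n X, contractible R X & properly_discontinuous a])
    & x = n%:R%:E].

(* A group acts on a complex by homeomorphisms that permute the open cells. *)
Definition gdim : \bar R :=
  ereal_inf [set x | exists2 n,
    (exists (X : topologicalType) (C : cw_structure R X) (a : G -> X -> X),
       [/\ cw_dim C n, contractible R X, properly_discontinuous a &
           forall g e, exists e', a g @` @open_cell R X C e = @open_cell R X C e'])
    & x = n%:R%:E].

End Dimensions.

(* Main.v *)
(* The n-fold join of three points is a (2n-2)-obstructor; its open cone is a
   product of n tripods and embeds in F_2^n along the powers of three letters.
   Conversely, if an m-obstructor cone expands into G and G is controlled by a
   contractible space W whose compact subsets map to d-manifolds with small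
   fibres, then d >= m+2: otherwise the map of the cone extends over W and
   distinct faces of the deleted join would never meet, whereas the equivariant
   cohomology of the configuration space of a d-manifold (in Alexander-Spanier
   cochains) is too small for the mod 2 Van Kampen class to survive. Here F_2
   acts on positive definite binary quadratic forms of determinant 1, a plane
   with an invariant proper metric, and on its tree; a k-dimensional complex is
   mapped to R^(2k+1) with small fibres by points of the moment curve. *)
Require Import Defs.
From HB Require Import structures.
From mathcomp Require Import all_boot all_order all_algebra finmap.
From mathcomp Require Import all_classical all_reals all_analysis.
From mathcomp Require Import lra ring zify.

Set Implicit Arguments.
Unset Strict Implicit.
Unset Printing Implicit Defensive.

Import Order.TTheory GRing.Theory Num.Theory.
Import numFieldNormedType.Exports.

Local Open Scope classical_set_scope.
Local Open Scope ring_scope.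



(** A cochain is an arbitrary boolean function on sequences of points, so discontinuous choices
    (grid labels, orbit representatives, sections) are admissible and a topological manifold need
    not be triangulated. The price is that identities hold only near compact sets, so vanishing may
    require a larger compact set. The class in question is a power of the degree-one class of the
    double cover of unordered by ordered pairs of distinct points. Above degree [2d] it is the
    coboundary of an invariant cochain, because pairs have charts with [2d] coordinates; a transfer
    lowers this degree step by step to [d], since contracting one point of the pair leaves a
    punctured manifold, without cohomology from degree [d] on. On the combinatorial side the same
    power is the parity of intersections under a generic linear map. Two equivariant systems of
    primitives that start with the constant 1 differ by an invariant coboundary, which identifies
    both sides. The deleted join is preferred to the deleted product as it lies in a vector space
    with antipodal involution; condition (3) on obstructors accounts for its extra faces. *)

Ltac is_atom a := lazymatch a with
 true => fail | false => fail | addb _ _ => fail | negb _ => fail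
 | andb _ _ => fail | _ => idtac end.
Ltac xorb := rewrite /=; repeat match goal with
 | |- context [addb ?a _] => is_atom a; case: a
 | |- context [addb _ ?a] => is_atom a; case: a
 | |- context [andb ?a _] => is_atom a; case: a
 | |- context [andb _ ?a] => is_atom a; case: a
 | |- context [negb ?a] => is_atom a; case: a
 end => //=.

(** * Ordered mod 2 cochains, coboundaries and prisms *)

Section Cochains.
Variable X : Type.
Implicit Types (c d : seq X -> bool) (s t : seq X) (U : set X).

(** Unfolds to the sum of [c] over all deletions of one entry. The value at [[::]] takes part, so
    the complex is augmented, and sequences of length [k] carry the degree [k - 1]. *)
Fixpoint delta c s : bool :=
 if s is x :: s' then c s' (+) delta (fun t => c (x :: t)) s' else false.

Fixpoint all_in U s : Prop := if s is x :: s' then U x /\ all_in U s' else True.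

Lemma all_inS U V s : U `<=` V -> all_in U s -> all_in V s.
Proof. by move=> UV; elim: s => //= x s IHs [/UV ? /IHs]. Qed.

Lemma all_inT s : all_in setT s.
Proof. by elim: s. Qed.

Lemma delta_ext U c d s :
 (forall t, (size t).+1 = size s -> all_in U t -> c t = d t) ->
 all_in U s -> delta c s = delta d s.
Proof.
elim: s c d => //= x s IHs c d cd [Ux Us]; rewrite cd //; congr (_ _).
by apply: IHs => // t [st] Ut; apply: cd => //=; rewrite st.
Qed.

Lemma eq_delta c d : c =1 d -> delta c =1 delta d.
Proof.
by move=> cd s; apply: delta_ext; last exact: all_inT.
Qed.

Lemma deltaD c d s :
 delta (fun t => c t (+) d t) s = delta c s (+) delta d s.
Proof.
elim: s c d => //= x s IHs c d; rewrite IHs; xorb.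
Qed.

Lemma delta0 s : delta (fun=> false) s = false.
Proof. by elim: s. Qed.

Lemma deltaK c s : delta (delta c) s = false.
Proof.
elim: s c => //= x s IHs c; rewrite deltaD IHs.
by case: (delta c s).
Qed.

End Cochains.

Section Maps.
Variables X Y : Type.
Implicit Types (c : seq Y -> bool) (s : seq X).

Lemma delta_map f c s : delta (fun t => c (map f t)) s = delta c (map f s).
Proof. by elim: s c => //= x s IHs c; rewrite (IHs (fun t => c (f x :: t))). Qed.

Lemma allin_map f (U : set Y) s : all_in U (map f s) <-> all_in (f @^-1` U) s.
Proof. by elim: s => //= x s ->. Qed.

(** Unfolds to the sum over [i] of [c] at [f x_0, ..., f x_i, g x_i, ..., g x_k]. *)
Fixpoint prism (f g : X -> Y) c s : bool :=
 if s is x :: s' then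
  c (f x :: g x :: map g s') (+) prism f g (fun t => c (f x :: t)) s'
 else false.

Lemma prismD f g c d s :
 prism f g (fun t => c t (+) d t) s = prism f g c s (+) prism f g d s.
Proof. elim: s c d => //= x s IHs c d; rewrite IHs; xorb. Qed.

Lemma prism_ext U f g c d s :
 (forall t, size t = (size s).+1 -> all_in U t -> c t = d t) ->
 all_in U (map f s) -> all_in U (map g s) -> prism f g c s = prism f g d s.
Proof.
elim: s c d => //= x s IHs c d cd [Uf Ufs] [Ug Ugs].
rewrite cd /= ?size_map //; congr (_ _).
by apply: IHs => // t st Ut; apply: cd => //=; rewrite st.
Qed.

(* The prism operator is a homotopy between the pullbacks along [f] and [g]. *)
Lemma prismP f g c s :
 delta (prism f g c) s (+) prism f g (delta c) s
 = c (map g s) (+) c (map f s).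
Proof.
elim: s c => [|x s IHs] c /=; first by case: (c [::]).
rewrite prismD deltaD (delta_map g (fun t => c (f x :: g x :: t))).
move: (IHs (fun t => c (f x :: t))); xorb.
Qed.

Lemma prism0 f g s : prism f g (fun=> false) s = false.
Proof. by elim: s. Qed.

End Maps.

Section CupDegreeOne.
Variables (X : Type) (s0 : X -> bool).

(* [head_mul c] and [cup1 c] are the cup products of [c] with the 0-cochain
  [s0] and with its delta. *)
Definition head_mul (c : seq X -> bool) (s : seq X) : bool :=
 if s is x :: _ then s0 x && c s else false.
Definition cup1 (c : seq X -> bool) (s : seq X) : bool :=
 if s is x :: (y :: _) as s' then (s0 x (+) s0 y) && c s' else false.

(** The Leibniz rule. On sequences of length one it fails because of the augmentation. *)
Lemma delta_head_mul c s : (1 < size s)%N ->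
 delta (head_mul c) s = cup1 c s (+) head_mul (delta c) s.
Proof.
case: s => [|x [|y s]] // /=.
have -> : forall b (d : seq X -> bool) u,
  delta (fun t => b && d t) u = b && delta d u.
 by move=> b d u; case: b => //=; rewrite delta0.
xorb.
Qed.

End CupDegreeOne.

(** If [P] failed on [K], the sets [A] for which [P] holds on [K] minus [A] would form a proper
    filter, and a cluster point of it contradicts the local hypothesis. This replaces finite
    subcovers throughout. *)
Lemma compact_ind (X : topologicalType) K (P : set X -> Prop) : compact K -> P set0 -> (forall A B, P A -> P B -> P (A
 `|` B)) -> (forall A B, A `<=` B -> P B -> P A) -> (forall x, K x -> exists2 U, nbhs x U & P (U `&` K)) -> P K.
Proof.
move=> cK P0 PU PS loc; apply: contrapT => nPK.
have FF : ProperFilter (fun A => P (K `\` A)).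
 apply: Build_ProperFilter_ex; last first.
  split.
  - by apply: PS P0 => x [_ []].
  - by move=> A B PA PB; apply: PS (PU _ _ PA PB) => x [Kx nAB]; have [Ax|nAx] := pselect (A x); [right|left]; split=> //
   Bx; apply: nAB.
  - by move=> A B AB; apply: PS => x [Kx nB]; split=> // /AB.
 by move=> A PA; apply: contrapT => nA; apply: nPK; apply: PS PA => x; split=> // Ax; apply: nA; exists x.
have [] := cK _ FF; first by apply: PS P0 => x [].
move=> x [Kx clx]; have [U xU PU'] := loc x Kx.
have [|y []] // := clx (~` U) U _ xU.
by apply: PS PU' => y [Ky /contrapT].
Qed.

Lemma compact_separated (X : topologicalType) (A B : set X) :
 hausdorff_space X -> compact A -> compact B -> A `&` B = set0 ->
 exists U V, [/\ open U, open V, A `<=` U, B `<=` V & U `&` V = set0].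
Proof.
move=> hX cA cB AB0.
pose sep C D := exists U V : set X,
 [/\ open U, open V, C `<=` U, D `<=` V & U `&` V = set0].
have sep0 D : sep set0 D.
 exists set0, setT; split; [exact: open0|exact: openT| | |exact: set0I] => //.
have sepC C D : sep C D -> sep D C.
 by move=> [U [V [oU UV]]]; exists V, U; rewrite setIC.
have sepU C C' D : sep C D -> sep C' D -> sep (C `|` C') D.
 move=> [U [V [oU oV CU DV UV]]] [U' [V' [oU' oV' CU' DV' UV']]].
 exists (U `|` U'), (V `&` V'); split.
 - exact: openU.
 - exact: openI.
 - by move=> x [Cx|Cx]; [left; apply: CU|right; apply: CU'].
 - split; first exact: DV; exact: DV'.
 - rewrite -subset0 => x [[Ux|Ux] [Vx Vx']].
   by rewrite -UV.
  by rewrite -UV'.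
have sepS C C' D : C `<=` C' -> sep C' D -> sep C D.
 move=> CC' [U [V [oU oV CU UV]]]; exists U, V; split=> //.
 exact: subset_trans CU.
have sep1 x y : x != y -> sep [set x] [set y].
 move=> xy; move: hX; rewrite open_hausdorff => /(_ _ _ xy) [[U V] [xU yV] [oU UV]].
 exists U, V; split=> //; last by apply/eqP.
  by move=> _ ->; rewrite inE in xU.
 by move=> _ ->; rewrite inE in yV.
apply: (@compact_ind _ A (sep^~ B)) => //.
- move=> C D; apply: sepU.
- move=> C D; apply: sepS.
move=> x Ax; have sBx : sep B [set x].
 apply: (@compact_ind _ B (sep^~ [set x])) => //.
 - move=> C D; apply: sepU.
 - move=> C D; apply: sepS.
 move=> y By; have xy : x != y.
  by apply/eqP => xy; have : set0 x by rewrite -AB0; split=> //; rewrite xy.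
 have [U [V [oU oV CU DV UV]]] := sep1 _ _ xy.
 exists V; first by apply: open_nbhs_nbhs; split=> //; apply: DV.
 by exists V, U; split=> //; rewrite setIC.
have [U [V [oU oV CU DV UV]]] := sBx.
exists V; first by apply: open_nbhs_nbhs; split=> //; apply: DV.
by exists V, U; split=> //; rewrite setIC.
Qed.

(** * Germs of cochains along a set, and their gluing *)

Section Germs.
Variables (X : topologicalType) (S : set X).
Implicit Types (A B : set X) (c d e : seq X -> bool) (k : nat).

(* [c] and [d] agree as Alexander-Spanier cochains of degree [k - 1] of the
  pair ([S], germ of [A]). *)
Definition near_eq k A c d : Prop :=
 forall x, A x -> exists2 U, nbhs x U &
  forall t, size t = k -> all_in (U `&` S) t -> c t = d t.

Lemma neq_all k A c d :
 (forall t, size t = k -> all_in S t -> c t = d t) -> near_eq k A c d.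
Proof.
move=> cd x _; exists setT; first exact: filterT.
by move=> t st At; apply: cd => //; apply: all_inS At => [].
Qed.

Lemma near_eq_sym k A c d : near_eq k A c d -> near_eq k A d c.
Proof.
by move=> cd x /cd [U xU Ucd]; exists U => // t st Ut; rewrite Ucd.
Qed.

Lemma neq_trans k A d c e :
 near_eq k A c d -> near_eq k A d e -> near_eq k A c e.
Proof.
move=> cd de x Ax; have [U xU Ucd] := cd x Ax; have [V xV Vde] := de x Ax.
exists (U `&` V) => [|t st UVt]; first exact: filterI.
rewrite Ucd ?Vde //.
 by apply: all_inS UVt => y [[]].
by apply: all_inS UVt => y [[]].
Qed.

Lemma near_eqS k A B c d : A `<=` B -> near_eq k B c d -> near_eq k A c d.
Proof. by move=> AB cd x /AB /cd. Qed.

Lemma near_eqU k A B c d :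
 near_eq k A c d -> near_eq k B c d -> near_eq k (A `|` B) c d.
Proof. by move=> cA cB x [/cA|/cB]. Qed.

Lemma near_eqD k A c d c' d' : near_eq k A c d -> near_eq k A c' d' ->
 near_eq k A (fun t => c t (+) c' t) (fun t => d t (+) d' t).
Proof.
move=> cd cd' x Ax; have [U xU Ucd] := cd x Ax; have [V xV Vcd] := cd' x Ax.
exists (U `&` V) => [|t st UVt]; first exact: filterI.
rewrite Ucd ?Vcd //.
 by apply: all_inS UVt => y [[]].
by apply: all_inS UVt => y [[]].
Qed.

Lemma neq_delta k A c d :
 near_eq k A c d -> near_eq k.+1 A (delta c) (delta d).
Proof.
move=> cd x /cd [U xU Ucd]; exists U => // t st Ut.
by apply: (delta_ext _ Ut) => u; rewrite st => -[su] Uu; apply: Ucd.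
Qed.

Lemma near_eq_open k A c d : near_eq k A c d -> exists G, [/\ open G, A `<=` G & near_eq k G c d].
Proof.
pose G := [set x : X | exists2 U, nbhs x U & forall t, size t = k -> all_in (U `&` S) t -> c t = d t].
exists G; split=> //; rewrite openE => x [U xU Ucd].
have : nbhs x U° by exact: nbhs_interior.
apply: filterS => Uy; exists U => //.
Qed.

End Germs.

Section Glue.
Variables (X : topologicalType) (S : set X) (T : X -> X).
Hypotheses (TK : involutive T) (cT : continuous T) (TS : forall x, S x -> S (T x)).
Implicit Types (A B : set X) (c d e : seq X -> bool) (k : nat).

Definition inv_cochain c : Prop := forall t, c (map T t) = c t.

Lemma near_eq_invariant k A c d : inv_cochain c -> inv_cochain d ->
 near_eq S k A c d -> near_eq S k (T @^-1` A) c d.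
Proof.
move=> ic id cd x /cd [U TxU Ucd]; exists (T @^-1` U); first exact: cT.
move=> t st Ut; rewrite -ic -id; apply: Ucd; first by rewrite size_map.
by apply/allin_map; apply: all_inS Ut => y [Uy Sy]; split=> //; apply: TS.
Qed.

(** Cut and paste by the first entry of a sequence, whence [0 < k]: the result is [c] if that entry
    lies in an invariant open set around the part of [A] where [c] and [d] may differ, and [d]
    otherwise. *)
Lemma glue_cochains k A B c d : (0 < k)%N -> hausdorff_space X -> compact A -> compact B ->
 (forall x, A x -> A (T x)) -> (forall x, B x -> B (T x)) ->
 inv_cochain c -> inv_cochain d -> near_eq S k (A `&` B) c d ->
 exists e, [/\ inv_cochain e, near_eq S k A e c & near_eq S k B e d].
Proof.
move=> k0 hX cA cB TA TB ic id cd.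
have [G0 [oG0 ABG0 Gcd0]] := near_eq_open cd.
pose G := G0 `|` T @^-1` G0.
have oG : open G by apply: openU => //; apply: open_comp => //.
have TG x : G x -> G (T x) by move=> [?|?]; [right; rewrite /= TK|left].
have Gcd : near_eq S k G c d by apply: near_eqU => //; apply: near_eq_invariant.
have cAG : compact (A `&` ~` G).
 by apply: compact_closedI => //; rewrite closedC.
have cBG : compact (B `&` ~` G).
 by apply: compact_closedI => //; rewrite closedC.
have [|U [V [oU oV AU BV UV]]] := compact_separated hX cAG cBG.
 rewrite -subset0 => x [[Ax nG] [Bx _]]; apply: nG; left; exact: ABG0.
(* [U] is enlarged by its mirror image and [V] shrunk to its symmetric part: both become invariant
   and remain disjoint. *)
pose U' := U `|` T @^-1` U; pose V' := V `&` T @^-1` V.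
have TU' x : U' x <-> U' (T x).
 rewrite /U' /= TK; tauto.
have oU' : open U' by apply: openU => //; apply: open_comp => //.
have oV' : open V' by apply: openI => //; apply: open_comp => //.
have UV' x : U' x -> ~ V' x.
 move=> Ux [Vx VTx]; rewrite -[False]/(set0 x).
 case: Ux => [Ux|UTx]; first by rewrite -UV.
 by have : set0 (T x) by rewrite -UV.
have TU'E x : `[< U' (T x) >] = `[< U' x >] by apply: asbool_equiv_eq; split=> ?; apply/TU'; rewrite ?TK.
pose e t := if t is x :: _ then if `[< U' x >] then c t else d t else false.
exists e; split.
- by case=> [//|x t]; rewrite /= TU'E -[T x :: _]/(map T (x :: t)) ic id.
- move=> x Ax; have [Gx|nGx] := pselect (G x).
  have [W xW Wcd] := Gcd x Gx; exists W => // -[|y t] st Wt.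
   by move: k0; rewrite -st.
  by rewrite /e; case: ifP => _; rewrite Wcd.
 exists U' => [|[|y t] st Wt].
 + by apply: open_nbhs_nbhs; split=> //; left; apply: AU.
 + by move: k0; rewrite -st.
 + by case: Wt => -[Uy _] _; rewrite /e asboolT.
- move=> x Bx; have [Gx|nGx] := pselect (G x).
  have [W xW Wcd] := Gcd x Gx; exists W => // -[|y t] st Wt.
   by move: k0; rewrite -st.
  by rewrite /e; case: ifP => // _; rewrite Wcd.
 exists V' => [|[|y t] st Wt].
 + by apply: open_nbhs_nbhs; split=> //; split; first exact: BV; apply: BV; split; [exact: TB|move=> /TG; rewrite TK].
 + by move: k0; rewrite -st.
 + by case: Wt => -[Vy _] _; rewrite /e asboolF // => /UV'.
Qed.

End Glue.

(** * Vanishing of cohomology above the dimension *)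

Section ColoredNerve.
Variable L : eqType.
Implicit Types (a : L) (g c : seq L -> bool) (s t : seq L).

Lemma all_inP U s : all_in U s <-> forall x, x \in s -> U x.
Proof.
elim: s => [|y s IHs] //=; rewrite IHs; split=> [[Uy Us] x|Us].
 by rewrite inE => /predU1P[->//|/Us].
by split=> [|x xs]; apply: Us; rewrite inE ?eqxx // xs orbT.
Qed.

Definition del a s := [seq x <- s | x != a].

Lemma del_id a s : a \notin s -> del a s = s.
Proof.
by move=> as_; apply/all_filterP/allP => y ys; apply: contraNneq as_ => <-.
Qed.

Lemma delta_del_notin a g s : a \notin s ->
 delta (fun t => g (del a t)) s = delta g s.
Proof.
elim: s g => //= x s IHs g; rewrite negb_or eq_sym => /andP[xa as_].
by rewrite xa del_id // -(IHs (fun t => g (x :: t))).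
Qed.

(** If [a] occurs in [s], a deletion avoids [a] only when [a] occurs once and is the deleted
    entry. *)
Lemma delta_notin a g s :
 delta (fun t => (a \notin t) && g t) s =
 if a \notin s then delta g s
 else (count_mem a s == 1%N) && g (del a s).
Proof.
elim: s g => //= x s IHs g.
have -> : delta (fun t => (a \notin x :: t) && g (x :: t)) s =
  (a != x) && delta (fun t => (a \notin t) && g (x :: t)) s.
 case: eqVneq => [->|ax] /=.
  by rewrite -(delta0 s); apply: eq_delta => t; rewrite inE eqxx.
 by apply: eq_delta => t; rewrite inE (negPf ax).
rewrite IHs inE [del _]/=; case: (eqVneq a x) => [<-|ax].
 rewrite eqSS addbF; case: (boolP (a \in s)) => [|as_].
  by rewrite -has_pred1 has_count lt0n => /negPf ->.
 by rewrite (count_memPn as_) del_id.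
case: (a \in s) => //=.
Qed.

Lemma delta_count1 a g s :
 delta (fun t => (count_mem a t == 1%N) && g (del a t)) s =
 (count_mem a s == 1%N) && delta g (del a s).
Proof.
have count0 t : (count_mem a t == 0) = (a \notin t).
 by rewrite -[LHS]negbK -lt0n -has_count has_pred1.
elim: s g => //= x s IHs g; have [->|xa] := eqVneq x.
 rewrite eqSS count0.
 under eq_delta => t do rewrite eqSS count0.
 rewrite (delta_notin a (fun t => g (del a t))).
 case: (boolP (a \in s)) => as_ /=; last first.
  by rewrite delta_del_notin // del_id // (count_memPn as_).
 by rewrite [del a (del a s)]del_id ?addbb // mem_filter eqxx.
by rewrite (IHs (fun t => g (x :: t))); case: (_ 1).
Qed.

Variable color : L -> nat.

(** Simplices have at most one vertex of each of the [r] colors, hence dimension below [r], while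
    [c] has degree [k - 1 >= r]. Induction removes the top color: sequences without top vertex are
    solved first, then the links of the top vertices. The primitive is built locally, so one choice
    serves all [B]. *)
Lemma colored_nerve_vanishing r k (adm : seq L -> Prop) c : (r < k)%N -> (forall s t, {subset t <= s} -> adm s -> adm t)
 -> (forall s a b, adm s -> a \in s -> b \in s -> color a = color b -> a = b) -> (forall s a, adm s -> a \in s -> (color
  a < r)%N) -> (forall s, size s = k.+1 -> adm s -> delta c s = false) -> exists psi, (forall s, size s = k -> adm s ->
   delta psi s = c s) /\ forall B, (forall s, size s = k -> adm s -> all_in B s -> c s = false) -> forall s, size s =
    k.-1 -> adm s -> all_in B s -> psi s = false.
Proof.
elim: r k adm c => [|r IHr] k adm c rk admS col1 colr dc.
 exists (fun=> false); split=> // -[|a s] sk ads.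
  by move: rk; rewrite -sk.
 by have := colr _ a ads; rewrite mem_head => /(_ isT).
pose top s := [seq a <- s | color a == r].
have toplow s a : adm s -> top s = [::] -> a \in s -> (color a < r)%N.
 move=> ads tops as_; rewrite ltn_neqAle -ltnS (colr _ _ ads as_) andbT.
 apply/negP => ar; have : a \in top s by rewrite mem_filter ar.
 by rewrite tops.
have topmem s a u : top s = a :: u -> a \in s /\ color a = r.
 move=> tops; have : a \in top s by rewrite tops mem_head.
 by rewrite mem_filter => /andP[/eqP].
have topS s a t : adm s -> a \in s -> color a = r -> {subset t <= s} ->
  if a \in t then exists u, top t = a :: u else top t = [::].
 move=> ads as_ ar ts; case: ifP => at_.
  have : a \in top t by rewrite mem_filter ar eqxx.
  by case tt: (top t) => [//|b u] _; exists u; congr (_ :: _); have [bt br] := topmem _ _ _ tt; apply: (col1 s) => //;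
   [exact: ts|rewrite br].
 by case tt: (top t) => [//|b u]; have [bt br] := topmem _ _ _ tt; rewrite (col1 s a b) ?bt ?br // in at_; apply: ts.
pose adm1 s := adm s /\ top s = [::].
have [psi1 [psi1P psi10]] : exists psi, (forall s, size s = k -> adm1 s -> delta psi s = c s) /\ forall B, (forall s,
 size s = k -> adm1 s -> all_in B s -> c s = false) -> forall s, size s = k.-1 -> adm1 s -> all_in B s -> psi s = false.
 apply: IHr => //; first exact: ltnW.
 - by move=> s t ts [ads tops]; split; first exact: admS ads; case tt: (top t) => [//|b u]; have [bt br] := topmem _ _ _
  tt; have := toplow _ b ads tops (ts _ bt); rewrite br ltnn.
 - by move=> s a b [ads _]; apply: col1.
 - by move=> s a [ads tops]; apply: toplow.
 - by move=> s sk [ads _]; apply: dc.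
pose adma a s := adm (a :: s) /\ a \notin s.
have top0 a s : color a = r -> adma a s -> top s = [::].
 by move=> ar [ads /negPf as_]; have := topS _ a s ads (mem_head _ _) ar; rewrite as_; apply=> b bs; rewrite inE bs orbT.
have adm_ a s : adma a s -> adm s.
 by move=> [+ _]; apply: admS => b bs; rewrite inE bs orbT.
(* [c (a :: s) (+) psi1 s] is a cocycle on the link of [a] because [c] is one on simplices through
   [a]; the link has one color less, and the degree drops by one as well. *)
have Eta a : exists eta : seq L -> bool, color a = r -> (forall s, size s = k.-1 -> adma a s -> delta eta s = c (a :: s)
 (+) psi1 s) /\ forall B, (forall s, size s = k.-1 -> adma a s -> all_in B s -> c (a :: s) (+) psi1 s = false) -> forall
  s, size s = k.-2 -> adma a s -> all_in B s -> eta s = false.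
 have [ar|nar] := eqVneq (color a) r; last first.
  by exists (fun=> false) => ar; rewrite ar eqxx in nar.
 have [|||||eta etaP] :=
  IHr k.-1 (adma a) (fun t => c (a :: t) (+) psi1 t); last by exists eta.
 - by move: rk; case: (k).
 - move=> s t ts [ads as_]; split; last by apply: contra as_; apply: ts.
  by apply: admS ads => b; rewrite !inE => /orP[->//|/ts ->]; rewrite orbT.
 - move=> s b d ads; apply: col1 (adm_ _ _ ads).
 - move=> s b ads bs; apply: toplow bs; [exact: adm_ ads|exact: top0 ads].
 - move=> s sk ads; rewrite prednK in sk; last by apply: leq_trans rk.
  have [ads' as_] := ads.
  have := dc (a :: s); rewrite /= sk deltaD => /(_ erefl ads').
  rewrite psi1P //; first by case: (c s); case: (delta _).
  split; [exact: adm_ ads|exact: top0 ads].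
have [eta etaP] := choice Eta.
(* The cone [c (a :: s)] fails to be a primitive only where [a] occurs exactly once; the error is
   [c (a :: _) (+) psi1] on the remaining entries, and [eta a] is a primitive of that error. *)
pose h s := if top s is a :: _ then c (a :: s) (+) ((count_mem a s == 1) && eta a (del a s)) else psi1 s.
exists h; split.
 move=> s sk ads; have alls : all_in [set x | x \in s] s by apply/all_inP.
 case tops: (top s) => [|a u].
  by rewrite -psi1P //; apply: (delta_ext _ alls) => t _ /all_inP ts; rewrite /h; case tt: (top t) => [//|b v]; have [bt
   br] := topmem _ _ _ tt; have := toplow _ b ads tops (ts _ bt); rewrite br ltnn.
 have [as_ ar] := topmem _ _ _ tops.
 transitivity (delta (fun t => (c (a :: t) (+) ((a \notin t) && (c (a :: t) (+) psi1 t))) (+) ((count_mem a t == 1) &&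
  eta a (del a t))) s).
  apply: (delta_ext _ alls) => t _ /all_inP ts; rewrite /h.
  have := topS s a t ads as_ ar ts; case: ifP => at_.
   by move=> [v ->] /=; rewrite addbF.
  by move=> ->; rewrite (count_memPn (negbT at_)) /=; case: (c _); case: (psi1 _).
 rewrite (deltaD (fun t => c (a :: t) (+) _)) deltaD (delta_notin a (fun t => c (a :: t) (+) psi1 t)) as_ delta_count1.
 have := dc (a :: s); rewrite /= sk => /(_ erefl) dcs.
 have {dcs} <- : delta (fun t => c (a :: t)) s = c s.
  have : c s (+) delta (fun t => c (a :: t)) s = false.
   by apply: dcs; apply: admS ads => b; rewrite inE => /predU1P[->|].
  by case: (c s); case: (delta _).
 case: eqP => [s1|_] /=; last by rewrite !addbF.
 have [+ _] := etaP a ar => ->; first by case: (delta _ _); case: (c _); case: (psi1 _).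
  by rewrite size_filter -sk -(count_predC (pred1 a) s) s1.
 split; last by rewrite mem_filter eqxx.
 apply: admS ads => b; rewrite inE mem_filter => /predU1P[->//|/andP[]//].
move=> B cB s sk ads Bs; rewrite /h.
have psi1B t : size t = k.-1 -> adm1 t -> all_in B t -> psi1 t = false.
 by apply: psi10 => u uk [adu _] Bu; apply: cB.
case tops: (top s) => [|a u]; first exact: psi1B.
have [as_ ar] := topmem _ _ _ tops; have Ba : B a by move/all_inP: Bs; apply.
have k0 : (0 < k)%N by apply: leq_trans rk.
rewrite cB //=; last 2 first.
- by rewrite sk prednK.
- by apply: admS ads => b; rewrite inE => /predU1P[->|].
case: eqP => [s1|//] /=; have [_ /(_ B)] := etaP a ar; apply=> //.
- move=> t tk [adt at_] Bt; rewrite (cB (a :: t)) //=; first last.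
  by rewrite tk prednK.
 rewrite psi1B //; split; first by apply: admS adt => b bt; rewrite inE bt orbT.
 by apply: (top0 a).
- by rewrite size_filter -sk -(count_predC (pred1 a) s) s1.
- split; last by rewrite mem_filter eqxx.
 apply: admS ads => b; rewrite inE mem_filter => /predU1P[->//|/andP[]//].
- move/all_inP: Bs => Bs'; apply/all_inP => b; by rewrite mem_filter => /andP[_ /Bs'].
Qed.

End ColoredNerve.

Lemma floor_eq_dist (R : realType) (a b : R) :
 Num.floor a = Num.floor b -> `|a - b| < 1.
Proof.
move=> ab; have := floor_le a; have := floorD1_gt a.
have := floor_le b; have := floorD1_gt b; rewrite ab !intrD mulr1z.
rewrite ltr_norml; lra.
Qed.

Lemma dist_between_le (R : realType) (a b q f : R) :
 a + q < f -> f <= b + q -> `|a + q - f| <= `|a - b|.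
Proof. move=> af fb; rewrite ltr0_norm ?subr_lt0 // ler0_norm; lra. Qed.

Section CoordinateVanishing.
Variables (R : realType) (X : topologicalType) (S : set X) (m : nat).
Variable kappa : X -> 'rV[R]_m.

Definition cclose (e : R) (x y : X) : Prop :=
 forall i, `|kappa x 0 i - kappa y 0 i| < e.

Lemma ccloseC e x y : cclose e x y -> cclose e y x.
Proof. by move=> xy i; rewrite distrC. Qed.

Lemma cclose_trans e f x y z :
 cclose e x y -> cclose f y z -> cclose (e + f) x z.
Proof.
move=> xy yz i; rewrite -(subrKA (kappa y 0 i)); apply: le_lt_trans (ler_normD _ _) _.
exact: ltrD.
Qed.

Lemma cclose_le e f x y : e <= f -> cclose e x y -> cclose f x y.
Proof. by move=> ef xy i; apply: lt_le_trans. Qed.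

(* [j : 'I_m.+1] is a good color of [u] if no coordinate of [u], shifted by
  [j / m.+1], is close to an integer; each coordinate excludes one color. *)
Definition good_color (u : 'rV[R]_m) (j : 'I_m.+1) : Prop :=
 forall i (z : int), (2 * m.+1%:R)^-1 <= `|u 0 i + j%:R / m.+1%:R - z%:~R|.

(** Pigeonhole: two shifts that are bad for the same coordinate differ by less than [1 / m.+1]
    modulo integers, hence coincide; there are [m.+1] shifts and only [m] coordinates. *)
Lemma good_color_exists u : exists j, good_color u j.
Proof.
apply: contrapT => nogood.
have bad (j : 'I_m.+1) : exists i, exists z, `|u 0 i + j%:R / m.+1%:R - z%:~R| < (2 * m.+1%:R)^-1.
 by apply: contrapT => nbad; apply: nogood; exists j => i z; rewrite leNgt; apply/negP => lt; apply: nbad; exists i, z.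
have [f fP] := choice bad.
suff /leq_card : injective f by rewrite !card_ord ltnn.
move=> j j' ff'; have [z zP] := fP j; have [z'] := fP j'; rewrite -ff' => z'P.
have m0 : 0 < m.+1%:R :> R by rewrite ltr0n.
have : `|(j%:Z - j'%:Z - (z - z') * m.+1%:Z)%:~R| < 1 :> R.
 have -> : (j%:Z - j'%:Z - (z - z') * m.+1%:Z)%:~R = ((u 0 (f j) + j%:R / m.+1%:R - z%:~R) - (u 0 (f j) + j'%:R / m.+1%:R
  - z'%:~R)) * m.+1%:R.
  by rewrite !rmorphD /= !rmorphN /= rmorphM /= !rmorphD /= rmorphN /= -!pmulrn; move: (m.+1%:R) m0 => M m0; field;
   rewrite gt_eqF.
 rewrite normrM (gtr0_norm m0) -ltr_pdivlMr //.
 apply: le_lt_trans (ler_normB _ _) _.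
 have -> : 1 / m.+1%:R = (2 * m.+1%:R)^-1 + (2 * m.+1%:R)^-1 :> R.
  by field; rewrite gt_eqF.
 exact: ltrD.
rewrite -intr_norm -[1]/(1%:~R) ltr_int; move: (ltn_ord j) (ltn_ord j') => jm j'm lt1.
have {lt1} : j%:Z - j'%:Z - (z - z') * m.+1%:Z = 0 by lia.
move=> E; apply/val_inj => /=.
have [zz|[zz|zz]] : z - z' = 0 \/ 1 <= z - z' \/ z - z' <= -1 by lia.
- move: E; rewrite zz; lia.
- nia.
- nia.
Qed.

Definition label : Type := ('I_m.+1 * {ffun 'I_m -> int})%type.

(** A label records a good shift and the cube of side [h] in the shifted grid. If two close points
    with the same shift were in different cubes, a wall between them would be too close to a point
    for which the shift is good. *)
Lemma label_exists (h : R) : 0 < h ->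
 exists lab : X -> label,
  (forall x y, lab x = lab y -> cclose h x y) /\
  (forall x y, cclose (h / (2 * m.+1%:R)) x y ->
    (lab x).1 = (lab y).1 -> lab x = lab y).
Proof.
move=> h0; pose u x := \row_i (kappa x 0 i / h).
have [col colP] := choice (fun x => good_color_exists (u x)).
pose lab x := (col x, [ffun i => Num.floor (u x 0 i + (col x)%:R / m.+1%:R)]).
have ud x y i : u x 0 i - u y 0 i = (kappa x 0 i - kappa y 0 i) / h.
 by rewrite !mxE mulrBl.
exists lab; split=> x y.
 by move=> [cxy] /ffunP fxy i; have := fxy i; rewrite !ffunE -cxy => fl; rewrite -[h]mul1r -ltr_pdivrMr // -[X in _ /
  X](gtr0_norm h0) -normf_div -ud; have := floor_eq_dist fl; rewrite opprD addrACA subrr addr0.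
move=> xy /= cxy; rewrite /lab cxy; congr (_, _); apply/ffunP => i; rewrite !ffunE.
wlog le_xy : x y xy cxy / u x 0 i <= u y 0 i.
 by move=> W; have [|/ltW] := leP (u x 0 i) (u y 0 i); first exact: W; move=> le; rewrite -cxy W //; apply: ccloseC.
apply/eqP; rewrite eq_le; apply/andP; split.
 by rewrite floor_ge_int; apply: le_trans (floor_le _) _; rewrite lerD2r.
rewrite -ltzD1 floor_lt_int ltNge; apply/negP => le1.
have := colP x i (Num.floor (u x 0 i + (col y)%:R / m.+1%:R) + 1).
rewrite cxy leNgt => /negP; apply.
apply: le_lt_trans (_ : `|u x 0 i - u y 0 i| < _).
 have := floorD1_gt (u x 0 i + (col y)%:R / m.+1%:R) => lt1.
 exact: dist_between_le.
by rewrite ud normf_div (gtr0_norm h0) ltr_pdivrMr // mulrC.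
Qed.

(* [kappa] is a chart of [S] around [A]: it is continuous along [S] on [A], and
  within the neighborhood [O] it separates points of [A] from their far away. *)
Variables A C O : set X.
Hypotheses (cA : compact A) (cAC : compact (A `&` C)) (AS : A `<=` S).
Hypothesis nbhsO : forall x, A x -> nbhs x O.
Hypothesis kappa_cont : forall x e, A x -> 0 < e ->
 exists2 U, nbhs x U & forall y, (U `&` S) y -> cclose e x y.
Hypothesis kappa_emb : forall x U, A x -> nbhs x U ->
 exists2 e, 0 < e & forall y, (S `&` O) y -> cclose e x y -> U y.

(** In the coordinates [kappa], compactness gives the neighborhoods of [near_eq] one common size. *)
Lemma lebesgue_number k B c : compact B -> B `<=` A -> near_eq S k B c (fun=> false) -> exists2 e, 0 < e & forall x t, B
 x -> size t = k -> all_in [set y | (S `&` O) y /\ cclose e x y] t -> c t = false.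
Proof.
move=> cB BA cB0.
suff [e e0 eP] : exists2 e, 0 < e & forall x t, (B `&` B) x -> size t = k ->
  all_in [set y | (S `&` O) y /\ cclose e x y] t -> c t = false.
 by exists e => // x t Bx; apply: eP.
pose P E := exists2 e, 0 < e & forall x t, (E `&` B) x -> size t = k ->
  all_in [set y | (S `&` O) y /\ cclose e x y] t -> c t = false.
suff: P B by [].
apply: compact_ind => //.
- by exists 1 => // x t [].
- move=> E F [e e0 eP] [f f0 fP]; exists (Num.min e f); first by rewrite lt_min e0.
 move=> x t [[Ex|Fx] Bx] st tU.
  by apply: (eP x) => //; apply: all_inS tU => y [? yx]; split=> //; apply: cclose_le yx; rewrite ge_min lexx.
 by apply: (fP x) => //; apply: all_inS tU => y [? yx]; split=> //; apply: cclose_le yx; rewrite ge_min lexx orbT.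
- move=> E F EF [e e0 eP]; exists e => // x t [Ex Bx]; apply: eP; split=> //.
 exact: EF.
move=> x Bx; have [U xU Uc] := cB0 x Bx.
have [e e0 eU] := kappa_emb (BA _ Bx) xU.
have e20 : 0 < e / 2 by lra.
have [V xV VP] := kappa_cont (BA _ Bx) e20.
exists V => //; exists (e / 2) => // y t [[Vy By] _] st tU; apply: Uc => //.
apply: all_inS tU => z [[Sz Oz] yz]; split=> //; apply: eU => //.
rewrite (splitr e); apply: cclose_trans yz; apply: VP; split=> //.
exact/AS/BA.
Qed.

(** Each point is replaced by a sample point with the same label. Up to a prism, [phi] is then
    pulled back from the nerve of labels, which has [m.+1] colors, while [phi] has degree
    [k > m]. *)
Lemma coordinate_vanishing k phi : (m < k)%N ->
 near_eq S k.+2 A (delta phi) (fun=> false) ->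
 near_eq S k.+1 (A `&` C) phi (fun=> false) ->
 exists psi, near_eq S k.+1 A (delta psi) phi /\
       near_eq S k (A `&` C) psi (fun=> false).
Proof.
move=> mk dphi phiC.
have [[x0 _]|nA] := pselect (exists x, A x); last first.
 by exists (fun=> false); split=> x; [move=> Ax|move=> [Ax _]]; case: nA; exists x.
have [e1 e10 e1P] := lebesgue_number cA (@subset_refl _ A) dphi.
have [e2 e20 e2P] := lebesgue_number cAC (@subIsetl _ A C) phiC.
pose e := Num.min e1 e2; have e0 : 0 < e by rewrite lt_min e10.
have ee1 : e <= e1 by rewrite ge_min lexx.
have ee2 : e <= e2 by rewrite ge_min lexx orbT.
pose h := e / 2; have h0 : 0 < h by rewrite /h; lra.
have [lab [lab_close lab_color]] := label_exists h0.
(* Points within [d] of [x] are within [d + d] of each other, the threshold of [label_exists] for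
   one label per color; their samples stay within [d + h <= e] of [x]. *)
pose d := h / (4 * m.+1%:R).
have d0 : 0 < d by rewrite divr_gt0.
have dd : d + d = h / (2 * m.+1%:R).
 by rewrite /d; field.
have dh : d <= h.
 rewrite ler_pdivrMr // ler_peMr ?ltW //.
 have : 1 <= m.+1%:R :> R by [rewrite ler1n]; lra.
have dhe : d + h <= e by move: dh; rewrite /h; lra.
have [samp sampP] : exists samp, forall p, (S `&` O) p -> (S `&` O) (samp (lab p)) /\ lab (samp (lab p)) = lab p.
 have /choice[samp sP] : forall l, exists q, forall p, (S `&` O) p -> lab p = l -> (S `&` O) q /\ lab q = l.
  move=> l; have [[q [SOq ql]]|nq] := pselect (exists q, (S `&` O) q /\ lab q = l).
   by exists q.
  by exists x0 => p SOp pl; case: nq; exists p.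
 by exists samp => p SOp; apply: (sP (lab p) p).
pose star x := [set l | exists p, [/\ (S `&` O) p, cclose d x p & lab p = l]].
have star_samp x l : star x l -> (S `&` O) (samp l) /\ cclose e x (samp l).
 by move=> [p [SOp xp <-]]; have [SOq lq] := sampP p SOp; split=> //; apply: cclose_le dhe _; apply: cclose_trans xp _;
  apply/ccloseC/lab_close.
pose adm s := exists2 x, A x & all_in (star x) s.
have [psi0 [psi0P psi00]] : exists psi, (forall s, size s = k.+1 -> adm s -> delta psi s = phi (map samp s)) /\ forall B,
 (forall s, size s = k.+1 -> adm s -> all_in B s -> phi (map samp s) = false) -> forall s, size s = k -> adm s -> all_in
  B s -> psi s = false.
 apply: (@colored_nerve_vanishing _ (fun l : label => l.1 : nat) m.+1 k.+1) => //.
 - move=> s t ts [x Ax /all_inP xs]; exists x => //; apply/all_inP => l /ts.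
  exact: xs.
 - by move=> s a b [x Ax /all_inP xs] /xs [p [SOp xp <-]] /xs [q [SOq xq <-]] pq; apply: lab_color; last exact: val_inj;
  rewrite -dd; apply: cclose_trans xq; apply: ccloseC.
 - move=> s sk [x Ax xs]; rewrite (delta_map samp) (e1P x) ?size_map //.
  apply/allin_map; apply: all_inS xs => l /star_samp [? xl]; split=> //.
  exact: cclose_le xl.
pose v x := samp (lab x).
exists (fun t => psi0 (map lab t) (+) prism id v phi t).
have near_star x : A x -> exists2 U, nbhs x U & forall t, all_in (U `&` S) t ->
  [/\ all_in (star x) (map lab t), all_in [set y | (S `&` O) y /\ cclose e x y] (map id t)
   & all_in [set y | (S `&` O) y /\ cclose e x y] (map v t)].
 move=> Ax; have [U xU UP] := kappa_cont Ax d0.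
 exists (U `&` O) => [|t tU]; first by apply: filterI => //; apply: nbhsO.
 have ts : all_in (star x) (map lab t).
  apply/allin_map; apply: all_inS tU => y [[Uy Oy] Sy]; exists y; split=> //.
  exact: UP.
 split=> //.
  apply/allin_map; apply: all_inS tU => y [[Uy Oy] Sy] /=; split=> //.
  apply: cclose_le (UP y _) => //; lra.
 rewrite (map_comp samp lab); apply/allin_map; apply: all_inS ts => l.
 exact: star_samp.
split=> x.
 move=> Ax; have [U xU UP] := near_star x Ax; exists U => // t st tU.
 have [ts tid tv] := UP t tU.
 rewrite deltaD (delta_map lab psi0) psi0P ?size_map //; last by exists x.
 have := prismP id v phi t; rewrite (@prism_ext _ _ _ id v (delta phi) (fun=> false) t _ tid tv).
  by rewrite prism0 addbF => ->; rewrite map_id (map_comp samp lab); case: (phi _); case: (phi _).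
 by move=> u; rewrite st => su uU; apply: (e1P x) => //; apply: all_inS uU => y [? xy]; split=> //; apply: cclose_le xy.
move=> ACx; have [Ax Cx] := ACx; have [U xU UP] := near_star x Ax; exists U => // t st tU.
have [ts tid tv] := UP t tU.
rewrite (psi00 (star x)) ?size_map //=; last by exists x.
 by rewrite (@prism_ext _ _ _ id v phi (fun=> false) t _ tid tv) ?prism0 //; move=> u; rewrite st => su uU; apply: (e2P
  x) => //; apply: all_inS uU => y [? xy]; split=> //; apply: cclose_le xy.
move=> s sk _ sx; apply: (e2P x); rewrite ?size_map //.
apply/allin_map; apply: all_inS sx => l /star_samp [? xl]; split=> //.
exact: cclose_le xl.
Qed.

End CoordinateVanishing.

(** * Pointwise continuity and homotopies *)

Section ContinuousAt.
Variables X Y Z T : topologicalType.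

Definition cont_at (X Y : topologicalType) (f : X -> Y) (a : X) : Prop :=
 forall U, nbhs (f a) U -> nbhs a (f @^-1` U).

Lemma cont_comp (f : X -> Y) (g : Y -> Z) a :
 cont_at f a -> cont_at g (f a) -> cont_at (fun x => g (f x)) a.
Proof. by move=> cf cg U /cg /cf. Qed.

Lemma cont_pair (f : X -> Y) (g : X -> Z) a :
 cont_at f a -> cont_at g a -> cont_at (fun x => (f x, g x)) a.
Proof. by apply: cvg_pair. Qed.

Lemma cont_comp2 f (g : X -> Z) (h : Y * Z -> T) a : cont_at f a -> cont_at g a -> cont_at h (f a, g a) -> cont_at (fun x
 => h (f x, g x)) a.
Proof. by move=> cf cg ch U /ch; apply: cont_pair. Qed.

Lemma cont_cst (b : Y) (a : X) : cont_at (fun=> b) a.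
Proof. by move=> U /nbhs_singleton Ub; apply: nearW. Qed.

Lemma cont_id (a : X) : cont_at (fun x => x) a.
Proof. by []. Qed.

Lemma cont_fst (p : X * Y) : cont_at fst p.
Proof. exact: cvg_fst. Qed.

Lemma cont_snd (p : X * Y) : cont_at snd p.
Proof. exact: cvg_snd. Qed.

Lemma cont_near_eq (f g : X -> Y) a :
 nbhs a [set x | f x = g x] -> cont_at f a -> cont_at g a.
Proof.
move=> fg cf U; rewrite -(nbhs_singleton fg) => /cf fU.
near=> x => /=; rewrite -(near fg x) //; near: x.
Unshelve. all: by end_near. Qed.

End ContinuousAt.

Section ContinuousAtReal.
Variables (R : realType) (X : topologicalType) (V : normedModType R).
Implicit Types (f g : X -> R) (u v : X -> V).

Lemma cont_atD u v a : cont_at u a -> cont_at v a -> cont_at (fun x => u x + v x) a.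
Proof. by apply: cvgD. Qed.

Lemma cont_atN u a : cont_at u a -> cont_at (fun x => - u x) a.
Proof. by apply: cvgN. Qed.

Lemma cont_atB u v a : cont_at u a -> cont_at v a -> cont_at (fun x => u x - v x) a.
Proof. by apply: cvgB. Qed.

Lemma cont_atZ f u a : cont_at f a -> cont_at u a -> cont_at (fun x => f x *: u x) a.
Proof. by apply: cvgZ. Qed.

Lemma cont_atM f g a : cont_at f a -> cont_at g a -> cont_at (fun x => f x * g x) a.
Proof. by apply: cvgM. Qed.

Lemma cont_norm u a : cont_at u a -> cont_at (fun x => `|u x|) a.
Proof. by apply: cvg_norm. Qed.

Lemma cont_max f g a : cont_at f a -> cont_at g a -> cont_at (fun x => Num.max (f x) (g x)) a.
Proof. by apply: continuous_max. Qed.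

Lemma cont_min f g a : cont_at f a -> cont_at g a -> cont_at (fun x => Num.min (f x) (g x)) a.
Proof. by apply: continuous_min. Qed.

Lemma cont_inv f a : f a != 0 -> cont_at f a -> cont_at (fun x => (f x)^-1) a.
Proof. by apply: cvgV. Qed.

Lemma cont_lt f g a : cont_at f a -> cont_at g a -> f a < g a ->
 nbhs a [set x | f x < g x].
Proof.
move=> cf cg fg; pose m := (f a + g a) / 2.
have h1 : nbhs a [set x | f x < m].
 apply: (cf [set x | x < m]); apply: lt_nbhsl; rewrite /m; lra.
have h2 : nbhs a [set x | m < g x].
 apply: (cg [set x | m < x]); apply: lt_nbhsr; rewrite /m; lra.
by apply: filterS (filterI h1 h2) => x [h3 h4]; apply: lt_trans h4.
Qed.

End ContinuousAtReal.

Lemma cont_coord (R : realType) n i (z : 'rV[R]_n) : cont_at (fun z : 'rV[R]_n => z 0 i) z.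
Proof. exact: (@coord_continuous R 1 n 0 i z). Qed.

Lemma cont_sum (R : realType) (X : topologicalType) I s (f : I -> X -> R) a : (forall i, cont_at (f i) a) -> cont_at (fun
 x => \sum_(i <- s) f i x) a.
Proof.
move=> cf; elim: s => [|k s IHs].
 have -> : (fun x => \sum_(i <- [::]) f i x) = (fun=> 0).
  by apply/funext => x; rewrite big_nil.
 exact: cont_cst.
have -> : (fun x => \sum_(i <- k :: s) f i x) = fun x => f k x + \sum_(i <- s) f i x.
 by apply/funext => x; rewrite big_cons.
exact: cont_atD.
Qed.
Ltac cont := repeat first
 [ match goal with H : cont_at _ _ |- _ => exact: H | H : forall z, cont_at _ z |- _ => exact: H end
 | exact: cont_cst | exact: cont_id | exact: cont_fst | exact: cont_snd | exact: cont_coord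
 | apply: cont_pair | apply: cont_max | apply: cont_min | apply: cont_atM
 | match goal with R : realType |- _ =>
   first [apply: (@cont_atD _ _ R) | apply: (@cont_atB _ _ R) | apply: (@cont_norm _ _ R)] end
 | apply: cont_atD | apply: cont_atB | apply: cont_atN | apply: cont_atZ | apply: cont_norm
 | apply: cont_sum => ? ].

#[export] Hint Extern 0 (cont_at _ _) => solve [cont] : core.

Lemma nbhs_pair (X Y : topologicalType) (x : X) (y : Y) U : nbhs (x, y) U -> exists2 V, nbhs x V & exists2 V', nbhs y V'
 & forall x' y', V x' -> V' y' -> U (x', y').
Proof.
move=> [[V V'] [xV yV'] VU]; exists V => //; exists V' => // x' y' Vx Vy.
by apply: (VU (x', y')).
Qed.

Lemma nbhs_R (R : realType) (t : R) U : nbhs t U ->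
 exists2 e, 0 < e & forall s, `|t - s| < e -> U s.
Proof. by []. Qed.

Section Homotopy.
Variables (R : realType) (Y X : topologicalType).

(** For fixed [y], compactness of the time interval gives a step size; compactness of [B] makes it
    uniform. Fineness is proved for all large [m], which allows two pieces to share a common [m]. *)
Lemma unif_subdiv B (H : Y * R -> X) good : compact B -> (forall z, cont_at H z) -> (forall y t, B y -> 0 <= t <= 1 ->
 exists2 U, nbhs (H (y, t)) U & good U) -> exists2 m, (0 < m)%N & forall y, B y -> exists2 V, nbhs y V & forall j, (j <
  m)%N -> exists2 O, good O & forall y' t, V y' -> j%:R / m%:R <= t <= j.+1%:R / m%:R -> O (H (y', t)).
Proof.
move=> cB cH loc.
pose fine m V := forall j, (j < m)%N -> exists2 O, good O & forall y t, V y -> j%:R / m%:R <= t <= j.+1%:R / m%:R -> O (H (y, t)).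
have fine1 y : B y -> exists2 V, nbhs y V &
  exists2 m0, (0 < m0)%N & forall m, (m0 <= m)%N -> fine m V.
 move=> By.
 pose Q E := exists V e, [/\ nbhs y V, 0 < e & forall t, (E `&` `[0, 1]) t -> exists2 O, good O & forall y' t', V y' ->
  `|t - t'| < e -> O (H (y', t'))].
 have [V [e [yV e0 Ve]]] : Q `[0, 1]%classic.
  apply: compact_ind; first exact: segment_compact.
  - by exists setT, 1; split=> //; [exact: filterT|move=> t []].
  - move=> E E' [V [e [yV e0 Ve]]] [V' [e' [yV' e0' Ve']]].
   exists (V `&` V'), (Num.min e e'); split.
   + exact: filterI.
   + by rewrite lt_min e0.
   + move=> t [[Et|Et] It].
     have [|O gO OP] := Ve t => //.
     exists O => // y' t' [Vy _] tt; apply: OP => //; apply: lt_le_trans tt _.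
     by rewrite ge_min lexx.
    have [|O gO OP] := Ve' t => //.
    exists O => // y' t' [_ Vy] tt; apply: OP => //; apply: lt_le_trans tt _.
    by rewrite ge_min lexx orbT.
  - by move=> E E' EE' [V [e [yV e0 Ve]]]; exists V, e; split=> // t [Et It]; apply: Ve; split=> //; apply: EE'.
  - move=> t It; have [|U HU gU] := loc y t By => //.
   have /nbhs_pair[V yV [V' /nbhs_R[e e0 eV'] VV']] := cH _ _ HU.
   exists (ball t (e / 2)); first by apply: nbhsx_ballx; lra.
   exists V, (e / 2); split=> //; first lra.
   by move=> s [[ts _] Is]; exists U => //; move=> y' t' Vy st; apply: VV' => //; apply: eV'; rewrite -(subrKA s); apply:
    le_lt_trans (ler_normD _ _) _; rewrite (splitr e); apply: ltrD.
 have [m0 m0P] : exists m0, e^-1 < m0%:R.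
  by exists (Num.bound e^-1); apply: archi_boundP; rewrite invr_ge0 ltW.
 exists V => //; exists m0.+1 => // m m0m j jm.
 have m_gt0 : 0 < m%:R :> R by rewrite ltr0n; apply: leq_trans m0m.
 have It : `[0, 1]%classic (j%:R / m%:R : R).
  rewrite /= in_itv /= divr_ge0 //= ler_pdivrMr // mul1r ler_nat.
  exact: ltnW.
 have [ O gO OP] := Ve _ (conj It It).
 exists O => // y' t Vy /andP[jt tj]; apply: OP => //.
 by rewrite ler0_norm ?subr_le0 // opprB ltrBlDr; apply: le_lt_trans tj _; rewrite -[j.+1]add1n natrD mulrDl ltrD2r div1r
  invf_plt //; apply: lt_le_trans m0P _; rewrite ler_nat; apply: leq_trans.
have [m0 m00 m0P] : exists2 m0, (0 < m0)%N & forall m, (m0 <= m)%N -> forall y, (B `&` B) y ->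
  exists2 V, nbhs y V & fine m V.
 pose Q E := exists2 m0, (0 < m0)%N & forall m, (m0 <= m)%N -> forall y, (E `&` B) y ->
  exists2 V, nbhs y V & fine m V.
 suff: Q B by [].
 apply: compact_ind => //.
 - by exists 1 => // m _ y [].
 - move=> E E' [m1 m10 h1] [m2 m20 h2]; exists (maxn m1 m2); first by rewrite leq_max m10.
  move=> m; rewrite geq_max => /andP[m1m m2m] y [[Ey|Ey] By]; [apply: h1|apply: h2] => //.
 - by move=> E E' EE' [m1 m10 h1]; exists m1 => // m m1m y [Ey By]; apply: h1 => //; split=> //; apply: EE'.
 move=> y By; have [V yV [m1 m10 h1]] := fine1 y By.
 exists V°; first exact: nbhs_interior.
 exists m1 => // m m1m y' [[Vy' _] _]; exists V => //; exact: h1.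
exists m0 => // y By; exact: m0P.
Qed.

(** [eta] is the sum of the prisms over short time steps. Each short prism stays in a set where
    [phi] is a cocycle, so [prismP] leaves no error term. *)
Lemma homotopy_cochain B (H : Y * R -> X) k phi : compact B -> (forall z, cont_at H z) -> near_eq setT k.+1 [set H z | z
 in B `*` `[0, 1]] (delta phi) (fun=> false) -> exists eta, near_eq setT k B (fun t => phi (map (fun y => H (y, 0)) t)
  (+) phi (map (fun y => H (y, 1)) t)) (delta eta).
Proof.
move=> cB cH dphi.
pose good O := forall t, size t = k.+1 -> all_in O t -> delta phi t = false.
have [|m0 m00 m0P] := @unif_subdiv B H good cB cH.
 move=> y t By It; have [|U HU Uphi] := dphi (H (y, t)); first by exists (y, t).
 by exists U => // u su uU; apply: Uphi => //; apply: all_inS uU.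
pose time j : R := j%:R / m0%:R.
pose eta := fix eta n : seq Y -> bool := if n is n'.+1 then
  fun t => eta n' t (+) prism (fun y => H (y, time n')) (fun y => H (y, time n)) phi t
 else fun=> false.
have etaP n : (n <= m0)%N -> near_eq setT k B (fun t => phi (map (fun y => H (y, time 0)) t) (+) phi (map (fun y => H (y,
 time n)) t)) (delta (eta n)).
 elim: n => [_|n IHn nm].
  by apply: neq_all => t _; rewrite addbb delta0.
 have step : near_eq setT k B
   (fun t => phi (map (fun y => H (y, time n)) t) (+) phi (map (fun y => H (y, time n.+1)) t))
   (delta (prism (fun y => H (y, time n)) (fun y => H (y, time n.+1)) phi)).
  move=> y By; have [V yV fV] := m0P y By.
  have [ O gO OP] := fV n nm; exists V => // t st tV.
  have m0R : 0 < m0%:R :> R by rewrite ltr0n.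
  have tt : time n <= time n.+1 by rewrite ler_pM2r ?invr_gt0 // ler_nat.
  have := prismP (fun y => H (y, time n)) (fun y => H (y, time n.+1)) phi t.
  rewrite (@prism_ext _ _ O _ _ (delta phi) (fun=> false)).
  + by rewrite prism0 addbF => ->; rewrite addbC.
  + rewrite st; apply: gO.
  + by apply/allin_map; apply: all_inS tV => z [Vz _]; apply: OP => //; rewrite lexx.
  + by apply/allin_map; apply: all_inS tV => z [Vz _]; apply: OP => //; rewrite lexx andbT.
 apply: neq_trans (neq_trans (near_eqD (IHn (ltnW nm)) step) _).
  by apply: neq_all => t; case: (phi _); case: (phi _); case: (phi _).
 by apply: neq_all => t _; rewrite -deltaD.
exists (eta m0); have := etaP m0 (leqnn _).
by rewrite /time mul0r divff // pnatr_eq0 -lt0n.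
Qed.

End Homotopy.

(** * Subspaces, charts, and moving a point inside a chart *)

Section SetType.
Variables (X : topologicalType) (A : set X).

Lemma st_nbhs (z : set_type A) P : nbhs z P <-> exists2 V, nbhs (set_val z) V & forall z', V (set_val z') -> P z'.
Proof.
split.
 by move=> [/= _ [[V oV <-] Vz] VP]; exists V; first exact: open_nbhs_nbhs.
move=> [V /(@initial_continuous (set_type A) X set_val) zV VP].
apply: (@filterS _ (nbhs z) _ (set_val @^-1` V)) => //.
Qed.

Lemma set_valP (z : set_type A) : A (set_val z).
Proof. by have := valP z; rewrite inE. Qed.

Lemma st_sub x : A x -> exists z : set_type A, set_val z = x.
Proof. by move=> Ax; exists (exist _ x (mem_set Ax)). Qed.

Lemma set_val_inj : injective (set_val : set_type A -> X).
Proof. by []. Qed.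

Lemma compact_set_type : compact A -> compact [set: set_type A].
Proof.
move=> cA F FF.
have FG : ProperFilter (set_val @ F).
 exact: fmap_proper_filter.
have [|x [Ax clx]] := cA _ FG; first by apply: nearW => z; apply: set_valP.
have [z zx] := st_sub Ax; exists z; split=> // P Q FP /st_nbhs[V zV VQ].
have [||y [[z' Pz' <-] Vz']] := clx (set_val @` P) V; last first.
- by exists z'; split=> //; apply: VQ.
- by rewrite -zx.
by apply: (@filterS _ F _ P) => // z' Pz'; exists z'.
Qed.

End SetType.

Section Charts.
Variables (R : realType) (d : nat) (W : topologicalType).
Hypotheses (hW : hausdorff_space W).
Implicit Types (x y b : W) (u v : 'rV[R]_d).

(* A chart onto the open ball of radius 4 for the sup norm, centered at [x0];
  the smaller concentric balls leave room to move points around. *)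
Record chart (x0 : W) (U : set W) (k : W -> 'rV[R]_d) (r : 'rV[R]_d -> W) : Prop := Chart {
 chart_open : open U;
 chart_center : U x0;
 chart_at0 : k x0 = 0;
 chart_lt4 : forall y, U y -> `|k y| < 4;
 chartK : forall y, U y -> r (k y) = y;
 chart_cont : forall y, U y -> cont_at k y;
 chart_in : forall u, `|u| < 4 -> U (r u);
 chartVK : forall u, `|u| < 4 -> k (r u) = u;
 chartV_cont : forall u, `|u| < 4 -> cont_at r u }.

Lemma chart_exists : manifold R d W -> forall x0 V, nbhs x0 V ->
 exists U k r, chart x0 U k r /\ U `<=` V.
Proof.
move=> [_ _ locE] x0 V0 x0V.
have [U0 [ O0 [oU0 Ux0 oO0 [f [cf [g [cg fK gK]]]]]]] := locE x0.
have [k0 k0P] : exists k0, forall z, k0 (set_val z) = set_val (f z).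
 have /choice[k0 k0P] : forall y, exists u, forall z, set_val z = y -> u = set_val (f z).
  move=> y; have [Uy|nUy] := pselect (U0 y).
   have [z zy] := st_sub Uy; exists (set_val (f z)) => z' z'y.
   by congr (set_val (f _)); apply: set_val_inj; rewrite zy.
  exists 0 => z zy; case: nUy; rewrite -zy; apply: set_valP.
 by exists k0 => z; apply: k0P.
have [r0 r0P] : exists r0, forall z : set_type O0, r0 (set_val z) = set_val (g z).
 have /choice[r0 r0P] : forall y : 'rV[R]_d, exists u : W, forall z, set_val z = y -> u = set_val (g z).
  move=> y; have [Uy|nUy] := pselect (O0 y).
   have [z zy] := st_sub Uy; exists (set_val (g z)) => z' z'y.
   by congr (set_val (g _)); apply: set_val_inj; rewrite zy.
  exists x0 => z zy; case: nUy; rewrite -zy; apply: set_valP.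
 by exists r0 => z; apply: r0P.
have ck0 y : U0 y -> cont_at k0 y.
 move=> /st_sub[z <-] V; rewrite k0P => fV.
 have : nbhs (f z) (set_val @^-1` V) by apply/st_nbhs; exists V.
 move=> /cf /st_nbhs[V' zV' V'P].
 have zU : nbhs (set_val z) U0 by apply: open_nbhs_nbhs; split=> //; apply: set_valP.
 by apply: filterS (filterI zV' zU) => y' [V'y' /st_sub[z' z'y']]; rewrite /= -z'y' k0P; apply: V'P; rewrite z'y'.
have cr0 (y : 'rV[R]_d) : O0 y -> cont_at r0 y.
 move=> /st_sub[z <-] V; rewrite r0P => fV.
 have : nbhs (g z) (set_val @^-1` V) by apply/st_nbhs; exists V.
 move=> /cg /st_nbhs[V' zV' V'P].
 have zU : nbhs (set_val z) O0 by apply: open_nbhs_nbhs; split=> //; apply: set_valP.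
 by apply: filterS (filterI zV' zU) => y' [V'y' /st_sub[z' z'y']]; rewrite /= -z'y' r0P; apply: V'P; rewrite z'y'.
have k0O y : U0 y -> O0 (k0 y) /\ r0 (k0 y) = y.
 move=> /st_sub[z <-]; rewrite k0P r0P fK; split=> //; exact: set_valP.
have r0U u : O0 u -> U0 (r0 u) /\ k0 (r0 u) = u.
 move=> /st_sub[z <-]; rewrite r0P k0P gK; split=> //; exact: set_valP.
have [e e0 eOV] : exists2 e : R, 0 < e & forall u, `|u - k0 x0| < e -> O0 u /\ V0 (r0 u).
 have [kO rk] := k0O _ Ux0.
 have /nbhs_ballP[e /= e0 eO] : nbhs (k0 x0) (O0 `&` r0 @^-1` V0).
  by apply: filterI; [exact: open_nbhs_nbhs|apply: cr0 => //; rewrite rk].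
 by exists e => // u ue; apply: eO; rewrite -ball_normE /= distrC.
have eO u : `|u - k0 x0| < e -> O0 u by case/eOV.
pose k y := (4 / e) *: (k0 y - k0 x0); pose r u := r0 (k0 x0 + (e / 4) *: u).
pose U := [set y | U0 y /\ `|k y| < 4].
have e4 : 0 < e / 4 by lra.
have ck y : U0 y -> cont_at k y.
 move=> Uy; apply: cont_atZ; first exact: cont_cst.
 apply: cont_atB; [exact: ck0|exact: cont_cst].
have rO u : `|u| < 4 -> O0 (k0 x0 + (e / 4) *: u).
 by move=> u4; apply: eO; rewrite addrAC subrr add0r normrZ gtr0_norm //; rewrite mulrAC ltr_pdivrMr // ltr_pM2l.
exists U, k, r; split; last first.
 by move=> y [Uy ky]; have [_ rk] := k0O _ Uy; rewrite -rk; apply: (eOV _ _).2; move: ky; rewrite normrZ gtr0_norm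
  ?divr_gt0 // mulrAC ltr_pdivrMr // ltr_pM2l.
split.
- rewrite openE => y [Uy ky]; apply: filterI; first by apply: open_nbhs_nbhs.
 by apply: cont_lt => //; apply: cont_norm; apply: ck.
- by split=> //; rewrite /k subrr scaler0 normr0.
- by rewrite /k subrr scaler0.
- by move=> y [].
- move=> y [Uy _]; rewrite /r scalerA.
 have -> : e / 4 * (4 / e) = 1 by field; rewrite gt_eqF.
 by rewrite scale1r addrC subrK; have [] := k0O _ Uy.
- by move=> y [Uy _]; apply: ck.
- by move=> u u4; have [Ur kr] := r0U _ (rO u u4); split=> //; rewrite /k kr addrAC subrr add0r scalerA (_ : 4 / e * (e /
 4) = 1) ?scale1r //; field; rewrite gt_eqF.
- by move=> u u4; have [Ur kr] := r0U _ (rO u u4); rewrite /k kr addrAC subrr add0r scalerA (_ : 4 / e * (e / 4) = 1)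
 ?scale1r //; field; rewrite gt_eqF.
- by move=> u u4; apply: (cont_comp); last exact: cr0 _ (rO u u4); apply: cont_atD; [exact: cont_cst|apply: cont_atZ].
Qed.

Lemma compact_ball0 s : compact [set u : 'rV[R]_d | `|u| <= s].
Proof.
apply: bounded_closed_compact.
 by exists s; split; [exact: num_real|move=> M sM u us; apply: le_trans (ltW sM)].
have -> : [set u : 'rV[R]_d | `|u| <= s] = (fun u => `|u|) @^-1` [set t | t <= s] by [].
apply: preimage_closed => //.
move=> u _; apply: norm_continuous.
Qed.

Section OneChart.
Variables (x0 : W) (U : set W) (k : W -> 'rV[R]_d) (r : 'rV[R]_d -> W).
Hypothesis ch : chart x0 U k r.

Definition cball (s : R) : set W := [set y | U y /\ `|k y| <= s].

Lemma cball_compact s : s < 4 -> compact (cball s).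
Proof.
move=> s4; have -> : cball s = r @` [set u | `|u| <= s].
 rewrite predeqE => y; split=> [[Uy ys]|[u us <-]].
  by exists (k y) => //; apply: (chartK ch).
 have u4 : `|u| < 4 by apply: le_lt_trans s4.
 by split; [apply: (chart_in ch)|rewrite (chartVK ch)].
apply: continuous_compact; last exact: compact_ball0.
apply: continuous_in_subspaceT => u; rewrite inE => us.
by apply: (chartV_cont ch); apply: le_lt_trans s4.
Qed.

Lemma chart_oball s : open [set y | U y /\ `|k y| < s].
Proof.
rewrite openE => y [Uy ky]; apply: filterI.
 apply: open_nbhs_nbhs; split=> //; apply: (chart_open ch).
apply: cont_lt => //.
by apply/cont_norm/(chart_cont ch).
Qed.

(** Equal to 1 up to radius [s], to 0 from radius [s + 2] on, with slope 1/2 in between; [push_neq]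
    rests on that slope. *)
Definition cbump (s : R) (b : W) : R :=
 if `[< U b >] then Num.max 0 (Num.min 1 ((s + 2 - `|k b|) / 2)) else 0.

Lemma bump_ge0 s b : 0 <= cbump s b.
Proof. by rewrite /cbump; case: ifP => // _; rewrite le_max lexx. Qed.

Lemma bump_le1 s b : cbump s b <= 1.
Proof. by rewrite /cbump; case: ifP => // _; rewrite ge_max ler01 ge_min lexx. Qed.

Lemma bump_out s b : ~ cball (s + 2) b -> cbump s b = 0.
Proof.
move=> nb; rewrite /cbump; case: asboolP => // Ub; apply: max_l.
rewrite ge_min; apply/orP; right; rewrite pmulr_lle0 // subr_le0 leNgt.
by apply/negP => lt; apply: nb; split=> //; apply: ltW.
Qed.

Lemma bump1 s b : U b -> `|k b| <= s -> cbump s b = 1.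
Proof.
move=> Ub bs; rewrite /cbump asboolT // min_l; first by rewrite max_r.
lra.
Qed.

Lemma bump_cont s b : s < 2 -> cont_at (cbump s) b.
Proof.
move=> s2; have [Ub|nUb] := pselect (U b).
 apply: (@cont_near_eq _ _ (fun b => Num.max 0 (Num.min 1 ((s + 2 - `|k b|) / 2)))).
  have : nbhs b U by apply: open_nbhs_nbhs; split=> //; apply: chart_open ch.
  by apply: filterS => y Uy /=; rewrite /cbump asboolT.
 by apply: cont_max; first exact: cont_cst; apply: cont_min; first exact: cont_cst; apply: cont_atM; last exact:
  cont_cst; apply: cont_atB; first exact: cont_cst; apply/cont_norm/(chart_cont ch).
apply: (@cont_near_eq _ _ (fun=> 0)) => //.
have cl : closed (cball (s + 2)).
 apply: compact_closed => //; apply: cball_compact; lra.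
have : nbhs b (~` cball (s + 2)).
 by apply: open_nbhs_nbhs; split; [exact: closed_openC|move=> []].
by apply: filterS => y /= ny; rewrite bump_out.
Qed.

(** Translation of [b] by the chart vector from [x] to [y], damped by the bump. It is a local
    substitute for isotopy extension: for [x] and [y] in [core] it carries the complement of [x]
    into the complement of [y], continuously in all three points. *)
Definition cpush (p : W * W * W) : W :=
 let: (x, y, b) := p in
 if `[< U b >] then r (k b + cbump 1 b *: (k y - k x)) else b.

Definition core : set W := [set y | U y /\ `|k y| < 1 / 2].

Lemma core_open : open core.
Proof. exact: chart_oball. Qed.

Lemma core_dist x y : core x -> core y -> `|k y - k x| < 1.
Proof.
move=> [_ xs] [_ ys]; apply: le_lt_trans (ler_normB _ _) _; lra.
Qed.

Lemma bump_coord_lt4 v b : U b -> `|v| < 1 -> `|k b + cbump 1 b *: v| < 4.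
Proof.
move=> Ub v1; have kb4 := chart_lt4 ch Ub; have b0 := bump_ge0 1 b; have b1 := bump_le1 1 b.
have [b3|b3] := lerP `|k b| 3; last first.
 rewrite bump_out ?scale0r ?addr0 // => -[_]; lra.
apply: le_lt_trans (ler_normD _ _) _; rewrite normrZ ger0_norm //.
have [v0] := normr_ge0 v; nra.
Qed.

Lemma pushxx x b : cpush (x, x, b) = b.
Proof.
by rewrite /cpush; case: asboolP => // Ub; rewrite subrr scaler0 addr0 (chartK ch).
Qed.

(** If [b] landed on [y], then [k b - k x] would be [1 - cbump] times a vector shorter than 1, while
    [1 - cbump] is at most half the norm of [k b - k x]; together these force [b = x]. *)
Lemma push_neq x y b : core x -> core y -> b <> x -> cpush (x, y, b) <> y.
Proof.
move=> cx cy bx; have v1 := core_dist cx cy; have [Ux xs] := cx; have [Uy ys] := cy.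
rewrite /cpush; case: asboolP => [Ub|nUb yb]; last by apply: nUb; rewrite yb.
move=> E; apply: bx; have := congr1 k E; rewrite (chartVK ch); last exact: bump_coord_lt4.
move=> {}E; have kb : k b = k y - cbump 1 b *: (k y - k x) by rewrite -[X in X - _]E addrK.
have {E} : k b - k x = (1 - cbump 1 b) *: (k y - k x).
 by rewrite kb scalerBl scale1r addrAC.
move=> /(congr1 Num.norm); rewrite normrZ ger0_norm ?subr_ge0 ?bump_le1 // => E.
have : 1 - cbump 1 b <= `|k b - k x| / 2.
 have : `|k b| <= `|k b - k x| + `|k x| by rewrite -{1}(subrK (k x) (k b)) ler_normD.
 rewrite /cbump asboolT // lerBlDr -lerBlDl le_max le_min.
 have := normr_ge0 (k b - k x); lra.
move=> h; have p0 : `|k b - k x| <= 0.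
 move: h E (normr_ge0 (k b - k x)) (normr_ge0 (k y - k x)) v1.
 nra.
have /eqP : `|k b - k x| = 0 by apply/eqP; rewrite eq_le p0 normr_ge0.
rewrite normr_eq0 subr_eq0 => /eqP kbx.
by rewrite -(chartK ch Ub) kbx (chartK ch).
Qed.

Lemma push_cont x y b : core x -> core y -> cont_at cpush (x, y, b).
Proof.
move=> cx cy; have [Ux xs] := cx; have [Uy ys] := cy.
have near_core : nbhs (x, y, b) [set p | core p.1.1 /\ core p.1.2].
 have h1 : nbhs (x, y, b) ((fun p => p.1.1) @^-1` core).
  apply: (cont_comp); first exact: cont_fst.
   by [].
  apply: open_nbhs_nbhs; split=> //; apply: core_open.
 have h2 : nbhs (x, y, b) ((fun p => p.1.2) @^-1` core).
  apply: (cont_comp); first exact: cont_fst.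
   by [].
  apply: open_nbhs_nbhs; split=> //; apply: core_open.
 exact: filterI.
have [Ub|nUb] := pselect (U b).
 apply: (@cont_near_eq _ _ (fun p => r (k p.2 + cbump 1 p.2 *: (k p.1.2 - k p.1.1)))).
  have h : nbhs (x, y, b) (snd @^-1` U).
   apply/cont_snd/open_nbhs_nbhs; split=> //; apply: chart_open ch.
  by apply: filterS h => -[[x' y'] b'] /= Ub'; rewrite asboolT.
 apply: (cont_comp); last first.
  by apply: (chartV_cont ch); apply: bump_coord_lt4 => //; apply: core_dist.
 have c11 : cont_at (fun p => k p.1.1) (x, y, b).
  by apply: (cont_comp); last exact: (chart_cont ch); apply: (cont_comp).
 have c12 : cont_at (fun p => k p.1.2) (x, y, b).
  by apply: (cont_comp); last exact: (chart_cont ch); apply: (cont_comp).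
 apply: cont_atD.
  apply: (cont_comp); [exact: cont_snd|exact: (chart_cont ch)].
 apply: cont_atZ; last exact: cont_atB.
 apply: (cont_comp); first exact: cont_snd.
 apply: bump_cont; lra.
apply: (@cont_near_eq _ _ snd) => //.
have cl : closed (cball (1 + 2)).
 apply: compact_closed => //; apply: cball_compact; lra.
have h : nbhs (x, y, b) (snd @^-1` (~` cball (1 + 2))).
 by apply/cont_snd/open_nbhs_nbhs; split; [exact: closed_openC|move=> []].
apply: filterS h => -[[x' y'] b'] /= nb; rewrite bump_out // scale0r addr0.
by case: asboolP => // Ub'; rewrite (chartK ch).
Qed.

End OneChart.
End Charts.

Definition clamp (R : realType) (t : R) : R := Num.max 0 (Num.min 1 t).

Lemma clamp_in (R : realType) (t : R) : 0 <= clamp t <= 1.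
Proof. by rewrite le_max lexx ge_max ler01 ge_min lexx. Qed.

Lemma clamp_id (R : realType) (t : R) : 0 <= t <= 1 -> clamp t = t.
Proof. by move=> /andP[t0 t1]; rewrite /clamp min_r // max_r. Qed.

Lemma clamp_cont (R : realType) (X : topologicalType) (f : X -> R) a :
 cont_at f a -> cont_at (fun x => clamp (f x)) a.
Proof.
by move=> cf; apply: cont_max; first exact: cont_cst.
Qed.

(** Clamping the time makes the homotopy total in [t]. Continuity is kept relative to [A], the only
    place where it is known. *)
Lemma contr_exists R (X : topologicalType) A B : contractible_in R A B -> exists (c : X * R -> X) p, [/\ B p, forall x t,
 A x -> B (c (x, t)), forall x, A x -> c (x, 0) = x, forall x, A x -> c (x, 1) = p & forall x t U, A x -> nbhs (c (x, t))
  U -> nbhs (x, t) [set z | A z.1 -> U (c z)]].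
Proof.
move=> [p [H [Bp cH HB HE]]]; exists (fun z => H (z.1, clamp z.2)), p; split=> //=.
- move=> x t Ax; apply: HB => //; apply: clamp_in.
- by move=> x Ax; rewrite clamp_id ?lexx ?ler01 //; have [] := HE x.
- by move=> x Ax; rewrite clamp_id ?lexx ?ler01 //; have [] := HE x.
move=> x t U Ax HU; move/subspace_continuousP: cH => cH.
have Ixt : (A `*` `[0, 1]%classic) (x, clamp t).
 by split=> //=; rewrite in_itv clamp_in.
have nH : nbhs (x, clamp t) [set z | (A `*` `[0, 1]%classic) z -> U (H z)].
 exact: cH (x, clamp t) Ixt U HU.
have cp : cont_at (fun z => (z.1, clamp z.2)) (x, t).
 by apply: cont_pair; first exact: cont_fst; apply: (clamp_cont).
have := cp _ nH; apply: filterS => -[y s] /= h Ay; apply: h.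
by rewrite in_itv clamp_in.
Qed.

(** * Contracting the first point of a pair of distinct points *)

Section Lifting.
Variables (R : realType) (d : nat) (W : topologicalType).
Hypotheses (hW : hausdorff_space W) (mW : manifold R d W).
Variables (c : W * R -> W) (p : W).
Hypotheses (c_cont : forall z, cont_at c z).
Hypotheses (c0 : forall x, c (x, 0) = x) (c1 : forall x, c (x, 1) = p).

Definition conf : set (W * W) := [set z | z.1 <> z.2].

Variable Y : topologicalType.
Hypothesis cY : compact [set: Y].

(** [G] and [G'] act alike on cohomology. The compact set [B] plays the part of the track of a
    homotopy and is fixed before the cochain. *)
Definition cohomol (G G' : Y -> W * W) : Prop :=
 exists B : set (W * W), [/\ compact B, B `<=` conf &
  forall k phi, near_eq setT k.+1 B (delta phi) (fun=> false) ->
   exists eta, near_eq setT k setT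
    (fun t => phi (map G t) (+) phi (map G' t)) (delta eta)].

Lemma cohomol_refl G : cohomol G G.
Proof.
exists set0; split; [exact: compact0|by []|move=> k phi _].
exists (fun=> false); apply: neq_all => t.
by rewrite addbb delta0.
Qed.

Lemma cohomol_trans G' G G'' :
 cohomol G G' -> cohomol G' G'' -> cohomol G G''.
Proof.
move=> [B [cB BF hB]] [B' [cB' BF' hB']]; exists (B `|` B'); split.
- exact: compactU.
- by move=> z [/BF|/BF'].
move=> k phi dphi.
have [|e he] := hB k phi; first by apply: near_eqS dphi => z; left.
have [|e' he'] := hB' k phi; first by apply: near_eqS dphi => z; right.
exists (fun t => e t (+) e' t); apply: neq_trans (neq_trans (near_eqD he he') _).
 by apply: neq_all => t; case: (phi _); case: (phi _); case: (phi _).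
by apply: neq_all => t _; rewrite deltaD.
Qed.

Lemma homotopy_cohomol (H : Y * R -> W * W) :
 (forall z, cont_at H z) -> (forall z, conf (H z)) ->
 cohomol (fun y => H (y, 0)) (fun y => H (y, 1)).
Proof.
move=> cH HF; exists [set H z | z in setT `*` `[0, 1]]; split.
- apply: continuous_compact; last first.
  apply: compact_setX => //; apply: segment_compact.
 apply: continuous_subspaceT => z; apply: cH.
- by move=> _ [z _ <-].
- by move=> k phi; apply: homotopy_cochain.
Qed.

Variable iota : Y -> W * W.
Hypotheses (iota_cont : forall y, cont_at iota y) (iota_conf : forall y, conf (iota y)).

(** An intermediate stage of lifting the contraction [c] of the first point to pairs of distinct
    points; the pair indexed by [y] has reached time [s y]. *)
Definition lifted (s : Y -> R) (G : Y -> W * W) : Prop :=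
 [/\ forall y, cont_at s y, forall y, cont_at G y, forall y, conf (G y),
   forall y, (G y).1 = c ((iota y).1, s y) & cohomol iota G].

(** Time advances to [t1] where the first point of the original pair lies in a small ball. The
    second point is pushed by [cpush] along with the moving first point, which keeps the two
    distinct. *)
Lemma lift_push t0 t1 (V : set W) x0 U (k : W -> 'rV[R]_d) r a U' (k' : W -> 'rV[R]_d) r' s G : t0 <= t1 -> chart x0 U k
 r -> (forall b t, V b -> t0 <= t <= t1 -> core U k (c (b, t))) -> chart a U' k' r' -> U' `<=` V -> lifted s G -> (forall
  y, t0 <= s y <= t1) -> exists s' G', [/\ lifted s' G', forall y, t0 <= s' y <= t1, forall y, s y <= s' y & forall y, U'
   (iota y).1 -> `|k' (iota y).1| <= 1 -> s' y = t1].
Proof.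
move=> t01 ch chV ch' U'V [cs cG GF G1 cohG] st.
pose l b := cbump U' k' 1 b.
(* The time never decreases, is unchanged where the bump [l] vanishes, and reaches [t1] at the end
   where [l] is 1. *)
pose sg z := Num.max (s z.1) (t0 + clamp z.2 * l (iota z.1).1 * (t1 - t0)).
have st' z : t0 <= sg z <= t1.
 have /andP[st0 st1] := st z.1; have /andP[q0 q1] := clamp_in z.2.
 rewrite le_max ge_max.
 have l0 := bump_ge0 U' k' 1 (iota z.1).1; have l1 := bump_le1 U' k' 1 (iota z.1).1.
 have h : clamp z.2 * l (iota z.1).1 <= 1 by rewrite mulr_ile1.
 have : clamp z.2 * l (iota z.1).1 * (t1 - t0) <= 1 * (t1 - t0).
  by apply: ler_wpM2r => //; rewrite subr_ge0.
 lra.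
have ci1 z : cont_at (fun z => (iota z.1).1) z.
 by apply: (cont_comp) => //; apply: (cont_comp).
have csg z : cont_at sg z.
 apply: cont_max.
  by apply: (cont_comp).
 apply: cont_atD; first exact: cont_cst.
 apply: cont_atM; last exact: cont_cst.
 apply: cont_atM; first by apply: (clamp_cont).
 apply: (cont_comp); first exact: ci1.
 apply: (bump_cont hW ch'); lra.
pose src (z : Y * R) := c ((iota z.1).1, s z.1).
pose dst z := c ((iota z.1).1, sg z).
have csrc z : cont_at src z.
 by apply: (cont_comp2); [exact: ci1| |exact: c_cont]; apply: (cont_comp).
have cdst z : cont_at dst z.
 by apply: (cont_comp2).
pose H z := (dst z, cpush U k r (src z, dst z, (G z.1).2)).
have cG2 z : cont_at (fun z => (G z.1).2) z.
 by apply: (cont_comp) => //; apply: (cont_comp).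
have cores z : U' (iota z.1).1 -> core U k (src z) /\ core U k (dst z).
 by move=> /U'V Vz; split; apply: chV.
have sdE z : l (iota z.1).1 = 0 -> dst z = src z.
 by move=> l0; rewrite /dst /sg l0 mulr0 mul0r addr0 max_l //; have /andP[] := st z.1.
have cH z : cont_at H z.
 apply: cont_pair => //.
 have [Uz|nUz] := pselect (U' (iota z.1).1).
  have [c1' c2'] := cores z Uz.
  apply: (cont_comp2).
  - by [].
  - by [].
  - exact: (push_cont hW ch).
 apply: (@cont_near_eq _ _ (fun z => (G z.1).2)) => //.
 have cl : closed (cball U' k' (1 + 2)).
  apply: compact_closed => //; apply: (cball_compact ch'); lra.
 have : nbhs z ((fun z => (iota z.1).1) @^-1` (~` cball U' k' (1 + 2))).
  by apply/ci1/open_nbhs_nbhs; split; [exact: closed_openC|move=> []].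
 apply: filterS => z' nz.
 change ((G z'.1).2 = cpush U k r (src z', dst z', (G z'.1).2)).
 rewrite sdE ?(pushxx ch) //; exact: bump_out.
have HF z : conf (H z).
 change (dst z <> cpush U k r (src z, dst z, (G z.1).2)).
 have [Uz|nUz] := pselect (U' (iota z.1).1).
  have [c1' c2'] := cores z Uz; apply/nesym/(push_neq ch) => //.
  rewrite /src -G1; apply/nesym/GF.
 have -> : cpush U k r (src z, dst z, (G z.1).2) = (G z.1).2.
  by rewrite sdE ?(pushxx ch) //; apply: bump_out => -[].
 by rewrite sdE; [rewrite /src -G1; apply: GF|apply: bump_out => -[]].
have HG : (fun y => H (y, 0)) = G.
 apply/funext => y; have dE : dst (y, 0) = src (y, 0).
  by rewrite /dst /sg clamp_id ?lexx //= !mul0r addr0 max_l //; have /andP[] := st y.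
 rewrite /H dE (pushxx ch) /src -G1; by case: (G y).
exists (fun y => sg (y, 1)), (fun y => H (y, 1)); split.
- split.
 + by move=> y; apply: (cont_comp); last exact: csg.
 + by move=> y; apply: (cont_comp); last exact: cH.
 + by [].
 + by [].
 + apply: cohomol_trans cohG _; rewrite -HG.
  exact: homotopy_cohomol.
- by [].
- by move=> y; rewrite le_max lexx.
- move=> y Uy ky; rewrite /sg clamp_id ?lexx ?ler01 // mul1r /l bump1 // mul1r addrC subrK max_r //; by have /andP[] := st y.
Qed.

(** Time is cut so finely that each short piece of a track lies in the core of a chart; in each time
    step [lift_push] is repeated over finitely many balls, by compactness induction. *)
Lemma lift_contraction : exists G : Y -> W * W,
 [/\ forall y, cont_at G y, forall y, (G y).1 = p, forall y, (G y).2 <> p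
  & cohomol iota G].
Proof.
pose B := [set (iota y).1 | y in [set: Y]].
have ci1 y : cont_at (fun y => (iota y).1) y.
 by apply: (cont_comp).
have cB : compact B.
 apply: continuous_compact => //.
 apply: continuous_subspaceT => z; apply: ci1.
pose good O := exists x0 U (k : W -> 'rV[R]_d) r, chart x0 U k r /\ O `<=` core U k.
have [|m m0 mP] := @unif_subdiv R W W B c good cB c_cont.
 move=> y t It; have [U [k [r [ch _]]]] := chart_exists mW (@filterT _ (nbhs (c (y, t))) _).
 exists (core U k); last by exists (c (y, t)), U, k, r; split.
 apply: open_nbhs_nbhs; split; first exact: core_open ch.
 split; [exact: chart_center ch|rewrite (chart_at0 ch) normr0; lra].
have mR : 0 < m%:R :> R by rewrite ltr0n.
have step n : (n <= m)%N -> exists2 G, lifted (fun=> n%:R / m%:R) G & True.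
 elim: n => [_|n IHn nm].
  exists iota => //; split=> //.
   by rewrite mul0r.
  exact: cohomol_refl.
 have [G0 lG0 _] := IHn (ltnW nm).
 pose t0 : R := n%:R / m%:R; pose t1 : R := n.+1%:R / m%:R.
 have t01 : t0 <= t1 by rewrite ler_pM2r ?invr_gt0 // ler_nat.
 pose P E := forall s G, lifted s G -> (forall y, t0 <= s y <= t1) -> exists s' G', [/\ lifted s' G', forall y, t0 <= s'
  y <= t1, forall y, s y <= s' y & forall y, E (iota y).1 -> s' y = t1].
 have /(_ _ _ lG0) [|s' [G' [lG' _ _ s'1]]] : P B.
  apply: compact_ind => //.
  - by move=> s G st; exists s, G.
  - move=> E E' PE PE' s G lG st.
   have [s1 [G1 [lG1 st1 ss1 s1E]]] := PE s G lG st.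
   have [s2 [G2 [lG2 st2 ss2 s2E]]] := PE' s1 G1 lG1 st1.
   exists s2, G2; split=> // y; first exact: le_trans (ss2 y).
   by move=> [Ey|Ey]; last exact: s2E; apply/eqP; rewrite eq_le; have /andP[_ ->] := st2 y; rewrite -(s1E y Ey) ss2.
  - move=> E E' EE' PE s G lG st; have [s1 [G1 [lG1 st1 ss1 s1E]]] := PE s G lG st.
   exists s1, G1; split=> // y /EE'; apply: s1E.
  - move=> a Ba; have [V aV VP] := mP a Ba; have [ O [x0 [U [k [r [ch OU]]]]] OP] := VP n nm.
   have [U' [k' [r' [ch' U'V]]]] := chart_exists mW aV.
   exists [set b | U' b /\ `|k' b| < 1].
    by apply: open_nbhs_nbhs; split; first exact: (chart_oball ch'); split; [exact: chart_center ch'|rewrite (chart_at0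
     ch') normr0].
   move=> s G lG st.
   have [b t Vb tt|s1 [G1 [lG1 st1 ss1 s1E]]] := lift_push t01 ch _ ch' U'V lG st.
    by apply/OU/OP.
   by exists s1, G1; split=> // y [[Uy ky] _]; apply: s1E => //; apply: ltW.
 - by rewrite lexx.
 by exists G' => //; have <- : s' = (fun=> t1) by apply/funext => y; apply: s'1; exists y.
have [G [_ cG GF G1 cohG] _] := step m (leqnn _).
have Gp y : (G y).1 = p by rewrite G1 divff // gt_eqF.
exists G; split=> // y Gy2; apply: (GF y); by rewrite Gp.
Qed.

End Lifting.

Section ChartCoordinates.
Variables (R : realType) (d : nat).

Lemma norm_coord_le (u : 'rV[R]_d) i : `|u 0 i| <= `|u|.
Proof. rewrite [leRHS]mx_normrE; apply: (le_bigmax _ (fun ij => `|u ij.1 ij.2|) (0, i)). Qed.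

Lemma norm_le_co (u : 'rV[R]_d) e : 0 <= e -> (forall i, `|u 0 i| <= e) -> `|u| <= e.
Proof.
by move=> e0 ue; rewrite [leLHS]mx_normrE; apply: bigmax_le => // -[i j] _; rewrite ord1.
Qed.

Lemma norm_lt_co (u : 'rV[R]_d) e : 0 < e -> (forall i, `|u 0 i| < e) -> `|u| < e.
Proof.
by move=> e0 ue; rewrite [ltLHS]mx_normrE; apply: bigmax_lt => // -[i j] _; rewrite ord1.
Qed.

Variables (W : topologicalType) (x0 : W) (U : set W).
Variables (k : W -> 'rV[R]_d) (r : 'rV[R]_d -> W).
Hypothesis ch : chart x0 U k r.

Lemma chart_cclose x e : U x -> 0 < e ->
 exists2 V, nbhs x V & forall y, V y -> cclose k e x y.
Proof.
exists [set y | `|k x - k y| < e].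
 apply: cont_lt; last by rewrite subrr normr0.
  apply/cont_norm/cont_atB; [exact: cont_cst|exact: (chart_cont ch)].
 by [].
by move=> y xy i; apply: le_lt_trans xy; have := norm_coord_le (k x - k y) i; rewrite !mxE.
Qed.

Lemma chart_coord_emb x V : U x -> nbhs x V ->
 exists2 e, 0 < e & forall y, U y -> cclose k e x y -> V y.
Proof.
move=> Ux xV; have kx4 := chart_lt4 ch Ux.
have : nbhs (k x) (r @^-1` V) by apply: (chartV_cont ch kx4); rewrite (chartK ch).
move=> /nbhs_ballP[e e0 eV]; exists e => // y Uy xy.
rewrite -(chartK ch Uy); apply: eV; rewrite -ball_normE /=; apply: norm_lt_co => // i.
by rewrite !mxE.
Qed.

End ChartCoordinates.

Definition swap2 (X : Type) (z : X * X) : X * X := (z.2, z.1).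

Lemma swap2K X : involutive (@swap2 X).
Proof. by case. Qed.

Lemma swap2_cont (X : topologicalType) (z : X * X) : cont_at (@swap2 X) z.
Proof. by []. Qed.

Lemma swap2_continuous (X : topologicalType) : continuous (@swap2 X).
Proof. apply: swap2_cont. Qed.

Lemma delta_size X f (t : seq X) : delta (fun t => f (size t)) t = odd (size t) && f (size t).-1.
Proof.
elim: t f => //= x t IHt f; rewrite (IHt (fun n => f n.+1)).
by case: (size t) => [|n] /=; [case: (f 0)|case: (odd n); case: (f n.+1)].
Qed.

Lemma map_const_nseq X Y (p : Y) (t : seq X) : map (fun=> p) t = nseq (size t) p.
Proof. by elim: t => //= x t ->. Qed.

Lemma delta_nseq X (c : seq X -> bool) n p : delta c (nseq n p) = odd n && c (nseq n.-1 p).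
Proof.
have -> : nseq n p = map (fun=> p) (nseq n tt) by rewrite map_nseq.
rewrite -delta_map; have -> : (fun t : seq unit => c (map (fun=> p) t)) =
  (fun t => c (nseq (size t) p)) by apply/funext => t; rewrite map_const_nseq.
by rewrite (delta_size (fun m => c (nseq m p))) size_nseq.
Qed.

Lemma map_id_all_in X (U : set X) (f : X -> X) t : (forall x, U x -> f x = x) -> all_in U t -> map f t = t.
Proof. by move=> fU; elim: t => //= x t IHt [Ux Ut]; rewrite fU // IHt. Qed.

Lemma all_in_nseq X (U : set X) n x : U x -> all_in U (nseq n x).
Proof. by move=> Ux; elim: n. Qed.

(** * Cohomology of the space of pairs of distinct points *)

Section ConfigurationSpace.
Variables (R : realType) (d : nat) (W : topologicalType).
Hypotheses (hW : hausdorff_space W) (mW : manifold R d W).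
Variables (c : W * R -> W) (p : W).
Hypotheses (c_cont : forall z, cont_at c z).
Hypotheses (c0 : forall x, c (x, 0) = x) (c1 : forall x, c (x, 1) = p).

Lemma hausdorff_prod : hausdorff_space (W * W)%type.
Proof.
move=> [x y] [x' y'] cl; congr (_, _); apply: hW => A B xA yB.
 have [||[a b] [/= Aa Ba]] := cl (fst @^-1` A) (fst @^-1` B); last by exists a.
  exact: cont_fst W (x, y) A xA.
 exact: cont_fst W (x', y') B yB.
have [||[a b] [/= Aa Ba]] := cl (snd @^-1` A) (snd @^-1` B); last by exists b.
 exact: cont_snd W (x, y) A xA.
exact: cont_snd W (x', y') B yB.
Qed.

Lemma disj_charts a b : a <> b ->
 exists Ua (ka : W -> 'rV[R]_d) ra Ub (kb : W -> 'rV[R]_d) rb,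
 [/\ chart a Ua ka ra, chart b Ub kb rb & Ua `&` Ub = set0].
Proof.
move=> /eqP ab; move: (hW); rewrite open_hausdorff => /(_ _ _ ab) [[A B] [aA bB] [oA oB AB]].
rewrite !inE in aA bB.
have [Ua [ka [ra [cha UA]]]] := chart_exists mW (open_nbhs_nbhs (conj oA aA)).
have [Ub [kb [rb [chb UB]]]] := chart_exists mW (open_nbhs_nbhs (conj oB bB)).
exists Ua, ka, ra, Ub, kb, rb; split=> //.
rewrite -subset0 => x [/UA Ax /UB Bx].
by move/eqP: AB; rewrite -subset0 => /(_ x (conj Ax Bx)).
Qed.

Lemma cball_nbhs x0 U (k : W -> 'rV[R]_d) r s : chart x0 U k r -> 0 < s ->
 nbhs x0 (cball U k s).
Proof.
move=> ch s0; have : nbhs x0 [set y | U y /\ `|k y| < s].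
 by apply: open_nbhs_nbhs; split; first exact: (chart_oball ch); split; [exact: chart_center ch|rewrite (chart_at0 ch) normr0].
by apply: filterS => y [Uy ky]; split=> //; apply: ltW.
Qed.

Lemma conf_compact_nbhs (B : set (W * W)) : compact B -> B `<=` @conf W ->
 exists K, [/\ compact K, K `<=` @conf W & forall z, B z -> nbhs z K].
Proof.
move=> cB BF.
pose P E := exists K, [/\ compact K, K `<=` @conf W & forall z, (E `&` B) z -> nbhs z K].
have [K [cK KF KP]] : P B.
 apply: compact_ind => //.
 - by exists set0; split=> //; [exact: compact0|move=> z []].
 - move=> E E' [K [cK KF KP]] [K' [cK' KF' KP']]; exists (K `|` K'); split.
  + exact: compactU.
  + by move=> z [/KF|/KF'].
  + move=> z [[Ez|Ez] Bz].
    by apply: filterS (KP z (conj Ez Bz)) => y; left.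
   by apply: filterS (KP' z (conj Ez Bz)) => y; right.
 - by move=> E E' EE' [K [cK KF KP]]; exists K; split=> // z [Ez Bz]; apply: KP; split=> //; apply: EE'.
 move=> [a b] Bab; have [Ua [ka [ra [Ub [kb [rb [cha chb dis]]]]]]] := disj_charts (BF _ Bab).
 pose K := cball Ua ka 2 `*` cball Ub kb 2.
 have nK : nbhs (a, b) K.
  exists (cball Ua ka 2, cball Ub kb 2) => //=.
  by split; [apply: (cball_nbhs cha)|apply: (cball_nbhs chb)].
 exists K°; first exact: nbhs_interior.
 exists K; split.
 - apply: compact_setX; [apply: (cball_compact cha)|apply: (cball_compact chb)]; lra.
 - by move=> [x y] [/= [Ux _] [Uy _]] xy; have {}xy : x = y := xy; move: dis; rewrite -subset0 => /(_ x); apply; split=>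
  //; rewrite xy.
 - by move=> z [[]].
by exists K; split=> // z Bz; apply: KP.
Qed.

(** [phi] has degree [k - 1 >= d]. Once the first point is contracted to [p], the second one ranges
    over the manifold punctured at [p]; a cocycle of this degree extends over the puncture and is
    then killed by the contraction. [B'] has to contain all the tracks involved. *)
Lemma pro_vanishing k (B : set (W * W)) : (d < k)%N -> compact B -> B `<=` @conf W ->
 exists B', [/\ compact B', B' `<=` @conf W &
  forall phi, near_eq setT k.+1 B' (delta phi) (fun=> false) ->
   exists eta, near_eq setT k B phi (delta eta)].
Proof.
move=> dk cB BF; have [K [cK KF KB]] := conf_compact_nbhs cB BF.
pose Y := set_type K.
have iota_cont y : cont_at (set_val : Y -> W * W) y by apply: initial_continuous.
have [G [cG G1 G2 [B1 [cB1 BF1 hB1]]]] := @lift_contraction R d W hW mW c p c_cont c0 c1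
 Y (compact_set_type cK) set_val iota_cont (fun y => KF _ (set_valP y)).
pose Y2 := [set (G y).2 | y in [set: Y]].
have cG2 y : cont_at (fun y => (G y).2) y.
 by apply: (cont_comp).
have cY2 : compact Y2.
 apply: continuous_compact; last exact: compact_set_type.
 apply: continuous_subspaceT => z; apply: cG2.
have nY2 : nbhs p (~` Y2).
 apply: open_nbhs_nbhs; split; first by apply: closed_openC; apply: compact_closed.
 by move=> [y _] yp; apply: (G2 y).
have [U [kap [r [ch UY2]]]] := chart_exists mW nY2.
pose E := [set c z | z in Y2 `*` `[0, 1]].
have cE : compact E.
 apply: continuous_compact; first by apply: continuous_subspaceT => z; apply: c_cont.
 apply: compact_setX => //; apply: segment_compact.
pose D := cball U kap 2.
have cD : compact D by apply: (cball_compact ch); lra.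
(* What the contraction sweeps out from the second points, together with a ball around [p], minus a
   smaller ball around [p]. *)
pose shell s := (E `|` D) `&` ~` [set y | U y /\ `|kap y| < s].
have cshell s : compact (shell s).
 apply: compact_closedI; first exact: compactU.
 apply/open_closedC/(chart_oball ch).
exists (B1 `|` [set (p, y) | y in shell 1]); split.
- by apply: compactU => //; apply: continuous_compact => //; apply: continuous_subspaceT => z; apply: cont_pair; first
 exact: cont_cst.
- by move=> z [/BF1//|[y [_ ny] <-]] py; apply: ny; have {}py : p = y := py; rewrite -py; split; [exact: chart_center
 ch|rewrite (chart_at0 ch) normr0].
move=> phi dphi; pose phip t := phi (map (pair p) t).
have dphip : near_eq setT k.+1 (shell 1) (delta phip) (fun=> false).
 move=> y sy; have [|V yV VP] := dphi (p, y); first by right; exists y.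
 exists (pair p @^-1` V); first by apply: cont_pair.
 move=> t st tV; rewrite delta_map; apply: VP; first by rewrite size_map.
 by apply/allin_map.
pose C := ~` [set y | U y /\ `|kap y| < 3 / 2].
have DC : D `&` C `<=` shell 1.
 move=> y [Dy Cy]; split; first by right.
 move=> [Uy ky]; apply: Cy; split=> //; lra.
have cDC : compact (D `&` C).
 apply: compact_closedI => //; apply/open_closedC/(chart_oball ch).
have DU y : D y -> nbhs y U.
 move=> [Uy _]; apply: open_nbhs_nbhs; split=> //; apply: chart_open ch.
(* Near [p] the cochain [phip] is arbitrary, so [delta phip] need not vanish there. It has a
   primitive [psi] that vanishes away from [p], and subtracting [psi] turns [phip] into a cocycle
   near the whole of [E]. *)
have [||||psi [psi1 psi2]] := @coordinate_vanishing R W setT d kap D C U cD cDC (fun _ _ => I) DU _ _ k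
 (delta phip) dk.
- by move=> x e [Ux _] e0; have [V xV VP] := chart_cclose ch Ux e0; exists V => // y [/VP].
- by move=> x V [Ux _] xV; have [e e0 eV] := chart_coord_emb ch Ux xV; exists e => // y [_ Uy]; apply: eV.
- apply: neq_all => t _ _; apply: deltaK.
- by apply: near_eqS dphip.
pose P := shell (3 / 2).
have PD : P `&` D `<=` D `&` C by move=> y [[_ nC] Dy].
have k0 : (0 < k)%N by apply: leq_ltn_trans dk.
have idK : involutive (@id W) by [].
have idc : continuous (@id W) by move=> z.
have [|||||chi [_ chiP chiD]] := @glue_cochains W setT id idK idc (fun _ _ => I) k P D
  phip (fun t => phip t (+) psi t) k0 hW (cshell _) cD.
- by [].
- by [].
- by move=> t; rewrite map_id.
- by move=> t; rewrite map_id.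
- by apply: (near_eqS PD); move=> z Az; have [V zV VP] := psi2 z Az; exists V => // t st tV; rewrite VP // addbF.
have dchi : near_eq setT k.+1 E (delta chi) (fun=> false).
 move=> y Ey; have [Dy|nDy] := pselect (D y).
  have h : near_eq setT k.+1 D (delta chi) (fun=> false).
   apply: neq_trans (neq_delta chiD) _.
   apply: (neq_trans).
    apply: neq_all => t _ _; apply: deltaD.
   by move=> z Dz; have [V zV VP] := psi1 z Dz; exists V => // t st tV; rewrite VP // addbb.
  exact: h.
 have h : near_eq setT k.+1 P (delta chi) (fun=> false).
  apply: neq_trans (neq_delta chiP) _; apply: near_eqS dphip.
  move=> z [EDz nz]; split=> // -[Uz kz]; apply: nz; split=> //; lra.
 apply: h; split; first by left.
 move=> [Uy ky]; apply: nDy; split=> //; lra.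
have Y2P : Y2 `<=` P.
 move=> y Y2y; split; last by move=> [/UY2].
 by left; exists (y, 0); [split=> //=; rewrite in_itv /= lexx ler01|rewrite c0].
have [eta1 eta1P] := homotopy_cochain cY2 c_cont dchi.
(* The second term is a primitive of the pullback of [chi] along the constant map to [p]. *)
pose eta2 t := eta1 t (+) chi (nseq (size t).+1 p).
have eta2P : near_eq setT k Y2 phip (delta eta2).
 move=> y Y2y; have [V yV VP] := eta1P y Y2y; have [V' yV' V'P] := chiP y (Y2P y Y2y).
 exists (V `&` V') => [|t st tV]; first exact: filterI.
 have tV1 : all_in (V `&` setT) t by apply: all_inS tV => z [[]].
 have tV2 : all_in (V' `&` setT) t by apply: all_inS tV => z [[]].
 rewrite deltaD -VP // -V'P // (eq_map (g := id)) // map_id (eq_map (g := fun=> p)) // map_const_nseq (delta_size (fun n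
  => chi (nseq n.+1 p))) st.
 have pE : E p by exists (y, 1); [split=> //=; rewrite in_itv /= lexx ler01|rewrite c1].
 have [V1 pV1 V1P] := dchi p pE.
 have := V1P (nseq k.+1 p); rewrite size_nseq delta_nseq => /(_ erefl).
 have nV1 : all_in (V1 `&` setT) (nseq k.+1 p).
  by apply: all_in_nseq; split=> //; apply: nbhs_singleton.
 by rewrite prednK ?(leq_ltn_trans dk) //= => h; move: h; case: (odd k) => /= [_|->]; case: (chi t); case: (chi _).
have [eta3 eta3P] : exists eta3 : seq Y -> bool,
  near_eq setT k setT (fun t => phi (map set_val t)) (delta eta3).
 have [|e eP] := hB1 k phi; first by apply: near_eqS dphi => z; left.
 exists (fun t => e t (+) eta2 (map (fun y => (G y).2) t)).
 have GE t : map G t = map (pair p) (map (fun y => (G y).2) t).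
  by rewrite -map_comp; apply: eq_map => y /=; rewrite -(G1 y); case: (G y).
 have h : near_eq setT k setT (fun t => phi (map G t)) (delta (fun t => eta2 (map (fun y => (G y).2) t))).
  move=> y _; have [|V yV VP] := eta2P (G y).2; first by exists y.
  exists ((fun y => (G y).2) @^-1` V); first exact: cG2.
  move=> t st tV; rewrite delta_map GE; apply: VP; first by rewrite size_map.
  by apply/allin_map.
 move=> y Yy; have [V yV VP] := eP y Yy; have [V' yV' VP'] := h y Yy.
 exists (V `&` V') => [|t st tV]; first exact: filterI.
 rewrite deltaD -VP -?VP' //; last first.
 - by apply: all_inS tV => w [[]].
 - by apply: all_inS tV => w [[]].
 by rewrite -addbA addbb addbF.
have [[z0 Bz0]|nB] := pselect (exists z, B z); last first.
 by exists (fun=> false) => z Bz; case: nB; exists z.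
have [y0 _] := st_sub (nbhs_singleton (KB z0 Bz0)).
(* An arbitrary extension of the inverse of the inclusion of [K]; only its values on [K] enter
   below. *)
have [s sP] : exists s : W * W -> Y, forall z, K z -> set_val (s z) = z.
 have /choice[s sP] : forall z, exists y : Y, K z -> set_val y = z.
  move=> z; have [Kz|nKz] := pselect (K z); last by exists y0.
  by have [y yz] := st_sub Kz; exists y.
 by exists s.
exists (fun t => eta3 (map s t)) => z Bz.
have zK := KB z Bz; have [y yz] := st_sub (nbhs_singleton zK).
have [//|V yV VP] := eta3P y; move/st_nbhs: yV => [V' zV' V'V].
exists (K `&` V'); first by apply: filterI => //; rewrite -yz.
move=> t st tKV; rewrite delta_map -VP ?size_map //.
 congr phi; rewrite -map_comp; apply/esym/(map_id_all_in (U := K)).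
  by [].
 by apply: all_inS tKV => w [[]].
apply/allin_map; apply: all_inS tKV => w [[Kw Vw] _]; split=> //.
by apply: V'V; rewrite sP.
Qed.

Local Notation T := (@swap2 W).

Lemma swap2_near_eq k A phi psi : inv_cochain T phi -> inv_cochain T psi ->
 near_eq setT k A phi psi -> near_eq setT k (T @^-1` A) phi psi.
Proof. apply: near_eq_invariant => //; apply: swap2_continuous. Qed.

Lemma swap2_glue k A B phi psi : (0 < k)%N -> compact A -> compact B ->
 (forall z, A z -> A (T z)) -> (forall z, B z -> B (T z)) ->
 inv_cochain T phi -> inv_cochain T psi ->
 near_eq setT k (A `&` B) phi psi -> exists e, [/\ inv_cochain T e,
  near_eq setT k A e phi & near_eq setT k B e psi].
Proof.
move=> k0 cA cB TA TB ip iq.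
by have := @glue_cochains (W * W)%type setT T (@swap2K W) (@swap2_continuous W) (fun _ _ => I) k A B phi psi k0
 hausdorff_prod cA cB TA TB ip iq.
Qed.

Lemma delta_invariant (c' : seq (W * W) -> bool) :
 inv_cochain T c' -> inv_cochain T (delta c').
Proof.
by move=> ic t; rewrite -delta_map; apply: eq_delta => s.
Qed.

(** Equivariant vanishing above degree [2d]. Being relative to [C] and inherited by invariant
    compact subsets [A] is what makes it stable under unions. *)
Definition equi_acyclic (K : set (W * W)) : Prop := forall k phi A C,
 (d + d < k)%N -> compact A -> compact C -> A `<=` K ->
 (forall z, A z -> A (T z)) -> (forall z, C z -> C (T z)) -> inv_cochain T phi ->
 near_eq setT k.+2 A (delta phi) (fun=> false) ->
 near_eq setT k.+1 (A `&` C) phi (fun=> false) ->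
 exists psi, [/\ inv_cochain T psi, near_eq setT k.+1 A (delta psi) phi
  & near_eq setT k (A `&` C) psi (fun=> false)].

Lemma compactI (X : topologicalType) (A B : set X) :
 hausdorff_space X -> compact A -> compact B -> compact (A `&` B).
Proof. by move=> hX cA cB; apply: compact_closedI => //; apply: compact_closed. Qed.

(** Mayer-Vietoris: solve on [K1], subtract, and solve the rest on [K2] relative to [K1] and [C],
    near which it already vanishes. *)
Lemma equi_acyclicU K1 K2 : compact K1 -> compact K2 ->
 (forall z, K1 z -> K1 (T z)) -> (forall z, K2 z -> K2 (T z)) ->
 equi_acyclic K1 -> equi_acyclic K2 ->
 equi_acyclic (K1 `|` K2).
Proof.
move=> cK1 cK2 T1 T2 h1 h2 k phi A C dk cA cC AK TA TC iphi dphi phi0.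
have hWW := hausdorff_prod; have k0 : (0 < k)%N by apply: leq_ltn_trans dk.
have i0 : inv_cochain T (fun=> false) by [].
have TI E F : (forall z, E z -> E (T z)) -> (forall z, F z -> F (T z)) -> forall z, (E `&` F) z -> (E `&` F) (T z) by
 move=> hE hF z [/hE ? /hF ?].
have cA1 : compact (A `&` K1) by apply: compactI.
have cA2 : compact (A `&` K2) by apply: compactI.
have cAC : compact (A `&` C) by apply: compactI.
have [||||p1 [ip1 dp1 zp1]] := h1 k phi (A `&` K1) C dk cA1 cC _ _ TC iphi => //.
- exact: TI.
- by apply: near_eqS dphi => [].
- by apply: near_eqS phi0 => z [[]].
have [|||e1 [ie1 e1A e1C]] := swap2_glue k0 cA1 cAC _ _ ip1 i0.
- exact: TI.
- exact: TI.
- by apply: near_eqS zp1 => z [Az [_ Cz]].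
pose phi' t := phi t (+) delta e1 t.
have iphi' : inv_cochain T phi'.
 by move=> t; rewrite /phi' iphi delta_invariant.
have phi'1 : near_eq setT k.+1 (A `&` K1) phi' (fun=> false).
 have h := neq_trans (neq_delta e1A) dp1.
 by move=> z Az; have [V zV VP] := h z Az; exists V => // t st tV; rewrite /phi' VP // addbb.
have phi'C : near_eq setT k.+1 (A `&` C) phi' (fun=> false).
 apply: (neq_trans (d := fun t => false (+) delta (fun=> false) t)).
  exact: near_eqD (neq_delta e1C).
 by apply: neq_all => t _; rewrite delta0.
pose C' := (A `&` K1) `|` (A `&` C).
have TC' z : C' z -> C' (T z).
 by case=> [[Az Kz]|[Az Cz]]; [left; split; [apply: TA|apply: T1]|right; split; [apply: TA|apply: TC]].
have cC' : compact C' by apply: compactU.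
have [||||p2 [ip2 dp2 zp2]] := h2 k phi' (A `&` K2) C' dk cA2 cC' _ _ TC' iphi' => //.
- exact: TI.
- by apply: near_eqS (_ : near_eq setT k.+2 A _ _) => //; apply: neq_trans dphi; apply: neq_all => t; rewrite deltaD deltaK addbF.
- by apply: near_eqS (near_eqU phi'1 phi'C) => [].
have [|||e2 [ie2 e2A e2C]] := swap2_glue k0 cA2 cC' _ _ ip2 i0.
- exact: TI.
- by [].
- by [].
exists (fun t => e1 t (+) e2 t); split.
- by move=> t; rewrite ie1 ie2.
- have dE : near_eq setT k.+1 A (delta (fun t => e1 t (+) e2 t))
   (fun t => delta e1 t (+) delta e2 t).
  apply: neq_all => t _ _; apply: deltaD.
 apply: neq_trans dE _; apply: (near_eqS (B := (A `&` K1) `|` (A `&` K2))).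
  by move=> z Az; have [] := AK z Az; [left|right].
 apply: near_eqU.
  have h1' := neq_trans (neq_delta e1A) dp1.
  have h2' : near_eq setT k.+1 (A `&` K1) (delta e2) (delta (fun=> false)).
   by apply: neq_delta; apply: near_eqS e2C => z; left.
  by apply: (neq_trans (near_eqD h1' h2')); apply: neq_all => t _; rewrite delta0 addbF.
 have h2' := neq_trans (neq_delta e2A) dp2.
 by move=> z Az; have [V zV VP] := h2' z Az; exists V => // t st tV; rewrite VP // addbC addbK.
- have h2' : near_eq setT k (A `&` C) e2 (fun=> false) by apply: near_eqS e2C => z; right.
 exact: near_eqD e1C h2'.
Qed.

(** Disjoint charts around [a] and [b] give [d + d] coordinates on a product that is disjoint from
    its mirror image; a solution on one copy is carried to the other by the swap. *)
Lemma equi_acyclic_local a b : a <> b -> exists K, [/\ compact K, nbhs ((a, b) : W * W) K,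
 forall z, K z -> K (T z) & equi_acyclic K].
Proof.
move=> ab; have [Ua [ka [ra [Ub [kb [rb [cha chb dis]]]]]]] := disj_charts ab.
have dis' x : Ua x -> Ub x -> False.
 by move=> Ux Vx; move: dis; rewrite -subset0 => /(_ x); apply.
pose Q := cball Ua ka 2 `*` cball Ub kb 2.
have cQ : compact Q.
 apply: compact_setX; [apply: (cball_compact cha)|apply: (cball_compact chb)]; lra.
have nQ : nbhs (a, b) Q.
 exists (cball Ua ka 2, cball Ub kb 2) => //=.
 by split; [apply: (cball_nbhs cha)|apply: (cball_nbhs chb)].
exists (Q `|` T @` Q); split.
- apply: compactU => //; apply: continuous_compact => //.
 apply/continuous_subspaceT/swap2_continuous.
- by apply: filterS nQ => z; left.
- by move=> z [Qz|[y Qy <-]]; [right; exists z|left; rewrite swap2K].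
move=> k phi A C dk cA cC AK TA TC iphi dphi phi0.
have hWW := hausdorff_prod.
have cAQ : compact (A `&` Q) by apply: compactI.
have cAQC : compact (A `&` Q `&` C) by apply: compactI.
pose O := Ua `*` Ub.
have oO : open O.
 rewrite openE => z [z1 z2]; exists (Ua, Ub) => //.
 split; apply: open_nbhs_nbhs; split=> //; [exact: chart_open cha|exact: chart_open chb].
pose kap z := row_mx (ka z.1) (kb z.2).
have closeE e x y : cclose ka e x.1 y.1 -> cclose kb e x.2 y.2 ->
  cclose kap e x y.
 move=> h1 h2 i; case: (split_ordP i) => j ->.
  by rewrite !row_mxEl.
 by rewrite !row_mxEr.
have QO z : (A `&` Q) z -> O z by move=> [_ [[? _] [? _]]].
have [|||||psi [psi1 psi2]] := @coordinate_vanishing R (W * W)%type setT (d + d) kap (A `&` Q) C O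
  cAQ cAQC (fun _ _ => I) _ _ _ k phi dk.
- by move=> z /QO Oz; apply: open_nbhs_nbhs.
- move=> z e /QO [Ua1 Ub1] e0.
 have [V zV VP] := chart_cclose cha Ua1 e0; have [V' zV' VP'] := chart_cclose chb Ub1 e0.
 exists (V `*` V'); first by exists (V, V').
 by move=> y [[Vy V'y] _]; apply: closeE; [apply: VP|apply: VP'].
- move=> z V /QO [Ua1 Ub1] [[V1 V2] [zV1 zV2] V12].
 have [e1 e10 e1P] := chart_coord_emb cha Ua1 zV1; have [e2 e20 e2P] := chart_coord_emb chb Ub1 zV2.
 exists (Num.min e1 e2); first by rewrite lt_min e10.
 move=> y [_ [Uy Uy']] zy; apply: V12; split=> /=.
  by apply: e1P => // i; have := zy (lshift d i); rewrite !row_mxEl lt_min => /andP[].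
 by apply: e2P => // i; have := zy (rshift d i); rewrite !row_mxEr lt_min => /andP[].
- by apply: near_eqS dphi => [].
- by apply: near_eqS phi0 => z [[]].
pose psi' t := if `[< all_in O t >] then psi t
 else if `[< all_in O (map T t) >] then psi (map T t) else false.
have mapTK : involutive (map T) by move=> t; rewrite mapK //; apply: swap2K.
have excl t : all_in O t -> all_in O (map T t) -> t = [::].
 by case: t => //= z t [[? ?] _] [[? ?] _]; case: (dis' z.1).
have ipsi' : inv_cochain T psi'.
 by move=> t; rewrite /psi' mapTK; case: asboolP => h1; case: asboolP => h2 //; rewrite (excl _ h2 h1).
have psi'O t : all_in O t -> psi' t = psi t by rewrite /psi' => /asboolP ->.
have near_O j : near_eq setT j (A `&` Q) psi' psi.
 by move=> z /QO Oz; exists O; first exact: open_nbhs_nbhs; move=> t _ tO; apply: psi'O; apply: all_inS tO => [].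
have AE : A `<=` (A `&` Q) `|` (T @^-1` (A `&` Q)).
 move=> z Az; have [Qz|[y Qy yz]] := AK z Az; first by left.
 by right; rewrite /= -yz swap2K; split=> //; rewrite -(swap2K y) yz; apply: TA.
have d1 := neq_trans (neq_delta (near_O k)) psi1.
have d2 : near_eq setT k (A `&` Q `&` C) psi' (fun=> false).
 by apply: neq_trans psi2; apply: near_eqS (near_O k) => [].
exists psi'; split=> //.
- apply: (near_eqS AE); apply: (near_eqU d1); apply: swap2_near_eq => //.
 exact: delta_invariant.
- apply: (near_eqS (B := (A `&` Q `&` C) `|` (T @^-1` (A `&` Q `&` C)))).
  by move=> z [Az Cz]; case: (AE z Az) => h; [by left|right]; split=> //; apply: TC.
 by apply: (near_eqU d2); apply: swap2_near_eq.
Qed.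

Lemma equi_acyclic_conf B : compact B -> B `<=` @conf W ->
 exists K, [/\ compact K, B `<=` K & equi_acyclic K].
Proof.
move=> cB BF.
pose P E := exists K, [/\ compact K, E `<=` K, forall z, K z -> K (T z) & equi_acyclic K].
have [K [cK BK _ hK]] : P B; last by exists K.
apply: compact_ind => //.
- exists set0; split=> //; first exact: compact0.
 move=> k phi A C _ _ _ A0 _; exists (fun=> false); split=> // z.
  by move=> /A0.
 by move=> [/A0].
- move=> E E' [K [cK EK TK hK]] [K' [cK' EK' TK' hK']]; exists (K `|` K'); split.
 + exact: compactU.
 + by move=> z [/EK|/EK']; [left|right].
 + by move=> z [/TK|/TK']; [left|right].
 + exact: equi_acyclicU.
- by move=> E E' EE' [K [cK EK hK]]; exists K; split=> // z /EE' /EK.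
- by move=> [a b] /BF ab; have [K [cK hK]] := equi_acyclic_local ab; exists K => //; exists K.
Qed.

Lemma conf_open : open (@conf W).
Proof.
rewrite openE => -[a b] ab; have [Ua [ka [ra [Ub [kb [rb [cha chb dis]]]]]]] := disj_charts ab.
exists (Ua, Ub).
 split; apply: open_nbhs_nbhs; split; [apply: chart_open cha|apply: chart_center cha|apply: chart_open chb|apply:
  chart_center chb].
move=> [x y] [Ux Uy] xy; have {}xy : x = y := xy.
by move: dis; rewrite -subset0 => /(_ x); apply; split=> //; rewrite xy.
Qed.

Variable s0 : W * W -> bool.
Hypothesis s0T : forall z, conf z -> s0 (T z) = ~~ s0 z.

(** On [k.+1] points [delta (sgnc k)] is the product of the differences of [s0] at consecutive
    points: the [k]-th cup power of the class of the double cover given by the swap. It is invariant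
    on [conf], whereas [sgnc k] in general is not. *)
Fixpoint sgnc (k : nat) : seq (W * W) -> bool :=
 if k is k'.+1 then head_mul s0 (delta (sgnc k')) else fun=> true.

Lemma delta_sgnc k x y t :
 delta (sgnc k.+1) [:: x, y & t] =
 (s0 x (+) s0 y) && delta (sgnc k) (y :: t).
Proof.
rewrite [sgnc k.+1]/= delta_head_mul //.
have -> : head_mul s0 (delta (delta (sgnc k))) [:: x, y & t] = false.
 by rewrite /head_mul deltaK andbF.
exact: addbF.
Qed.

Lemma sgnc_invariant k t : all_in (@conf W) t ->
 delta (sgnc k) (map T t) = delta (sgnc k) t.
Proof.
elim: k t => [|k IHk] [|x [|y t]] //.
 by rewrite (delta_size (fun=> true)) (delta_size (fun=> true)) size_map.
move=> [Fx [Fy Ft]]; rewrite !delta_sgnc !s0T // addbN addNb negbK.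
by rewrite -map_cons IHk.
Qed.

Lemma sign_class_top k (B : set (W * W)) : (d + d < k)%N -> compact B -> B `<=` @conf W ->
 (forall z, B z -> B (T z)) -> exists omega, inv_cochain T omega /\
  near_eq setT k.+1 B (delta (sgnc k)) (delta omega).
Proof.
move=> dk cB BF TB; have [K [cK BK hK]] := equi_acyclic_conf cB BF.
(* Cut off outside [conf], because [s0] is known to change under the swap only there. *)
pose u t := `[< all_in (@conf W) t >] && delta (sgnc k) t.
have FT t : all_in (@conf W) (map T t) <-> all_in (@conf W) t.
 rewrite allin_map; split; apply: all_inS => z /=; exact: nesym.
have iu : inv_cochain T u.
 move=> t; rewrite /u; case: asboolP => h1; case: asboolP => h2 //.
 - by apply: sgnc_invariant.
 - by case: h2; apply/FT.
 - by case: h1; apply/FT.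
have uB j : near_eq setT j B u (delta (sgnc k)).
 move=> z /BF Fz; exists (@conf W); first by apply: open_nbhs_nbhs; split=> //; apply: conf_open.
 by move=> t _ tF; rewrite /u; case: asboolP => // -[]; apply: all_inS tF => [].
have [|||psi [ipsi dpsi _]] := hK k u B set0 dk cB compact0 BK TB _ iu.
- by [].
- apply: neq_trans (neq_delta (uB _)) _.
 apply: neq_all => t _ _; apply: deltaK.
- by move=> z [].
exists psi; split=> //; apply: neq_trans (near_eq_sym (uB _)) (near_eq_sym dpsi).
Qed.

(** A transfer. If [delta (sgnc k.+1)] is the coboundary of an invariant [om], then
    [sgnc k.+1 (+) om] is a cocycle, hence some [delta eta] by [pro_vanishing]. Adding the mirror
    image cancels [om] and leaves [delta (sgnc k)] as the coboundary of [eta] plus its mirror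
    image. *)
Lemma sign_class_down k (B : set (W * W)) : (d <= k)%N ->
 (forall B, compact B -> B `<=` @conf W -> (forall z, B z -> B (T z)) ->
   exists omega, inv_cochain T omega /\
    near_eq setT k.+2 B (delta (sgnc k.+1)) (delta omega)) ->
 compact B -> B `<=` @conf W -> (forall z, B z -> B (T z)) ->
 exists omega, inv_cochain T omega /\
  near_eq setT k.+1 B (delta (sgnc k)) (delta omega).
Proof.
move=> dk IH cB BF TB; have [B' [cB' BF' hB']] := @pro_vanishing k.+1 B dk cB BF.
have [|||om [iom omP]] := IH (B' `|` T @` B').
- apply: compactU => //; apply: continuous_compact => //.
 apply/continuous_subspaceT/swap2_continuous.
- by move=> z [/BF'//|[y /BF' Fy <-]]; apply: nesym.
- by move=> z [Bz|[y By <-]]; [right; exists z|left; rewrite swap2K].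
pose phi t := sgnc k.+1 t (+) om t.
have [|eta etaP] := hB' phi.
 apply: (neq_trans).
  apply: neq_all => t _ _; apply: deltaD.
 have h : near_eq setT k.+2 B' (delta (sgnc k.+1)) (delta om).
  by apply: near_eqS omP => z; left.
 apply: (neq_trans (d := fun t => delta om t (+) delta om t)).
  by move=> z Bz; have [V zV VP] := h z Bz; exists V => // t st tV; rewrite VP.
 apply: neq_all => t _ _; apply: addbb.
exists (fun t => eta t (+) eta (map T t)); split.
 by move=> t; rewrite addbC (mapK (@swap2K W)).
move=> z Bz; have [V zV VP] := etaP z Bz; have [V' zV' VP'] := etaP (T z) (TB z Bz).
exists (V `&` (T @^-1` V') `&` @conf W).
 apply: filterI; last by apply: open_nbhs_nbhs; split; [exact: conf_open|exact: BF].
 by apply: filterI => //; apply: swap2_cont.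
move=> t st tV; rewrite deltaD delta_map -VP //; last by apply: all_inS tV => w [[[]]].
rewrite -VP' ?size_map //; last by rewrite allin_map; apply: all_inS tV => w [[[]]].
rewrite /phi iom.
have tF : all_in (@conf W) t by apply: all_inS tV => w [[]].
case: t st tV tF => // x t st tV [Fx Ft].
have consE y u : sgnc k.+1 (y :: u) = s0 y && delta (sgnc k) (y :: u) by [].
rewrite !consE s0T // -map_cons sgnc_invariant => //.
by case: (s0 x); case: (delta _); case: (om _).
Qed.

End ConfigurationSpace.

(** Descending induction: degree [k + 2d + 1] is covered by [sign_class_top], and [2d + 1] transfers
    lead down to [k]. *)
Lemma sign_class_vanishing R d k (W : topologicalType) (B : set (W * W)) : (d <= k)%N -> manifold R d W -> contractible R
 W -> compact B -> B `<=` @conf W -> (forall z, B z -> B (swap2 z)) -> exists s0, (forall z, conf z -> s0 (swap2 z) = ~~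
  s0 z) /\ exists omega, inv_cochain (@swap2 W) omega /\ near_eq setT k.+1 B (delta (sgnc s0 k)) (delta omega).
Proof.
move=> dk mW cW cB BF TB.
have [hW _ _] := mW; have [c [p [_ _ c0 c1 cc]]] := contr_exists cW.
have c_cont z : cont_at c z.
 by case: z => x t U HU; have := cc x t U I HU; apply: filterS => z /(_ I).
(* A choice of one pair in each swap orbit; [s0] tells whether a pair is the chosen one. *)
pose rep (z : W * W) := choose (fun w => (w == z) || (w == swap2 z)) z.
pose s0 z := rep z == z.
have s0T z : conf z -> s0 (swap2 z) = ~~ s0 z.
 move=> Fz; rewrite /s0; have rT : rep (swap2 z) = rep z.
  rewrite /rep; set P := fun w => (w == z) || _.
  have -> : choose (fun w => (w == swap2 z) || (w == swap2 (swap2 z))) (swap2 z) = choose P (swap2 z).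
   by apply: eq_choose => w; rewrite orbC.
  by apply: choose_id; rewrite /P eqxx ?orbT.
 have zT : swap2 z != z by case: z Fz {rT} => a b Fz; apply/eqP => -[ba _]; apply: Fz.
 rewrite rT; have : (rep z == z) || (rep z == swap2 z).
  by apply: (@chooseP _ (fun w => (w == z) || (w == swap2 z))); rewrite eqxx.
 by case: (eqVneq (rep z) z) => [->|_] => //; rewrite eq_sym (negPf zT).
exists s0.
suff H j B' : compact B' -> B' `<=` @conf W -> (forall z, B' z -> B' (swap2 z)) ->
  (j <= (d + d).+1)%N -> exists omega, inv_cochain (@swap2 W) omega /\
  near_eq setT (k + (d + d).+1 - j).+1 B'
   (delta (sgnc s0 (k + (d + d).+1 - j))) (delta omega).
 by have := H _ B cB BF TB (leqnn _); rewrite addnK.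
elim: j B' => [|j IHj] B' cB' BF' TB' jd.
 apply: (@sign_class_top R d W hW mW s0 s0T) => //; lia.
have jE : (k + (d + d).+1 - j = (k + (d + d).+1 - j.+1).+1)%N by lia.
apply: (@sign_class_down R d W hW mW c p c_cont (fun x => c0 x I) (fun x => c1 x I) s0 s0T) => //.
 lia.
move=> B2 cB2 BF2 TB2; have := IHj B2 cB2 BF2 TB2 (ltnW jd).
by rewrite jE.
Qed.

Lemma delta_extf (X : eqType) (c d : seq X -> bool) t :
 (forall s, subseq s t -> size s = (size t).-1 -> c s = d s) ->
 delta c t = delta d t.
Proof.
elim: t c d => //= x t IHt c d cd.
have -> : c t = d t by apply: cd => //; apply: subseq_cons.
congr addb.
case: t IHt cd => // y t IHt cd; apply: IHt => s st ss; apply: cd => /=.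
 by rewrite eqxx.
by rewrite ss.
Qed.

Lemma delta_seq1 X (c : seq X -> bool) x : delta c [:: x] = c [::].
Proof. by rewrite /= addbF. Qed.

(** * Barycentric subdivision of cochains on a vector space *)

Section Subdivision.
Variables (R : realType) (N : nat).
Local Notation E := 'rV[R]_N.
Implicit Types (t s : seq E) (c d : seq E -> bool) (C : set E).

Definition convexs C : Prop := forall x y (l : R), C x -> C y -> 0 <= l <= 1 ->
 C (l *: x + (1 - l) *: y).

Definition mean t : E := (size t)%:R^-1 *: \sum_(x <- t) x.

Lemma convex_ball (m : E) r : convexs [set x | `|m - x| <= r].
Proof.
move=> x y l /= hx hy /andP[l0 l1].
have -> : m - (l *: x + (1 - l) *: y) = l *: (m - x) + (1 - l) *: (m - y).
 apply/rowP => i; rewrite !mxE; ring.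
apply: le_trans (ler_normD _ _) _; rewrite !normrZ ger0_norm // (ger0_norm) ?subr_ge0 //.
have -> : r = l * r + (1 - l) * r by rewrite -mulrDl addrC subrK mul1r.
by apply: lerD; apply: ler_wpM2l => //; rewrite subr_ge0.
Qed.

Lemma convexI C D : convexs C -> convexs D -> convexs (C `&` D).
Proof. by move=> hC hD x y l [? ?] [? ?] hl; split; [apply: hC|apply: hD]. Qed.

Lemma mean_in C t : convexs C -> all_in C t -> t != [::] -> C (mean t).
Proof.
move=> hC; elim: t => // x t IHt [Cx Ct] _.
have [->|t0] := eqVneq t [::]; first by rewrite /mean big_seq1 invr1 scale1r.
have n0 : (size t)%:R != 0 :> R by rewrite pnatr_eq0 size_eq0.
have m0 : (size t).+1%:R != 0 :> R by rewrite pnatr_eq0.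
have -> : mean (x :: t) = (size t).+1%:R^-1 *: x + (1 - (size t).+1%:R^-1) *: mean t.
 by rewrite /mean big_cons scalerDr; congr (_ _); rewrite scalerA; congr (_ *: _); move: n0 m0; rewrite -natr1; move:
  (size t)%:R => a a0 a1; field; rewrite a0.
apply: hC => //; first exact: IHt.
by rewrite invr_ge0 ler0n invf_le1 // ler1n.
Qed.

Lemma mean_opp t : mean (map -%R t) = - mean t.
Proof. by rewrite /mean size_map big_map sumrN scalerN. Qed.

Lemma mean_dist t x r : 0 <= r -> x \in t -> (forall y, y \in t -> `|y - x| <= r) ->
 `|mean t - x| <= (size t).-1%:R / (size t)%:R * r.
Proof.
move=> r0 xt hr; have n0 : (size t)%:R != 0 :> R by rewrite pnatr_eq0 size_eq0; case: t xt hr.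
have -> : mean t - x = (size t)%:R^-1 *: \sum_(y <- t) (y - x).
 rewrite sumrB scalerBr.
 have -> : \sum_(y <- t) x = (size t)%:R *: x.
  by rewrite big_const_seq iter_addr_0 scaler_nat.
 by rewrite scalerA mulVf ?scale1r.
rewrite normrZ ger0_norm // [leRHS]mulrAC mulrC; apply: ler_wpM2r.
 by [].
rewrite (big_rem x) //= subrr add0r.
apply: le_trans (ler_norm_sum _ _ _) _.
have -> : (size t).-1%:R * r = \sum_(y <- rem x t) r.
 by rewrite big_const_seq count_predT iter_addr_0 size_rem // mulr_natl.
rewrite !big_seq; apply: ler_sum => y /mem_rem; exact: hr.
Qed.

(** Evaluates [c] on the flags of faces of [t], starting with the barycenter of the largest face;
    [n] is fuel. *)
Fixpoint sd_rec n c t : bool :=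
 if n is n'.+1 then delta (sd_rec n' (fun s => c (mean t :: s))) t else c [::].

Definition sd c t := sd_rec (size t) c t.

Lemma sd_nil c : sd c [::] = c [::].
Proof. by []. Qed.

Lemma sd_cons c t : t != [::] -> sd c t = delta (sd (fun s => c (mean t :: s))) t.
Proof.
case: t => // x t _.
by apply: (delta_extf) => s _ ss; rewrite /sd ss.
Qed.

Lemma sdD c d t : sd (fun s => c s (+) d s) t = sd c t (+) sd d t.
Proof.
rewrite /sd; move: (size t) => n; elim: n c d t => [|n IHn] c d t //=.
by rewrite -deltaD; apply: eq_delta => s.
Qed.

Lemma eq_sd c d : c =1 d -> sd c =1 sd d.
Proof.
move=> cd t; rewrite /sd; move: (size t) => n; elim: n c d cd t => [|n IHn] c d cd t /= => //.
by apply: eq_delta => s; apply: IHn => u.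
Qed.

Lemma sd_delta c t : sd (delta c) t = delta (sd c) t.
Proof.
elim: {t}(size t) {-2}t (erefl (size t)) c => [|n IHn] t st c; first by case: t st.
have t0 : t != [::] by case: t st.
rewrite sd_cons //.
have -> : delta (sd (fun s => delta c (mean t :: s))) t =
  delta (fun s => sd c s (+) delta (sd (fun u => c (mean t :: u))) s) t.
 apply: delta_extf => s _; rewrite st => ss.
 rewrite -IHn // -sdD; exact: eq_sd.
by rewrite deltaD deltaK addbF.
Qed.

Lemma sd_opp c t : sd c (map -%R t) = sd (fun s => c (map -%R s)) t.
Proof.
elim: {t}(size t) {-2}t (erefl (size t)) c => [|n IHn] t st c; first by case: t st.
have t0 : t != [::] by case: t st.
rewrite !sd_cons -?size_eq0 ?size_map ?size_eq0 // -delta_map.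
apply: delta_extf => s _; rewrite st => ss; rewrite IHn //.
by rewrite mean_opp.
Qed.

Definition diam_le (r : R) t : Prop := {in t &, forall x y, `|x - y| <= r}.

(** The simplices of the subdivision stay in the convex set [C], and their diameter has shrunk by
    the factor [K / K.+1], since a barycenter of [n] points is within [(n - 1) / n] of the diameter
    from each of them. *)
Lemma sd_local K C c d t (r : R) : convexs C -> 0 <= r -> (size t <= K.+1)%N ->
 all_in C t -> diam_le r t ->
 (forall s, size s = size t -> all_in C s -> diam_le (K%:R / K.+1%:R * r) s -> c s = d s) ->
 sd c t = sd d t.
Proof.
elim: {t}(size t) {-2}t (erefl (size t)) C c d => [|n IHn] t st C c d hC r0 tK Ct dt cd.
 by case: t st Ct dt cd tK => // _ _ _ cd _; rewrite !sd_nil cd.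
have t0 : t != [::] by case: t st {Ct dt cd tK}.
rewrite !sd_cons //; apply: delta_extf => s sub ss; rewrite st in ss.
set l := K%:R / K.+1%:R * r in cd.
have Cm : C (mean t) by apply: mean_in.
have tP : forall x, x \in t -> C x /\ `|mean t - x| <= l.
 move=> x xt; split; first by move/all_inP: Ct; apply.
 apply: le_trans (mean_dist r0 xt _) _; first by move=> y yt; apply: dt.
 by apply: ler_wpM2r => //; rewrite st ler_pdivrMr // mulrAC ler_pdivlMr //; rewrite -!natrM ler_nat !mulnS [(K *
  n)%N]mulnC leq_add2r; move: tK; rewrite st.
apply: (IHn s ss (C `&` [set x | `|mean t - x| <= l])) => //.
- apply: convexI => //; apply: convex_ball.
- by rewrite ss; move: tK; rewrite st => /ltnW.
- by apply/all_inP => x /(mem_subseq sub) /tP.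
- by move=> x y /(mem_subseq sub) xt /(mem_subseq sub) yt; apply: dt.
move=> u su Cu du; apply: cd; first by rewrite /= su ss.
 by split=> //; apply: all_inS Cu => [].
have uP x : x \in u -> `|mean t - x| <= l by move/all_inP: Cu => h /h [].
have l0 : 0 <= l by apply: mulr_ge0 => //.
move=> x y; rewrite !inE => /predU1P[->|xu] /predU1P[->|yu].
- by rewrite subrr normr0.
- exact: uP.
- by rewrite distrC; apply: uP.
- exact: du.
Qed.

Lemma iter_sd_local K C c d t (r : R) m : convexs C -> 0 <= r -> (size t <= K.+1)%N ->
 all_in C t -> diam_le r t ->
 (forall s, size s = size t -> all_in C s -> diam_le ((K%:R / K.+1%:R) ^+ m * r) s -> c s = d s) ->
 iter m sd c t = iter m sd d t.
Proof.
move=> hC; elim: m r t => [|m IHm] r t r0 tK Ct dt cd.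
 by apply: cd => //; rewrite mul1r.
apply: (sd_local hC r0 tK Ct dt) => s ss Cs ds.
apply: (IHm (K%:R / K.+1%:R * r)) => //; first exact: mulr_ge0.
 by rewrite ss.
by move=> u su Cu du; apply: cd => //; rewrite ?su // exprSr -mulrA.
Qed.

Lemma iter_sd_delta c t m : iter m sd (delta c) t = delta (iter m sd c) t.
Proof.
elim: m t => // m IHm t; rewrite !iterS -sd_delta.
by apply: eq_sd => s.
Qed.

Lemma iter_sd_opp c t m : iter m sd c (map -%R t) = iter m sd (fun s => c (map -%R s)) t.
Proof.
elim: m t => // m IHm t; rewrite !iterS sd_opp.
by apply: eq_sd => s.
Qed.

Lemma iter_sdD c d t m : iter m sd (fun s => c s (+) d s) t = iter m sd c t (+) iter m sd d t.
Proof.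
elim: m t => // m IHm t; rewrite !iterS -sdD.
by apply: eq_sd => s.
Qed.

Lemma iter_sd_nil c m : iter m sd c [::] = c [::].
Proof. by elim: m. Qed.

End Subdivision.

(** * Comparison of equivariant systems of primitives *)

Section Resolutions.
Variables (X : eqType) (T : X -> X) (s0 : X -> bool) (adm : seq X -> Prop).
Hypotheses (TK : involutive T) (s0T : forall x, s0 (T x) = ~~ s0 x).
Hypotheses (admS : forall s t, subseq s t -> adm t -> adm s).
Hypothesis admT : forall t, adm t -> adm (map T t).

(** Such a system exhibits each [delta (M k)] as the [k]-th power of the double cover class of [T].
    Both [sgnc] and intersection parities are of this form. *)
Definition resolution (M : nat -> seq X -> bool) (n : nat) : Prop := M 0%N [::] = true /\
 forall k t, (k < n)%N -> adm t -> size t = k.+1 ->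
  M k.+1 t (+) M k.+1 (map T t) = delta (M k) t.

(** The difference in degree [k.+1] becomes invariant after adding [delta (head_mul s0 mu)], with
    [mu] from the degree below; its coboundary does not change. *)
Lemma resolution_unique M M' n : resolution M n -> resolution M' n ->
 exists mu, (forall t, mu (map T t) = mu t) /\
  forall t, adm t -> size t = n.+1 ->
   delta (M n) t (+) delta (M' n) t = delta mu t.
Proof.
move=> [M0 MS] [M'0 M'S].
suff H k : (k <= n)%N -> exists mu, [/\ forall t, mu (map T t) = mu t, mu [::] = false &
  forall t, adm t -> size t = k.+1 ->
   delta (M k) t (+) delta (M' k) t = delta mu t].
 by have [mu [i h]] := H n (leqnn n); exists mu.
elim: k => [|k IHk] kn.
 exists (fun=> false); split=> // -[|x [|y t]] //.
 by rewrite !delta_seq1 M0 M'0.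
have [mu [imu mu0 muE]] := IHk (ltnW kn).
have admTE t : adm (map T t) <-> adm t.
 by split=> [/admT|/admT]; rewrite ?mapK.
pose h t := M k.+1 t (+) M' k.+1 t (+) delta (head_mul s0 mu) t.
have hT t : adm t -> size t = k.+1 -> h (map T t) = h t.
 move=> at_ st.
 have e1 := MS k t kn at_ st; have e2 := M'S k t kn at_ st; have e3 := muE t at_ st.
 have e4 : delta (head_mul s0 mu) t (+) delta (head_mul s0 mu) (map T t) = delta mu t.
  by rewrite -delta_map -deltaD; apply: eq_delta => -[|x s] //; rewrite map_cons /head_mul s0T -map_cons imu; case: (s0
   x); case: (mu _).
 by move: e1 e2 e3 e4; rewrite /h => <- <- <-; move: (M k.+1 t) (M k.+1 (map T t)) (M' k.+1 t) (M' k.+1 (map T t)) (delta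
  (head_mul s0 mu) t) (delta (head_mul s0 mu) (map T t)); do 6 case.
(* [h] is invariant only on admissible sequences of the right length and is set to 0 elsewhere. *)
exists (fun t => [&& `[< adm t >], size t == k.+1 & h t]); split.
- by move=> t; rewrite size_map (asbool_equiv_eq (admTE t)); case: asboolP => at_; case: eqP => // st; apply: hT.
- by rewrite andbF.
move=> t at_ st.
have -> : delta (fun t => [&& `[< adm t >], size t == k.+1 & h t]) t = delta h t.
 by apply: delta_extf => s sub ss; rewrite ss st eqxx; case: asboolP => // -[]; apply: admS at_.
by rewrite !deltaD deltaK addbF.
Qed.

End Resolutions.

Lemma lin_rel (R : fieldType) n (I : finType) (G : I -> 'rV[R]_n) (A : {set I}) :
 (n < #|A|)%N -> exists y : I -> R, [/\ exists i, y i != 0, forall i, i \notin A -> y i = 0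
  & \sum_i y i *: G i = 0].
Proof.
move=> nA; pose M := \matrix_(k < #|A|) G (enum_val k).
have : kermx M != 0.
 rewrite -mxrank_eq0 mxrank_ker -lt0n subn_gt0; apply: leq_ltn_trans nA.
 exact: rank_leq_col.
move=> /rowV0Pn[u /sub_kermxP uM u0].
pose y i := \sum_(k < #|A|) u 0 k *+ (enum_val k == i).
have yE k : y (enum_val k) = u 0 k.
 by rewrite /y (bigD1 k) //= eqxx big1 ?addr0 // => l lk; rewrite (inj_eq enum_val_inj) (negPf lk).
exists y; split.
- have /rV0Pn[k uk] := u0; by exists (enum_val k); rewrite yE.
- by move=> i iA; rewrite /y big1 // => k _; case: eqP => // ki; move: iA; rewrite -ki enum_valP.
rewrite -[RHS](uM); apply/rowP => j; rewrite !mxE summxE.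
under eq_bigr => i do rewrite mxE mulr_suml.
rewrite exchange_big /=; apply: eq_bigr => k.
rewrite (bigD1 (enum_val k)) //= eqxx big1 ?addr0 ?mxE // => i.
by rewrite eq_sym => /negPf ->; rewrite mul0r.
Qed.

(** On the moment curve each linear form becomes a nonzero polynomial in the parameter, and the
    product of these has finitely many roots. *)
Lemma exists_generic (R : realType) n (I : finType) (u : I -> 'I_n.+1 -> R) :
 (forall i, exists j, u i j != 0) -> exists e : 'I_n.+1 -> R,
 forall i, \sum_j u i j * e j != 0.
Proof.
move=> u0; pose p := \prod_i \poly_(j < n.+1) u i (inord j).
have p0 : p != 0.
 by apply/prodf_neq0 => i _; have [j uj] := u0 i; apply/eqP => /polyP/(_ j); rewrite coef_poly coef0 ltn_ord inord_val; apply/eqP.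
have [s sp] : exists s, p.[s] != 0.
 apply: contrapT => h; have := @max_poly_roots _ p [seq k%:R | k <- iota 0 (size p)] p0.
 rewrite map_inj_uniq ?iota_uniq; last by move=> a b /eqP; rewrite eqr_nat => /eqP.
 rewrite size_map size_iota ltnn => /(_ _ isT) H; have : false => //.
 apply/H/allP => x _; apply/negPn/negP => px; apply: h; by exists x.
exists (fun j => s ^+ j) => i; move: sp; rewrite horner_prod => /prodf_neq0/(_ i isT).
by rewrite horner_poly; under eq_bigr => j do rewrite inord_val.
Qed.

(** * Intersection parities of generic vectors *)

Section GenericVectors.
Variables (R : realType) (v : nat).
Local Notation sgn_ix := ('I_v * bool)%type.

Definition flip (x : sgn_ix) : sgn_ix := (x.1, ~~ x.2).

Lemma flipK : involutive flip.
Proof. by case=> i b; rewrite /flip negbK. Qed.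

Definition signr (b : bool) : R := (-1) ^+ b.

Definition supp (c : 'I_v -> R) : {set 'I_v} := [set i | c i != 0].

Definition generic D (F : 'I_v -> 'rV[R]_D) : Prop := forall c, (#|supp c| <= D)%N ->
 \sum_i c i *: F i = 0 -> forall i, c i = 0.

(* [w] is a combination with positive coefficients of the vectors [F i] or
  [- F i] prescribed by [t]. *)
Definition hits D (F : 'I_v -> 'rV[R]_D) (t : seq sgn_ix) (w : 'rV[R]_D) : Prop :=
 exists c : 'I_v -> R, [/\ forall x, x \in t -> 0 < signr x.2 * c x.1,
  forall i, i \notin map fst t -> c i = 0 & \sum_i c i *: F i = w].

Definition distinct (t : seq sgn_ix) : Prop := uniq (map fst t).

Lemma supp_sub (c : 'I_v -> R) (t : seq sgn_ix) :
 (forall i, i \notin map fst t -> c i = 0) -> (#|supp c| <= size t)%N.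
Proof.
move=> ct; rewrite -(size_map fst); apply: leq_trans (card_size _).
apply/subset_leq_card/fintype.subsetP => i; rewrite inE.
by apply: contraR => /ct ->.
Qed.

(** Any [D] of the vectors are killed by a nonzero linear form; [e] avoids the kernels of these
    finitely many forms and of the last coordinate. *)
Lemma generic_vector D (F : 'I_v -> 'rV[R]_D.+1) : exists e : 'rV[R]_D.+1,
 e 0 ord_max != 0 /\ forall c a, (#|supp c| <= D)%N -> \sum_i c i *: F i = a *: e -> a = 0.
Proof.
have H (A : {set 'I_v}) : exists u, (#|A| <= D)%N -> (exists j, u j != 0) /\ forall i, i \in A -> \sum_j u j * F i 0 j = 0.
 have [AD|_] := leqP #|A| D; last by exists (fun=> 0).
 have [|u [u0 _ uG]] := @lin_rel R #|A| 'I_D.+1 (fun j => \row_k F (enum_val k) 0 j) [set: 'I_D.+1].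
  by rewrite cardsT card_ord.
 exists u => _; split=> // i iA; have := congr1 (fun M : 'rV_#|A| => M 0 (enum_rank_in iA i)) uG.
 by rewrite summxE [RHS]mxE => h; rewrite -[RHS]h; apply: eq_bigr => j; rewrite !mxE enum_rankK_in.
have [u uP] := choice H.
have [|e eP] := @exists_generic R D (option {A : {set 'I_v} | (#|A| <= D)%N})
  (fun o => if o is Some A then u (val A) else fun j => (j == ord_max)%:R).
 case=> [A|]; last by exists ord_max; rewrite eqxx oner_eq0.
 by have [] := uP _ (valP A).
exists (\row_j e j); split.
 have := eP None; rewrite (bigD1 ord_max) //= eqxx mul1r big1 ?addr0 ?mxE //.
 by move=> j /negPf ->; rewrite mul0r.
move=> c a cD cE; have := eP (Some (exist (fun A : {set _} => (#|A| <= D)%N) (supp c) cD)).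
move=> ue; apply/eqP; have := congr1 (fun w : 'rV_D.+1 => \sum_j u (supp c) j * w 0 j) cE.
have [_ uF] := uP _ cD.
have -> : \sum_j u (supp c) j * (\sum_i c i *: F i) 0 j = 0.
 under eq_bigr => j do rewrite summxE mulr_sumr.
 rewrite exchange_big big1 //= => i.
 have [ci|ci] := boolP (i \in supp c); last first.
  by move: ci; rewrite inE negbK => /eqP ->; rewrite big1 // => j _; rewrite !mxE mul0r mulr0.
 have -> : \sum_j u (supp c) j * (c i *: F i) 0 j = c i * \sum_j u (supp c) j * F i 0 j.
  by rewrite mulr_sumr; apply: eq_bigr => j _; rewrite !mxE mulrCA.
 by rewrite uF // mulr0.
under eq_bigr => j do rewrite !mxE mulrCA.
by rewrite -mulr_sumr => /esym/eqP; rewrite mulf_eq0 (negPf ue) orbF.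
Qed.

Lemma delta_rem (c : seq sgn_ix -> bool) t : uniq t ->
 delta c t = \big[addb/false]_(x <- t) c [seq y <- t | y != x].
Proof.
elim: t c => [|x t IHt] c /=; first by rewrite big_nil.
move=> /andP[xt ut]; rewrite big_cons eqxx /=; congr addb.
 congr c; apply/esym/all_filterP/allP => y yt; apply: contraNneq xt => <-; exact: yt.
rewrite IHt // !big_seq; apply: eq_bigr => y yt.
by rewrite (_ : x != y) //; apply: contraNneq xt => ->.
Qed.

Lemma addb_unique (X : eqType) s (P : X -> bool) x : uniq s -> x \in s -> P x -> (forall y, y \in s -> P y -> y = x) ->
 \big[addb/false]_(y <- s) P y.
Proof.
move=> us xs Px h; rewrite (bigD1_seq x) //= Px big1_seq // => y /andP[yx ys].
by apply/negP => /(h y ys) e; rewrite e eqxx in yx.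
Qed.

Lemma addb_pair (X : eqType) s (P : X -> bool) x x' : uniq s -> x \in s -> x' \in s -> x != x' -> P x -> P x' -> (forall
 y, y \in s -> P y -> y = x \/ y = x') -> \big[addb/false]_(y <- s) P y = false.
Proof.
move=> us xs xs' xx' Px Px' h; rewrite (bigD1_seq x) //= Px -big_filter (bigD1_seq x') ?filter_uniq //=; last by rewrite
 mem_filter eq_sym xx'.
rewrite Px' big1_seq // => y /andP[yx']; rewrite mem_filter => /andP[yx ys].
by apply/negP => /(h y ys) [e|e]; rewrite e eqxx in yx yx'.
Qed.

Lemma seq_argmax (X : eqType) (s : seq X) (P : X -> bool) (r : X -> R) :
 (exists2 x, x \in s & P x) ->
 exists x, [/\ x \in s, P x & forall y, y \in s -> P y -> r y <= r x].
Proof.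
elim: s => [[]//|a s IHs] [x]; rewrite inE => xs Px.
have [/IHs [y [ys Py ymax]]|ns] := pselect (exists2 x, x \in s & P x).
 have [Pa|nPa] := boolP (P a); last first.
  exists y; split=> //; first by rewrite inE ys orbT.
  by move=> z; rewrite inE => /predU1P[->|zs] Pz; [rewrite Pz in nPa|apply: ymax].
 have [ay|ya] := leP (r a) (r y).
  exists y; split=> //; first by rewrite inE ys orbT.
  by move=> z; rewrite inE => /predU1P[->|zs] Pz; [|apply: ymax].
 exists a; split=> //; first by rewrite inE eqxx.
 by move=> z; rewrite inE => /predU1P[->|zs] Pz //; apply: le_trans (ltW ya); apply: ymax.
case/predU1P: xs => [xa|xs]; last by case: ns; exists x.
exists a; split; rewrite ?inE ?eqxx -?xa // => z.
by rewrite inE => /predU1P[->|zs] Pz //; case: ns; exists z.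
Qed.

(* The values of [z] at which the line [c + z a] lies in the positive orthant
  form an interval with two ends, or one if all slopes have the same sign. *)
Lemma orthant_parity (X : eqType) s (a r : X -> R) : uniq s -> s != [::] -> {in s, forall x, a x != 0} -> {in s &,
 injective r} -> \big[addb/false]_(x <- s) `[< {in s, forall y, y != x -> 0 < a y * (r x - r y)} >] = all (fun x => 0 < a
  x) s || all (fun x => a x < 0) s.
Proof.
move=> us s0 a0 ri; pose V x := `[< {in s, forall y, y != x -> 0 < a y * (r x - r y)} >].
have aN x : x \in s -> (a x < 0) = ~~ (0 < a x).
 by move=> /a0 ax; rewrite -leNgt lt_neqAle ax.
have posP x : V x -> x \in s -> forall y, y \in s -> y != x -> (0 < a y) = (r y < r x).
 move=> /asboolP Vx xs y ys yx; have := Vx y ys yx.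
 have [ay|ay] := boolP (0 < a y); first by rewrite pmulr_rgt0 // subr_gt0 => ->.
 by rewrite -aN // in ay; rewrite nmulr_rgt0 // subr_lt0 => /ltW; rewrite leNgt => /negPf ->.
have Vi x : x \in s -> (forall y, y \in s -> y != x -> (0 < a y) = (r y < r x)) -> V x.
 move=> xs h; apply/asboolP => y ys yx; have := h y ys yx.
 have [ay|ay] := boolP (0 < a y); first by rewrite pmulr_rgt0 // subr_gt0 => <-.
 by rewrite -aN // in ay; rewrite nmulr_rgt0 // subr_lt0 => /esym/negbT; rewrite -leNgt le_eqVlt; case/predU1P => // /(ri
  _ _ xs ys) e; rewrite e eqxx in yx.
have [x0 x0s] : exists x, x \in s by case: (s) s0 => // x t _; exists x; rewrite inE eqxx.
have [allp|/allPn[q qs nq]] := boolP (all (fun x => 0 < a x) s) => /=.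
 have [|m [ms _ mM]] := @seq_argmax _ s predT r; first by exists x0.
 apply: (addb_unique us ms) => [|y ys Vy].
  by apply: Vi => // y ys ym; rewrite (allP allp) // lt_neqAle mM // andbT; apply/esym; apply: contraNneq ym => /(ri _ _
   ys ms) ->.
 by apply: contrapT => /eqP ym; have := posP y Vy ys m ms; rewrite eq_sym ym (allP allp) // => /(_ isT)/esym; rewrite ltNge mM.
have [alln|/allPn[p ps np]] := boolP (all (fun x => a x < 0) s).
 have [|m [ms _ mM]] := @seq_argmax _ s predT (fun x => - r x); first by exists x0.
 apply: (addb_unique us ms) => [|y ys Vy].
  by apply: Vi => // y ys ym; rewrite -[LHS]negbK -aN // (allP alln) //=; apply/esym/negbTE; rewrite -leNgt -lerN2 mM.
 by apply: contrapT => /eqP ym; have := posP y Vy ys m ms; rewrite eq_sym ym -[0 < a m]negbK -aN // (allP alln) // => /(_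
  isT)/esym/negbT; rewrite -leNgt => ry; have := mM y ys isT; rewrite lerN2 => ry'; move: ym; rewrite (ri y m ys ms)
   ?eqxx //; apply: le_anti; rewrite ry.
rewrite aN // negbK in np.
have [|mp [mps mpP mpM]] := @seq_argmax _ s (fun x => 0 < a x) r; first by exists p.
have [|mq [mqs mqP mqM]] := @seq_argmax _ s (fun x => ~~ (0 < a x)) (fun x => - r x).
 by exists q.
have mpq : mp != mq by apply: contraNneq mqP => <-.
have Vmax x : V x -> x \in s -> x = mp \/ x = mq.
 move=> Vx xs; have [ax|ax] := boolP (0 < a x).
  left; apply: contrapT => /eqP xm; have := posP x Vx xs mp mps.
  by rewrite eq_sym xm mpP => /(_ isT)/esym; rewrite ltNge mpM.
 right; apply: contrapT => /eqP xm; have := posP x Vx xs mq mqs.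
 rewrite eq_sym xm (negPf mqP) => /(_ isT)/esym/negbT; rewrite -leNgt => rx.
 have := mqM x xs ax; rewrite lerN2 => rx'.
 by move: xm; rewrite (ri x mq xs mqs) ?eqxx //; apply: le_anti; rewrite rx.
have [lt|ge] := ltP (r mp) (r mq).
 apply: (addb_pair us mps mqs mpq) => [||y ys Vy]; last exact: Vmax.
  apply: Vi => // y ys ym; have [ay|ay] := boolP (0 < a y).
   by rewrite lt_neqAle mpM // andbT; apply/esym; apply: contraNneq ym; move=> /(ri _ _ ys mps) ->.
  by apply/esym/negbTE; rewrite -leNgt; have := mqM y ys ay; rewrite lerN2; apply/le_trans/ltW.
 apply: Vi => // y ys ym; have [ay|ay] := boolP (0 < a y).
  by apply/esym; apply: le_lt_trans lt; apply: mpM.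
 by apply/esym/negbTE; rewrite -leNgt -lerN2; apply: mqM.
apply: big1_seq => y /andP[_ ys]; apply/negP => Vy; case: (Vmax y Vy ys) => e; subst.
 have := posP mp Vy mps mq mqs; rewrite eq_sym mpq (negPf mqP) => /(_ isT)/esym/negbT.
 rewrite -leNgt => h; move/eqP: mpq; apply; apply: ri => //; apply: le_anti; rewrite h //.
have := posP mq Vy mqs mp mps; rewrite mpq mpP => /(_ isT)/esym.
by rewrite ltNge ge.
Qed.

Lemma hits_flip D (F : 'I_v -> 'rV[R]_D) t w :
 hits F (map flip t) w <-> hits F t (- w).
Proof.
have mE : map fst (map flip t) = map fst t by rewrite -map_comp.
split=> -[c [cp c0 cE]]; exists (fun i => - c i); split.
- by move=> x xt; have := cp (flip x) (map_f _ xt); rewrite /signr signrN mulNr mulrN.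
- by move=> i it; rewrite c0 ?oppr0 // mE.
- by rewrite -cE -sumrN; apply: eq_bigr => i _; rewrite scaleNr.
- by move=> _ /mapP[x xt ->]; have := cp x xt; rewrite /signr signrN mulNr mulrN opprK.
- by move=> i; rewrite mE => /c0 ->; rewrite oppr0.
- by rewrite -[w]opprK -cE -sumrN; apply: eq_bigr => i _; rewrite scaleNr.
Qed.

Section Projection.
Variables (D : nat) (F : 'I_v -> 'rV[R]_D.+1) (e : 'rV[R]_D.+1).
Hypotheses (gF : generic F) (e0 : e 0 ord_max != 0).
Hypothesis ge : forall c a, (#|supp c| <= D)%N -> \sum_i c i *: F i = a *: e -> a = 0.

(** The projection along [e] onto the hyperplane of last coordinate 0. *)
Definition drop_al (x : 'rV[R]_D.+1) : 'rV[R]_D :=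
 \row_j (x 0 (lift ord_max j) - x 0 ord_max / e 0 ord_max * e 0 (lift ord_max j)).

Lemma drop_al_sum (c : 'I_v -> R) :
 \sum_i c i *: drop_al (F i) = drop_al (\sum_i c i *: F i).
Proof.
apply/rowP => j; rewrite !mxE !summxE !mulr_suml -sumrB; apply: eq_bigr => i _.
rewrite !mxE; ring.
Qed.

Lemma drop_al0 x : drop_al x = 0 -> exists a, x = a *: e.
Proof.
move=> /rowP h; exists (x 0 ord_max / e 0 ord_max); apply/rowP => j; rewrite !mxE.
have [i ->|->] := unliftP ord_max j; last by rewrite divfK.
by have := h i; rewrite !mxE => /eqP; rewrite subr_eq0 => /eqP.
Qed.

Lemma drop_alZ a : drop_al (a *: e) = 0.
Proof. by apply/rowP => j; rewrite !mxE mulfK // subrr. Qed.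

Lemma generic_drop_al : generic (drop_al \o F).
Proof.
move=> c cD; rewrite drop_al_sum => /drop_al0[a cE].
have a0 := ge cD cE; apply: gF; first exact: leqW.
by rewrite cE a0 scale0r.
Qed.

Lemma hits_scale t w a : 0 < a -> hits F t (a *: w) -> hits F t w.
Proof.
move=> a0 [c [cp c0 cE]]; exists (fun i => a^-1 * c i); split.
- by move=> x xt; rewrite mulrCA mulr_gt0 ?invr_gt0 ?cp.
- by move=> i it; rewrite c0 ?mulr0.
- under eq_bigr => i do rewrite -scalerA.
 by rewrite -scaler_sumr cE scalerA mulVf ?scale1r // gt_eqF.
Qed.

(** The projected cone contains 0 exactly if the cone contains a multiple of [e]. Genericity
    excludes the multiple 0, and also that [e] and [-e] both lie in the cone. *)
Lemma hits_drop_al t : distinct t -> size t = D.+1 ->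
 `[< hits F t e >] (+) `[< hits F (map flip t) e >] =
 `[< hits (drop_al \o F) t 0 >].
Proof.
move=> dt st; have x0 : exists x, x \in t by case: t st {dt} => // x t _; exists x; rewrite inE eqxx.
have down w a : w = a *: e -> hits F t w -> hits (drop_al \o F) t 0.
 by move=> -> [c [cp c0 cE]]; exists c; rewrite drop_al_sum cE drop_alZ.
have suppt c : (forall i, i \notin map fst t -> c i = 0) -> (#|supp c| <= D.+1)%N.
 by move=> /supp_sub; rewrite st.
have up : hits (drop_al \o F) t 0 -> hits F t e \/ hits F t (- e).
 move=> [c [cp c0]]; rewrite drop_al_sum => /drop_al0[a cE].
 have [a0|a0|a0] := ltgtP a 0.
 - right; apply: (hits_scale (a := - a)); first by rewrite oppr_gt0.
  by exists c; rewrite scalerN scaleNr opprK.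
 - by left; apply: (hits_scale a0); exists c.
 - have [x xt] := x0; have := cp x xt.
  by rewrite (gF (suppt _ c0)) ?mulr0 ?ltxx // cE a0 scale0r.
case: asboolP => h1; case: asboolP => /hits_flip h2.
- case: h1 h2 => c [cp c0 cE] [c' [cp' c0' cE']].
 have [x xt] := x0; have := addr_gt0 (cp x xt) (cp' x xt).
 have s0 i : i \notin map fst t -> c i + c' i = 0 by move=> it; rewrite c0 // c0' // addr0.
 rewrite -mulrDr (gF (suppt _ s0)) ?mulr0 ?ltxx //.
 under eq_bigr => i do rewrite scalerDl.
 by rewrite big_split /= cE cE' subrr.
- by apply/esym/asboolP/(down e 1 _ h1); rewrite scale1r.
- by apply/esym/asboolP/(down (- e) (- 1) _ h2); rewrite scaleN1r.
- by apply/esym/asboolP => /up[/h1|/h2].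
Qed.

(** The [D.+2] vectors satisfy a single relation [a], so the representations of [e] form a line.
    Facets whose cone contains [e] are the ends of the part of this line in the positive orthant;
    their number is odd exactly if that part is a ray, that is, if [a] has constant sign. *)
Lemma hits_delta t : distinct t -> size t = D.+2 ->
 delta (fun s => `[< hits F s e >]) t = `[< hits F t 0 >].
Proof.
move=> dt st; pose S := [set i | i \in map fst t]%SET.
have cS : #|S| = D.+2.
 by rewrite cardsE (card_uniqP dt) size_map.
have tS x : x \in t -> x.1 \in S by move=> xt; rewrite inE map_f.
have ut := map_uniq dt.
have suppS c : (forall i, i \notin S -> c i = 0) -> supp c \subset S.
 by move=> h; apply/fintype.subsetP => i; rewrite inE; apply: contraR => /h ->.
have [a [[i1 ai1] aS aE]] := @lin_rel R D.+1 _ F S (eq_leq (esym cS)).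
have rel_zero c k : (forall i, i \notin S -> c i = 0) -> k \in S -> c k = 0 ->
  \sum_i c i *: F i = 0 -> forall i, c i = 0.
 move=> cS0 kS ck; apply: gF.
 have : supp c \proper S.
  by apply/properP; split; [exact: suppS|exists k => //; rewrite inE ck eqxx].
 by move=> /proper_card; rewrite cS.
have a0 k : k \in S -> a k != 0.
 move=> kS; apply/eqP => ak; move/eqP: ai1; apply.
 exact: (rel_zero a k aS kS ak aE).
have [c [cS0 cE]] : exists c, (forall i, i \notin S -> c i = 0) /\ \sum_i c i *: F i = e.
 have i1S : i1 \in S by apply: contraNT ai1 => /aS ->.
 pose G o := if o is Some i then F i else e.
 pose A := (None |: [set Some i | i in S :\ i1])%SET.
 have cA : (D.+1 < #|A|)%N.
  have nA : None \notin [set Some i | i in S :\ i1]%SET by apply/imsetP => -[].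
  rewrite cardsU1 card_imset => //.
  have := cardsD1 i1 S; lia.
 have [y [[w yw] yA]] := lin_rel G cA.
 rewrite (bigD1 None) //= (reindex_omap Some id) /=; last by case.
 under eq_bigl => i do rewrite eqxx.
 move=> yE.
 have yS i : i \notin S -> y (Some i) = 0.
  by move=> iS; apply: yA; rewrite !inE /=; apply/imsetP => -[j]; rewrite inE => /andP[_ jS] [e1]; rewrite e1 jS in iS.
 have yi1 : y (Some i1) = 0.
  by apply: yA; rewrite !inE /=; apply/imsetP => -[j]; rewrite !inE => /andP[ji _] [e1]; rewrite e1 eqxx in ji.
 have yN : y None != 0.
  apply/eqP => y0; rewrite y0 scale0r add0r in yE.
  have h := rel_zero (fun i => y (Some i)) i1 yS i1S yi1 yE.
  by case: w yw => [i|]; rewrite ?h ?y0 eqxx.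
 exists (fun i => - (y None)^-1 * y (Some i)); split=> [i /yS ->|]; first by rewrite mulr0.
 under eq_bigr => i do rewrite -scalerA.
 by rewrite -scaler_sumr; move/eqP: yE; rewrite addrC addr_eq0 => /eqP ->; rewrite scalerN scaleNr opprK scalerA mulVf // scale1r.
(* The parameter of the line at which the coefficient of [x] vanishes. *)
pose r (x : sgn_ix) := - c x.1 / a x.1.
have lineE z : \sum_i (c i + z * a i) *: F i = e.
 under eq_bigr => i do rewrite scalerDl -scalerA.
 by rewrite big_split /= -scaler_sumr aE scaler0 addr0.
have fst_inj x y : x \in t -> y \in t -> x.1 = y.1 -> x = y.
 move=> xt yt xy; have := nth_index x xt; have := nth_index x yt.
 have <- : index x t = index y t; last by move=> <- ->.
 have si z : z \in t -> (index z t < size (map fst t))%N by rewrite size_map index_mem.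
 by apply/eqP; rewrite -(nth_uniq x.1 (si x xt) (si y yt) dt) !(nth_map x) ?index_mem //; rewrite !nth_index // xy.
have ri : {in t &, injective r}.
 move=> x y xt yt rxy; apply: contrapT => nxy.
 have nxy1 : x.1 != y.1 by apply/eqP => /(fst_inj x y xt yt).
 have z0 w : w \in t -> c w.1 + r w * a w.1 = 0.
  by move=> wt; rewrite divfK ?subrr // a0 ?tS.
 (* If two coefficients vanished together, [e] would be a combination of [D] vectors, against its
    choice. *)
 have : (1 : R) = 0; last by apply/eqP.
 apply: (ge (c := fun i => c i + r x * a i)); last by rewrite scale1r.
 have sub : supp (fun i => c i + r x * a i) \subset (S :\ x.1) :\ y.1.
  apply/fintype.subsetP => i; rewrite !inE => ci; apply/and3P; split.
  - by apply: contraNneq ci => ->; rewrite rxy z0.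
  - by apply: contraNneq ci => ->; rewrite z0.
  - apply: contraNT ci => it; rewrite cS0 ?aS ?inE // mulr0 addr0 //.
 apply: leq_trans (subset_leq_card sub) _.
 have h2 : y.1 \in S :\ x.1 by rewrite !inE eq_sym nxy1 map_f.
 have := cardsD1 y.1 (S :\ x.1); have := cardsD1 x.1 S; rewrite cS tS // h2 /= !add1n.
 by move=> [<-] [<-].
pose al x := signr x.2 * a x.1.
have al0 : {in t, forall x, al x != 0}.
 by move=> x xt; rewrite mulf_neq0 ?signr_eq0 // a0 ?tS.
have t0 : t != [::] by case: t st {dt S cS tS ut suppS aS rel_zero a0 cS0 fst_inj ri al0}.
have := orthant_parity ut t0 al0 ri.
have hitE x : x \in t -> `[< hits F [seq y <- t | y != x] e >] =
  `[< {in t, forall y, y != x -> 0 < al y * (r x - r y)} >].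
 move=> xt; apply: asbool_equiv_eq.
 have valE y : y \in t -> signr y.2 * (c y.1 + r x * a y.1) = al y * (r x - r y).
  by move=> yt; rewrite /al /r; field; rewrite !a0 ?tS.
 split.
  move=> [c' [cp' c0' cE']].
  have c'E i : c' i - (c i + r x * a i) = 0.
   apply: (rel_zero (fun i => c' i - (c i + r x * a i)) x.1).
   - move=> j jS; rewrite cS0 // aS // mulr0 addr0 subr0 c0' //.
    apply: contraNN jS => /mapP[y]; rewrite mem_filter => /andP[_ yt] ->; exact: tS.
   - exact: tS.
   - rewrite c0'; first by rewrite /r; field; rewrite a0 ?tS.
    by apply/mapP => -[y]; rewrite mem_filter => /andP[yx yt] xy; rewrite (fst_inj x y xt yt xy) eqxx in yx.
   - under eq_bigr => j do rewrite scalerBl.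
    by rewrite sumrB cE' lineE subrr.
  by move=> y yt yx; rewrite -valE //; have := cp' y; rewrite mem_filter yx yt => /(_ isT); have /eqP := c'E y.1; rewrite
   subr_eq0 => /eqP ->.
 move=> h; exists (fun i => c i + r x * a i); split=> //.
  by move=> y; rewrite mem_filter => /andP[yx yt]; rewrite valE //; apply: h.
 move=> i it; have [iS|iS] := boolP (i \in S); last by rewrite cS0 // aS // mulr0 addr0.
 move: iS; rewrite inE => /mapP[y yt iy]; rewrite iy.
 have -> : y = x.
  by apply: contrapT => /eqP yx; move: it; rewrite iy => /negP; apply; apply/mapP; exists y => //; rewrite mem_filter yx.
 by rewrite /r; field; rewrite a0 ?tS.
have -> : delta (fun s => `[< hits F s e >]) t = \big[addb/false]_(x <- t)
  `[< {in t, forall y, y != x -> 0 < al y * (r x - r y)} >].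
 rewrite delta_rem // !big_seq; apply: eq_bigr => xt; apply: hitE.
move=> ->; apply/idP/asboolP.
 case/orP => /allP h; [exists a|exists (fun i => - a i)]; split.
 - by [].
 - by move=> i it; apply: aS; rewrite inE.
 - by [].
 - move=> xt; rewrite mulrN oppr_gt0; apply: h.
 - by move=> i it; rewrite aS ?oppr0 // inE.
 - by under eq_bigr => i do rewrite scaleNr; rewrite sumrN aE oppr0.
move=> [c' [cp' c0' cE']]; have [x xt] : exists x, x \in t.
 by case: (t) t0 => // x u _; exists x; rewrite inE eqxx.
pose q := c' x.1 / a x.1.
have c'E i : c' i - q * a i = 0.
 apply: (rel_zero (fun i => c' i - q * a i) x.1).
 - by move=> j jS; rewrite aS // mulr0 subr0 c0' //; move: jS; rewrite inE.
 - exact: tS.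
 - by rewrite divfK ?subrr // a0 ?tS.
 - under eq_bigr => j do rewrite scalerBl -scalerA.
  by rewrite sumrB -scaler_sumr aE scaler0 subr0.
have c'q y : y \in t -> 0 < q * al y.
 by move=> yt; have := cp' y yt; have /eqP := c'E y.1; rewrite subr_eq0 => /eqP ->; rewrite mulrCA.
have [q0|q0|q0] := ltgtP q 0.
- by apply/orP; right; apply/allP => y yt; have := c'q y yt; rewrite nmulr_rgt0.
- by apply/orP; left; apply/allP => y yt; have := c'q y yt; rewrite pmulr_rgt0.
- by have := c'q x xt; rewrite q0 mul0r ltxx.
Qed.

End Projection.

Lemma distinctS s t : subseq s t -> distinct t -> distinct s.
Proof. by move=> st; apply/subseq_uniq/map_subseq. Qed.

Lemma distinct_flip t : distinct t -> distinct (map flip t).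
Proof. by rewrite /distinct -map_comp. Qed.

(** The top cochain tests whether the cone contains a generic vector [e]. By [hits_drop_al] it
    continues the system obtained inductively from the projection along [e], and by [hits_delta] its
    coboundary tests whether the cone contains 0. *)
Lemma generic_resolution D (F : 'I_v -> 'rV[R]_D) : generic F ->
 exists M, resolution flip distinct M D /\ forall t, distinct t -> size t = D.+1 ->
  delta (M D) t = `[< hits F t 0 >].
Proof.
elim: D F => [|D IHD] F gF.
 exists (fun _ _ => true); split=> //.
 move=> [|x [|y t]] // _ _; apply/esym/asboolP; exists (fun i => if i == x.1 then signr x.2 else 0).
 split; last by apply/rowP => -[].
  by move=> y; rewrite inE => /eqP ->; rewrite eqxx -expr2 sqrr_sign.
 by move=> i; rewrite inE => /negPf ->.
have [e [e0 ge]] := generic_vector F.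
have [M [[M0 MS] ME]] := IHD _ (generic_drop_al gF e0 ge).
exists (fun k => if k == D.+1 then fun t => `[< hits F t e >] else M k); split.
 split=> // k t; rewrite ltnS leq_eqVlt => /predU1P[->|kD] dt st.
  by rewrite eqxx (_ : D == D.+1 = false); last lia; rewrite ME // hits_drop_al.
 by rewrite (_ : k.+1 == D.+1 = false); last lia; rewrite (_ : k == D.+1 = false); [apply: MS|lia].
by rewrite eqxx; apply: hits_delta.
Qed.

End GenericVectors.

(** Since [s0] takes both values on a swap orbit, exactly one of the two summands contributes the
    invariant [delta (sgnc s0 k)]. *)
Lemma sgnc_resolution W s0 k t : (forall z, conf z -> s0 (swap2 z) = ~~ s0 z) -> all_in (@conf W) t -> t != [::] -> sgnc
 s0 k.+1 t (+) sgnc s0 k.+1 (map (@swap2 W) t) = delta (sgnc s0 k) t.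
Proof.
case: t => // x t s0T [Fx Ft].
have consE y u : sgnc s0 k.+1 (y :: u) = s0 y && delta (sgnc s0 k) (y :: u) by [].
rewrite !consE s0T // -map_cons sgnc_invariant //.
by case: (s0 x); case: (delta _).
Qed.

Lemma expr_lt_eps (R : realType) (l e r : R) : 0 <= l -> l < 1 -> 0 < e ->
 exists m, l ^+ m * r < e.
Proof.
move=> l0 l1 e0; have [r0|r0] := leP r 0.
 by exists 0; apply: le_lt_trans e0; rewrite mul1r.
have : (fun n => l ^+ n) @ \oo --> 0 by apply: cvg_expr; rewrite ger0_norm.
move=> /cvgrPdist_lt/(_ (e / r)) h; have [|N _ hN] := h; first by rewrite divr_gt0.
exists N; have := hN N (leqnn N); rewrite sub0r normrN ger0_norm ?exprn_ge0 //.
by rewrite ltr_pdivlMr.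
Qed.

(** * Maps that separate antipodes *)

Section AntipodalObstruction.
Variables (R : realType) (v D d : nat) (F : 'I_v -> 'rV[R]_D).
Hypothesis gF : generic F.

Definition svertex (x : 'I_v * bool) : 'rV[R]_v := signr R x.2 *: delta_mx 0 x.1.

Lemma svertex_flip t :
 map svertex (map (@flip v) t) = map -%R (map svertex t).
Proof.
rewrite -!map_comp; apply: eq_map => x /=.
by rewrite /svertex /signr signrN scaleNr.
Qed.

Lemma svertex_norm x : `|svertex x| <= 1.
Proof.
apply: norm_le_co => // i; rewrite !mxE /=; case: (_ == _); last first.
 by rewrite mulr0 normr0.
by rewrite mulr1 normrX normrN1.
Qed.

(** [G] sends antipodes to swapped pairs. Pulled back and subdivided, [sgnc] is a resolution whose
    top coboundary is the coboundary of an invariant cochain. By uniqueness the same holds for the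
    intersection parity, which therefore sums to 0 over [Y]. *)
Theorem antipodal_obstruction (Y : seq (seq ('I_v * bool))) (P : set 'rV[R]_v)
  (W : topologicalType) (gam : 'rV[R]_v -> W) :
 (d <= D)%N -> manifold R d W -> contractible R W ->
 {in Y, forall t, distinct t /\ size t = D.+1} ->
 (forall mu, (forall t, mu (map (@flip v) t) = mu t) ->
   \big[addb/false]_(t <- Y) delta mu t = false) ->
 \big[addb/false]_(t <- Y) `[< hits F t 0 >] = true ->
 compact P -> (forall z, P z -> P (- z)) ->
 (forall t, t \in Y -> exists C, [/\ convexs C, all_in C (map svertex t) & C `<=` P]) ->
 {within P, continuous gam} -> ~ (forall z, P z -> gam z <> gam (- z)).
Proof.
move=> dD mW cW Ysz Ycyc Yodd cP PN YP /subspace_continuousP cg gN.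
pose G z := (gam z, gam (- z)).
have GN s : map G (map -%R s) = map (@swap2 W) (map G s).
 by rewrite -!map_comp; apply: eq_map => z /=; rewrite /G opprK.
have cG x V : P x -> nbhs (G x) V -> nbhs x [set z | P z -> V (G z)].
 move=> Px [[V1 V2] [n1 n2] V12].
 have h1 := cg x Px V1 n1; have h2 := cg (- x) (PN _ Px) V2 n2.
 have h3 : nbhs x [set z | P (- z) -> V2 (gam (- z))].
  have cN : cont_at (fun z : 'rV[R]_v => - z) x.
   by apply: (@cont_atN _ _ 'rV[R]_v (fun z => z)).
  exact: cN _ h2.
 near=> z => Pz; apply: V12; split=> /=; first by move: Pz; near: z.
 by have := PN z Pz; near: z.
have cB : compact (G @` P).
 apply: continuous_compact cP; apply/subspace_continuousP => x Px nV; exact: cG.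
have BF : G @` P `<=` @conf W by move=> _ [z Pz <-]; apply: gN.
have [|s0 [s0T [om [iom omP]]]] := @sign_class_vanishing R d D W (G @` P) dD mW cW cB BF.
- by move=> _ [z Pz <-]; exists (- z); [exact: PN|rewrite /G opprK].
pose M' k t := sgnc s0 k (map G t); pose om' t := om (map G t).
have near_c : near_eq P D.+1 P (fun t => delta (M' D) t (+) delta om' t) (fun=> false).
 move=> x Px; have [|V xV VP] := omP (G x) => //.
 exists [set z | P z -> V (G z)]; first exact: cG.
 by move=> t st tV; rewrite !delta_map VP ?size_map ?addbb //; apply/allin_map; apply: all_inS tV => z [h /h Vz].
have [e e0 eP] : exists2 e, 0 < e & forall x t, P x -> size t = D.+1 -> all_in [set y | P y /\ `|x - y| < e] t -> delta
 (M' D) t = delta om' t.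
 have [| |e e0 eP] := @lebesgue_number R _ P v id P setT (fun _ => id) _ _ D.+1 P _ cP (fun _ => id) near_c.
 - move=> x e e0; exists [set y | `|x - y| < e].
   apply: cont_lt; last by rewrite subrr normr0.
    by apply/cont_norm/cont_atB.
   by [].
  by move=> y [xy _] i; apply: le_lt_trans xy; have := norm_coord_le (x - y) i; rewrite !mxE.
 - move=> x U Px /nbhs_ballP[e e0 eU]; exists e => // y _ xy; apply: eU.
  rewrite -ball_normE /=; apply: norm_lt_co => // i; rewrite !mxE; exact: xy.
 exists e => // x t Px st tP; have tP' : all_in [set y | (P `&` setT) y /\ cclose id e x y] t.
  by apply: all_inS tP => y [Py xy]; split=> // i; apply: le_lt_trans xy; have := norm_coord_le (x - y) i; rewrite !mxE.
 by have := eP x t Px st tP'; case: (delta _ t); case: (delta _ t).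
pose l : R := D%:R / D.+1%:R.
have l0 : 0 <= l by apply: divr_ge0.
have l1 : l < 1 by rewrite ltr_pdivrMr // mul1r ltr_nat.
(* The vertices have norm at most 1, so the unsubdivided simplices have diameter at most 2. *)
have [m me] := expr_lt_eps 2 l0 l1 e0.
have diam2 t : diam_le 2 (map svertex t).
 move=> _ _ /mapP[x _ ->] /mapP[y _ ->]; apply: le_trans (ler_normB _ _) _.
 apply: lerD; apply: svertex_norm.
pose M2 k t := iter m (@sd R v) (M' k) (map svertex t).
pose adm t := distinct t /\ exists C, [/\ convexs C, all_in C (map svertex t) & C `<=` P].
have admS s t : subseq s t -> adm t -> adm s.
 move=> st [dt [C [hC Ct CP]]]; split; first exact: distinctS dt.
 exists C; split=> //; apply/all_inP => x xs; move/all_inP: Ct; apply.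
 exact: mem_subseq (map_subseq _ st) _ xs.
have admT t : adm t -> adm (map (@flip v) t).
 move=> [dt [C [hC Ct CP]]]; split; first exact: distinct_flip.
 exists [set z | C (- z)]; split.
 - move=> x y a01; rewrite /= opprD -!scalerN; exact: hC.
 - by rewrite svertex_flip allin_map; apply: all_inS Ct => z /=; rewrite opprK.
 - by move=> z /CP/PN; rewrite opprK.
have res2 : resolution (@flip v) adm M2 D.
 split=> [|k t kD [dt [C [hC Ct CP]]] st]; first by rewrite /M2 iter_sd_nil.
 rewrite /M2 svertex_flip iter_sd_opp -iter_sdD delta_map -iter_sd_delta.
 apply: (@iter_sd_local R v k C _ _ _ 2 m hC) => //; first by rewrite size_map st.
 move=> s ss Cs _; rewrite /M' delta_map GN sgnc_resolution //.
  apply/allin_map; apply: all_inS Cs => z /CP Pz; exact: gN.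
 by rewrite -size_eq0 size_map ss size_map st.
have [M [[M0 MS] ME]] := generic_resolution gF.
have res1 : resolution (@flip v) adm M D by split=> // k t kD [dt _] st; apply: MS.
have [mu [imu muE]] := @resolution_unique _ (@flip v) snd adm (@flipK v) (fun _ => erefl)
 admS admT M2 M D res2 res1.
pose mu' t := iter m (@sd R v) om' (map svertex t).
have imu' t : mu' (map (@flip v) t) = mu' t.
 by rewrite /mu' svertex_flip iter_sd_opp; congr (iter m (@sd R v) _); apply/funext => s; rewrite /om' GN.
have E t : t \in Y -> `[< hits F t 0 >] = delta mu t (+) delta mu' t.
 move=> tY; have [dt st] := Ysz t tY; have [C [hC Ct CP]] := YP t tY.
 have at_ : adm t by split=> //; exists C.
 rewrite -ME // -muE // [delta mu' t]delta_map -iter_sd_delta.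
 have -> : iter m (@sd R v) (delta om') (map svertex t) = delta (M2 D) t.
  rewrite [RHS]delta_map -iter_sd_delta.
  apply: (@iter_sd_local R v D C _ _ _ 2 m hC) => //; first by rewrite size_map st.
  move=> [|x s] ss Cs ds => //.
  apply/esym/(eP x); [by have [/CP] := Cs|by rewrite ss size_map|].
  apply/all_inP => ys; split; first by apply: CP; move/all_inP: Cs; apply.
  by apply: le_lt_trans me; apply: ds => //; rewrite inE eqxx.
 by rewrite addbAC addbb.
move: Yodd; rewrite big_seq; under eq_bigr => t tY do rewrite E //.
rewrite -big_seq big_split Ycyc // Ycyc.
Unshelve. all: by end_near.
Qed.

End AntipodalObstruction.

(** * Word metrics *)

Section WordMetricTheory.
Variables (G : groupType) (S : seq G).
Hypothesis genS : generates S.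
Local Notation wd := (word_dist S).

Lemma walk_cat A (e : A -> A -> Prop) k l x y z : walk e k x y -> walk e l y z -> walk e (k + l) x z.
Proof.
elim: k x => [|k IHk] x /=; first by move=> ->.
by move=> [w wy] yz; exists w => //; apply: IHk.
Qed.

Lemma walk_rev A (e : A -> A -> Prop) k x y : (forall a b, e a b -> e b a) -> walk e k x y -> walk e k y x.
Proof.
move=> es; elim: k x => [|k IHk] x => //.
move=> [w xw /IHk wy]; have := @walk_cat _ e k 1 y w x wy; rewrite addn1; apply.
by exists x => //; apply: es.
Qed.

Lemma cayleyC x y : cayley S x y -> cayley S y x.
Proof. by move=> [s sS [h|h]]; exists s => //; [right|left]. Qed.

Lemma cayleyM g x y : cayley S x y -> cayley S (g * x)%g (g * y)%g.
Proof. by move=> [s sS [h|h]]; exists s => //; [left|right]; rewrite h mulgA. Qed.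

Lemma walkM g k x y : walk (cayley S) k x y -> walk (cayley S) k (g * x)%g (g * y)%g.
Proof.
elim: k x => [|k IHk] x /=; first by move=> ->.
by move=> [w wy]; exists (g * w)%g; [apply: cayleyM|apply: IHk].
Qed.

Lemma walk_exists x y : exists k, walk (cayley S) k x y.
Proof.
pose H := [set g | exists k, walk (cayley S) k 1%g g].
have HT : H = setT.
 apply: genS.
 - by exists 0.
 - move=> a b [k ka] [l lb]; exists (l + k).
  have h := walkM (a * b^-1) lb; rewrite mulg1 -mulgA mulVg mulg1 in h.
  have := walk_cat ka (walk_rev cayleyC h).
  by rewrite addnC.
 - by exists 1, s => //; exists s => //; left; rewrite mul1g.
have [k kP] : H (x^-1 * y)%g by rewrite HT.
by exists k; have := walkM x kP; rewrite mulg1 mulgA mulgV mul1g.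
Qed.

Lemma wd_walk x y : walk (cayley S) (wd x y) x y.
Proof.
rewrite /word_dist /path_dist; case: xgetP => [k _ []//|none].
have [k kP] := walk_exists x y; exfalso.
have ex : exists k, `[< walk (cayley S) k x y >] by exists k; apply/asboolP.
case: (ex_minnP ex) => m /asboolP mP mmin; apply: (none m); split=> // l lP.
by apply/mmin/asboolP.
Qed.

Lemma wd_le k x y : walk (cayley S) k x y -> (wd x y <= k)%N.
Proof.
move=> kP; rewrite /word_dist /path_dist; case: xgetP => [j _ [_ jmin]|none]; first exact: jmin.
have ex : exists k, `[< walk (cayley S) k x y >] by exists k; apply/asboolP.
case: (ex_minnP ex) => m /asboolP mP mmin; case: (none m); split=> // l lP.
by apply/mmin/asboolP.
Qed.

Lemma wdxx x : wd x x = 0%N.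
Proof. by apply/eqP; rewrite -leqn0; apply: wd_le. Qed.

Lemma wd_sym x y : wd x y = wd y x.
Proof.
apply/eqP; rewrite eqn_leq; apply/andP; split; apply/wd_le/(walk_rev cayleyC); apply: wd_walk.
Qed.

Lemma wd_triangle y x z : (wd x z <= wd x y + wd y z)%N.
Proof. apply/wd_le/walk_cat; apply: wd_walk. Qed.

Lemma wdM g x y : wd (g * x)%g (g * y)%g = wd x y.
Proof.
apply/eqP; rewrite eqn_leq; apply/andP; split; apply: wd_le.
 apply/walkM/wd_walk.
by have := walkM g^-1 (wd_walk (g * x) (g * y)); rewrite !mulKg.
Qed.

Lemma ball_finite x r : finite_set [set y | (wd x y <= r)%N].
Proof.
have step k : finite_set [set y | walk (cayley S) k x y].
 elim: k => [|k IHk]; first by apply: sub_finite_set (finite_set1 x) => y.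
 pose mv (p : G * G) := (p.1 * p.2)%g; pose mv' (p : G * G) := (p.1 * p.2^-1)%g.
 apply: sub_finite_set (_ : finite_set (
   (mv @` ([set y | walk (cayley S) k x y] `*` [set` S])) `|`
   (mv' @` ([set y | walk (cayley S) k x y] `*` [set` S])))); last first.
  by rewrite finite_setU; split; apply/finite_image/finite_setX.
 move=> y h; have [z yz /(walk_rev cayleyC) zx] := walk_rev cayleyC h.
 case: yz => s sS [e|->]; last by left; exists (z, s).
 by right; exists (z, s) => //=; rewrite /mv' e -mulgA mulgV mulg1.
apply: sub_finite_set (_ : finite_set (\bigcup_(k in `I_r.+1) [set y | walk (cayley S) k x y])).
 move=> y yr; exists (wd x y) => //=; apply: wd_walk.
apply: bigcup_finite => //.
Qed.

End WordMetricTheory.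

Lemma nbhs_all (X : topologicalType) (x : X) (I : finType) (P : I -> set X) :
 (forall i, nbhs x (P i)) -> nbhs x [set y | forall i, P i y].
Proof.
move=> h; have hs (s : seq I) : nbhs x [set y | forall i, i \in s -> P i y].
 elim: s => [|i s IHs]; first by apply: filterE.
 by apply: filterS (filterI (h i) IHs) => y [Pi Ps] j; rewrite inE => /predU1P[->//|/Ps].
by apply: filterS (hs (enum I)) => y hy i; apply: hy; rewrite mem_enum.
Qed.

(** * From a coarse map to a continuous one *)

Section CubicalFloor.
Variable R : realType.

(** The distance from [t] to the integers, that is, to the walls of the unit grid. *)
Definition int_gap (t : R) : R := Num.min (t - (Num.floor t)%:~R) ((Num.floor t)%:~R + 1 - t).

Lemma int_gap_le t k : int_gap t <= `|t - k%:~R|.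
Proof.
rewrite /int_gap.
have [kt|tk] := leP (k%:~R) t.
 have : (k <= Num.floor t) by rewrite floor_ge_int.
 rewrite -(ler_int R) ger0_norm ?subr_ge0 //.
 rewrite ge_min; lra.
have : (Num.floor t + 1 <= k) by rewrite lezD1 floor_lt_int.
rewrite -(ler_int R) intrD ltr0_norm ?subr_lt0 //.
rewrite ge_min; lra.
Qed.

Lemma int_gap_attained t : exists k, int_gap t = `|t - k%:~R|.
Proof.
rewrite /int_gap; have := floor_le t; have := floorD1_gt t; rewrite intrD => h1 h2.
case: leP => _; [exists (Num.floor t)|exists (Num.floor t + 1)].
 by rewrite ger0_norm ?subr_ge0.
by rewrite intrD ltr0_norm ?subr_lt0 // opprB.
Qed.

Lemma int_gap_ge0 t : 0 <= int_gap t.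
Proof. by have [k ->] := int_gap_attained t. Qed.

Lemma int_gap_lipschitz t t' : int_gap t <= `|t - t'| + int_gap t'.
Proof.
have [k ->] := int_gap_attained t'; apply: le_trans (int_gap_le t k) _.
rewrite -(subrKA t'); apply: ler_normD.
Qed.

Lemma floor_locally_constant t t' : `|t - t'| < int_gap t -> Num.floor t' = Num.floor t.
Proof.
rewrite lt_min => /andP[]; have := t; have := floorD1_gt t.
rewrite intrD => h1 h2; rewrite !ltr_norml => /andP[h3 h4] /andP[h5 h6].
apply: floor_def.
lra.
Qed.

Lemma cont_int_gap (X : topologicalType) (f : X -> R) a :
 cont_at f a -> cont_at (fun x => int_gap (f x)) a.
Proof.
move=> cf U /nbhs_R[e e0 eU].
have : nbhs a [set x | `|f x - f a| < e].
 apply: cont_lt; last by rewrite subrr normr0.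
  apply/cont_norm/cont_atB => //.
 by [].
apply: filterS => x /= xa; apply: eU.
have := int_gap_lipschitz (f x) (f a); have := int_gap_lipschitz (f a) (f x).
rewrite (distrC (f a) (f x)) ltr_norml.
lra.
Qed.

Lemma cont_bigmin (X : topologicalType) (I : finType) (f : I -> X -> R) a :
 (forall i, cont_at (f i) a) -> cont_at (fun x => \big[Num.min/1]_i f i x) a.
Proof.
move=> cf; elim: (index_enum I) => [|k s IHs].
 have -> : (fun x => \big[Num.min/1]_(i <- [::]) f i x) = (fun=> 1).
  by apply/funext => x; rewrite big_nil.
 by [].
have -> : (fun x => \big[Num.min/1]_(i <- k :: s) f i x) =
  fun x => Num.min (f k x) (\big[Num.min/1]_(i <- s) f i x).
 by apply/funext => x; rewrite big_cons.
exact: cont_min.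
Qed.

End CubicalFloor.

Section ControlledExtension.
Variables (R : realType) (v : nat) (G : Type) (wd : G -> G -> nat) (kap : nat).
Variables (W : topologicalType) (Reg : nat -> G -> set W).
Hypothesis contr : forall j g, exists A : set W,
 (forall g', (wd g' g <= kap)%N -> Reg j g' `<=` A) /\ contractible_in R A (Reg j.+1 g).
Variables (K : set 'rV[R]_v) (q : 'rV[R]_v -> G) (del : R).
Hypotheses (del0 : 0 < del)
 (fine : forall x y, K x -> K y -> `|x - y| < del -> (wd (q x) (q y) <= kap)%N).

(** [lab j x] is [q] at a representative of the cube around [x] in the [j]-th of [v.+1] shifted
    grids; [s j x] is 0 on the walls of that grid and 1 where [j] is a good color. With [del / 4],
    three steps of size below [h] stay below [del]. *)
Let h := del / 4.
Let u j (x : 'rV[R]_v) i : R := x 0 i / h + j%:R / v.+1%:R.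
Let fl j x : {ffun 'I_v -> int} := [ffun i => Num.floor (u j x i)].
Let rp j f : 'rV[R]_v := xget 0 [set y | K y /\ fl j y = f].
Let lab j x : G := q (rp j (fl j x)).
Let gap j x : R := \big[Num.min/1]_i int_gap (u j x i).
Let s j x : R := Num.min 1 (2 * v.+1%:R * gap j x).

Let h0 : 0 < h. Proof. by rewrite divr_gt0. Qed.

Let gap_le j x i : gap j x <= int_gap (u j x i).
Proof. by rewrite /gap (bigD1 i) //= ge_min lexx. Qed.

Let s_ge0 j x : 0 <= s j x.
Proof.
rewrite le_min ler01 mulr_ge0 // /gap.
by elim/big_ind: _ => // [a b a0 b0|i _]; [rewrite le_min a0 b0|apply: int_gap_ge0].
Qed.

Let cont_s j x : cont_at (s j) x.
Proof.
apply: cont_min; first exact: cont_cst.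
apply: cont_atM; first exact: cont_cst.
apply: cont_bigmin => i; apply/cont_int_gap/cont_atD.
 apply: cont_atM; last exact: cont_cst.
 exact: (@coord_continuous R 1 v 0 i x).
by [].
Qed.

Let good x : exists2 j, (j < v.+1)%N & s j x = 1.
Proof.
have [j jP] := good_color_exists (h^-1 *: x); exists j => //.
apply: min_l; rewrite mulrC -ler_pdivrMr // mul1r /gap.
elim/big_ind: _ => [|a b|i _].
- rewrite invf_le1 // -natrM ler1n; lia.
- by rewrite le_min => -> ->.
- have [k ->] := int_gap_attained (u j x i); have := jP i k.
 by rewrite mxE [h^-1 * _]mulrC.
Qed.

Let fl_close j x y : fl j x = fl j y -> `|x - y| < h.
Proof.
move=> /ffunP e; apply: norm_lt_co => // i; rewrite !mxE.
have := e i; rewrite !ffunE => /floor_eq_dist.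
by rewrite opprD addrACA subrr addr0 -mulrBl normrM (gtr0_norm (x := h^-1)) ?invr_gt0 // ltr_pdivrMr // mul1r.
Qed.

Let rpP j x : K x -> K (rp j (fl j x)) /\ `|rp j (fl j x) - x| < h.
Proof.
move=> Kx; rewrite /rp; case: xgetP => [y _ [Ky e]|/(_ x)]; last by case.
split=> //; apply: fl_close e.
Qed.

Let lab_near i j x y : K x -> K y -> `|x - y| < h -> (wd (lab i x) (lab j y) <= kap)%N.
Proof.
move=> Kx Ky xy; have [K1 d1] := rpP i Kx; have [K2 d2] := rpP j Ky; apply: fine => //.
have := ler_normD (rp i (fl i x) - x) (x - y + (y - rp j (fl j y))).
rewrite !subrKA => h1.
have h2 := ler_normD (x - y) (y - rp j (fl j y)); rewrite (distrC y) subrKA in h2.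
move: del0 d1 d2 xy h2; rewrite /h; lra.
Qed.

Let lab_const j x : 0 < s j x -> nbhs x [set y | lab j y = lab j x].
Proof.
move=> s0; have g0 : 0 < gap j x.
 by move: s0; rewrite lt_min pmulr_rgt0 // => /andP[].
have : nbhs x [set y | forall i, `|u j x i - u j y i| < gap j x].
 apply: nbhs_all => i; apply: cont_lt; last by rewrite subrr normr0.
  by apply/cont_norm/cont_atB; first exact: cont_cst; apply: cont_atD; last exact: cont_cst.
 by [].
apply: filterS => y xy; congr (q (rp j _)); apply/ffunP => i; rewrite !ffunE.
apply: floor_locally_constant; apply: lt_le_trans (xy i) (gap_le j x i).
Qed.

Let lab_candidates j (x : 'rV[R]_v) : exists g : {ffun 'I_v -> 'I_3} -> G,
 nbhs x [set y | exists f, lab j y = g f].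
Proof.
exists (fun f : {ffun 'I_v -> 'I_3} => q (rp j [ffun i => Num.floor (u j x i) + (f i)%:Z - 1])).
have : nbhs x [set y | forall i, `|u j x i - u j y i| < 1].
 apply: nbhs_all => i; apply: cont_lt; last by rewrite subrr normr0.
  by apply/cont_norm/cont_atB; first exact: cont_cst; apply: cont_atD; last exact: cont_cst.
 by [].
apply: filterS => y xy.
exists [ffun i => inord (absz (Num.floor (u j y i) - Num.floor (u j x i) + 1))].
congr (q (rp j _)); apply/ffunP => i; rewrite !ffunE.
have := xy i; rewrite ltr_norml => /andP[a1 a2].
have := floor_le (u j x i); have := floorD1_gt (u j x i).
have := floor_le (u j y i); have := floorD1_gt (u j y i).
move: (u j x i) (u j y i) a1 a2 => a b a1 a2; set fa := Num.floor a; set fb := Num.floor b.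
rewrite !intrD => b1 b2 b3 b4.
have l1 : fb < fa + 2 by rewrite -(ltr_int R) intrD; lra.
have l2 : fa - 2 < fb by rewrite -(ltr_int R) intrB; lra.
rewrite inordK; [lia|lia].
Qed.

(** Stage [j] moves the current value along the contraction named by [lab j x], up to time [s j x].
    Jumps of the label occur where that time is 0, and at time 1 the earlier value is forgotten.
    Every point has a good color, so after [v.+1] stages the value is controlled everywhere. *)
Lemma controlled_extension : W -> exists Psi, {within K, continuous Psi} /\ forall x, K x -> exists y, [/\ K y, `|x - y|
 < del & Reg v.+1 (q y) (Psi x)].
Proof.
move=> w0.
have /choice[Ac AcP] : forall jg, exists Ac : set W * (W * R -> W) * W, let A := Ac.1.1 in let c := Ac.1.2 in let p :=
 Ac.2 in (forall g', (wd g' jg.2 <= kap)%N -> Reg jg.1 g' `<=` A) /\ [/\ Reg jg.1.+1 jg.2 p, forall x t, A x -> Reg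
  jg.1.+1 jg.2 (c (x, t)), forall x, A x -> c (x, 0) = x, forall x, A x -> c (x, 1) = p & forall x t U, A x -> nbhs (c
   (x, t)) U -> nbhs (x, t) [set z | A z.1 -> U (c z)]].
 by move=> [j g]; have [A [hA cA]] := contr j g; have [c [p cP]] := contr_exists cA; exists (A, c, p).
pose A j g := (Ac (j, g)).1.1; pose c j g := (Ac (j, g)).1.2; pose p j g := (Ac (j, g)).2.
pose Phi := fix Phi j x := if j is j'.+1 then
 if s j' x == 1 then p j' (lab j' x) else c j' (lab j' x) (Phi j' x, s j' x) else w0.
(* Some earlier color is good at [x]; control and continuity are claimed at such points only. *)
pose Z j x := exists2 i, (i < j)%N & s i x = 1.
have H j : (forall x, K x -> Z j x -> Reg j (lab j.-1 x) (Phi j x)) /\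
  (forall x U, K x -> Z j x -> nbhs (Phi j x) U ->
   nbhs x [set y | K y -> Z j y -> U (Phi j y)]).
 elim: j => [|j [IHr IHc]]; first by split=> x; [move=> _ []|move=> U _ []].
 have inA x y : K x -> Z j x -> K y -> `|x - y| < h -> A j (lab j y) (Phi j x).
  by move=> Kx Zx Ky xy; have [hA _] := AcP (j, lab j y); apply: (hA (lab j.-1 x)); [apply: lab_near|apply: IHr].
 have inA' x : K x -> Z j x -> A j (lab j x) (Phi j x).
  by move=> Kx Zx; apply: inA => //; rewrite subrr normr0.
 have PhiZ x : K x -> Z j x -> Phi j.+1 x = c j (lab j x) (Phi j x, s j x).
  by move=> Kx Zx /=; case: eqP => // ->; have [_ [_ _ _ c1 _]] := AcP (j, lab j x); apply/esym/c1/inA'.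
 have ZS x : Z j.+1 x -> s j x = 1 \/ Z j x.
  by move=> [i]; rewrite ltnS leq_eqVlt => /predU1P[->|ij] si; [left|right; exists i].
 split.
  move=> x Kx /ZS [sx|Zx]; first by rewrite /= sx eqxx; have [_ []] := AcP (j, lab j x).
  rewrite PhiZ //=; have [_ [_ hc _ _ _]] := AcP (j, lab j x); exact/hc/inA'.
 move=> x U Kx ZSx HU; have [Zx|nZx] := pselect (Z j x); last first.
  have sx : s j x = 1 by case: (ZS x ZSx).
  have nZ : nbhs x [set y | ~ Z j y].
   have : nbhs x [set y | forall i : 'I_j, s i y < 1].
    apply: nbhs_all => i; apply: cont_lt; [exact: cont_s|exact: cont_cst|].
    rewrite lt_neqAle ge_min lexx andbT; apply/eqP => si; apply: nZx; by exists i.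
   by apply: filterS => y hy [i ij si]; have := hy (Ordinal ij); rewrite si ltxx.
  have nL := @lab_const j x; rewrite sx in nL; have {}nL := nL ltr01.
  by apply: filterS (filterI nZ nL) => y [nZy ly] Ky /ZS[sy|//]; move: (nbhs_singleton HU); rewrite /= sx sy eqxx ly.
 have [N [V [nN nV NV]]] : exists N V, [/\ nbhs (Phi j x, s j x) N, nbhs x V &
   forall y z, V y -> K y -> N z -> A j (lab j y) z.1 -> U (c j (lab j y) z)].
  rewrite PhiZ // in HU.
  have [sx|sx] := ltP 0 (s j x).
   have [_ [_ _ _ _ hc]] := AcP (j, lab j x).
   exists [set z | A j (lab j x) z.1 -> U (c j (lab j x) z)], [set y | lab j y = lab j x].
   split; [by apply: hc => //; apply: inA'|exact: lab_const|].
   by move=> y z ->.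
  have {}sx : s j x = 0 by apply: le_anti; rewrite sx s_ge0.
  (* At a wall several labels occur nearby, but only finitely many, and at time 0 all their
     contractions fix the current value. *)
  have [g gP] := lab_candidates j x.
  have HU' : nbhs (Phi j x) U.
   have [_ [_ _ c0 _ _]] := AcP (j, lab j x); move: HU; rewrite sx.
   by rewrite /c (c0 (Phi j x)) //; apply: inA'.
  exists [set z | forall f, A j (g f) (Phi j x) -> A j (g f) z.1 -> U (c j (g f) z)].
  exists [set y | `|x - y| < h /\ exists f, lab j y = g f]; split.
  - apply: nbhs_all => f; have [Af|nAf] := pselect (A j (g f) (Phi j x)); last first.
    by apply: filterE.
   have [_ [_ _ c0 _ hc]] := AcP (j, g f).
   have := hc (Phi j x) (s j x) U Af; rewrite sx (c0 _ Af) => /(_ HU').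
   by apply: filterS => z.
  - apply: filterI => //; apply: cont_lt; last by rewrite subrr normr0.
    by apply/cont_norm/cont_atB.
   by [].
  - by move=> y z [xy [f yf]] Ky zN; rewrite yf; apply: zN; rewrite -yf; apply: inA.
 move: nN => [[N1 N2] /= [nN1 nN2] N12].
 have n1 := IHc x N1 Kx Zx nN1; have n2 : nbhs x (s j @^-1` N2) by apply: cont_s.
 have n3 : nbhs x [set y | s j y = 1 -> ~ Z j y -> K y -> U (p j (lab j y))].
  have [sx|sx] := eqVneq (s j x) 1; last first.
   have : nbhs x [set y | s j y < 1].
    by apply: cont_lt; [exact: cont_s|exact: cont_cst|]; rewrite lt_neqAle sx ge_min lexx.
   by apply: filterS => y sy sy1; rewrite /= sy1 ltxx in sy.
  have nL := @lab_const j x; rewrite sx in nL; have {}nL := nL ltr01.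
  by apply: filterS nL => y ly _; rewrite ly; move: (nbhs_singleton HU); rewrite /= sx eqxx.
 apply: filterS (filterI (filterI n1 n2) (filterI n3 nV)) => y [[h1 h2] [h3 h4]] Ky ZSy.
 have [Zy|nZy] := pselect (Z j y).
  have := PhiZ y Ky Zy; rewrite /= => ->; apply: NV => //=; last exact: inA'.
  by apply: N12; split=> //=; apply: h1.
 have sy : s j y = 1 by case: (ZS y ZSy).
 by rewrite sy eqxx; apply: h3.
have Zall x : Z v.+1 x by apply: good.
have [Hr Hc] := H v.+1.
exists (Phi v.+1); split.
 by apply/subspace_continuousP => x Kx U HU; have := Hc x U Kx (Zall x) HU; apply: filterS => y hy Ky; apply: hy.
move=> x Kx; exists (rp v (fl v x)); have [K1 d1] := rpP v Kx; split=> //.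
 rewrite distrC; apply: lt_le_trans d1 _; rewrite /h; move: del0; lra.
exact: Hr x Kx (Zall x).
Qed.

End ControlledExtension.

(** [Reg j g] is the region allowed at stage [j] for a point labeled [g]; passing to the next stage
    absorbs a change of label by at most [kap]. *)
Definition contracting (R : realType) (G : Type) (wd : G -> G -> nat) (W : topologicalType)
  (kap : nat) (Reg : nat -> G -> set W) : Prop :=
 forall j g, exists A : set W, (forall g', (wd g' g <= kap)%N -> Reg j g' `<=` A) /\
   contractible_in R A (Reg j.+1 g).

(* [W] itself need not be a manifold: it is enough that compact subsets of [W] map
  to contractible [d]-manifolds with fibers that are small from the point of view
  of the group. *)
Definition controlled (R : realType) (G : Type) (wd : G -> G -> nat) (d : nat)
  (W : topologicalType) : Prop :=
 forall kap : nat, exists Reg : nat -> G -> set W, contracting R wd kap Reg /\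
  forall j, exists D : nat, forall P : set W, compact P ->
  exists (M : topologicalType) (e : W -> M),
  [/\ manifold R d M, contractible R M, {within P, continuous e} &
   forall g g' w w', P w -> P w' -> Reg j g w -> Reg j g' w' -> e w = e w' ->
    (wd g g' <= D)%N].

Lemma nat_bound T A (f : T -> nat) : finite_set A -> exists D, forall x, A x -> (f x <= D)%N.
Proof.
move=> fA; have : finite_set (f @` A) by apply: finite_image.
move=> /finite_fsetP[F FE]; exists (\max_(i <- F) i) => x Ax.
have fF : [set` F] (f x) by rewrite -FE.
exact: (leq_bigmax_seq _ fF).
Qed.

Lemma compact_bigcup (X : topologicalType) (I : choiceType) D (C : I -> set X) : finite_set D -> (forall i, D i ->
 compact (C i)) -> compact (\bigcup_(i in D) C i).
Proof.
move=> /finite_fsetP[F ->] cC; rewrite bigcup_fset big_seq.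
apply: bigsetU_compact => iF; apply: cC.
Qed.

(** * Control from group actions and from uniformly proper maps *)

Section ActionControl.
Variables (R : realType) (G : groupType) (S : seq G) (X : topologicalType) (a : G -> X -> X).
Hypotheses (genS : generates S) (cX : contractible R X) (pa : properly_discontinuous a).

Lemma actK g x : a g^-1%g (a g x) = x.
Proof. by have [a1 aM _] := pa; rewrite -aM mulVg. Qed.

Lemma actKV g x : a g (a g^-1%g x) = x.
Proof. by have [a1 aM _] := pa; rewrite -aM mulgV. Qed.

Lemma action_image_compact g C : compact C -> compact (a g @` C).
Proof.
apply: continuous_compact => //; apply: continuous_subspaceT.
by have [_ _ ca _] := pa.
Qed.

Lemma contr_compact (A : set X) : compact A ->
 exists C, compact C /\ contractible_in R A C.
Proof.
have [c [p [_ _ c0 c1 cc]]] := contr_exists cX.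
have c_cont z : cont_at c z.
 by case: z => x t U HU; have := cc x t U I HU; apply: filterS => z /(_ I).
exists ((c @` (A `*` `[0, 1]%classic)) `|` [set p]); split.
 apply: compactU; last exact: compact_set1.
 apply: continuous_compact; first by apply: continuous_subspaceT => z; apply: c_cont.
 apply: compact_setX => //; apply: segment_compact.
exists p, c; split; [by right| | |].
- apply: continuous_subspaceT => z; apply: c_cont.
- left; exists (x, t) => //.
- by move=> Ax; rewrite c0 // c1.
Qed.

Lemma contr_translate g A B : contractible_in R A B -> contractible_in R (a g @` A) (a g @` B).
Proof.
move=> [c [H [Bc cH HB HE]]]; have [_ _ ca _] := pa.
exists (a g c), (fun z => a g (H (a g^-1 z.1, z.2))); split.
- by [].
- apply/subspace_continuousP => -[x t] [/= [y Ay yx] t01] U HU.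
 move/subspace_continuousP: cH => cH.
 have xy : a g^-1 x = y by rewrite -yx actK.
 have nH : nbhs (H (y, t)) (a g @^-1` U) by apply: ca; rewrite -xy.
 have := cH (y, t) (conj Ay t01) _ nH => nyt.
 have cm : cont_at (fun z => (a g^-1 z.1, z.2)) (x, t).
  apply: cont_pair => //.
  apply: (cont_comp); [exact: cont_fst|move=> V; exact: ca].
 by rewrite -xy in nyt; have := cm _ nyt; apply: filterS => -[x' t'] h [/= [y' Ay' yx'] t01']; apply: h; rewrite -yx' actK.
- by move=> x t [y Ay <-] t01; exists (H (y, t)); first exact: HB; rewrite actK.
- by move=> x [y Ay <-]; rewrite actK; have [-> ->] := HE y Ay.
Qed.

(** The regions are translates of compact sets, so it suffices to work at the identity: [nxt]
    contains a contraction of the finitely many translates of [C j] by elements of length at most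
    [kap]. *)
Lemma action_regions kap : exists C, (forall j, compact (C j)) /\ contracting R (word_dist S) kap (fun j g => a g @` C j).
Proof.
have [a1 aM ca paC] := pa.
have [x0 _] := cX.
pose near1 C := \bigcup_(g in [set g | (word_dist S 1 g <= kap)%N]) (a g @` C).
have /choice[nxt nxtP] : forall C, exists C', compact C -> compact C' /\ contractible_in R (near1 C) C'.
 move=> C; have [cC|nC] := pselect (compact C); last by exists C.
 have [|C' [cC' kC']] := @contr_compact (near1 C).
  apply: compact_bigcup => [|g _]; [exact: ball_finite|exact: action_image_compact].
 by exists C'.
pose C := fix C j := if j is j'.+1 then nxt (C j') else [set x0].
have cC j : compact (C j).
 by elim: j => [|j IHj]; [exact: compact_set1|have [] := nxtP _ IHj].
exists C; split=> // j g; exists (a g @` near1 (C j)); split.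
 move=> g' gg' _ [x Cx <-]; exists (a (g^-1 * g') x); last by rewrite aM actKV.
 exists (g^-1 * g')%g => //.
 by rewrite /= -(wdM genS g) mulg1 mulgA mulgV mul1g (wd_sym genS).
by apply: contr_translate; have [] := nxtP _ (cC j).
Qed.

Lemma action_bounded C : compact C -> exists D, forall g g', (a g @` C) `&` (a g' @` C) !=set0 -> (word_dist S g g' <= D)%N.
Proof.
move=> cC; have [a1 aM ca paC] := pa.
have [D DP] := nat_bound (word_dist S 1) (paC _ cC).
exists D => g g' [w [[x Cx xw] [y Cy yw]]].
rewrite -(wdM genS g^-1) mulVg; apply: DP.
exists x; split=> //; exists y => //.
by rewrite aM yw -xw actK.
Qed.

Lemma action_controlled d : manifold R d X -> controlled R (word_dist S) d X.
Proof.
move=> mX kap; have [C [cC contr]] := action_regions kap.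
exists (fun j g => a g @` C j); split=> // j.
have [D DP] := action_bounded (cC j); exists D => P _; exists X, id; split=> //.
 by apply: continuous_subspaceT => x.
by move=> g g' w w' _ _ gw gw' e; apply: DP; exists w; split=> //; rewrite e.
Qed.

End ActionControl.

(** The regions are balls whose radii iterate [rho]. If two of them meet, the distance of the images
    of the centers is bounded, hence so is the word distance, by properness of [phi]. *)
Lemma updim_controlled R (G : groupType) (S : seq G) n : updim_le R S n -> exists W, contractible R W /\ (generates S ->
 controlled R (word_dist S) n W).
Proof.
move=> [W [g [rho [[mW cW] _ [L gL] [_ [phi [phi0 phiC] phiP]] hrho]]]].
exists W; split=> // genS kap.
pose L' := Num.max L 0.
have gL' x y : mdist (g x) (g y) <= L' * (word_dist S x y)%:R.
 by apply: le_trans (gL x y) _; apply: ler_wpM2r => //; rewrite le_max lexx.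
have L0 : 0 <= L' by rewrite le_max lexx orbT.
pose r := fix r j := if j is j'.+1 then rho (r j' + L' * kap%:R) else 1.
have rk0 j : 0 < r j -> 0 < r j + L' * kap%:R.
 by apply: ltr_wpDr => //; apply: mulr_ge0.
have r0 j : 0 < r j by elim: j => [|j /rk0/hrho[]].
exists (fun j x => ball (g x) (r j)); split=> [j x|j].
- exists (ball (g x) (r j + L' * kap%:R)); split; last by have [_] := hrho _ (rk0 _ (r0 j)).
 by move=> y xy w; rewrite !ballEmdist => yw; apply: le_lt_trans (metric_triangle _ (g y) _) _; rewrite addrC; apply:
  ltr_leD => //; apply: le_trans (gL' x y) _; apply: ler_wpM2l => //; rewrite ler_nat (wd_sym genS).
- have [|D DP] := @nat_bound nat [set k : nat | phi k%:R <= r j + r j] id.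
  pose C := `[0, r j + r j]%classic; have C0 : C `<=` `[0, +oo[.
   by move=> t; rewrite /= !in_itv andbT => /andP[].
  have := compact_bounded (phiC C C0 (@segment_compact _ _ _)) => -[M [_ hM]].
  have M1 : M < Num.max M 0 + 1 by apply: le_lt_trans (_ : M <= Num.max M 0) _;
   [rewrite le_max lexx|rewrite ltrDl].
  apply: sub_finite_set (finite_II (Num.bound (Num.max M 0 + 1))) => k /= phk.
  rewrite -(ltr_nat R); apply: le_lt_trans (archi_boundP _); last first.
   by apply: addr_ge0 => //; rewrite le_max lexx orbT.
  have := hM _ M1 k%:R; rewrite /= ger0_norm ?ler0n //; apply; split=> /=.
   by rewrite in_itv /= ler0n.
  by rewrite /C /= in_itv /= phi0.
 exists D => P _; exists W, id; split=> //; first by apply: continuous_subspaceT => x.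
 by move=> x y w w' _ _ xw yw ww'; rewrite -ww' in yw; apply: DP => /=; apply: le_trans (phiP x y) _; rewrite !ballEmdist
  in xw yw; apply: le_trans (metric_triangle _ w _) _; rewrite (metric_sym w); apply: lerD; apply: ltW.
Qed.

(** Every subset of the image is closed, so the image is discrete within a compact set. *)
Lemma discrete_finite (I : choiceType) (X : topologicalType) (D : set I) f (K : set X) : compact K -> {in D &, injective
 f} -> f @` D `<=` K -> (forall J, J `<=` D -> closed (f @` J)) -> finite_set D.
Proof.
move=> cK fi fK fcl.
pose P E := finite_set [set i | D i /\ E (f i)].
suff: P K by apply: sub_finite_set => Di; split=> //; apply: fK.
apply: compact_ind => //.
- by apply: sub_finite_set (@finite_set0 I) => i [].
- move=> A B fA fB; have : finite_set ([set i | D i /\ A (f i)] `|` [set i | D i /\ B (f i)]).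
  by rewrite finite_setU.
 by apply: sub_finite_set => i [Di [Ai|Bi]]; [left|right].
- by move=> A B AB; apply: sub_finite_set => i [Di /AB].
- move=> x Kx; pose J := [set i | D i /\ f i <> x].
 exists (~` (f @` J)).
  apply: open_nbhs_nbhs; split; first by rewrite openC; apply: fcl => i [].
  by move=> [i [_ nx]].
 have [[i0 [Di0 fi0]]|none] := pselect (exists i, D i /\ f i = x).
  by apply: sub_finite_set (finite_set1 i0) => i [Di [nJ _]]; apply: fi; rewrite ?inE // fi0; apply: contrapT => nx;
   apply: nJ; exists i.
 apply: sub_finite_set (@finite_set0 I) => i [Di [nJ _]].
 apply: nJ; exists i => //; split=> // fx; apply: none; by exists i.
Qed.

Lemma closed_le (R : realType) (X : topologicalType) (f g : X -> R) :
 (forall z, cont_at f z) -> (forall z, cont_at g z) -> closed [set z | f z <= g z].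
Proof.
move=> cf cg; rewrite -[X in closed X]setCK; apply: open_closedC.
rewrite openE => z /negP; rewrite -ltNge => zl.
by apply: filterS (cont_lt (cg z) (cf z) zl) => y yl; apply/negP; rewrite -ltNge.
Qed.

Lemma fset_sum_eq (R : nmodType) (V : choiceType) (s t : {fset V}) (f : V -> R) :
 (forall w, w \notin s -> f w = 0) -> (forall w, w \notin t -> f w = 0) ->
 \sum_(w <- s) f w = \sum_(w <- t) f w.
Proof.
move=> fs ft.
have -> : \sum_(w <- s) f w = \sum_(w <- (s `|` t)%fset) f w.
 apply: big_fset_incl => [|w _ /fs//]; apply: fsubsetUl.
apply/esym/big_fset_incl => [|w _ /ft//]; apply: fsubsetUr.
Qed.

(** * Realizations, open cones and their triangulations *)

Section Realizations.
Variables (R : realType) (V : choiceType) (K : scomplex V).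
Local Notation real := (realization R K).
Local Notation coord := (@Defs.coord R V K).

Lemma realization_nbhs (x : real) U : nbhs x U -> exists O, [/\ realization_open O, O x & O `<=` U].
Proof. by []. Qed.

Lemma nbhs_realization (x : real) O : realization_open O -> O x -> nbhs x O.
Proof. by move=> oO Ox; apply: open_nbhs_nbhs. Qed.

Lemma coord_inj (x y : real) : (forall w, coord x w = coord y w) -> x = y.
Proof. move=> e; apply/val_inj/funext => w; apply: e. Qed.

Lemma coord_bary (x : real) : bary K (coord x).
Proof. by have := valP x => /asboolP. Qed.

Lemma coord0 (x : real) w : 0 <= coord x w.
Proof. by have [s _ []] := coord_bary x. Qed.

Lemma carrier_exists (x : real) : exists2 s, faces K s & forall w, (w \in s) = (0 < coord x w).
Proof.
have [s Ks [x0 xs x1]] := coord_bary x.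
pose c := [fset w in s | 0 < coord x w]%fset.
have cE w : (w \in c) = (0 < coord x w).
 by rewrite !inE /=; case: (boolP (w \in s)) => //= /xs ->.
exists c => //; apply: (faces_sub Ks).
 by apply/fsubsetP => w; rewrite !inE => /andP[].
apply/eqP => c0; have : (1 : R) = 0; last by apply/eqP.
rewrite -x1 big1 // => w ws.
have : w \notin c by rewrite c0.
by rewrite cE -leNgt => wle; apply: le_anti; rewrite wle x0.
Qed.

Definition mk_point (x0 : real) (f : V -> R) : real :=
 match pselect (bary K f) with
 | left H => exist (fun f => is_true `[< bary K f >]) f (asboolT H)
 | right _ => x0
 end.

Lemma coord_mk x0 f : bary K f -> coord (mk_point x0 f) = f.
Proof. by rewrite /mk_point; case: pselect. Qed.

Lemma cont_mk_face (X : topologicalType) (x0 : real) (A : set X) f t a : faces K t -> A a -> (forall x, A x -> bary K (f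
 x) /\ forall w, w \notin t -> f x w = 0) -> (forall w, w \in t -> forall e, 0 < e -> nbhs a [set x | A x -> `|f x w - f
  a w| < e]) -> forall U, nbhs (mk_point x0 (f a)) U -> nbhs a [set x | A x -> U (mk_point x0 (f x))].
Proof.
move=> Kt Aa fb fc U /realization_nbhs[B [oO Oa OU]].
have inT x : A x -> closed_face t (mk_point x0 (f x)).
 move=> Ax wt; rewrite coord_mk; [apply: (fb x Ax).2|apply: (fb x Ax).1].
have [e e0 eO] := oO t Kt _ (inT a Aa) Oa.
have h : nbhs a [set x | forall w : t, A x -> `|f x (val w) - f a (val w)| < e].
 apply: nbhs_all => w; apply: fc => //; apply: valP.
apply: filterS h => x hx Ax; apply/OU/eO; first exact: inT.
move=> w; rewrite !coord_mk ?(fb _).1 //; [|exact: (fb a Aa).1|exact: (fb x Ax).1].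
have [wt|wt] := boolP (w \in t); first exact: hx [`wt]%fset Ax.
by rewrite (fb x Ax).2 // (fb a Aa).2 // subrr normr0.
Qed.

End Realizations.

Section StandardSimplex.
Variables (R : realType) (n : nat).

Definition std_simplex : set 'rV[R]_n := [set x | (forall i, 0 <= x 0 i) /\ \sum_i x 0 i = 1].

Lemma bounded_compact (A : set 'rV[R]_n) r : closed A -> A `<=` [set x | `|x| <= r] -> compact A.
Proof.
move=> cA Ar; have -> : A = [set x | `|x| <= r] `&` A.
 by apply/seteqP; split=> [x Ax|x []//]; split=> //; apply: Ar.
apply: compact_closedI => //; apply: compact_ball0.
Qed.

Lemma closed_forall (X : topologicalType) I (A : I -> set X) : (forall i, closed (A i)) -> closed [set x | forall i, A i x].
Proof. by move=> cA; have := @closed_bigI X I setT A (fun i _ => cA i); congr closed; apply/seteqP; split=> x h i //;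
 apply: h. Qed.

Lemma closed_eq (X : topologicalType) (f g : X -> R) :
 (forall z, cont_at f z) -> (forall z, cont_at g z) -> closed [set z | f z = g z].
Proof.
move=> cf cg; have -> : [set z | f z = g z] = [set z | f z <= g z] `&` [set z | g z <= f z].
 by apply/seteqP; split=> z /= [e]; [rewrite e|move=> e'; apply: le_anti; rewrite e e'].
by apply: closedI; apply: closed_le.
Qed.

Lemma compact_std_simplex : compact std_simplex.
Proof.
apply: (bounded_compact).
 apply: closedI.
  apply: closed_forall => i; apply: closed_le => z; [exact: cont_cst|exact: cont_coord].
 by apply: closed_eq => z; last exact: cont_cst; apply: cont_sum => i.
move=> x [x0 x1] /=; apply: norm_le_co => // i; rewrite ger0_norm //.
by rewrite -x1 (bigD1 i) //= lerDl; apply: sumr_ge0.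
Qed.

End StandardSimplex.

Section CompactFaces.
Variables (R : realType) (V : choiceType) (K : scomplex V).

Lemma closed_face_cpt t : faces K t -> compact (@closed_face R V K t).
Proof.
move=> Kt; have [->|] := eqVneq (@closed_face R V K t) set0; first exact: compact0.
move=> /set0P[x0 x0t].
pose f (x : 'rV[R]_#|{: t}|) w := if insub w is Some u then x 0 (enum_rank u) else 0.
have fE x u : f x (val u) = x 0 (enum_rank u) by rewrite /f valK.
have f0 x w : w \notin t -> f x w = 0 by rewrite /f => wt; rewrite insubN.
have fb x : std_simplex x -> bary K (f x) /\ forall w, w \notin t -> f x w = 0.
 move=> [xp x1]; split; last by move=> w; apply: f0.
 exists t => //; split=> [w|w|]; [|exact: f0|].
  by rewrite /f; case: insubP => [u _|_].
 rewrite big_seq_fsetE /=; under eq_bigr => u do rewrite fE.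
 rewrite -x1 [RHS](reindex enum_rank) //.
 exact/onW_bij/enum_rank_bij.
have fin x : std_simplex x -> closed_face t (mk_point x0 (f x)).
 by move=> sx wt; rewrite coord_mk; [exact: f0|have [] := fb x sx].
have -> : closed_face t = (fun x => mk_point x0 (f x)) @` @std_simplex R #|{: t}|.
 apply/seteqP; split=> [y yt|_ [x sx <-]]; last exact: fin.
 have [s _ [y0 _ _]] := coord_bary y.
 pose x : 'rV[R]_#|{: t}| := \row_i Defs.coord y (val (enum_val i)).
 have fx w : f x w = Defs.coord y w.
  have [wt|wt] := boolP (w \in t); last by rewrite f0 // yt.
  by rewrite -[w]/(val [`wt]%fset) fE mxE enum_rankK.
 have sx : std_simplex x.
  split=> [i|]; first by rewrite mxE.
  have [s2 _ [_ ys2 y1]] := coord_bary y.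
  rewrite (reindex enum_rank) /=; last exact/onW_bij/enum_rank_bij.
  under eq_bigr => u do rewrite mxE enum_rankK.
  by rewrite -(big_seq_fsetE _ _ xpredT (Defs.coord y)) -y1; apply: fset_sum_eq.
 by exists x => //; apply: coord_inj => w; rewrite coord_mk //; have [] := fb x sx.
apply: continuous_compact; last exact: compact_std_simplex.
apply/subspace_continuousP => x sx U HU.
apply: (@cont_mk_face R V K _ x0 _ f t x Kt sx fb _ U HU) => w wt e e0.
have : nbhs x [set y | `|y 0 (enum_rank [`wt]%fset) - x 0 (enum_rank [`wt]%fset)| < e].
 apply: cont_lt; last by rewrite subrr normr0.
  apply/cont_norm/cont_atB; [exact: cont_coord|exact: cont_cst].
 by [].
by apply: filterS => y hy _; rewrite -[w]/(val [`wt]%fset) !fE.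
Qed.

End CompactFaces.

Lemma compact_realization R (V : finType) (K : scomplex V) : compact [set: realization R K].
Proof.
have -> : [set: realization R K] =
  \bigcup_(t in [set t : {fset V} | faces K t]) closed_face t.
 by apply/seteqP; split=> // x _; have [s Ks [_ xs _]] := coord_bary x; exists s.
apply: compact_bigcup => [|t]; first exact: finite_finset.
exact: closed_face_cpt.
Qed.

Lemma sum_fset (V : finType) (Z : nmodType) (s : {fset V}) (f : V -> Z) : (forall w, w \notin s -> f w = 0) ->
 \sum_(w <- s) f w = \sum_w f w.
Proof.
move=> f0; rewrite [RHS](bigID (fun w => w \in s)) /= [X in _ + X]big1 ?addr0 //.
rewrite -[RHS]big_filter; apply/perm_big/uniq_perm.
- exact: fset_uniq.
- by rewrite filter_uniq // index_enum_uniq.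
- by move=> w; rewrite mem_filter mem_index_enum andbT.
Qed.

Section OpenCone.
Variables (R : realType) (V : finType) (K : scomplex V).
Local Notation real := (realization R K).
Local Notation cone := (open_cone R K).
Local Notation E := 'rV[R]_#|V|.

Lemma halfline_in (r : R) : Num.max r 0 \in (`[0, +oo[%classic : set R).
Proof. by rewrite inE /= in_itv /= le_max lexx orbT. Qed.

Definition hpt (r : R) : halfline R := exist _ (Num.max r 0) (halfline_in r).

Lemma halfline_val (r : halfline R) : 0 <= val r.
Proof. by have := valP r; rewrite inE /= in_itv andbT. Qed.

Lemma hptK (r : halfline R) : hpt (val r) = r.
Proof. by apply: val_inj; rewrite /= max_l // halfline_val. Qed.

Lemma hpt_cont r : cont_at hpt r.
Proof.
move=> U /st_nbhs[A nA AU].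
have c : cont_at (fun r : R => Num.max r 0) r.
 by [].
by apply: filterS (c _ nA) => r' h; apply: AU.
Qed.

Lemma halfline_val_cont (r : halfline R) : cont_at (fun r : halfline R => val r : R) r.
Proof. exact: @initial_continuous (halfline R) R val r. Qed.

Lemma cone_ptE (p p' : real * halfline R) :
 cone_pt p = cone_pt p' <-> p = p' \/ (val p.2 = 0 /\ val p'.2 = 0).
Proof.
split=> [/eqmodP|h].
 by move=> /orP[/eqP|/andP[/eqP ? /eqP ?]]; [left|right].
apply/eqmodP/orP; case: h => [->|[h1 h2]]; first by left.
by right; rewrite h1 h2 eqxx.
Qed.

Lemma cone_pt_surj (c : cone) : exists p, c = cone_pt p.
Proof. by exists (repr c); rewrite /cone_pt reprK. Qed.

Lemma cone_pt_cont p : cont_at (@cone_pt R V K) p.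
Proof. exact: pi_continuous p. Qed.

Definition clevel (c : cone) : R := val (repr c).2.

Lemma clevel_pt p : clevel (cone_pt p) = val p.2.
Proof.
rewrite /clevel; have /cone_ptE := reprK (cone_pt p).
by move=> [->|[-> ->]].
Qed.

Lemma clevel_cont c : cont_at clevel c.
Proof.
have h : continuous ((fun p => val p.2) \o repr : cone -> R).
 apply: repr_comp_continuous.
  move=> p; apply: (cont_comp (f := snd)); [exact: cont_snd|exact: halfline_val_cont].
 by move=> a b /eqP/cone_ptE[->//|[-> ->]].
exact: h.
Qed.

Lemma cone_compact_ball r : compact [set c | clevel c <= r].
Proof.
have -> : [set c | clevel c <= r] = (@cone_pt R V K \o (fun z => (z.1, hpt z.2))) @` ([set: real] `*` `[0, r]).
 apply/seteqP; split=> [c cr|_ [[p t] [/= _ ht] <-]].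
  have [[p t] cE] := cone_pt_surj c; exists (p, val t); last by rewrite /= hptK.
  by split=> //=; rewrite in_itv /= halfline_val -(clevel_pt (p, t)) -cE.
 by move: ht; rewrite in_itv => /andP[t0 tr]; rewrite clevel_pt /= max_l.
apply: continuous_compact; last first.
 apply: compact_setX; [exact: compact_realization|exact: segment_compact].
apply: continuous_subspaceT => z; apply: (cont_comp (g := @cone_pt R V K)); last exact: cone_pt_cont.
apply: cont_pair => //.
apply: (cont_comp); [exact: cont_snd|exact: hpt_cont].
Qed.

(** Compactness of the base makes the bound on the level uniform. *)
Lemma cone_apex_nbhs p0 (U : set cone) : nbhs (cone_pt (p0, hpt 0)) U -> exists2 e, 0 < e & forall p r, r < e -> U
 (cone_pt (p, hpt r)).
Proof.
move=> HU; pose P A := exists2 e, 0 < e & forall p r, A p -> r < e -> U (cone_pt (p, hpt r)).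
suff [e e0 eP] : P setT by exists e => // p r; apply: eP.
apply: compact_ind (@compact_realization R V K) _ _ _ _.
- by exists 1.
- move=> A B [e e0 eP] [f f0 fP]; exists (Num.min e f); first by rewrite lt_min e0.
 by move=> p r [Ap|Bp]; rewrite lt_min => /andP[re rf]; [apply: eP|apply: fP].
- move=> A B AB [e e0 eP]; exists e => // p r /AB; apply: eP.
move=> p _; have pE : cone_pt (p, hpt 0) = cone_pt (p0, hpt 0).
 by apply/cone_ptE; right; rewrite /= maxxx.
have : nbhs (p, 0) ((fun z => cone_pt (z.1, hpt z.2)) @^-1` U).
 have c : cont_at (fun z => cone_pt (z.1, hpt z.2)) (p, 0).
  apply: (cont_comp); last exact: cone_pt_cont.
  apply: cont_pair => //.
  apply: (cont_comp); [exact: cont_snd|exact: hpt_cont].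
 by apply: c; rewrite pE.
move=> /nbhs_pair[A nA [B nB AB]]; have [e e0 eB] := nbhs_R nB; exists A => //; exists e => // q r [Aq _] re.
have [r0|r0] := leP 0 r; first by apply: (AB q r) => //; apply: eB; rewrite sub0r normrN ger0_norm.
have -> : hpt r = hpt 0 by apply: val_inj; rewrite /= max_r ?maxxx // ltW.
by apply: (AB q 0) => //; apply: eB; rewrite subrr normr0.
Qed.

Definition weight (x : E) (w : V) : R := x 0 (enum_rank w).
Definition total (x : E) : R := \sum_w weight x w.

Definition fcone (s : {fset V}) : set E :=
 [set x | (forall w, 0 <= weight x w) /\ forall w, w \notin s -> weight x w = 0].

(** A model of the open cone inside the positive orthant, with [total] as radial coordinate. *)
Definition cdom : set E := [set x | exists2 s, faces K s & fcone s x].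

Definition to_cone (p0 : real) (x : E) : cone :=
 cone_pt (mk_point p0 (fun w => weight x w / total x), hpt (total x)).

Lemma cont_weight w x : cont_at (weight^~ w) x.
Proof. by []. Qed.

Lemma cont_total x : cont_at total x.
Proof. by apply: cont_sum => w. Qed.

Lemma total0 x s : fcone s x -> 0 <= total x.
Proof. by move=> [x0 _]; apply: sumr_ge0. Qed.

Lemma weight_le_total x s w : fcone s x -> weight x w <= total x.
Proof. by move=> [x0 _]; rewrite /total (bigD1 w) //= lerDl; apply: sumr_ge0. Qed.

Lemma fcone_bary x s : faces K s -> fcone s x -> 0 < total x ->
 bary K (fun w => weight x w / total x).
Proof.
move=> Ks [x0 xs] t0; exists s => //; split.
- by move=> w; rewrite divr_ge0 // ltW.
- by move=> w /xs ->; rewrite mul0r.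
- by rewrite sum_fset => [|w /xs ->]; rewrite ?mul0r // -mulr_suml divff // gt_eqF.
Qed.

Lemma clevel_to_cone p0 x s : fcone s x -> clevel (to_cone p0 x) = total x.
Proof. by move=> sx; rewrite clevel_pt /= max_l // (total0 sx). Qed.

Lemma to_cone_subcone p0 x s : faces K s -> fcone s x -> subcone s (to_cone p0 x).
Proof.
move=> Ks sx; have := total0 sx; rewrite le_eqVlt => /predU1P[t0|t0].
 have [w ws] : exists w, w \in s.
  by have /fset0Pn := faces_neq0 Ks.
 exists (vertex_pt R K w, hpt (total x)).
  by move=> u us /=; case: eqP => // uw; rewrite uw ws in us.
 by apply/cone_ptE; right; rewrite /= -t0 maxxx.
exists (mk_point p0 (fun w => weight x w / total x), hpt (total x)) => //.
move=> w ws /=; rewrite coord_mk; last exact: fcone_bary sx t0.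
by have [_ ->] := sx; rewrite ?mul0r.
Qed.

Lemma to_cone_cont p0 x U : cdom x -> nbhs (to_cone p0 x) U ->
 nbhs x [set y | cdom y -> U (to_cone p0 y)].
Proof.
move=> [s Ks sx] HU; have := total0 sx; rewrite le_eqVlt => /predU1P[t0|t0].
 have [|e e0 eP] := @cone_apex_nbhs p0 U.
  by move: HU; congr (nbhs _ U); apply/cone_ptE; right; rewrite /= -t0 maxxx.
 have : nbhs x [set y | total y < e].
  by apply: cont_lt; [exact: cont_total|exact: cont_cst|rewrite -t0].
 by apply: filterS => y ye _; apply: eP.
have nt : nbhs x [set y | 0 < total y].
 by apply: cont_lt; [exact: cont_cst|exact: cont_total|].
have := cone_pt_cont HU => /nbhs_pair[A nA [B nB AB]].
have nB' : nbhs x [set y | B (hpt (total y))].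
 have c : cont_at (fun y => hpt (total y)) x.
  apply: (cont_comp); [exact: cont_total|exact: hpt_cont].
 exact: c.
have nA' : nbhs x [set y | forall s' : {fset V}, faces K s' -> fcone s' y -> 0 < total y ->
  A (mk_point p0 (fun w => weight y w / total y))].
 apply: nbhs_all => s'; have [Ks'|nKs'] := pselect (faces K s'); last by apply: filterE.
 have [s'x|ns'x] := pselect (fcone s' x); last first.
  have [w [ws' xw]] : exists w, w \notin s' /\ 0 < weight x w.
   by apply: contrapT => h; apply: ns'x; have [x0 _] := sx; split=> // w ws'; apply: le_anti; rewrite x0 andbT leNgt;
    apply/negP => xw; apply: h; exists w.
  have : nbhs x [set y | 0 < weight y w].
   by apply: cont_lt.
  by apply: filterS => y yw _ [_ /(_ w ws') yw0]; rewrite /= yw0 ltxx in yw.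
 have fb y : fcone s' y /\ 0 < total y ->
   bary K (fun w => weight y w / total y) /\ forall w, w \notin s' -> weight y w / total y = 0.
  by move=> [s'y ty]; split; first exact: fcone_bary s'y ty; move=> w ws'; have [_ ->] := s'y; rewrite ?mul0r.
 have := @cont_mk_face R V K _ p0 [set y | fcone s' y /\ 0 < total y]
  (fun y w => weight y w / total y) s' x Ks' (conj s'x t0) fb _ A nA.
 move=> h; have : nbhs x [set y | [set y | fcone s' y /\ 0 < total y] y ->
   A (mk_point p0 (fun w => weight y w / total y))].
  apply: h => w _ e e0.
  have c : cont_at (fun y => weight y w / total y) x.
   by apply: cont_atM; first exact: cont_weight; apply: cont_inv; [rewrite gt_eqF|exact: cont_total].
  have : nbhs x [set y | `|weight y w / total y - weight x w / total x| < e].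
   apply: cont_lt; last by rewrite subrr normr0.
    by apply/cont_norm/cont_atB.
   by [].
  by apply: filterS => y hy.
 by apply: filterS => y hy _ s'y ty; apply: hy.
apply: filterS (filterI nt (filterI nA' nB')) => y [ty [hA hB]] [s' Ks' s'y].
by apply: AB => //; apply: hA s'y ty.
Qed.

End OpenCone.

Lemma edge_dist_le1 V (T : scomplex V) u w : faces T [fset u; w]%fset -> (edge_dist T u w <= 1)%N.
Proof.
by move=> uw; rewrite /edge_dist /path_dist; case: xgetP => [k _ [_ kmin]|none]; first by apply: kmin; exists w.
Qed.

Section ConeTriangulation.
Variables (R : realType) (V : finType) (K : scomplex V) (V' : choiceType) (T : scomplex V').
Variables (phi : realization R T -> open_cone R K) (psi : open_cone R K -> realization R T).
Hypotheses (cphi : continuous phi) (cpsi : continuous psi).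
Hypotheses (phiK : cancel phi psi) (psiK : cancel psi phi).

Lemma vpoint_face t w : faces T t -> w \in t -> closed_face t (vertex_pt R T w).
Proof.
move=> Tt wt u ut /=; case: eqP => // uw.
by rewrite uw wt in ut.
Qed.

(** Obtained by a small step from [w] towards the barycenter of [t]. *)
Lemma star_point w t (N : set (realization R T)) : nbhs (vertex_pt R T w) N -> faces T t -> w \in t -> exists2 y, N y &
 forall u, (u \in t) = (0 < Defs.coord y u).
Proof.
move=> /realization_nbhs[B [oB Bw BN]] Tt wt.
have [e e0 eB] := oB t Tt _ (vpoint_face Tt wt) Bw.
pose l := Num.min (1/2) (e / 2).
have l0 : 0 < l by rewrite lt_min !divr_gt0.
have l1 : l < 1 by rewrite gt_min; lra.
have le : l < e by rewrite gt_min; lra.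
have n0 : 0 < #|` t|%:R :> R by rewrite ltr0n cardfs_gt0; apply: faces_neq0 Tt.
pose f u := (1 - l) * (u == w)%:R + l / #|` t|%:R * (u \in t)%:R.
have fpos u : u \in t -> 0 < f u.
 move=> ut; rewrite /f ut mulr1; apply: ltr_wpDl; last by rewrite divr_gt0.
 by rewrite mulr_ge0 // subr_ge0 ltW.
have f0 u : u \notin t -> f u = 0.
 move=> ut; rewrite /f (negPf ut) mulr0 addr0; case: eqP => [uw|]; last by rewrite mulr0.
 by rewrite uw wt in ut.
have fb : bary T f.
 exists t => //; split=> [u|u|]; [|exact: f0|].
  by have [/fpos/ltW//|/f0 ->] := boolP (u \in t).
 rewrite big_split /= -!mulr_sumr.
 have -> : \sum_(u <- t) (u == w)%:R = 1 :> R.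
  by rewrite (big_fsetD1 w) //= eqxx big_seq big1 ?addr0 // => u; rewrite !inE => /andP[/negPf ->].
 have -> : \sum_(u <- t) (u \in t)%:R = #|` t|%:R :> R.
  by rewrite big_seq; under eq_bigr => u ut do rewrite ut; rewrite -big_seq big_const_seq iter_addr_0.
 by rewrite divfK ?gt_eqF // mulr1 subrK.
exists (mk_point (vertex_pt R T w) f).
 apply/BN/eB; first by move=> ut; rewrite coord_mk //; apply: f0.
 move=> u; rewrite coord_mk //.
 have -> : (1 - l) * (u == w)%:R + l / #|` t|%:R * (u \in t)%:R - (u == w)%:R =
   l * ((u \in t)%:R / #|` t|%:R - (u == w)%:R) by field; rewrite gt_eqF.
 rewrite normrM (gtr0_norm l0); apply: le_lt_trans le; rewrite ler_piMr //; first exact: ltW.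
 pose a : R := (u \in t)%:R / #|` t|%:R; pose b : R := (u == w)%:R.
 have /andP[a0 a1] : 0 <= a <= 1.
  rewrite divr_ge0 //= ler_pdivrMr // mul1r ler_nat.
  case: (u \in t) => //=; rewrite cardfs_gt0; apply: faces_neq0 Tt.
 have /andP[b0 b1] : 0 <= b <= 1 by rewrite /b; case: (u == w); rewrite ?lexx ?ler01.
 rewrite -/a ler_norml; lra.
move=> u; rewrite coord_mk //; have [ut|ut] := boolP (u \in t); first by rewrite fpos.
by rewrite f0.
Qed.

(** Local finiteness follows from local compactness of the cone: one interior point of each simplex
    at [w], chosen in a compact neighborhood of [w], gives a family all of whose subsets are closed
    in the weak topology. *)
Lemma star_finite w : finite_set [set t : {fset V'} | faces T t /\ w \in t].
Proof.
set D := [set t : {fset V'} | _]; pose a := phi (vertex_pt R T w).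
pose M := psi @` [set c | clevel c <= clevel a + 1].
have cM : compact M.
 apply: continuous_compact; last exact: cone_compact_ball.
 exact: continuous_subspaceT.
have nM : nbhs (vertex_pt R T w) M.
 have : nbhs (vertex_pt R T w) [set y | clevel (phi y) < clevel a + 1].
  apply: cont_lt; [|exact: cont_cst|by rewrite ltrDl].
  apply: (cont_comp); [exact: cphi|exact: clevel_cont].
 by apply: filterS => y hy; exists (phi y) => //=; apply: ltW.
have /choice[y yP] : forall t, exists y, D t -> M y /\ forall u, (u \in t) = (0 < Defs.coord y u).
 move=> t; have [[Tt wt]|nD] := pselect (D t); last by exists (vertex_pt R T w).
 by have [y yt] := star_point nM Tt wt; exists y.
apply: (discrete_finite (f := y) cM).
- by move=> t t'; rewrite !inE => Dt Dt' e; apply/fsetP => u; have [_ ->] := yP t Dt; have [_ ->] := yP t' Dt'; rewrite e.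
- by move=> _ [t Dt <-]; have [] := yP t.
move=> J JD; rewrite -[X in closed X]setCK; apply: open_closedC.
change (realization_open (~` (y @` J))) => s Ts x sx nx.
have pos (t : fpowerset s) : exists e, 0 < e /\ (J (val t) -> ~ forall u, `|Defs.coord (y (val t)) u - Defs.coord x u| < e).
 have [Jt|nJt] := pselect (J (val t)); last by exists 1.
 have [u ux] : exists u, Defs.coord (y (val t)) u != Defs.coord x u.
  by apply: contrapT => h; apply: nx; exists (val t) => //; apply: coord_inj => u; apply: contrapT => /eqP ne; apply: h; exists u.
 exists `|Defs.coord (y (val t)) u - Defs.coord x u|; split; first by rewrite normr_gt0 subr_eq0.
 by move=> _ /(_ u); rewrite ltxx.
have [e eP] := choice pos.
exists (\big[Num.min/1]_t e t).
 by elim/big_ind: _ => // [a1 b1 a0 b0|t _]; [rewrite lt_min a0 b0|have [] := eP t].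
move=> z sz xz [t Jt tz]; have Dt := JD t Jt; have [_ tP] := yP t Dt.
have ts : t \in fpowerset s.
 by rewrite fpowersetE; apply/fsubsetP => u; rewrite tP tz; apply: contraTT => us; rewrite sz // ltxx.
have [_ h] := eP [` ts]%fset; apply: (h Jt) => u /=; rewrite tz.
by apply: lt_le_trans (xz u) _; rewrite (bigD1 [` ts]%fset) //= ge_min lexx.
Qed.

(** The closed star of [w] is compact by [star_finite]. *)
Lemma vertex_level_bound w : exists b, forall y, 0 < Defs.coord y w -> clevel (phi y) <= b.
Proof.
pose Q := \bigcup_(t in [set t : {fset V'} | faces T t /\ w \in t]) @closed_face R V' T t.
have cQ : compact ((fun y => clevel (phi y)) @` Q).
 apply: continuous_compact.
  apply: continuous_subspaceT => y.
  apply: (cont_comp (f := phi)); [exact: cphi|exact: clevel_cont].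
 apply: compact_bigcup => [|t [Tt _]]; [exact: star_finite|exact: closed_face_cpt].
have [M [_ hM]] := compact_bounded cQ; exists (Num.max M 0 + 1) => y yw.
have M1 : M < Num.max M 0 + 1.
 by apply: le_lt_trans (_ : M <= Num.max M 0) _; [rewrite le_max lexx|rewrite ltrDl].
apply: le_trans (ler_norm _) _; apply: (hM _ M1); exists y => //.
have [t Tt tE] := carrier_exists y; exists t; first by split=> //; rewrite tE.
move=> u; rewrite tE -leNgt => u0; apply: le_anti; by rewrite u0 coord0.
Qed.

End ConeTriangulation.

Lemma near_vertex_exists R V (T : scomplex V) (y : realization R T) : exists w, 0 < Defs.coord y w.
Proof.
have [t Tt tE] := carrier_exists y; have /fset0Pn[w wt] := faces_neq0 Tt.
by exists w; rewrite -tE.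
Qed.

Lemma near_vertex_edge R V (T : scomplex V) (y : realization R T) u w : 0 < Defs.coord y u -> 0 < Defs.coord y w -> faces
 T [fset u; w]%fset.
Proof.
move=> yu yw; have [t Tt tE] := carrier_exists y; apply: (faces_sub Tt).
 by apply/fsubsetP => z; rewrite !inE => /orP[]/eqP ->; rewrite tE.
by apply/fset0Pn; exists u; rewrite !inE eqxx.
Qed.

Lemma positive_coord_nbhs R V (T : scomplex V) (y : realization R T) w : 0 < Defs.coord y w -> nbhs y [set z | 0 <
 Defs.coord z w].
Proof.
apply: nbhs_realization => // s Ts x xw; exists (Defs.coord x w) => // z sz /(_ w).
by rewrite ltr_norml => /andP[h _] /=; rewrite -(ltrD2r (- Defs.coord x w)) sub0r.
Qed.

Lemma local_to_uniform (R : realType) v (Q : set 'rV[R]_v) P : compact Q -> (forall x, Q x -> nbhs x [set y | Q y -> P x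
 y]) -> exists2 e : R, 0 < e & forall x y, Q x -> Q y -> `|x - y| < e -> exists z, P z x /\ P z y.
Proof.
move=> cQ hP; pose L A := exists2 e, 0 < e & forall x y, A x -> Q x -> Q y -> `|x - y| < e -> exists z, P z x /\ P z y.
suff [e e0 eP] : L Q by exists e => // x y Qx; apply: eP.
apply: (compact_ind cQ).
- by exists 1.
- move=> A B [e e0 eP] [f f0 fP]; exists (Num.min e f); first by rewrite lt_min e0.
 by move=> x y [Ax|Bx] Qx Qy; rewrite lt_min => /andP[re rf]; [apply: (eP x y)|apply: (fP x y)].
- move=> A B AB [e e0 eP]; exists e => // x y /AB; apply: eP.
move=> x Qx; have /nbhs_ballP[e /= e0 eP] := hP x Qx.
exists [set y | `|x - y| < e / 2].
 apply: cont_lt; last by rewrite subrr normr0 divr_gt0.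
  by apply/cont_norm/cont_atB.
 by [].
exists (e / 2); first by rewrite divr_gt0.
move=> y z [/= xy _] yz; exists x; split; apply: eP => //; rewrite -ball_normE /=.
 lra.
rewrite -(subrKA y); apply: le_lt_trans (ler_normD _ _) _.
by rewrite [ltRHS](splitr e); apply: ltrD.
Qed.

Lemma addb_even_fibers (I J : eqType) (s : seq I) Q (f : J -> bool) : (forall i, i \in s -> ~~ odd (count (fun j => Q j
 == Q i) s)) -> \big[addb/false]_(i <- s) f (Q i) = false.
Proof.
elim: {s}(size s) {-2}s (leqnn (size s)) => [|n IHn] s sn hs.
 by move: sn; rewrite leqn0 size_eq0 => /eqP ->; rewrite big_nil.
case: s sn hs => [|i s] sn hs; first by rewrite big_nil.
rewrite (bigID (fun j => Q j == Q i)) /= -[X in _ (+) X]big_filter.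
have -> : \big[addb/false]_(j <- i :: s | Q j == Q i) f (Q j) =
  odd (count (fun j => Q j == Q i) (i :: s)) && f (Q i).
 elim: (i :: s) => [|j t IHt]; first by rewrite big_nil.
 by rewrite big_cons oddD; case: eqP => [->|_]; rewrite IHt //=; case: (odd _); case: (f _).
rewrite (negPf (hs i _)) ?inE ?eqxx // addFb; apply: IHn.
 by rewrite size_filter /= eqxx /=; apply: leq_trans (count_size _ _) _.
move=> j; rewrite mem_filter => /andP[ji js]; rewrite count_filter (eq_count (a2 := fun k => Q k == Q j)) ?hs // => k /=.
by case: eqP => //= ->.
Qed.

Lemma fset2_eq (T : choiceType) (a b c d : T) : [fset a; b]%fset = [fset c; d]%fset ->
 a = c /\ b = d \/ a = d /\ b = c.
Proof.
move=> e; have ha : a \in [fset c; d]%fset by rewrite -e !inE eqxx.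
have hb : b \in [fset c; d]%fset by rewrite -e !inE eqxx orbT.
have hc : c \in [fset a; b]%fset by rewrite e !inE eqxx.
have hd : d \in [fset a; b]%fset by rewrite e !inE eqxx orbT.
move: ha hb hc hd; rewrite !inE => /orP[]/eqP h1 /orP[]/eqP h2 /orP[]/eqP h3 /orP[]/eqP h4; by [left|right].
Qed.

Lemma count_unique (T : eqType) (P : pred T) s : uniq s -> {in s &, forall x y, P x -> P y -> x = y} -> count P s = has P s.
Proof.
elim: s => //= x s IHs /andP[xs us] h; rewrite IHs //; last first.
 by move=> y z ys zs; apply: h; rewrite inE ?ys ?zs orbT.
case Px: (P x) => //=; case: hasP => // -[y ys Py].
by move: xs; rewrite (h x y _ _ Px Py) ?ys // inE ?eqxx ?ys ?orbT.
Qed.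

Lemma sum_row_mx (R : nzRingType) (I : finType) a b c (A : I -> 'rV[R]_a) (B : I -> 'rV[R]_b) : \sum_i c i *: row_mx (A
 i) (B i) = row_mx (\sum_i c i *: A i) (\sum_i c i *: B i).
Proof.
apply/rowP => j; rewrite summxE; case: (split_ordP j) => k ->.
 by rewrite row_mxEl summxE; apply: eq_bigr => i _; rewrite [LHS]mxE row_mxEl [RHS]mxE.
by rewrite row_mxEr summxE; apply: eq_bigr => i _; rewrite [LHS]mxE row_mxEr [RHS]mxE.
Qed.

(** * Obstructor cycles in the deleted join *)

Section PairLists.
Variables (V : finType).
Local Notation v := #|V|.
Implicit Types (a b : {fset V}).

(* The simplex [a * b] of the deleted join, with the vertices of [b] negated. *)
Definition plist a b : seq ('I_v * bool) :=
 [seq (i, enum_val i \in b) | i <- [seq i <- enum 'I_v | enum_val i \in (a `|` b)%fset]].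

Lemma mem_plist a b x : (x \in plist a b) =
 (enum_val x.1 \in (a `|` b)%fset) && (x.2 == (enum_val x.1 \in b)).
Proof.
apply/mapP/andP => [[i]|[xab /eqP xb]].
 by rewrite mem_filter mem_enum andbT => iab ->.
exists x.1; first by rewrite mem_filter xab mem_enum.
by rewrite -xb; case: x {xab xb}.
Qed.

Lemma plist_fst a b : map fst (plist a b) = [seq i <- enum 'I_v | enum_val i \in (a `|` b)%fset].
Proof. by rewrite -map_comp map_id. Qed.

Lemma plist_distinct a b : distinct (plist a b).
Proof. by rewrite /distinct plist_fst filter_uniq // enum_uniq. Qed.

Lemma plist_uniq a b : uniq (plist a b).
Proof. exact: map_uniq (plist_distinct a b). Qed.

Lemma plist_size a b : [disjoint a & b]%fset -> size (plist a b) = (#|` a| + #|` b|)%N.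
Proof.
move=> dab; rewrite -(size_map fst) plist_fst -(size_map enum_val).
have -> : (#|` a| + #|` b|)%N = #|` (a `|` b)%fset|.
 by rewrite cardfsU (eqP dab) subn0.
apply/perm_size/uniq_perm.
- by rewrite map_inj_uniq => //; rewrite filter_uniq // enum_uniq.
- exact: fset_uniq.
move=> w; apply/mapP/idP => [[i]|wab]; first by rewrite mem_filter => /andP[h _] ->.
exists (enum_rank w); last by rewrite enum_rankK.
by rewrite mem_filter enum_rankK wab mem_enum.
Qed.

Lemma plist_flip a b : [disjoint a & b]%fset -> plist b a = map (@flip v) (plist a b).
Proof.
move=> dab; rewrite /plist fsetUC -map_comp; apply/eq_in_map => i.
rewrite mem_filter inE => /andP[/orP iab _]; congr (_, _) => /=.
move/fdisjointP: dab => dab.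
case: iab => [ia|ib]; first by rewrite (negPf (dab _ ia)).
rewrite ib /=; apply/negP => /dab; by rewrite ib.
Qed.

Lemma plist_del a b i : [seq y <- plist a b | y != (i, enum_val i \in b)] =
 plist (a `\ enum_val i)%fset (b `\ enum_val i)%fset.
Proof.
rewrite /plist filter_map -filter_predI.
have -> : [seq k <- enum 'I_v | enum_val k \in (a `\ enum_val i `|` b `\ enum_val i)%fset] =
  [seq k <- enum 'I_v | (predI (preim (fun k => (k, enum_val k \in b))
    (fun y => y != (i, enum_val i \in b))) (fun k => enum_val k \in (a `|` b)%fset)) k].
 apply: eq_filter => k /=; rewrite !inE (inj_eq enum_val_inj).
 case: eqP => [->|ki] /=; first by rewrite eqxx.
 by rewrite (_ : (_ == _) = false) //; apply/eqP => -[].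
apply/eq_in_map => k; rewrite mem_filter => /andP[/andP[/= ki _] _].
rewrite !inE (inj_eq enum_val_inj).
by move: ki; case: (eqVneq i) => [->|//]; rewrite eqxx.
Qed.

Section InvariantSum.
Variable mu : seq ('I_v * bool) -> bool.
Hypothesis imu : forall t, mu (map (@flip v) t) = mu t.

(** Well defined on unordered pairs, because exchanging the two simplices flips the list and [mu] is
    invariant under flips. *)
Definition pair_value (q : {fset {fset V}}) : bool :=
 `[< exists a b, [/\ q = [fset a; b]%fset, [disjoint a & b]%fset & mu (plist a b)] >].

Lemma pair_valueE a b : [disjoint a & b]%fset -> pair_value [fset a; b]%fset = mu (plist a b).
Proof.
move=> dab; apply/asboolP/idP => [[a' [b' [e dab' h]]]|h]; last by exists a, b.
by case: (fset2_eq e) => -[-> ->] //; rewrite plist_flip ?imu.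
Qed.

Definition pair_del (st : {fset {fset V}}) (w : V) : {fset {fset V}} :=
 [fset (u `\ w)%fset | u in st]%fset.

Lemma pair_delE (s t : {fset V}) w : pair_del [fset s; t]%fset w = [fset (s `\ w); (t `\ w)]%fset.
Proof.
apply/fsetP => u; rewrite !inE; apply/imfsetP/orP => [[u']|].
 by rewrite !inE => /orP[]/eqP -> ->; [left|right].
by case=> /eqP ->; [exists s|exists t] => //; rewrite !inE eqxx ?orbT.
Qed.

Lemma delta_plist a b : [disjoint a & b]%fset -> delta mu (plist a b) =
 \big[addb/false]_(w <- [seq w <- enum V | w \in (a `|` b)%fset]) pair_value (pair_del [fset a; b]%fset w).
Proof.
move=> dab; rewrite delta_rem ?plist_uniq // (perm_big (map enum_val [seq i <- enum 'I_v | enum_val i \in (a `|` b)%fset])).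
 by rewrite !big_map; apply: eq_bigr => i _; rewrite plist_del pair_delE pair_valueE //; apply/fdisjointP => w; rewrite
  !inE => /andP[_ wa]; apply/negP => /andP[_ wb]; move/fdisjointP: dab => /(_ w wa); rewrite wb.
apply: uniq_perm.
- by rewrite filter_uniq // enum_uniq.
- by rewrite map_inj_uniq => //; rewrite filter_uniq // enum_uniq.
move=> w; rewrite mem_filter mem_enum andbT; apply/idP/mapP => [wab|[i]].
 by exists (enum_rank w); rewrite ?enum_rankK // mem_filter enum_rankK wab mem_enum.
by rewrite mem_filter => /andP[h _] ->.
Qed.

End InvariantSum.
End PairLists.

Section ObstructorChain.
Variables (R : realType) (V : finType) (K : scomplex V) (m : nat).
Local Notation v := #|V|.

Lemma pair_cell_disjoint d (s t : {fset V}) : pair_cell K d [fset s; t]%fset ->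
 [/\ faces K s, faces K t, [disjoint s & t]%fset & (#|` s|.-1 + #|` t|.-1 = d)%N].
Proof.
move=> [s' [t' [Ks Kt dst e <-]]]; case: (fset2_eq e) => -[-> ->]; split=> //.
 by rewrite fdisjoint_sym.
by rewrite addnC.
Qed.

Variable Sigma : {fset {fset {fset V}}}.
Hypothesis cyc : cellular_cycle K m Sigma.
Hypothesis tops : forall s, faces K s -> #|` s|.-1 = m ->
 ~~ odd #|[set v : V | [fset s; [fset v]]%fset \in Sigma]|.

Definition psupp (st : {fset {fset V}}) : seq V :=
 [seq w <- enum V | has (fun u : {fset V} => w \in u) st].

Lemma mem_psupp (s t : {fset V}) w :
 (w \in psupp [fset s; t]%fset) = (w \in (s `|` t)%fset).
Proof.
rewrite mem_filter mem_enum andbT inE; apply/hasP/orP => [[u]|].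
 by rewrite !inE => /orP[]/eqP ->; [left|right].
by case=> h; [exists s|exists t] => //; rewrite !inE eqxx ?orbT.
Qed.

(** Two deletions could agree only if one simplex turned into the other, which disjointness and
    nonemptiness exclude. *)
Lemma pair_del_inj (st : {fset {fset V}}) w w' : st \in Sigma -> w \in psupp st ->
 w' \in psupp st -> pair_del st w = pair_del st w' -> w = w'.
Proof.
move=> stS; have [h _] := cyc; have [s [t [Ks Kt dst -> _]]] := h st stS.
move/fdisjointP: (dst) => dP.
rewrite !mem_psupp !pair_delE !inE => ws ws' e.
have key a b x y : faces K a -> faces K b -> (forall u, u \in a -> u \notin b) -> x \in a -> y \in (a `|` b)%fset -> x
 \notin b -> [fset (a `\ x); (b `\ x)]%fset = [fset (a `\ y); (b `\ y)]%fset -> x = y.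
 move=> Ka Kb dab xa yab xb e'; apply: contrapT => /eqP xy.
 have [e1|e1] : b = (a `\ y)%fset \/ b = (b `\ y)%fset.
  have : (b `\ x)%fset \in [fset (a `\ y); (b `\ y)]%fset by rewrite -e' !inE eqxx orbT.
  by rewrite (mem_fsetD1 xb) !inE => /orP[]/eqP; [left|right].
 - have /fset0Pn[z zb] := faces_neq0 Kb; have : z \in a.
   by move: zb; rewrite e1 !inE => /andP[].
  by move=> /dab; rewrite zb.
 - have yb : y \notin b by rewrite e1 !inE eqxx.
  have ya : y \in a by move: yab; rewrite inE (negPf yb) orbF.
  have : (a `\ x)%fset \in [fset (a `\ y); (b `\ y)]%fset by rewrite -e' !inE eqxx.
  rewrite (mem_fsetD1 yb) !inE => /orP[]/eqP e2.
   have : x \in (a `\ x)%fset by rewrite e2 !inE xy.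
   by rewrite !inE eqxx.
  have : y \in b by rewrite -e2 !inE eq_sym xy.
  by rewrite (negPf yb).
case/orP: ws => w1.
 by apply: (key s t) => //; rewrite ?inE // dP.
apply: (key t s) => //.
- by move=> u ut; apply/negP => /dP; rewrite ut.
- by rewrite inE orbC.
- by apply/negP => /dP; rewrite w1.
- by rewrite fsetUC [RHS]fsetUC.
Qed.

(** As long as the simplex losing [w0] stays nonempty, this is the cellular cycle condition. If it
    becomes empty, only the other simplex remains, of dimension [m], and the count is the number of
    vertices paired with it, even by [tops]. *)
Lemma pair_del_even st0 w0 : st0 \in Sigma -> w0 \in psupp st0 ->
 ~~ odd (\sum_(st <- Sigma) count (fun w => pair_del st w == pair_del st0 w0) (psupp st)).
Proof.
move=> st0S w00; have [hS hcyc] := cyc.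
have [s0 [t0 [[Ks0 Kt0 dst0 st0E dim0] w0s]]] : exists s0 t0, [/\ faces K s0, faces K t0,
  [disjoint s0 & t0]%fset, st0 = [fset s0; t0]%fset & (#|` s0|.-1 + #|` t0|.-1 = m)%N] /\ w0 \in s0.
 have [s [t [Ks Kt dst E dm]]] := hS st0 st0S.
 move: w00; rewrite E mem_psupp inE => /orP[ws|wt]; first by exists s, t.
 exists t, s; split=> //; split=> //; first by rewrite fdisjoint_sym.
  by rewrite fsetUC.
 by rewrite addnC.
move/fdisjointP: (dst0) => dP0.
have qE : pair_del st0 w0 = [fset (s0 `\ w0); t0]%fset.
 by rewrite st0E pair_delE (mem_fsetD1 (dP0 _ w0s)).
have [a0|a0] := eqVneq (s0 `\ w0)%fset fset0.
 have s0E : s0 = [fset w0]%fset.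
  by rewrite -(fsetD1K w0s) a0 fsetU0.
 have dimt : #|` t0|.-1 = m by move: dim0; rewrite s0E cardfs1.
 have /fset0Pn[z0 z0t] := faces_neq0 Kt0.
 have cE st : st \in Sigma -> count (fun w => pair_del st w == pair_del st0 w0) (psupp st) =
   count (fun w => [fset t0; [fset w]]%fset == st) (enum V).
  move=> stS; rewrite count_filter; apply: eq_count => w.
  have [s [t [Ks Kt dst E _]]] := hS st stS; move/fdisjointP: (dst) => dP.
  rewrite qE a0; apply/andP/eqP => [[/eqP e ws]|e].
   have {}ws : w \in (s `|` t)%fset by rewrite -mem_psupp -E mem_filter ws mem_enum.
   have key (x y : {fset V}) : faces K y -> (forall u, u \in x -> u \notin y) -> w \in x ->
     st = [fset x; y]%fset -> [fset t0; [fset w]]%fset = st.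
    move=> Ky xy wx Exy; move: e; rewrite Exy pair_delE (mem_fsetD1 (xy _ wx)) => e.
    have ye : y = t0.
     have : y \in [fset fset0; t0]%fset by rewrite -e !inE eqxx orbT.
     by rewrite !inE (negPf (faces_neq0 Ky)) => /eqP.
    have : (x `\ w)%fset \in [fset fset0; t0]%fset by rewrite -e !inE eqxx.
    rewrite !inE => /orP[]/eqP e2; first by rewrite -(fsetD1K wx) e2 fsetU0 ye fsetUC.
    have : z0 \in x by move: z0t; rewrite -e2 !inE => /andP[].
    by move=> /xy; rewrite ye z0t.
   case/fsetUP: ws => ws; first exact: (key s t).
   apply: (key t s) => //; last by rewrite fsetUC.
   by move=> u ut; apply/negP => /dP; rewrite ut.
  have := hS st stS; rewrite -e => /pair_cell_disjoint[_ _ dtw _].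
  have wt : w \notin t0.
   by apply/negP => wt; move/fdisjointP: dtw => /(_ w wt); rewrite inE eqxx.
  split; last by apply/hasP; exists [fset w]%fset; rewrite !inE eqxx ?orbT.
  apply/eqP; rewrite pair_delE (mem_fsetD1 wt) fsetUC; congr (_ |` _)%fset.
  by apply/fsetP => u; rewrite !inE; case: eqP.
 rewrite big_seq; under eq_bigr => st stS do rewrite cE // -sum1_count big_mkcond.
 rewrite -big_seq exchange_big.
 have -> : \sum_(w <- enum V) \sum_(st <- Sigma) (if [fset t0; [fset w]]%fset == st then 1 else 0) =
   #|[set w : V | [fset t0; [fset w]]%fset \in Sigma]|.
  rewrite -sum1_card big_enum [RHS]big_mkcond; apply: eq_bigr => w.
  have -> : (w \in in_set [set w1 | [fset t0; [fset w1]]%fset \in Sigma]) =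
    ([fset t0; [fset w]]%fset \in Sigma).
   by rewrite /in_set; apply/asboolP/idP.
  case: ifPn => [h|h].
   rewrite (big_fsetD1 _ h) eqxx big_seq big1 // => st.
   by rewrite !inE eq_sym => /andP[/negPf ->].
  by rewrite big_seq big1 // => st stS; case: eqP => // e; rewrite -e (negPf h) in stS.
 exact: tops.
have pc : pair_cell K m.-1 (pair_del st0 w0).
 have ca : #|` s0| = #|` (s0 `\ w0)%fset|.+1 by rewrite (cardfsD1 w0) w0s.
 have ca0 : (0 < #|` (s0 `\ w0)%fset|)%N by rewrite cardfs_gt0.
 exists (s0 `\ w0)%fset, t0; split=> //.
 - apply: faces_sub Ks0 _ a0; apply: fsubD1set.
 - by apply/fdisjointP => u; rewrite !inE => /andP[_ /dP0].
 - move: ca.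
  lia.
have m0 : m.-1.+1 = m.
 have ca : #|` s0| = #|` (s0 `\ w0)%fset|.+1 by rewrite (cardfsD1 w0) w0s.
 have ca0 : (0 < #|` (s0 `\ w0)%fset|)%N by rewrite cardfs_gt0.
 lia.
have := hcyc m.-1 (pair_del st0 w0) m0 pc.
suff -> : \sum_(st <- Sigma) count (fun w => pair_del st w == pair_del st0 w0) (psupp st) =
  #|` [fset p in Sigma | `[< pair_facet (pair_del st0 w0) p >]]%fset| by [].
have -> : #|` [fset p in Sigma | `[< pair_facet (pair_del st0 w0) p >]]%fset| =
  \sum_(st <- Sigma) (`[< pair_facet (pair_del st0 w0) st >] : nat).
 transitivity (size [seq st <- Sigma | `[< pair_facet (pair_del st0 w0) st >]]).
  apply/perm_size/uniq_perm; rewrite ?filter_uniq // => st.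
  by rewrite mem_filter !inE andbC.
 rewrite size_filter -sum1_count big_mkcond.
 by [].
rewrite !big_seq; apply: eq_bigr => st stS.
rewrite count_unique; last first.
- by move=> x y xs ys /eqP h1 /eqP h2; apply: (pair_del_inj stS) => //; rewrite h1.
- by rewrite filter_uniq // enum_uniq.
congr nat_of_bool; have [s [t [Ks Kt dst E dm]]] := hS st stS; move/fdisjointP: (dst) => dP.
apply/hasP/asboolP => [[w]|].
 rewrite E mem_psupp => /fsetUP[ws|wt] /eqP <-.
  exists (s `\ w)%fset, s, t; split=> //.
  - by rewrite pair_delE (mem_fsetD1 (dP _ ws)).
  - exact: fsubD1set.
  - by rewrite (cardfsD1 w) ws.
 exists (t `\ w)%fset, t, s; split=> //.
 - rewrite pair_delE fsetUC (mem_fsetD1 (A := s)) //.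
  by apply/negP => /dP; rewrite wt.
 - by rewrite fsetUC.
 - exact: fsubD1set.
 - by rewrite (cardfsD1 w) wt.
move=> [a [s' [t' [e1 e2 as' ca]]]].
have := hS st stS; rewrite e2 => /pair_cell_disjoint[_ _ /fdisjointP dP' _].
have /fset0Pn[w] : (s' `\` a)%fset != fset0.
 rewrite -cardfs_gt0; have := cardfsID a s'.
 rewrite (fsetIidPr as') ca; lia.
rewrite !inE => /andP[wa ws].
exists w; first by rewrite mem_psupp inE ws.
rewrite pair_delE (mem_fsetD1 (dP' _ ws)) e1; apply/eqP; congr [fset _; t']%fset.
apply/esym/eqP; rewrite eqEfcard; apply/andP; split.
 by apply/fsubsetP => u ua; rewrite !inE (fsubsetP as' _ ua) andbT; apply: contraNneq wa => <-.
by have := cardfsD1 w s'; rewrite ws ca => -[->].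
Qed.

Lemma pair_cycle mu : (forall t, mu (map (@flip v) t) = mu t) ->
 \big[addb/false]_(st <- Sigma) \big[addb/false]_(w <- psupp st) pair_value mu (pair_del st w) = false.
Proof.
move=> imu.
pose L := [seq (st, w) | st <- Sigma, w <- psupp st].
have -> : \big[addb/false]_(st <- Sigma) \big[addb/false]_(w <- psupp st)
  pair_value mu (pair_del st w) = \big[addb/false]_(x <- L) pair_value mu (pair_del x.1 x.2).
 by rewrite big_allpairs_dep.
apply: (addb_even_fibers) => x xL.
have [st0S w00] : x.1 \in Sigma /\ x.2 \in psupp x.1.
 by case/allpairsPdep: xL => st [w [? ? ->]].
have := pair_del_even st0S w00; congr (~~ odd _); apply/esym.
rewrite -[LHS]sum1_count big_mkcond big_allpairs_dep.
by apply: eq_bigr => st _; rewrite -sum1_count [RHS]big_mkcond.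
Qed.

Variable p : V -> 'rV[R]_m.
Hypothesis gp : general_position p.

(** Placing the points at height 1 turns affine relations into linear ones. *)
Definition jvec (i : 'I_v) : 'rV[R]_m.+1 :=
 row_mx (const_mx 1 : 'rV[R]_1) (p (enum_val i)).

Lemma jvec_sum (c : 'I_v -> R) : \sum_i c i *: jvec i = 0 <->
 \sum_w c (enum_rank w) = 0 /\ \sum_w c (enum_rank w) *: p w = 0.
Proof.
have reI (Z : nmodType) (G : V -> Z) : \sum_w G w = \sum_(i < v) G (enum_val i).
 by rewrite (reindex (enum_val : 'I_v -> V)) //; apply: onW_bij.
have -> : \sum_i c i *: jvec i = row_mx (\sum_i c i *: const_mx 1 : 'rV_1)
 (\sum_i c i *: p (enum_val i)) :=
  sum_row_mx c (fun=> const_mx 1 : 'rV_1) (fun i => p (enum_val i)).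
rewrite !reI; under [X in _ <-> X = 0 /\ _]eq_bigr => i do rewrite enum_valK.
under [X in _ /\ X = 0]eq_bigr => i do rewrite enum_valK.
rewrite -[0 : 'rV_(1 + m)]row_mx0; split.
 move=> h; have [h1 h2] := @eq_row_mx _ 1 1 m _ _ _ _ h; split=> //; clear h.
 have := congr1 (fun A : 'rV_1 => A 0 0) h1; rewrite summxE mxE => h; rewrite -[RHS]h.
 by apply: eq_bigr => i _; rewrite !mxE mulr1.
move=> [h1 h2]; rewrite h2; set u := (X in row_mx X _); have -> : u = 0 => //.
apply/rowP => j.
by rewrite summxE mxE -[RHS]h1; apply: eq_bigr => i _; rewrite !mxE mulr1.
Qed.

Lemma jvec_generic : generic jvec.
Proof.
move=> c cm /jvec_sum[c1 cp] i; pose A := [set enum_val i | i in supp c]%SET.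
have cA : (#|A| <= m.+1)%N by apply: leq_trans cm; apply: leq_imset_card.
have inA w : (w \in A) = (c (enum_rank w) != 0).
 apply/imsetP/idP => [[k]|cw]; first by rewrite inE => ck ->; rewrite enum_valK.
 by exists (enum_rank w); rewrite ?inE ?enum_rankK.
have [iA|iA] := boolP (enum_val i \in A); last first.
 by move: iA; rewrite inA enum_valK negbK => /eqP.
have zero (Z : lmodType R) (G : V -> Z) : \sum_(w in A) c (enum_rank w) *: G w = \sum_w c (enum_rank w) *: G w.
 by rewrite [RHS](bigID (fun w => w \in A)) /= [X in _ + X]big1 ?addr0 // => w; rewrite inA negbK => /eqP ->; rewrite scale0r.
have := gp cA (c := fun w => c (enum_rank w)); rewrite zero cp => h.
have /h : \sum_(w in A) c (enum_rank w) = 0.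
 have := zero (R^o : lmodType R) (fun=> 1); rewrite -[RHS]/(\sum_w c (enum_rank w) * 1).
 under eq_bigr => w do rewrite -[_ *: _]/(c (enum_rank w) * 1) mulr1.
 by under [X in _ = X]eq_bigr => w do rewrite mulr1; rewrite c1.
by move=> /(_ erefl _ iA); rewrite enum_valK.
Qed.

(** A common point of the two images is a linear relation, positive on [s] and negative on [t],
    normalized to sum 1 on [s]. General position makes all coefficients nonzero and the relation
    unique up to scaling, so there is at most one point. *)
Lemma image_meet_count s t : faces K s -> faces K t -> [disjoint s & t]%fset -> (#|` s|.-1 + #|` t|.-1 = m)%N -> #|`
 fset_set (@image_meet R V K m p [fset s; t]%fset)| = `[< hits jvec (plist s t) 0 >].
Proof.
move=> Ks Kt dst dm; set X := image_meet _ _ _.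
move/fdisjointP: (dst) => dP.
have sz : size (plist s t) = m.+2.
 have := faces_neq0 Ks; have := faces_neq0 Kt; rewrite -!cardfs_gt0 plist_size //.
 lia.
have sumV x (u : {fset V}) : bary K (fun w => x w) -> \sum_w x w = 1 :> R.
 by move=> [u' _ [_ xu <-]]; rewrite (sum_fset xu).
pose good (c : 'I_v -> R) := [/\ forall x, x \in plist s t -> 0 < signr R x.2 * c x.1,
 forall i, i \notin map fst (plist s t) -> c i = 0 & \sum_i c i *: jvec i = 0].
have rel0 c w : (forall w, w \notin (s `|` t)%fset -> c (enum_rank w) = 0) -> w \in (s `|` t)%fset ->
  c (enum_rank w) = 0 -> \sum_i c i *: jvec i = 0 -> forall i, c i = 0.
 move=> c0 wst cw; apply: jvec_generic; rewrite -ltnS -sz -(size_map fst).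
 have -> : size [seq i.1 | i <- plist s t] = #|[set i in [seq i.1 | i <- plist s t]]%SET|.
  by rewrite cardsE (card_uniqP (plist_distinct s t)).
 apply/proper_card/properP; split; last first.
  exists (enum_rank w); last by rewrite inE cw eqxx.
  by rewrite inE plist_fst mem_filter enum_rankK wst mem_enum.
 by apply/fintype.subsetP => i; rewrite !inE plist_fst mem_filter mem_enum andbT; apply: contraR => ist; rewrite -[i]enum_valK c0.
have fstE i : (i \in map fst (plist s t)) = (enum_val i \in (s `|` t)%fset).
 by rewrite plist_fst mem_filter mem_enum andbT.
have toC z : X z -> exists c, good c /\ [/\ \sum_(w <- s) c (enum_rank w) = 1 &
  z = \sum_(w <- s) c (enum_rank w) *: p w].
 move=> Xz; have [|x sx xz] := Xz s; first by rewrite /= !inE eqxx.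
 have [|y ty yz] := Xz t; first by rewrite /= !inE eqxx orbT.
 pose c (i : 'I_v) : R := Defs.coord x (enum_val i) - Defs.coord y (enum_val i).
 have cE w : c (enum_rank w) = Defs.coord x w - Defs.coord y w by rewrite /c enum_rankK.
 have cs w : w \in s -> c (enum_rank w) = Defs.coord x w.
  by move=> ws; rewrite cE ty ?subr0 // dP.
 have ct w : w \in t -> c (enum_rank w) = - Defs.coord y w.
  by move=> wt; rewrite cE sx ?sub0r //; apply/negP => /dP; rewrite wt.
 have c0 w : w \notin (s `|` t)%fset -> c (enum_rank w) = 0.
  by rewrite inE negb_or => /andP[ws wt]; rewrite cE sx // ty // subrr.
 have cF : \sum_i c i *: jvec i = 0.
  apply/jvec_sum; split.
   under eq_bigr => w do rewrite cE.
   rewrite sumrB !sumV ?subrr //; apply: coord_bary.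
  under eq_bigr => w do rewrite cE scalerBl.
  have e : affine_map p x = affine_map p y by rewrite xz.
  by rewrite /affine_map in e; rewrite sumrB e subrr.
 have s1 : \sum_(w <- s) Defs.coord x w = 1 by rewrite (sum_fset sx) sumV //; exact: coord_bary.
 (* A vanishing coefficient would leave at most [m.+1] vectors, and these are independent. *)
 have cn w : w \in (s `|` t)%fset -> c (enum_rank w) != 0.
  move=> wst; apply/eqP => cw; have cz := rel0 c w c0 wst cw cF.
  have : (1 : R) = 0; last by apply/eqP.
  by rewrite -s1 big_seq big1 // => u us; rewrite -cs.
 exists c; split; [split=> //|split].
 - move=> [i b]; rewrite mem_plist => /andP[ist /eqP ->].
  have := cn (enum_val i); rewrite ist enum_valK => /(_ isT) ci.
  move: ist; rewrite inE; have [it _|it] := boolP (enum_val i \in t).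
   have := ct _ it; rewrite enum_valK => e; rewrite e in ci *.
   by rewrite mulN1r opprK lt_neqAle coord0 andbT eq_sym; rewrite -oppr_eq0.
  by rewrite orbF => is_; have := cs _ is_; rewrite enum_valK => e; rewrite e in ci *; rewrite mul1r lt_neqAle coord0
   andbT eq_sym.
 - by move=> i; rewrite fstE => ist; have := c0 _ ist; rewrite enum_valK.
 - by rewrite -s1 !big_seq; apply: eq_bigr => w ws; rewrite cs.
 - rewrite -xz /affine_map -(sum_fset (s := s)) => [|w ws]; last by rewrite sx // scale0r.
  by rewrite !big_seq; apply: eq_bigr => w ws; rewrite cs.
have uniqX z z' : X z -> X z' -> z = z'.
 move=> /toC[c [[cp c0 cF] [c1 ->]]] /toC[c' [[cp' c0' cF'] [c1' ->]]].
 have /fset0Pn[w0 w0s] := faces_neq0 Ks.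
 have w0p : (enum_rank w0, false) \in plist s t.
  by rewrite mem_plist enum_rankK inE w0s eq_sym; apply/eqP/negbTE/dP.
 have cw' : 0 < c' (enum_rank w0) by have := cp' _ w0p; rewrite mul1r.
 pose l := c (enum_rank w0) / c' (enum_rank w0).
 have d0 i : c i - l * c' i = 0.
  apply: (rel0 (fun i => c i - l * c' i) w0).
  - by move=> w wst; rewrite c0 ?c0' ?mulr0 ?subrr // fstE enum_rankK.
  - by rewrite inE w0s.
  - by rewrite divfK ?subrr // gt_eqF.
  - under eq_bigr => k do rewrite scalerBl -scalerA.
   by rewrite sumrB cF -scaler_sumr cF' scaler0 subrr.
 have l1 : l = 1.
  have : \sum_(w <- s) c (enum_rank w) - l * \sum_(w <- s) c' (enum_rank w) = 0.
   by rewrite mulr_sumr -sumrB big1_seq.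
  by rewrite c1 c1' mulr1 => /eqP; rewrite subr_eq0 => /eqP.
 by apply: eq_bigr => w _; congr (_ *: _); apply/eqP; rewrite -subr_eq0; have := d0 (enum_rank w); rewrite l1 mul1r => ->.
case: asboolP => [[c [cp c0 cF]]|nc].
 have cs w : w \in s -> 0 < c (enum_rank w).
  by move=> ws; have := cp (enum_rank w, false); rewrite mem_plist enum_rankK inE ws mul1r; apply; rewrite eq_sym;
   apply/eqP/negbTE/dP.
 have ct w : w \in t -> 0 < - c (enum_rank w).
  by move=> wt; have := cp (enum_rank w, true); rewrite mem_plist enum_rankK inE wt orbT mulN1r; apply.
 have c0' w : w \notin (s `|` t)%fset -> c (enum_rank w) = 0.
  by move=> wst; apply: c0; rewrite fstE enum_rankK.
 have /jvec_sum[c1 c2] := cF.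
 pose S := \sum_(w <- s) c (enum_rank w).
 have /fset0Pn[w0 w0s] := faces_neq0 Ks.
 have S0 : 0 < S.
  by rewrite /S (big_fsetD1 w0) //=; apply: ltr_wpDr; last exact: cs; rewrite big_seq; apply: sumr_ge0 => w; rewrite !inE
   => /andP[_ /cs/ltW].
 have split_sum (Z : nmodType) (G : V -> Z) : (forall w, w \notin (s `|` t)%fset -> G w = 0) ->
   \sum_w G w = \sum_(w <- s) G w + \sum_(w <- t) G w.
  move=> G0; rewrite (bigID (fun w => w \in s)) /=; congr (_ + _).
   rewrite -[LHS]big_filter; apply/perm_big/uniq_perm.
   - by rewrite filter_uniq // index_enum_uniq.
   - exact: fset_uniq.
   - by move=> w; rewrite mem_filter mem_index_enum andbT.
  rewrite (bigID (fun w => w \in t)) /= [X in _ + X]big1 ?addr0; last first.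
   by move=> w /andP[ws wt]; apply: G0; rewrite inE negb_or ws.
  rewrite -[LHS]big_filter; apply/perm_big/uniq_perm.
  - by rewrite filter_uniq // index_enum_uniq.
  - exact: fset_uniq.
  - by move=> w; rewrite mem_filter mem_index_enum andbT andb_idl // => wt; apply/negP => /dP; rewrite wt.
 have tS : \sum_(w <- t) c (enum_rank w) = - S.
  by apply/eqP; rewrite -addr_eq0 addrC; apply/eqP; rewrite -(split_sum _ (fun w => c (enum_rank w))).
 pose fx w := if w \in s then c (enum_rank w) / S else 0.
 pose fy w := if w \in t then - c (enum_rank w) / S else 0.
 have bx : bary K fx.
  exists s => //; split=> [w|w|]; rewrite /fx.
  - by case: ifP => // ws; rewrite divr_ge0 ?ltW ?cs.
  - by move=> /negPf ->.
  - by rewrite big_seq; under eq_bigr => w ws do rewrite ws; rewrite -big_seq -mulr_suml divff // gt_eqF.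
 have by_ : bary K fy.
  exists t => //; split=> [w|w|]; rewrite /fy.
  - by case: ifP => // wt; rewrite divr_ge0 ?ltW ?ct.
  - by move=> /negPf ->.
  - by rewrite big_seq; under eq_bigr => w wt do rewrite wt; rewrite -big_seq -mulr_suml sumrN tS opprK divff // gt_eqF.
 pose x0 := vertex_pt R K w0.
 pose z := \sum_w fx w *: p w.
 have zy : z = \sum_w fy w *: p w.
  apply/eqP; rewrite -subr_eq0 -sumrB; apply/eqP.
  transitivity (\sum_w S^-1 *: (c (enum_rank w) *: p w)); last by rewrite -scaler_sumr c2 scaler0.
  apply: eq_bigr => w.
  rewrite scalerA -scalerBl /fx /fy.
  case: ifPn => ws; first by rewrite (negPf (dP _ ws)) subr0 mulrC.
  case: ifPn => wt; first by rewrite sub0r mulNr opprK mulrC.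
  by rewrite c0' ?mulr0 ?subrr // inE negb_or ws.
 have Xz : X z.
  move=> u; rewrite /= !inE => /orP[]/eqP ->.
   exists (mk_point x0 fx); first by move=> w ws; rewrite coord_mk // /fx (negPf ws).
   by rewrite /affine_map coord_mk.
  exists (mk_point x0 fy); first by move=> w wt; rewrite coord_mk // /fy (negPf wt).
  by rewrite /affine_map coord_mk.
 have -> : X = [set z] by apply/seteqP; split=> [z' /uniqX|_ ->] //; apply.
 by rewrite fset_set1 cardfs1.
have -> : X = set0; last by rewrite fset_set0.
rewrite -subset0 => z /toC[c [[cp c0 cF] _]]; apply: nc; exists c; split=> //.
Qed.

End ObstructorChain.

Lemma cont_row (R : realType) (X : topologicalType) n (f : X -> 'rV[R]_n) a :
 (forall i, cont_at (fun x => f x 0 i) a) -> cont_at f a.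
Proof.
move=> cf U /nbhs_ballP[e e0 sub].
have : nbhs a [set x | forall i, `|f a 0 i - f x 0 i| < e].
 apply: nbhs_all => i; apply: cont_lt; last by rewrite subrr normr0.
  by apply/cont_norm/cont_atB.
 by [].
apply: filterS => x h; apply: sub; split=> // j; rewrite ord1; exact: h.
Qed.

Lemma closed_imply (X : topologicalType) (b : bool) (A : set X) : closed A ->
 closed (fun x => b -> A x).
Proof.
case: b => cA; [set A' := fun => _|set A' := fun => _].
 by have -> : A' = A by apply/seteqP; split=> x; [apply|move=> h _].
by [].
Qed.

(** * Collisions between disjoint faces of the truncated cone *)

Section Collision.
Variables (R : realType) (V : finType) (K : scomplex V).
Notation v := #|V|.
Notation E := 'rV[R]_v.

(** The join of [s] and [t] on the [l1] unit sphere, with the vertices of [t] on negative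
    half-axes. *)
Definition jcell (s t : {fset V}) : set E :=
 let e w : R := if w \in t then -1 else 1 in
 [set z | [/\ forall w, w \notin (s `|` t)%fset -> weight z w = 0,
   forall w, 0 <= e w * weight z w & \sum_w e w * weight z w = 1]].

Definition deleted_join : set E :=
 \bigcup_(st in [set st : {fset V} * {fset V} |
   [/\ faces K st.1, faces K st.2 & [disjoint st.1 & st.2]%fset]]) jcell st.1 st.2.

Definition pospart (z : E) : E := \row_i Num.max (z 0 i) 0.

Lemma weight_pospart z w : weight (pospart z) w = Num.max (weight z w) 0.
Proof. by rewrite /weight mxE. Qed.

Lemma weightN (z : E) w : weight (- z) w = - weight z w.
Proof. by rewrite /weight mxE. Qed.

Lemma jcell_opp s t z : [disjoint s & t]%fset -> jcell s t z -> jcell t s (- z).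
Proof.
move=> /fdisjointP dP [z0 z1].
have e w : (if w \in s then -1 else 1) * weight (- z) w = (if w \in t then -1 else 1) * weight z w.
 rewrite weightN; case: ifPn => ws; first by rewrite (negPf (dP _ ws)) mulN1r opprK mul1r.
 case: ifPn => wt; first by rewrite mulN1r mul1r.
 by rewrite z0 ?oppr0 // inE negb_or ws.
split=> [w wst|w|]; first by rewrite weightN z0 ?oppr0 // fsetUC.
 by rewrite e.
by under eq_bigr => w do rewrite e.
Qed.

Lemma deleted_join_opp z : deleted_join z -> deleted_join (- z).
Proof.
move=> [[s t] [/= st] zst]; exists (t, s) => /=; last exact: jcell_opp.
by rewrite fdisjoint_sym.
Qed.

Lemma jcell_convex s t : convexs (jcell s t).
Proof.
move=> x y l [x0 xp x1] [y0 yp y1] /andP[l0 l1].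
have wE w : weight (l *: x + (1 - l) *: y) w = l * weight x w + (1 - l) * weight y w.
 by rewrite /weight !mxE.
split=> [w wst|w|].
- by rewrite wE x0 // y0 // !mulr0 addr0.
- by rewrite wE mulrDr addr_ge0 // mulrCA mulr_ge0 // subr_ge0.
- pose e w : R := if w \in t then -1 else 1.
 transitivity (\sum_w (l * (e w * weight x w) + (1 - l) * (e w * weight y w))); last first.
  by rewrite big_split /= -!mulr_sumr x1 y1 !mulr1 addrC subrK.
 apply: eq_bigr => w _; rewrite wE /e.
 ring.
Qed.

Lemma jcell_compact s t : compact (jcell s t).
Proof.
have ce w z : cont_at (fun z => (if w \in t then -1 else 1) * weight z w) z.
 by apply: cont_atM.
apply: bounded_compact.
 have -> : jcell s t = [set z | forall w, w \notin (s `|` t)%fset -> weight z w = 0] `&`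
   ([set z | forall w, 0 <= (if w \in t then -1 else 1) * weight z w] `&`
   [set z | \sum_w (if w \in t then -1 else 1) * weight z w = 1]).
  by apply/seteqP; split=> [z []|z [? []]].
 apply: closedI; last apply: closedI.
 - by apply: closed_forall => w; apply: closed_imply; apply: closed_eq => z.
 - apply: closed_forall => w; apply: closed_le => z; [exact: cont_cst|exact: ce].
 - apply: closed_eq => z; [apply: cont_sum => w; apply: ce|exact: cont_cst].
move=> z [z0 zp z1] /=; apply: norm_le_co => // i; have := (enum_val i).
have -> : `|z 0 i| = (if enum_val i \in t then -1 else 1) * weight z (enum_val i).
 by rewrite -(ger0_norm (zp _)) normrM /weight enum_valK; case: ifP => _; rewrite ?normrN normr1 mul1r.
move=> _; apply: le_trans (_ : _ <= \sum_w (if w \in t then -1 else 1) * weight z w) _.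
 rewrite (bigD1 (enum_val i)) //= lerDl; apply: sumr_ge0 => w _; exact: zp.
by rewrite z1.
Qed.

Lemma pospart_face s t z : faces K s -> faces K t -> [disjoint s & t]%fset -> jcell s t z ->
 fcone s (pospart z).
Proof.
move=> Ks Kt dst [z0 zp z1]; split=> [w|w ws]; rewrite weight_pospart.
 by rewrite le_max lexx orbT.
apply/max_idPr; have [wt|wt] := boolP (w \in t); last by rewrite z0 // inE negb_or ws.
by have := zp w; rewrite wt mulN1r oppr_ge0.
Qed.

Lemma pospart_total s t z : jcell s t z ->
 total (pospart z) + total (pospart (- z)) = 1.
Proof.
move=> [z0 zp <-]; rewrite -big_split /=; apply: eq_bigr => w.
rewrite !weight_pospart weightN; have := zp w.
case: ifP => _; rewrite ?mul1r ?mulN1r ?oppr_ge0 => h.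
 by rewrite (max_idPr h) add0r (max_idPl _) // oppr_ge0.
by rewrite (max_idPl h) (max_idPr _) ?addr0 // oppr_le0.
Qed.

Lemma pospart_cont z : cont_at pospart z.
Proof.
apply: cont_row => i; have -> : (fun x => pospart x 0 i) = (fun x => Num.max (x 0 i) 0).
 by apply/funext => x; rewrite mxE.
by apply: cont_max.
Qed.

(** The positive parts of [z] and [-z] are the two components of a point of the join, so a
    coincidence of [Psi] composed with [pospart] at antipodes is a collision. The bound is [m.+1]
    rather than [m] because joining adds a coordinate. *)
Lemma obstructor_collision m d (W : topologicalType) (Psi : E -> W) : obstructor R K m -> (d <= m.+1)%N -> manifold R d W
 -> contractible R W -> {within [set x | cdom K x /\ total x <= 1], continuous Psi} -> exists s t x y, [/\ [/\ faces K s,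
  faces K t & [disjoint s & t]%fset], fcone s x, fcone t y, total x + total y = 1 & Psi x = Psi y].
Proof.
move=> [_ [Sigma [cyc [p [gp odd_p]] tops]]] dm mW cW cPsi; apply: contrapT => no.
have /choice[sp spP] : forall st, exists q, st \in Sigma -> [/\ faces K q.1, faces K q.2, [disjoint q.1 & q.2]%fset, st =
 [fset q.1; q.2]%fset & (#|` q.1|.-1 + #|` q.2|.-1) = m].
 move=> st; have [stS|_] := boolP (st \in Sigma); last by exists (fset0, fset0).
 by have [s [t h]] := cyc.1 _ stS; exists (s, t).
pose Y := [seq plist (sp st).1 (sp st).2 | st <- Sigma].
apply: (@antipodal_obstruction R v m.+1 d _ (jvec_generic gp) Y deleted_join W
 (Psi \o pospart) dm mW cW).
- move=> _ /mapP[st stS ->]; have [Ks Kt sz] := spP _ stS; split; first exact: plist_distinct.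
 have := faces_neq0 Ks; have := faces_neq0 Kt; rewrite -!cardfs_gt0 plist_size //.
 lia.
- move=> mu imu; rewrite big_map -[RHS](pair_cycle cyc tops imu) !big_seq.
 apply: eq_bigr => st stS; have [Ks Kt dst e sz] := spP _ stS.
 rewrite delta_plist // -e; apply: congr_big => //.
 move: (sp st) e => q ->; apply: eq_filter => w; rewrite inE.
 apply/orP/hasP => [[wq|wq]|[u]]; first by exists q.1; rewrite // !inE eqxx.
  by exists q.2; rewrite // !inE eqxx orbT.
 by rewrite !inE => /orP[]/eqP-> wq; [left|right].
- by rewrite big_map; transitivity (odd (\sum_(st <- Sigma) #|` fset_set (image_meet K p st)|)) => //; rewrite big_seq
 [in RHS]big_seq (big_morph odd oddD (erefl (odd 0))); apply: eq_bigr => st stS; have [Ks Kt dst e sz] := spP _ stS;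
  rewrite [in RHS]e (image_meet_count gp Ks Kt dst sz) oddb.
- apply: compact_bigcup; first exact: finite_finset.
 move=> st _; apply: jcell_compact.
- exact: deleted_join_opp.
- move=> _ /mapP[st stS ->]; have [Ks sz] := spP _ stS.
 exists (jcell (sp st).1 (sp st).2); split; first exact: jcell_convex.
  apply/allin_map/all_inP => x; rewrite mem_plist => /andP[x1 /eqP x2].
  have wE w : weight (svertex R x) w = if w == enum_val x.1 then signr R x.2 else 0.
   by rewrite /weight !mxE eqxx -(inj_eq enum_val_inj) enum_rankK; case: eqP; rewrite ?mulr1 ?mulr0.
  have sq : (if enum_val x.1 \in (sp st).2 then -1 else 1) * signr R x.2 = 1.
   by rewrite x2 /signr; case: ifP => _; rewrite ?mulr1 // mulN1r opprK.
  split=> [w wst|w|]; rewrite ?wE.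
  + by case: eqP => // e; rewrite e x1 in wst.
  + by case: eqP => [->|_]; rewrite ?sq // mulr0.
  + by rewrite (bigD1 (enum_val x.1)) //= wE eqxx big1 ?addr0 // => w /negPf wx; rewrite wE wx mulr0.
 by exists (sp st).
- apply/subspace_continuousP => z Pz U Uz.
 have sub y : deleted_join y -> cdom K (pospart y) /\ total (pospart y) <= 1.
  move=> [[s t] [/= Ks Kt st] yst]; split; first by exists s => //; apply: pospart_face yst.
  by rewrite -(pospart_total yst) lerDl; apply: total0; apply: (@pospart_face t s) => //; [rewrite fdisjoint_sym|exact:
   jcell_opp].
 have /subspace_continuousP/(_ _ (sub _ Pz) U Uz) := cPsi.
 by move=> /(pospart_cont); apply: filterS => y h Py; apply/h/sub.
- move=> z [[s t] [/= Ks Kt st] zst] e; apply: no.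
 exists s, t, (pospart z), (pospart (- z)); split=> //.
 + exact: pospart_face zst.
 + by apply: (@pospart_face t s) => //; [rewrite fdisjoint_sym|exact: jcell_opp].
 + exact: pospart_total zst.
Qed.

End Collision.

(** For [d <= m.+1] the coarse map on a large truncated cone extends to [W], and two points of
    disjoint faces with totals adding up to 1 get the same image in [M]. Their labels are then
    close, so by expansion one label is among finitely many, hence so is the other, and both totals
    are below 1/2. *)
Theorem obstructor_bound (R : realType) (G : groupType) (S : seq G) m d (W : topologicalType) :
 generates S -> obstructor_maps_to R S m -> contractible R W ->
 controlled R (word_dist S) d W -> (m.+2 <= d)%N.
Proof.
move=> genS [V [K [V' [T [phi [h [oK [[cphi [psi [cpsi phiK psiK]]] tri] hprop [L hL] hexp]]]]]]] cW ctrl.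
rewrite leqNgt ltnS; apply/negP => dm.
pose wd := word_dist S.
have [kap0 kap0P] : exists k, forall u w, faces T [fset u; w]%fset -> (wd (h u) (h w) <= k)%N.
 exists (Num.bound `|L|) => u w uw; rewrite -(ler_nat R); apply: le_trans (hL u w) _.
 have := edge_dist_le1 uw; case: (edge_dist T u w) => [|[|k]] // _; first by rewrite mulr0.
 rewrite mulr1; apply: le_trans (ler_norm _) _; apply: ltW.
 by have := archi_boundP (normr_ge0 L); rewrite /Num.bound.
have [Reg [contr far]] := ctrl (kap0 + kap0)%N.
have [D1 farD] := far #|V|.+1.
(* [D1] bounds the labels in a fiber of [e]; the other terms pay for the passage from [x] and [y] to
   the nearby points supplied by the extension. *)
pose D := (D1 + (kap0 + kap0) + (kap0 + kap0))%N.
have [w0 _] := cW.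
have [p0 _] : exists p0 : realization R K, True.
 have [_ [Sigma [[cyc _] [p [_ odd_p]] _]]] := oK.
 case: (fset_0Vmem Sigma) => [e|[st stS]]; first by rewrite e big_seq_fset0 in odd_p.
 have [s [_ [Ks _ _ _ _]]] := cyc _ stS; have /fset0Pn[w _] := faces_neq0 Ks.
 by exists (vertex_pt R K w).
have [C [fC CP]] : exists C, finite_set C /\ forall s t u u', faces K s -> faces K t -> [disjoint s & t]%fset -> subcone
 s (phi (vertex_pt R T u)) -> subcone t (phi (vertex_pt R T u')) -> (wd (h u) (h u') <= D)%N -> C u \/ C u'.
 have /choice[c cP] : forall st, exists C, finite_set C /\ forall u u', faces K st.1 -> faces K st.2 -> [disjoint st.1 &
  st.2]%fset -> subcone st.1 (phi (vertex_pt R T u)) -> subcone st.2 (phi (vertex_pt R T u')) -> (wd (h u) (h u') <= D)%N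
   -> C u \/ C u'.
  move=> [s t] /=; have [[Ks Kt dst]|no] := pselect [/\ faces K s, faces K t & [disjoint s & t]%fset]; last first.
   by exists set0; split=> // u u' Ks Kt dst; case: no.
  have [C1 [C2 [f1 f2 _ _ far12]]] := hexp s t Ks Kt dst D.+1%:R (ltr0Sn _ _).
  exists (C1 `|` C2); split; first by rewrite finite_setU.
  move=> u u' _ _ _ us ut' wdD; apply: contrapT => /not_orP[n1 n2].
  have := far12 u u'; rewrite ltr_nat ltnNge (leq_trans wdD (leqnSn _)) => /(_ _ _)/negP; apply; split=> // uC.
   by apply: n1; left.
  by apply: n2; right.
 exists (\bigcup_(st in setT) c st); split.
  apply: bigcup_finite => [|st _]; [exact: finite_finset|exact: (cP st).1].
 by move=> s t u u' Ks Kt dst us ut' wdD; have [cu|cu] := (cP (s, t)).2 u u' Ks Kt dst us ut' wdD; [left|right]; exists (s, t).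
(* Vertices with image at distance at most [D] from the image of [C]; a finite set, as [h] is
   proper. *)
pose far_from_C : set V' := \bigcup_(c in C) [set w | (wd (h w) (h c) <= D)%N].
have fE : finite_set far_from_C.
 apply: bigcup_finite => // c _; apply: (hprop [set g | (wd g (h c) <= D)%N]).
 under eq_set => g do rewrite /wd wd_sym //; exact: ball_finite.
have /choice[b bP] : forall w, exists b, forall y, 0 < Defs.coord y w -> clevel (phi y) <= b%:R.
 move=> w; have [r rP] := vertex_level_bound cphi cpsi phiK w.
 exists (Num.bound `|r|) => y yw; apply: le_trans (rP y yw) _.
 exact: le_trans (ler_norm _) (ltW (archi_boundP (normr_ge0 _))).
have [B BP] := nat_bound b fE.
(* More than [2 B], so a point whose rescaling has level at most [B] has total below 1/2. *)
pose N : R := (B.+1 + B.+1)%:R.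
have N0 : 0 < N by rewrite ltr0n.
pose Q := [set x | @cdom R V K x /\ total x <= 1].
have scale_face s (x : 'rV[R]_#|V|) : fcone s x -> fcone s (N *: x).
 move=> [x0 xs]; split=> [w|w ws]; rewrite /weight mxE; first by apply: mulr_ge0; [exact: ltW|exact: x0].
 by have := xs w ws; rewrite /weight => ->; rewrite mulr0.
have scale_total x : total (N *: x) = N * total x.
 by rewrite mulr_sumr; apply: eq_bigr => w _; rewrite /weight mxE.
have scale_dom x : cdom K x -> cdom K (N *: x).
 by move=> [s Ks /scale_face]; exists s.
have /choice[vert vertP] : forall y : realization R T, exists w, 0 < Defs.coord y w.
 exact: near_vertex_exists.
pose yN x := psi (to_cone p0 (N *: x)).
pose q x := h (vert (yN x)).
have cQ : compact Q.
 have -> : Q = \bigcup_(s in [set s | faces K s]) [set x | fcone s x /\ total x <= 1].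
  by apply/seteqP; split=> [x [[s xs] x1]|x [s Ks [xs x1]]]; [exists s|split=> //; exists s].
 apply: compact_bigcup; first exact: finite_finset.
 move=> s _; apply: bounded_compact.
  have -> : [set x : 'rV[R]_#|V| | fcone s x /\ total x <= 1] = [set x | forall w, 0 <= weight x w] `&`
    ([set x | forall w, w \notin s -> weight x w = 0] `&` [set x | total x <= 1]).
   by apply/seteqP; split=> [x [[? ?] ?]|x [? [? ?]]].
  apply: closedI; last apply: closedI.
  - by apply: closed_forall => w; apply: closed_le => z.
  - by apply: closed_forall => w; apply: closed_imply; apply: closed_eq => z.
  - apply: closed_le => z; [exact: cont_total|exact: cont_cst].
 move=> x [xs x1] /=; apply: norm_le_co => // i; rewrite -[i]enum_valK ger0_norm; last exact: xs.1.
 apply: le_trans x1; exact: weight_le_total xs.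
have [del del0 delP] : exists2 e, 0 < e & forall x y, Q x -> Q y -> `|x - y| < e -> exists z, 0 < Defs.coord (yN x) (vert
 (yN z)) /\ 0 < Defs.coord (yN y) (vert (yN z)).
 apply: (local_to_uniform (P := fun z x => 0 < Defs.coord (yN x) (vert (yN z))) cQ) => x [xd _].
 have := positive_coord_nbhs (vertP (yN x)) => /cpsi/(to_cone_cont (scale_dom _ xd)).
 have /[apply] : cont_at (fun x : 'rV[R]_#|V| => N *: x) x.
  by apply: (@cont_atZ R _ _ (fun=> N) id).
 by apply: filterS => y hy [yd _]; apply/hy/scale_dom.
have fine x y : Q x -> Q y -> `|x - y| < del -> (wd (q x) (q y) <= kap0 + kap0)%N.
 move=> Qx Qy /(delP x y Qx Qy)[z [zx zy]].
 have t := wd_triangle genS (h (vert (yN z))) (q x) (q y).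
 apply: leq_trans t _.
 apply: leq_add; apply: kap0P; first exact: near_vertex_edge (vertP _) zx.
 exact: near_vertex_edge (vertP _).
have [Psi [cPsi PsiP]] := controlled_extension contr del0 fine w0.
have [M [e [mM cM ce eP]]] := farD _ (continuous_compact cPsi cQ).
have cePsi : {within Q, continuous (e \o Psi)}.
 apply/subspace_continuousP => x Qx U Uz; move/subspace_continuousP: cPsi => cPsi.
 have PQx : (Psi @` Q) (Psi x) by exists x.
 move/subspace_continuousP: ce => /(_ _ PQx U Uz) ce.
 have h1 : nbhs x [set z | Q z -> (Psi @` Q) (Psi z) -> U (e (Psi z))] := cPsi x Qx _ ce.
 apply: filterS h1 => z h1 Qz; apply: h1 => //.
have [s [t [x [y [[Ks Kt dst] xs yt xy1 exy]]]]] := obstructor_collision oK dm mM cM cePsi.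
have tx := total0 xs; have ty := total0 yt.
have Qx : Q x by split; [exists s|rewrite -xy1 lerDl].
have Qy : Q y by split; [exists t|rewrite -xy1 lerDr].
have wdxy : (wd (q x) (q y) <= D)%N.
 have [x' [Qx' xx' rx]] := PsiP x Qx; have [y' [Qy' yy' ry]] := PsiP y Qy.
 have h1 := fine _ _ Qx Qx' xx'; have h2 := fine _ _ Qy Qy' yy'.
 have h3 : (wd (q x') (q y') <= D1)%N by apply: eP exy.
 have t1 := wd_triangle genS (q x') (q x) (q y).
 have t2 := wd_triangle genS (q y') (q x') (q y).
 by rewrite (wd_sym genS (q y')) in t2; apply: leq_trans t1 _; rewrite addnC /D; apply: leq_add => //; apply: leq_trans
  t2 _; apply: leq_add.
have vert_in r z : faces K r -> fcone r z -> subcone r (phi (vertex_pt R T (vert (yN z)))).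
 move=> Kr zr; have [L0 [LT Lsub re]] := tri r Kr.
 have := to_cone_subcone p0 Kr (scale_face _ _ zr); rewrite -re => -[y1 [t1 t1L y1t] y1e].
 exists (vertex_pt R T (vert (yN z))) => //; exists t1 => //.
 apply: vpoint_face; first exact: LT.
 apply: contraTT (vertP (yN z)) => nt; have yE : yN z = y1 by rewrite /yN -y1e.
 by rewrite yE in nt *; rewrite y1t // ltxx.
have ux := vert_in _ _ Ks xs; have uy := vert_in _ _ Kt yt.
have both : far_from_C (vert (yN x)) /\ far_from_C (vert (yN y)).
 have [Cx|Cy] := CP _ _ _ _ Ks Kt dst ux uy wdxy.
  split; exists (vert (yN x)) => //=; first by rewrite /wd wdxx.
  by rewrite /wd wd_sym.
 by split; exists (vert (yN y)) => //=; rewrite /wd wdxx.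
have bound r z : fcone r z -> far_from_C (vert (yN z)) -> total z < 1 / 2.
 move=> zr /BP bz; have := bP _ _ (vertP (yN z)); rewrite psiK (clevel_to_cone _ (scale_face _ _ zr)) scale_total => h1.
 have h2 : (b (vert (yN z)))%:R <= B%:R :> R by rewrite ler_nat.
 have : N * total z <= B%:R by apply: le_trans h2.
 nra.
have := bound _ _ xs both.1; have := bound _ _ yt both.2; move: xy1.
lra.
Qed.

(** Vandermonde: the relation is tested against the polynomial vanishing on the support except at
    [i]. *)
Lemma moment_indep (R : realFieldType) (I : finType) (t c : I -> R) D : injective t ->
 (forall j, (j <= D)%N -> \sum_i c i * t i ^+ j = 0) -> (#|[pred i | (c i != 0)%R]| <= D.+1)%N ->
 forall i, c i = 0.
Proof.
move=> ti hc hD i; apply/eqP/contraT => ci.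
pose A := ([set i | (c i != 0)] :\ i)%SET.
pose p := \prod_(z <- map t (enum A)) ('X - z%:P).
have pz k : (p.[t k] == 0) = (k \in A).
 by rewrite -[LHS]/(root p (t k)) root_prod_XsubC mem_map ?mem_enum.
have sp : (size p <= D.+1)%N.
 rewrite size_prod_XsubC size_map -cardE.
 have : (#|[set k | (c k != 0)%R]%SET| <= D.+1)%N by rewrite cardsE.
 by rewrite (cardsD1 i) inE ci.
have h : \sum_k c k * p.[t k] = 0.
 under eq_bigr => k do rewrite (horner_coef_wide _ sp) mulr_sumr.
 rewrite exchange_big big1 // => j.
 under eq_bigr => k do rewrite mulrCA.
 by rewrite -mulr_sumr hc ?mulr0 // -ltnS.
have pi0 : \sum_k c k * p.[t k] = c i * p.[t i].
 rewrite (bigD1 i) //= big1 ?addr0 // => k ki.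
 have [->|ck] := eqVneq (c k) 0; first by rewrite mul0r.
 by have /eqP-> : p.[t k] == 0; rewrite ?mulr0 // pz !inE ki.
have : c i * p.[t i] == 0 by rewrite -pi0 h.
by rewrite mulf_eq0 (negPf ci) pz !inE eqxx.
Qed.

(** * Euclidean space as a contractible manifold *)

Section EuclideanSpace.
Variables (R : realType) (d : nat).

Lemma rV_contractible : contractible R ('rV[R]_d : topologicalType).
Proof.
exists 0, (fun p => (1 - p.2) *: p.1); split=> //; last first.
 by move=> x /=; rewrite subr0 scale1r subrr scale0r.
apply: continuous_subspaceT => p.
suff h : cont_at (fun p : 'rV[R]_d * R => (1 - p.2) *: p.1) p by exact: h.
apply: cont_atZ; last exact: cont_fst.
by apply: cont_atB.
Qed.

Definition rational_box (qj : 'rV[rat]_d * nat) : set 'rV[R]_d :=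
 [set x | forall i, `|ratr (qj.1 0 i) - x 0 i| < qj.2.+1%:R^-1].

Lemma rational_box_open qj : open (rational_box qj).
Proof.
rewrite openE => x xq; apply: nbhs_all => i; apply: cont_lt; last exact: xq.
 apply/cont_norm/cont_atB; [exact: cont_cst|exact: cont_coord].
by [].
Qed.

Lemma rV_second_countable : @second_countable 'rV[R]_d.
Proof.
exists (range rational_box); first exact: sub_countable (card_image_le _ _) (countableP _).
split=> [_ [qj _ <-]|x U xU]; first exact: rational_box_open.
have [e /= e0 eU] := (nbhs_ballP _ _).1 xU.
have [j je] : exists j, j.+1%:R^-1 < e / 2.
 exists (Num.bound (e / 2)^-1); rewrite invf_plt ?posrE ?divr_gt0 //.
 by apply: lt_trans (archi_boundP _) _; rewrite ?invr_ge0 ?divr_ge0 ?ltW // ltr_nat.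
have /choice[q qP] : forall i, exists q, `|ratr q - x 0 i| < j.+1%:R^-1.
 move=> i; have [|q] := @rat_in_itvoo R (x 0 i - j.+1%:R^-1) (x 0 i + j.+1%:R^-1).
  by rewrite ltrBlDr -addrA ltrDl.
 by rewrite in_itv /= => /andP[h1 h2]; exists q; rewrite ltr_distl h1.
exists (rational_box (\row_i q i, j)); first by split=> [|i]; [exists (\row_i q i, j)|rewrite mxE; exact: qP].
move=> y yq; apply: eU; split=> // i0 i; rewrite ord1.
have := yq i; rewrite mxE /= => h1.
rewrite (splitr e); apply: le_lt_trans (ler_distD (ratr (q i)) _ _) _.
by apply: ltrD; apply: lt_trans je; rewrite // distrC.
Qed.

Lemma rV_manifold : manifold R d ('rV[R]_d : topologicalType).
Proof.
split; [exact: norm_hausdorff|exact: rV_second_countable|].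
exists setT, setT; split=> //; [exact: openT|exact: openT|].
exists id; split; first by move=> y.
by exists id; split=> y.
Qed.

End EuclideanSpace.

Lemma closed_preim (X Y : topologicalType) A (f : X -> Y) B : closed A -> {within A, continuous f} -> closed B -> closed
 (A `&` f @^-1` B).
Proof.
move=> cA /subspace_continuousP cf cB x xcl.
have Ax : A x by apply: cA => U /xcl[y [[Ay _] Uy]]; exists y.
split=> //; apply: contrapT => nB.
have : nbhs x [set z | A z -> (~` B) (f z)].
 suff h : nbhs (f x) (~` B) by exact: cf h.
 apply: open_nbhs_nbhs; split=> //; exact: closed_openC.
by move=> /xcl[z [[Az Bz] /(_ Az)]].
Qed.

Lemma closed_preimages_within (X Y : topologicalType) A (f : X -> Y) : (forall B, closed B -> closed (A `&` f @^-1` B))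
 -> {within A, continuous f}.
Proof.
move=> cf; apply/subspace_continuousP => x Ax U.
rewrite nbhsE => -[V [oV Vx] VU].
have : nbhs x (~` (A `&` f @^-1` (~` V))).
 by apply: open_nbhs_nbhs; split; first exact/closed_openC/cf/open_closedC; move=> [_].
by apply: filterS => z h Az; apply: VU; apply: contrapT => nV; apply: h.
Qed.

(** * Mapping cell complexes to Euclidean space with small fibers *)

Section Radial.
Variables (R : realType) (d : nat).
Notation E := 'rV[R]_d.

Definition radius (u : E) : R := Num.sqrt (\sum_i u 0 i ^+ 2).
Definition radial (u : E) : E := (radius u)^-1 *: u.

Lemma sum_sq_ge0 (u : E) : 0 <= \sum_i u 0 i ^+ 2.
Proof. apply: sumr_ge0 => i _; exact: sqr_ge0. Qed.

Lemma radius_cont u : cont_at radius u.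
Proof.
apply: (cont_comp); last exact: sqrt_continuous.
by apply: cont_sum => i.
Qed.

Lemma radius_le1 u : disc u <-> radius u <= 1.
Proof. by rewrite -[X in _ <= X]sqrtr1 ler_psqrt ?nnegrE ?sum_sq_ge0. Qed.

Lemma radius_lt1 u : open_disc u <-> radius u < 1.
Proof. by rewrite -[X in _ < X]sqrtr1 ltr_sqrt. Qed.

Lemma radius_eq1 u : sphere u <-> radius u = 1.
Proof.
split=> [h|h]; first by rewrite /radius h sqrtr1.
by rewrite /sphere /= -[LHS](sqr_sqrtr (sum_sq_ge0 u)) -/(radius u) h expr1n.
Qed.

Lemma radial_sph u : 0 < radius u -> sphere (radial u).
Proof.
move=> u0; rewrite /sphere /=; under eq_bigr => i do rewrite mxE exprMn.
rewrite -mulr_sumr -(sqr_sqrtr (sum_sq_ge0 u)) -/(radius u) -exprMn mulVf ?expr1n //.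
by rewrite gt_eqF.
Qed.

Lemma radial_id u : sphere u -> radial u = u.
Proof. by move=> /radius_eq1 h; rewrite /radial h invr1 scale1r. Qed.

Lemma radial_cont u : 0 < radius u -> cont_at radial u.
Proof.
move=> u0; apply: cont_atZ; last exact: cont_id.
by apply: cont_inv; [rewrite gt_eqF|exact: radius_cont].
Qed.

Lemma radiusZ l u : 0 <= l -> radius (l *: u) = l * radius u.
Proof.
move=> l0; rewrite /radius; under eq_bigr => i do rewrite mxE exprMn.
by rewrite -mulr_sumr sqrtrM ?sqr_ge0 // sqrtr_sqr ger0_norm.
Qed.

Lemma disc_compact : compact (@disc R d).
Proof.
apply: bounded_compact.
 by apply: closed_le => z; last exact: cont_cst; apply: cont_sum => i.
move=> u u1; apply: norm_le_co => // i.
rewrite -(@ler_pXn2r _ 2) ?nnegrE // expr1n real_normK ?num_real //; apply: le_trans u1.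
rewrite (bigD1 i) //= lerDl; apply: sumr_ge0 => j _; exact: sqr_ge0.
Qed.

Lemma sphere_disc : @sphere R d `<=` @disc R d.
Proof. by move=> u; rewrite /disc /= => ->. Qed.

Lemma sphere_closed : closed (@sphere R d).
Proof.
apply: closed_eq => z; last exact: cont_cst.
by apply: cont_sum => i.
Qed.

End Radial.

Section CellCoordinates.
Variables (R : realType) (X : topologicalType) (C : cw_structure R X).
Notation cell := (Defs.cell C).
Implicit Types (e f : cell) (x y : X).

Lemma carrier_param x : exists eu : {e : cell & 'rV[R]_(cell_dim e)},
 @open_disc R _ (projT2 eu) /\ cell_map (projT2 eu) = x.
Proof.
have [e [[u ud ux] _]] := cells_partition C x.
by exists (existT _ e u).
Qed.

Definition carrier_point x := projT1 (cid (carrier_param x)).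
Definition carrier x : cell := projT1 (carrier_point x).
Definition param x : 'rV[R]_(cell_dim (carrier x)) := projT2 (carrier_point x).

Lemma param_disc x : @open_disc R _ (param x).
Proof. by have [] := projT2 (cid (carrier_param x)). Qed.

Lemma paramK x : cell_map (param x) = x.
Proof. by have [] := projT2 (cid (carrier_param x)). Qed.

Lemma carrier_open_cell x : open_cell (carrier x) x.
Proof. exists (param x); [exact: param_disc|exact: paramK]. Qed.

Lemma carrier_uniq e x : open_cell e x -> carrier x = e.
Proof.
move=> ex; have [e0 [_ h]] := cells_partition C x.
by rewrite -(h _ ex) -(h _ (carrier_open_cell x)).
Qed.

Lemma carrier_disc e u : open_disc u -> carrier (@cell_map _ _ C e u) = e.
Proof. by move=> ud; apply: carrier_uniq; exists u. Qed.

Lemma bd_carrier e : exists F : set cell, [/\ finite_set F, forall f, F f -> (cell_dim f < cell_dim e)%N & forall u,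
 sphere u -> F (carrier (@cell_map _ _ C e u))].
Proof.
have [F [fF Fd Fs]] := cells_closure_finite e; exists F; split=> // u us.
have [|f Ff /carrier_uniq ->] // := Fs (cell_map u).
Qed.

Lemma bd_dim e u : sphere u -> (cell_dim (carrier (@cell_map _ _ C e u)) < cell_dim e)%N.
Proof. by have [F [_ Fd Fs]] := bd_carrier e => /Fs/Fd. Qed.

Definition closed_cell e : set X := @cell_map _ _ C e @` @disc R (cell_dim e).

Lemma closed_cell_compact e : compact (closed_cell e).
Proof. apply: continuous_compact; [exact: cell_map_continuous|exact: disc_compact]. Qed.

Lemma open_disc_disc d : @open_disc R d `<=` @disc R d.
Proof. by move=> u /ltW. Qed.

Lemma open_cell_closed_cell e : open_cell e `<=` closed_cell e.
Proof. by move=> x [u ux]; exists u => //; apply: open_disc_disc. Qed.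

Lemma disc_closed d : closed (@disc R d).
Proof. apply: compact_closed; [exact: norm_hausdorff|exact: disc_compact]. Qed.

(* The invariant form of the face relation: unlike characteristic maps, closures
  are preserved by homeomorphisms permuting the open cells. *)
Definition face_rel (P Q : set X) : Prop := P `&` (closure Q `\` Q) !=set0.

Inductive reach e : cell -> Prop :=
| reach_refl : reach e e
| reach_step e1 f : face_rel (open_cell e1) (open_cell e) -> reach e1 f -> reach e f.

Lemma face_rel_boundary e f : face_rel (open_cell f) (open_cell e) -> exists2 u, sphere u & f = carrier (@cell_map _ _ C e u).
Proof.
move=> [p [fp [ecl np]]].
have : closed_cell e p.
 have cc := compact_closed (cw_hausdorff C) (@closed_cell_compact e).
 apply: cc; apply: closure_subset ecl; exact: open_cell_closed_cell.
move=> [u ud up]; exists u; last by rewrite up (carrier_uniq fp).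
apply/radius_eq1/eqP; rewrite eq_le (radius_le1 u).1 //= leNgt.
by apply/negP => /radius_lt1 u1; apply: np; exists u.
Qed.

Lemma boundary_face_rel e u : sphere u -> face_rel (open_cell (carrier (@cell_map _ _ C e u))) (open_cell e).
Proof.
move=> us; exists (cell_map u); split; first exact: carrier_open_cell.
split; last first.
 by move=> /carrier_uniq h; have := bd_dim us; rewrite h ltnn.
move=> U Uu; pose V := [set z | disc z -> U (@cell_map _ _ C e z)].
have Vu : nbhs (1 *: u) V.
 rewrite scale1r; have /subspace_continuousP h := @cell_map_continuous _ _ C e.
 exact: h (sphere_disc us) U Uu.
have cs : cont_at (fun t : R => t *: u) 1.
 by apply: cont_atZ.
have : nbhs (1 : R) [set t | V (t *: u)] by exact: cs.
move=> /nbhs_R[r r0 rP].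
pose t := 1 - Num.min (r / 2) (1 / 2).
have m0 : 0 < Num.min (r / 2) (1 / 2) by rewrite lt_min !divr_gt0.
have m1 : Num.min (r / 2) (1 / 2) <= 1 / 2 by rewrite ge_min lexx orbT.
have m2 : Num.min (r / 2) (1 / 2) <= r / 2 by rewrite ge_min lexx.
have tr : radius (t *: u) = t by rewrite radiusZ ?(radius_eq1 u).1 // /t; lra.
exists (cell_map (t *: u)); split.
 exists (t *: u) => //; apply/radius_lt1; rewrite tr /t; lra.
apply: rP; [rewrite /t ger0_norm; lra|apply/radius_le1; rewrite tr /t; lra].
Qed.

Lemma reach_dim e f : reach e f -> (cell_dim f <= cell_dim e)%N.
Proof.
elim=> {e f} // e e1 f /face_rel_boundary[u us ->] _ /leq_trans; apply.
exact: ltnW (bd_dim us).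
Qed.

Lemma reach_finite e : finite_set [set f | reach e f].
Proof.
move: {2}(cell_dim e).+1 (ltnSn (cell_dim e)) => k; elim: k e => // k IHk e ek.
have [F [fF Fd Fs]] := bd_carrier e.
have : finite_set ([set e] `|` \bigcup_(e1 in F) [set f | reach e1 f]).
 by rewrite finite_setU; split => //; apply: bigcup_finite => // e1 /Fd e1d; apply: IHk; apply: leq_trans e1d _.
apply: sub_finite_set => f [|e1 {}f /face_rel_boundary[u us ->] r]; first by left.
right; exists (carrier (cell_map u)) => //; exact: Fs.
Qed.

(** One point of [K] in each open cell met by [K]: every subset of these points meets a closed cell
    in finitely many points, hence is closed. *)
Lemma compact_carriers K : compact K -> finite_set (carrier @` K).
Proof.
move=> cK.
have /choice[pt ptP] : forall e, exists x, (carrier @` K) e -> K x /\ carrier x = e.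
 move=> e; have [[x xe]|n] := pselect ((carrier @` K) e); first by exists x.
 by exists (cell_map (0 : 'rV[R]_(cell_dim e))).
apply: (@discrete_finite {classic cell} X _ pt K cK).
- by move=> e f; rewrite !inE => /ptP[_ {2}<-] /ptP[_ {2}<-] ->.
- by move=> _ [e /ptP[? _] <-].
move=> J JD; apply: (cells_weak_topology) => e.
have [F [fF Fd Fs]] := bd_carrier e.
have fE : finite_set (pt @` (J `&` (e |` F))).
 by apply: finite_image; apply: sub_finite_set (@subIsetr _ _ _) _; rewrite finite_setU.
have cE : closed (pt @` (J `&` (e |` F))).
 by have h := accessible_finite_set_closed.1 (hausdorff_accessible (cw_hausdorff C)); apply: h.
have := closed_preim (@disc_closed _) (@cell_map_continuous _ _ C e) cE.
congr closed; apply/seteqP; split=> u [ud [f Jf fu]]; split=> //; exists f => //; first by case: Jf.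
split=> //; have [_ <-] := ptP _ (JD _ Jf); rewrite fu.
have [u1|u1] := ltP (radius u) 1; first by left; rewrite carrier_disc //; exact/radius_lt1.
by right; apply/Fs/radius_eq1/eqP; rewrite eq_le (radius_le1 u).1.
Qed.

(** Zero up to radius 1/2, which hides the discontinuity of [radial] at the center, and 1 on the
    sphere. *)
Definition ramp (r : R) : R := Num.max 0 (2 * r - 1).

Lemma ramp0 r : r <= 1 / 2 -> ramp r = 0.
Proof. move=> h; apply/max_idPl; lra. Qed.

Lemma ramp1 : ramp 1 = 1.
Proof. rewrite /ramp mulr1 (_ : 2 - 1 = 1) ?(max_idPr _) //; lra. Qed.

Lemma ramp_ge0 r : 0 <= ramp r.
Proof. by rewrite le_max lexx. Qed.

Lemma ramp_lt1 r : r < 1 -> ramp r < 1.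
Proof. rewrite gt_max ltr01; lra. Qed.

Lemma ramp_gt0 r : ramp r != 0 -> 0 < r.
Proof. rewrite ltNge; apply: contra => h; rewrite ramp0 //; lra. Qed.

(* Barycentric coordinates with respect to the flags of cells below the carrier;
  [k] is fuel, sufficient when it exceeds the dimension of the carrier. *)
Fixpoint fweight_rec (k : nat) f x : R :=
 if k is k'.+1 then
  ramp (radius (param x)) * fweight_rec k' f (cell_map (radial (param x))) +
  (1 - ramp (radius (param x))) * `[< f = carrier x >]%:R
 else 0.

Definition fweight f x := fweight_rec (cell_dim (carrier x)).+1 f x.

Lemma fweight_fuel k l f x : (cell_dim (carrier x) < k)%N -> (cell_dim (carrier x) < l)%N ->
 fweight_rec k f x = fweight_rec l f x.
Proof.
elim: k l x => [|k IHk] [|l] x //= xk xl; congr (_ + _).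
have [->|/ramp_gt0 r0] := eqVneq (ramp (radius (param x))) 0; first by rewrite !mul0r.
by congr (_ _); have := bd_dim (radial_sph r0) => d; apply: IHk; apply: leq_trans d _.
Qed.

Lemma fweightE f x : fweight f x =
 ramp (radius (param x)) * fweight f (cell_map (radial (param x))) +
  (1 - ramp (radius (param x))) * `[< f = carrier x >]%:R.
Proof.
congr (_ + _).
have [->|/ramp_gt0 r0] := eqVneq (ramp (radius (param x))) 0; first by rewrite !mul0r.
congr (_ _); apply: fweight_fuel => //; exact: bd_dim (radial_sph r0).
Qed.

(** [param (cell_map u)] and [u] live in spaces of provably but not definitionally equal dimension;
    quantifying over [P] avoids a transport. *)
Lemma param_unique e u : open_disc u -> forall P : forall e, 'rV[R]_(cell_dim e) -> Prop, P _ (param (cell_map u)) -> P e u.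
Proof.
move=> ud P; have := carrier_disc ud; move: (param_disc (cell_map u)) (paramK (cell_map u)).
move: (param (cell_map u)); move: (carrier _) => e' w wd wu ee.
subst e'; have -> // : u = w.
by apply: cell_map_inj; rewrite ?inE.
Qed.

(** The recursion in the coordinates of the closed disc; on the sphere, where the carrier changes,
    it is trivial because [ramp] is 1. *)
Lemma fweight_cell e f (u : 'rV[R]_(cell_dim e)) : @disc R _ u ->
 fweight f (cell_map u) = ramp (radius u) * fweight f (cell_map (radial u)) +
  (1 - ramp (radius u)) * `[< f = e >]%:R.
Proof.
move=> ud; have [u1|u1] := ltP (radius u) 1; last first.
 have r1 : radius u = 1 by apply/eqP; rewrite eq_le (radius_le1 u).1.
 by rewrite radial_id ?r1 ?ramp1 ?mul1r ?subrr ?mul0r ?addr0 //; apply/radius_eq1.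
have uo := (radius_lt1 u).2 u1; rewrite {1}fweightE.
pose P e' (w : 'rV[R]_(cell_dim e')) := ramp (radius (param (cell_map u))) *
  fweight f (cell_map (radial (param (cell_map u)))) +
 (1 - ramp (radius (param (cell_map u)))) * `[< f = carrier (cell_map u) >]%:R =
 ramp (radius w) * fweight f (cell_map (radial w)) + (1 - ramp (radius w)) * `[< f = e' >]%:R.
exact: (param_unique uo (P := P)).
Qed.

Lemma carrier_ind (P : X -> Prop) : (forall x, (0 < radius (param x) ->
  reach (carrier x) (carrier (cell_map (radial (param x)))) ->
  (cell_dim (carrier (cell_map (radial (param x)))) < cell_dim (carrier x))%N ->
  P (cell_map (radial (param x)))) -> P x) -> forall x, P x.
Proof.
move=> h x; move: {2}(cell_dim (carrier x)).+1 (ltnSn (cell_dim (carrier x))) => k.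
elim: k x => // k IHk x xk; apply: h => r0 _ d.
by apply: IHk; apply: leq_trans d _.
Qed.

Lemma radial_reach x : 0 < radius (param x) ->
 reach (carrier x) (carrier (cell_map (radial (param x)))).
Proof.
move=> r0; apply: (reach_step (e1 := carrier (cell_map (radial (param x))))); last exact: reach_refl.
exact: boundary_face_rel (radial_sph r0).
Qed.

Lemma reach_trans e e1 f : reach e e1 -> reach e1 f -> reach e f.
Proof. by elim=> {e e1} // e e2 e1 h _ IH /IH; apply: reach_step. Qed.

Lemma fweight_ge0 f x : 0 <= fweight f x.
Proof.
elim/carrier_ind: x => x IH; rewrite fweightE; apply: addr_ge0.
 have [->|r0] := eqVneq (ramp (radius (param x))) 0; first by rewrite mul0r.
 apply: mulr_ge0; first exact: ramp_ge0.
 have r := ramp_gt0 r0; apply: IH => //; first exact: radial_reach.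
 exact: bd_dim (radial_sph r).
apply: mulr_ge0 => //.
rewrite subr_ge0 ltW // ramp_lt1 //; exact/radius_lt1/param_disc.
Qed.

Lemma fweight_reach f x : fweight f x != 0 -> reach (carrier x) f.
Proof.
elim/carrier_ind: x => x IH; rewrite fweightE.
have [->|_] := asboolP (f = carrier x); first by move=> _; exact: reach_refl.
rewrite mulr0 addr0 mulf_eq0 negb_or => /andP[/ramp_gt0 r fy].
have rr := radial_reach r; apply: reach_trans (rr) _; apply: IH => //.
exact: bd_dim (radial_sph r).
Qed.

(** Each step of the recursion adds one cell and passes to a boundary point, whose cells have
    smaller dimension; the cells of nonzero weight thus form a flag. *)
Lemma fweight_dim_inj f f' x : fweight f x != 0 -> fweight f' x != 0 ->
 cell_dim f = cell_dim f' -> f = f'.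
Proof.
elim/carrier_ind: x => x IH fx f'x ff'; apply: contrapT => nff'.
have step g : fweight g x != 0 -> g <> carrier x -> 0 < radius (param x) /\
  fweight g (cell_map (radial (param x))) != 0.
 by rewrite fweightE => gx /asboolPn/negbTE gc; move: gx; rewrite gc mulr0 addr0 mulf_eq0 negb_or => /andP[/ramp_gt0].
have low g : 0 < radius (param x) -> fweight g (cell_map (radial (param x))) != 0 ->
  (cell_dim g < cell_dim (carrier x))%N.
 move=> r /fweight_reach/reach_dim/leq_ltn_trans; apply; exact: bd_dim (radial_sph r).
have [fc|fc] := pselect (f = carrier x).
 have [|r f'y] := step f' f'x; first by rewrite -fc; apply/nesym.
 by have := low f' r f'y; rewrite -ff' fc ltnn.
have [r fy] := step f fx fc.
have [f'c|f'c] := pselect (f' = carrier x).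
 by have := low f r fy; rewrite ff' f'c ltnn.
have [_ f'y] := step f' f'x f'c.
apply/nff'/IH => //; [exact: radial_reach|exact: bd_dim (radial_sph r)].
Qed.

Lemma fweight_sum (s : seq {classic cell}) x : uniq s ->
 (forall f, fweight f x != 0 -> (f : {classic cell}) \in s) -> \sum_(f <- s) fweight f x = 1.
Proof.
move=> us; elim/carrier_ind: x => x IH hs.
have r1 : ramp (radius (param x)) < 1 by apply: ramp_lt1; exact/radius_lt1/param_disc.
have cs : carrier x \in s.
 apply: hs; rewrite fweightE asboolT // mulr1 gt_eqF //.
 apply: ltr_wpDl; [apply: mulr_ge0; [exact: ramp_ge0|exact: fweight_ge0]|lra].
under eq_bigr => f do rewrite fweightE.
have one : \sum_(f <- s) `[< f = carrier x >]%:R = 1 :> R.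
 by rewrite (bigD1_seq _ cs us) /= asboolT // big1 ?addr0 // => f fx; case: asboolP => // fc; rewrite fc eqxx in fx.
rewrite big_split /= -!mulr_sumr one mulr1.
have [->|r0] := eqVneq (ramp (radius (param x))) 0; first by rewrite mul0r subr0 add0r.
have r := ramp_gt0 r0; rewrite IH; first by rewrite mulr1 addrC subrK.
- by [].
- exact: radial_reach.
- exact: bd_dim (radial_sph r).
move=> f fy; apply: hs; rewrite fweightE gt_eqF //; apply: ltr_wpDr.
 apply: mulr_ge0; [lra|exact: ler0n].
by rewrite lt_neqAle eq_sym mulf_neq0 // mulr_ge0 ?ramp_ge0 ?fweight_ge0.
Qed.

Lemma ramp_cont r : cont_at ramp r.
Proof.
apply: cont_max; first exact: cont_cst.
by apply: cont_atB; [apply: cont_atM|exact: cont_cst].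
Qed.

(** Induction on the dimension. On the sphere, the preimage of a closed set is pulled back from
    finitely many closed cells of lower dimension; inside the disc [fweight_cell] gives the weight
    in terms of the sphere. *)
Lemma fweight_cell_cont e f :
 {within @disc R (cell_dim e), continuous (fun u => fweight f (@cell_map _ _ C e u))}.
Proof.
move: {2}(cell_dim e).+1 (ltnSn (cell_dim e)) => k; elim: k e => // k IHk e ek.
have [F [fF Fd Fs]] := bd_carrier e.
have sph : {within @sphere R (cell_dim e), continuous (fun u => fweight f (@cell_map _ _ C e u))}.
 apply: closed_preimages_within => B cB.
 pose Z := \bigcup_(e1 in (F : set {classic cell})) (@cell_map _ _ C e1 @`
  (@disc R _ `&` (fun u => fweight f (cell_map u)) @^-1` B)).
 have cZ : closed Z.
  apply: compact_closed; first exact: cw_hausdorff C.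
  apply: compact_bigcup => // e1 Fe1.
  have cD : closed (@disc R _ `&` (fun u => fweight f (@cell_map _ _ C e1 u)) @^-1` B).
   by apply: closed_preim cB; first exact: disc_closed; apply: IHk; apply: leq_trans (Fd _ Fe1) _.
  apply: continuous_compact; last first.
   exact: subclosed_compact (@disc_compact _ _) (@subIsetl _ _ _).
  by apply: continuous_subspaceW (@cell_map_continuous _ _ C e1).
 have -> : @sphere R (cell_dim e) `&` (fun u => fweight f (cell_map u)) @^-1` B =
   @sphere R (cell_dim e) `&` (@disc R _ `&` @cell_map _ _ C e @^-1` Z).
  apply/seteqP; split=> u [us h]; split=> //.
   split; first exact: sphere_disc.
   exists (carrier (cell_map u)); first exact: Fs.
   exists (param (cell_map u)); last exact: paramK.
   by split; [exact/open_disc_disc/param_disc|rewrite /= paramK].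
  by case: h => _ [e1 _ [w [_ wB] wu]]; rewrite /= -wu.
 apply: closedI; first exact: sphere_closed.
 apply: closed_preim cZ; [exact: disc_closed|exact: cell_map_continuous].
apply/subspace_continuousP => u ud U Uu.
suff : nbhs u [set z | disc z -> U (fweight f (cell_map z))] by [].
pose g z := ramp (radius z) * fweight f (@cell_map _ _ C e (radial z)) +
 (1 - ramp (radius z)) * `[< f = e >]%:R.
have gu : fweight f (cell_map u) = g u := fweight_cell f ud.
suff cg : cont_at g u.
 have : nbhs (g u) U by rewrite -gu.
 by move=> /cg; apply: filterS => z Uz zd; rewrite fweight_cell.
have crr : cont_at (fun z : 'rV[R]_(cell_dim e) => ramp (radius z)) u.
 apply: (cont_comp); [exact: radius_cont|exact: ramp_cont].
have [r2|r2] := ltP (radius u) (1 / 2).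
 have near0 : nbhs u [set z | radius z < 1 / 2].
  apply: cont_lt => //; exact: radius_cont.
 have gc z : radius z < 1 / 2 -> g z = `[< f = e >]%:R.
  by move=> /ltW/ramp0 z0; rewrite /g z0 mul0r add0r subr0 mul1r.
 move=> V; rewrite gc // => Vc.
 suff : nbhs u [set z | V (g z)] by [].
 by apply: filterS near0 => z z2; rewrite /= gc //; apply: nbhs_singleton.
have r0 : 0 < radius u by lra.
apply: cont_atD; last by apply: cont_atM; [apply: cont_atB => //; exact: cont_cst|exact: cont_cst].
apply: cont_atM => // V Vu.
have : nbhs (radial u) [set z | sphere z -> V (fweight f (@cell_map _ _ C e z))].
 move/subspace_continuousP: sph => h; exact: h (radial_sph r0) V Vu.
move=> /(radial_cont r0) h1.
have h2 : nbhs u [set z | 0 < radius z].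
 apply: cont_lt => //; exact: radius_cont.
apply: filterS2 h1 h2 => z h1 h2; exact/h1/radial_sph.
Qed.

Lemma fweight_cont f : continuous (fweight f).
Proof.
apply/continuous_closedP => B cB; apply: (cells_weak_topology) => e.
apply: (@closed_preim _ _ _ (fun u => fweight f (cell_map u))) cB; [exact: disc_closed|exact: fweight_cell_cont].
Qed.

Lemma flag_support_card (s : seq {classic cell}) x k : uniq s -> (forall e, (cell_dim e <= k)%N) ->
 (count (fun f : {classic cell} => (fweight f x != 0)%R) s <= k.+1)%N.
Proof.
move=> us hk; rewrite -size_filter; set s' := [seq _ <- _ | _].
have us' : uniq (map (fun f : {classic cell} => inord (cell_dim f) : 'I_k.+1) s').
 rewrite map_inj_in_uniq; first by rewrite filter_uniq.
 by move=> f f'; rewrite !mem_filter => /andP[fx _] /andP[f'x _] /(congr1 val); rewrite /= !inordK ?ltnS // =>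
  /(fweight_dim_inj fx f'x).
by rewrite -(size_map (fun f : {classic cell} => inord (cell_dim f) : 'I_k.+1)) -(card_uniqP us') -[X in (_ <=
 X)%N]card_ord max_card.
Qed.

End CellCoordinates.

Section CellularAction.
Variables (R : realType) (G : groupType) (S : seq G) (X : topologicalType) (a : G -> X -> X).
Variables (C : cw_structure R X) (k : nat).
Hypotheses (genS : generates S) (cX : contractible R X) (pa : properly_discontinuous a).
Notation oc := (@open_cell R X C).
Hypothesis perm : forall g (e : cell C), exists e', a g @` oc e = oc e'.
Hypothesis dimC : forall e : cell C, (cell_dim e <= k)%N.

Let actC g x : a g^-1%g (a g x) = x.
Proof. exact: actK. Qed.

Lemma face_rel_act g P Q : face_rel P Q -> face_rel (a g @` P) (a g @` Q).
Proof.
have [a1 aM ca _] := pa; move=> [p [Pp [Qp nQp]]]; exists (a g p); split => //.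
split; last by move=> [q Qq /(congr1 (a g^-1))]; rewrite !actC => qp; apply: nQp; rewrite -qp.
by move=> U /(ca g p)/Qp[q [Qq Uq]]; exists (a g q).
Qed.

Lemma reach_act g e f e' f' : reach e f -> a g @` oc e = oc e' -> a g @` oc f = oc f' -> reach e' f'.
Proof.
move=> r; elim: r e' => {e f} [e|e e1 f er _ IH] e' he hf.
 have [x ex] : exists x, oc e' x.
  exists (cell_map (0 : 'rV[R]_(cell_dim e'))), 0 => //.
  by rewrite /open_disc /= big1 // => i _; rewrite mxE expr0n.
 rewrite -(carrier_uniq ex); rewrite -he hf in ex; rewrite (carrier_uniq ex); exact: reach_refl.
have [e1' he1] := perm g e1; apply: (reach_step (e1 := e1')); last exact: IH.
by rewrite -he -he1; apply: face_rel_act.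
Qed.

Lemma act_carrier g x : a g @` oc (carrier C x) = oc (carrier C (a g x)).
Proof.
have [e' he] := perm g (carrier C x); rewrite he; congr (open_cell _).
apply/esym/carrier_uniq; rewrite -he; exists x => //; exact: carrier_open_cell.
Qed.

Lemma reach_of_compact P : compact P -> finite_set [set f | exists2 x, P x & reach (carrier C x) f].
Proof.
move=> cP; have := compact_carriers C cP => fP.
have : finite_set (\bigcup_(e in (carrier C @` P : set {classic cell C})) [set f | reach e f]).
 apply: bigcup_finite => // e _; exact: reach_finite.
apply: sub_finite_set => f [x r]; exists (carrier C x) => //.
Qed.

(** Flag weights have at most [k + 1] nonzero entries, so their difference at two points has at most
    [2k + 2], and points of the moment curve in dimension [2k + 1] admit no nontrivial affine
    relation of that length. Equal images thus have equal weights and share a cell [f], whose center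
    lies in the translates of one compact set by both group elements. *)
Theorem cellular_controlled : controlled R (word_dist S) k.*2.+1 X.
Proof.
move=> kap; have [K [cK contr]] := action_regions genS cX pa kap.
exists (fun j g => a g @` K j); split=> // j.
pose H : set {classic cell C} := [set f | exists2 x, K j x & reach (carrier C x) f].
pose B := \bigcup_(f in H) closed_cell f.
have cB : compact B.
 apply: compact_bigcup; first exact: reach_of_compact.
 move=> f _; exact: closed_cell_compact.
have [D DP] := action_bounded genS pa cB; exists D => P cP.
have [s [us sP]] : exists s : seq {classic cell C}, uniq s /\ forall f x, P x -> reach (carrier C x) f -> f \in s.
 have : finite_set ([set f | exists2 x, P x & reach (carrier C x) f] : set {classic cell C}).
  exact: reach_of_compact.
 by move=> /finite_fsetP[F FE]; exists (enum_fset F); split; first exact: fset_uniq; move=> f x Px r; suff : [set` F] f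
  by []; rewrite -FE; exists x.
pose cellI i := tnth (in_tuple s) i.
have sumE (F : cell C -> R) : \sum_(f <- s) F f = \sum_i F (cellI i).
 by rewrite (big_tnth _ _ s).
pose v i : 'rV[R]_(k.*2.+1) := \row_(d < k.*2.+1) (i%:R ^+ d.+1).
pose e x := \sum_(i < size s) fweight (cellI i) x *: v i.
exists 'rV[R]_(k.*2.+1), e; split; [exact: rV_manifold|exact: rV_contractible| |].
 apply: continuous_subspaceT => x.
 apply: cont_row => d.
 have -> : (fun x => e x 0 d) = (fun x => \sum_(i < size s) fweight (cellI i) x * v i 0 d).
  by apply/funext => y; rewrite summxE; apply: eq_bigr => i _; rewrite mxE.
 apply: cont_sum => i; apply: cont_atM; [exact: fweight_cont|exact: cont_cst].
move=> g g' w w' Pw Pw' gw gw' eww'.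
have sw z (Pz : P z) : \sum_i fweight (cellI i) z = 1.
 rewrite -(sumE (fun f => fweight f z)); apply: fweight_sum => // f /fweight_reach; exact: sP.
pose c i := fweight (cellI i) w - fweight (cellI i) w'.
have c0 : forall i, c i = 0.
 have mi := @moment_indep R 'I_(size s) (fun i => i%:R) c k.*2.+1; apply: mi.
 - by move=> i i' /eqP; rewrite eqr_nat => /eqP/val_inj.
 - move=> [|d] dk.
   under eq_bigr => i do rewrite mulr1.
   by rewrite sumrB !sw // subrr.
  have := congr1 (fun u : 'rV_(k.*2.+1) => u 0 (Ordinal dk)) eww'; rewrite /e !summxE => h.
  under eq_bigr => i do rewrite mulrBl.
  rewrite sumrB; apply/eqP; rewrite subr_eq0; apply/eqP.
  transitivity (\sum_(i < size s) (fweight (cellI i) w *: v i) 0 (Ordinal dk)).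
   by apply: eq_bigr => i _; rewrite !mxE.
  by rewrite h; apply: eq_bigr => i _; rewrite !mxE.
 - have cnt z : (#|[pred i | (fweight (cellI i) z != 0)%R]| <= k.+1)%N.
   have := flag_support_card z us dimC; rewrite -sum1_count (big_tnth _ _ s) => h.
   by rewrite -sum1_card.
  apply: (@leq_trans (#|[predU [pred i | (fweight (cellI i) w != 0)] & [pred i | (fweight (cellI i) w' != 0)]]|)).
   by apply/subset_leq_card/fintype.subsetP => i; rewrite /c; apply: contraNT; rewrite negb_or !negbK => /andP[/eqP->
    /eqP->]; rewrite subrr.
  have := cardUI [pred i | (fweight (cellI i) w != 0)] [pred i | (fweight (cellI i) w' != 0)].
  have := cnt w; have := cnt w'; move: #|_| #|_| #|_| #|_| => x1 x2 x3 x4.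
  lia.
have [i wi] : exists i, fweight (cellI i) w != 0.
 apply: contrapT => no; have : (1 : R) = 0; last by apply/eqP.
 by rewrite -(sw w Pw) big1 // => i _; apply/eqP; apply: contrapT => /negP h; apply: no; exists i.
have w'i : fweight (cellI i) w' != 0.
 by have /eqP := c0 i; rewrite subr_eq0 => /eqP <-.
set f := cellI i in wi w'i.
have f0 : oc f (cell_map (0 : 'rV[R]_(cell_dim f))).
 by exists 0 => //; rewrite /open_disc /= big1 // => l _; rewrite mxE expr0n.
have in_B g0 z : (a g0 @` K j) z -> fweight f z != 0 -> (a g0 @` B) (cell_map (0 : 'rV[R]_(cell_dim f))).
 move=> [x Kx xz] /fweight_reach r.
 have [f1 f1E] := perm g0^-1 f.
 exists (a g0^-1 (cell_map (0 : 'rV[R]_(cell_dim f)))); last exact: actKV.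
 exists f1; last by apply: open_cell_closed_cell; rewrite -f1E.
 exists x => //; apply: reach_act r _ f1E; rewrite -xz act_carrier actC //.
apply: DP; exists (cell_map (0 : 'rV[R]_(cell_dim f))); split; [exact: in_B wi|exact: in_B w'i].
Qed.

End CellularAction.

Lemma seq_minimum (R : realType) (T : eqType) (s : seq T) (P : pred T) (f : T -> R) :
 (exists2 x, x \in s & P x) ->
 exists x, [/\ x \in s, P x & forall y, y \in s -> P y -> f x <= f y].
Proof.
elim: s => [|a s IHs] [x] => //.
have [[y [ys Py ymin]] _|none] := pselect (exists y, [/\ y \in s, P y & forall z, z \in s -> P z -> f y <= f z]).
 have [Pa|nPa] := boolP (P a); last first.
  exists y; split=> //; first by rewrite inE ys orbT.
  by move=> z; rewrite inE => /predU1P[->|]; [rewrite (negPf nPa)|exact: ymin].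
 have [ay|ya] := leP (f a) (f y).
  exists a; split=> //; first by rewrite inE eqxx.
  move=> z; rewrite inE => /predU1P[->//|zs Pz].
  exact: le_trans (ymin z zs Pz).
 exists y; split=> //; first by rewrite inE ys orbT.
 move=> z; rewrite inE => /predU1P[-> _|]; [exact: ltW|exact: ymin].
have ns z : z \in s -> ~ P z by move=> zs Pz; apply/none/IHs; exists z.
rewrite inE => /predU1P[->|xs Px]; last by case: (ns x xs).
exists a; split=> //; first by rewrite inE eqxx.
by move=> z; rewrite inE => /predU1P[->//|/ns].
Qed.

Lemma sum_pred1 (Z : nmodType) (T : choiceType) (s : {fset T}) (f : T -> Z) u : u \in s ->
 \sum_(w <- s | w == u) f w = f u.
Proof.
move=> us; rewrite big_mkcond (big_fsetD1 _ us) /= eqxx big_seq big1 ?addr0 // => w.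
by rewrite !inE => /andP[/negPf->].
Qed.

Lemma sum_cond (Z : nmodType) (T : choiceType) (P : pred T) (s : {fset T}) (f : T -> Z) :
 \sum_(w <- s | P w) f w = \sum_(w <- s) if (w \in s) && P w then f w else 0.
Proof. by rewrite big_seq_cond big_mkcond. Qed.

(** * The Kuhn triangulation of the cone *)

Section StepIntegral.
Variables (R : realType).

(* The integral over [[a, 1]] of a function constant between the thresholds
  [a :: ts]. *)
Fixpoint stepint (F : R -> R) (a : R) (ts : seq R) : R :=
 if ts is b :: ts' then (b - a) * F a + stepint F b ts' else (1 - a) * F a.

Lemma stepint_ge0 F a ts : (forall t, 0 <= F t) -> path <=%R a ts -> all (fun t => t <= 1) (a :: ts) ->
 0 <= stepint F a ts.
Proof.
move=> F0; elim: ts a => [|b ts IHts] a.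
 by move=> _ /andP[a1 _]; rewrite mulr_ge0 // subr_ge0.
move=> /andP[ab pb] /and3P[a1 b1 h]; apply: addr_ge0; first by rewrite mulr_ge0 // subr_ge0.
by apply: IHts => //=; rewrite b1.
Qed.

Lemma stepint_cst c a ts : stepint (fun=> c) a ts = (1 - a) * c.
Proof. elim: ts a => [|b ts IHts] a //=; rewrite IHts; ring. Qed.

Lemma stepintD F F' a ts :
 stepint (fun t => F t + F' t) a ts = stepint F a ts + stepint F' a ts.
Proof. elim: ts a => [|b ts IHts] a /=; rewrite ?IHts; ring. Qed.

Lemma stepint_lt (f a : R) ts : path <=%R a ts -> all (fun t => t <= 1) (a :: ts) -> f \in a :: ts -> stepint (fun t =>
 (t < f)%R%:R) a ts = f - a.
Proof.
have low a' ts' : f <= a' -> path <=%R a' ts' -> stepint (fun t => (t < f)%R%:R) a' ts' = 0.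
 elim: ts' a' => [|b ts' IHts] a' fa /=; first by rewrite ltNge fa mulr0.
 by move=> /andP[ab pb]; rewrite ltNge fa mulr0 add0r IHts // (le_trans fa).
move=> pa a1 fin; have [fa|af] := leP f a.
 rewrite low //; move: fin; rewrite inE => /predU1P[->|fts]; first by rewrite subrr.
 have := allP (order_path_min le_trans pa) _ fts => af.
 by apply/eqP; rewrite eq_sym subr_eq0 eq_le fa.
elim: ts a pa a1 fin af => [|b ts IHts] a /=.
 by move=> _ _; rewrite inE => /eqP->; rewrite ltxx.
move=> /andP[ab pb] /and3P[a1 b1 h] fin af; rewrite af mulr1.
have fb : f \in b :: ts by move: fin; rewrite inE => /predU1P[fa|//]; rewrite fa ltxx in af.
have [fb'|bf] := leP f b.
 rewrite low // addr0; move: fb; rewrite inE => /predU1P[->//|fts].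
 have := allP (order_path_min le_trans pb) _ fts => bf.
 by have -> : f = b by apply: le_anti; rewrite fb'.
by rewrite IHts //=; [ring|rewrite b1].
Qed.

Lemma stepint_sum (T : choiceType) (s : {fset T}) W c a ts : (forall t, t \in a :: ts -> W t \in s) -> \sum_(u <- s)
 stepint (fun t => (W t == u)%:R) a ts * c u = stepint (fun t => c (W t)) a ts.
Proof.
have one t : W t \in s -> \sum_(u <- s) (W t == u)%:R * c u = c (W t).
 by move=> Ws; rewrite (big_fsetD1 _ Ws) /= eqxx mul1r big_seq big1 ?addr0 // => u; rewrite !inE eq_sym => /andP[/negPf->
  _]; rewrite mul0r.
elim: ts a => [|b ts IHts] a hs.
 under eq_bigr => u do rewrite -mulrA.
 by rewrite -mulr_sumr one // hs // inE.
under eq_bigr => u do rewrite mulrDl -mulrA.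
rewrite big_split -mulr_sumr one ?hs ?inE ?eqxx // IHts // => t tin.
by apply: hs; rewrite inE tin orbT.
Qed.

Lemma stepint_eq0 F a ts : (forall t, t \in a :: ts -> F t = 0) -> stepint F a ts = 0.
Proof.
elim: ts a => [|b ts IHts] a h /=; rewrite h ?inE ?eqxx // mulr0 // add0r IHts // => t tin.
by apply: h; rewrite inE tin orbT.
Qed.

Lemma eq_stepint F F' a ts : (forall t, t \in a :: ts -> F t = F' t) -> stepint F a ts = stepint F' a ts.
Proof.
elim: ts a => [|b ts IHts] a h /=; rewrite h ?inE ?eqxx //; congr (_ _).
by apply: IHts => t tin; apply: h; rewrite inE tin orbT.
Qed.

End StepIntegral.

Lemma real_linear_cont R V (K : scomplex V) (f : realization R K -> R) c : (forall s x, faces K s -> closed_face s x -> f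
 x = \sum_(u <- s) Defs.coord x u * c u) -> forall x, cont_at f x.
Proof.
move=> fE x U /nbhs_R[e e0 eU].
suff : nbhs x [set y | `|f x - f y| < e] by apply: filterS => y /eU.
apply: nbhs_realization; last by rewrite /= subrr normr0.
move=> s Ks y fy; pose M := 1 + \sum_(u <- s) `|c u|.
have M0 : 0 < M by apply: ltr_wpDr => //; apply: sumr_ge0.
exists ((e - `|f x - f y|) / M); first by rewrite divr_gt0 // subr_gt0.
move=> z sz zy; apply: le_lt_trans (ler_distD (f y) _ _) _; rewrite -ltrBrDl (fE s y) // (fE s z) // -sumrB -(fE s y) //;
 apply: le_lt_trans (ler_norm_sum _ _ _) _.
set d := (e - `|f x - f y|) / M.
have d0 : 0 < d by rewrite divr_gt0 // subr_gt0.
apply: (@le_lt_trans _ _ (\sum_(u <- s) d * `|c u|)).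
 by apply: ler_sum => u _; rewrite -mulrBl normrM ler_wpM2r // distrC ltW.
rewrite -mulr_sumr -[X in _ < X](divfK (lt0r_neq0 M0)) ltr_pM2l // /M.
by rewrite addrC ltrDl.
Qed.

Section Kuhn.
Variables (R : realType) (V : finType) (K : scomplex V).
Notation E := 'rV[R]_#|V|.

Definition lattice_point (u : {ffun V -> nat}) : bool :=
 `[< exists2 s, faces K s & forall v, v \notin s -> u v = 0%N >].

Definition lattice : Type := {u : {ffun V -> nat} | lattice_point u}.
HB.instance Definition _ := Choice.on lattice.
Implicit Types (u w : lattice).

(** [w] is a vertex of the unit cube with lowest corner [u]; the simplices of the Kuhn triangulation
    are the chains for this relation. *)
Definition below u w : bool := [forall v, (val u v <= val w v <= (val u v).+1)%N].

Lemma belowP u w : reflect (forall v, (val u v <= val w v <= (val u v).+1)%N) (below u w).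
Proof. exact: forallP. Qed.

Lemma below_refl u : below u u.
Proof. by apply/belowP => v; rewrite leqnn leqnSn. Qed.

Lemma below_anti u w : below u w -> below w u -> u = w.
Proof.
move=> /belowP uw /belowP wu; apply/val_inj/ffunP => v; apply/eqP.
by rewrite eqn_leq; have /andP[-> _] := uw v; have /andP[-> _] := wu v.
Qed.

Definition kfaces : set {fset lattice} :=
 [set s | s != fset0 /\ forall u w, u \in s -> w \in s -> below u w || below w u].

Lemma kfaces_neq0 s : kfaces s -> s != fset0.
Proof. by case. Qed.

Lemma kfaces_sub (s t : {fset lattice}) : kfaces s -> (t `<=` s)%fset -> t != fset0 -> kfaces t.
Proof. move=> [_ h] /fsubsetP ts t0; split=> // u w /ts us /ts; exact: h. Qed.

Lemma kfaces1 u : kfaces [fset u]%fset.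
Proof.
split=> [|w w']; first by apply/fset0Pn; exists u; rewrite inE.
by rewrite !inE => /eqP-> /eqP->; rewrite below_refl.
Qed.

Definition kuhn : scomplex lattice := SComplex kfaces_neq0 kfaces_sub kfaces1.
Notation T := (realization R kuhn).
Implicit Types x y : T.
Notation coord := (@Defs.coord R lattice kuhn).

Definition sface x : {fset lattice} := projT1 (cid2 (carrier_exists x)).

Lemma sface_face x : kfaces (sface x).
Proof. by rewrite /sface; case: cid2. Qed.

Lemma mem_sface x u : (u \in sface x) = (0 < coord x u).
Proof. by rewrite /sface; case: cid2. Qed.

Lemma coord_supp x u : u \notin sface x -> coord x u = 0.
Proof.
by rewrite mem_sface -leNgt => h; apply: le_anti; rewrite h coord0.
Qed.

Lemma supp_sum x : \sum_(u <- sface x) coord x u = 1.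
Proof.
have [s _ [_ xs <-]] := coord_bary x.
apply: fset_sum_eq => // u; exact: coord_supp.
Qed.

Definition lin x : E := \row_i \sum_(u <- sface x) coord x u * (val u (enum_val i))%:R.

Lemma weight_lin x v : weight (lin x) v = \sum_(u <- sface x) coord x u * (val u v)%:R.
Proof. by rewrite /weight mxE enum_rankK. Qed.

Lemma weight_lin_face (s : {fset lattice}) x v : closed_face s x ->
 weight (lin x) v = \sum_(u <- s) coord x u * (val u v)%:R.
Proof.
move=> sx; rewrite weight_lin; apply: fset_sum_eq => u; first by move=> /coord_supp->; rewrite mul0r.
by move=> /sx; rewrite /Defs.coord => ->; rewrite mul0r.
Qed.

Lemma lin_cont x : cont_at lin x.
Proof.
apply: cont_row => i; apply: (@real_linear_cont _ _ _ _ (fun u => (val u (enum_val i))%:R)).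
by move=> s y _ sy; rewrite -(weight_lin_face (enum_val i) sy) /weight enum_valK.
Qed.

(** The largest vertex of the carrier, found by its coordinate sum, bounds the others, so a face
    supporting it supports the whole point. *)
Lemma lin_domain x : cdom K (lin x).
Proof.
have [s0 chain] := sface_face x; have /fset0Pn[u0 u0s] := s0.
have [u [us _ umax]] := @seq_minimum R _ (sface x) predT
 (fun u => - (\sum_v val u v)%:R) (ex_intro2 _ _ u0 u0s isT).
have top w : w \in sface x -> below w u.
 move=> ws; have /orP[//|uw] := chain w u ws us.
 have := umax w ws isT; rewrite lerN2 ler_nat => sle.
 suff -> : u = w by exact: below_refl.
 apply/val_inj/ffunP => v; apply/eqP; rewrite eqn_leq.
 have /belowP uw' := uw; have /andP[-> _] /= := uw' v.
 by rewrite leqNgt; apply/negP => lt; move: sle; rewrite leqNgt => /negP; rewrite (bigD1 v) //= [X in (_ < X)%N](bigD1 v)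
  //= -addSn leq_add //; apply: leq_sum => v' _; have /andP[] := uw' v'.
have /asboolP[s Ks us'] := valP u; exists s => //; split=> v.
 by rewrite weight_lin big_seq; apply: sumr_ge0 => w; rewrite mulr_ge0 ?coord0.
move=> vs; rewrite weight_lin big_seq big1 // => w /top/belowP/(_ v).
by rewrite us' // leqn0 => /andP[/eqP-> _]; rewrite mulr0.
Qed.

(** Listing the vertices of the carrier from the largest down, their coordinates cut the unit
    interval into pieces; the piece of [u] starts at [above x u]. *)
Definition above x u : R := \sum_(w <- sface x | below u w && (w != u)) coord x w.
Definition under x u : R := \sum_(w <- sface x | below w u && (w != u)) coord x w.

Lemma above_under x u : u \in sface x -> above x u + coord x u + under x u = 1.
Proof.
move=> us; have [_ chain] := sface_face x.
have -> : coord x u = \sum_(w <- sface x | w == u) coord x w by rewrite sum_pred1.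
rewrite -[RHS](supp_sum x) /above /under (sum_cond (fun w => below u w && (w != u))) (sum_cond (fun w => w == u))
 (sum_cond (fun w => below w u && (w != u))) -!big_split /= !big_seq; apply: eq_bigr => w ws; rewrite ws.
have [->|wu] := eqVneq w u; first by rewrite !andbF addr0 add0r.
have := chain u w us ws.
have [uw|uw] := boolP (below u w); have [wu'|wu'] := boolP (below w u) => //= _; rewrite ?addr0 ?add0r //.
by move: wu; rewrite (below_anti uw wu') eqxx.
Qed.

(* [u] is the vertex obtained by rounding [z - t] up. *)
Definition cut (t : R) (z : E) u : Prop :=
 forall v, (val u v)%:R - 1 < weight z v - t <= (val u v)%:R.

Lemma cut_unique t z u w : cut t z u -> cut t z w -> u = w.
Proof.
move=> cu cw; apply/val_inj/ffunP => v.
have /andP[a1 a2] := cu v; have /andP[b1 b2] := cw v.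
have h a b : (a%:R : R) - 1 < b%:R -> (a <= b)%N.
 by rewrite -ltnS -(ltr_nat R) -natr1 -ltrBlDr.
by apply/eqP; rewrite eqn_leq !h //; [apply: lt_le_trans a2|apply: lt_le_trans b2].
Qed.

(** Relative to [u], larger vertices raise a coordinate of [lin x] by at most [above x u] and
    smaller ones lower it by at most [under x u]. *)
Lemma cut_of_interval t x u : u \in sface x -> above x u <= t < above x u + coord x u ->
 cut t (lin x) u.
Proof.
move=> us /andP[t1 t2] v; have [_ chain] := sface_face x.
have -> : weight (lin x) v - t = (val u v)%:R + \sum_(w <- sface x) coord x w * ((val w v)%:R - (val u v)%:R) - t.
 by rewrite weight_lin; under [X in _ = _ X - _]eq_bigr => w do rewrite mulrBr; rewrite sumrB -mulr_suml supp_sum mul1r;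
  congr (_ _); rewrite addrC subrK.
have up : \sum_(w <- sface x) coord x w * ((val w v)%:R - (val u v)%:R) <= above x u.
 rewrite [leRHS]big_mkcond big_seq [leRHS]big_seq; apply: ler_sum => w ws.
 have := chain u w us ws; have [uw _|uw /= wu] := boolP (below u w).
  have [->|wu] := eqVneq w u; first by rewrite subrr mulr0.
  have /belowP/(_ v)/andP[_] := uw; rewrite /= -(ler_nat R) -natr1 => h.
  rewrite -[leRHS]mulr1 ler_wpM2l ?coord0 //; lra.
 have /belowP/(_ v)/andP[h _] := wu; rewrite mulr_ge0_le0 ?coord0 // subr_le0 ler_nat //.
have down : - under x u <= \sum_(w <- sface x) coord x w * ((val w v)%:R - (val u v)%:R).
 rewrite [X in - X]big_mkcond -sumrN big_seq [leRHS]big_seq; apply: ler_sum => w ws.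
 have := chain u w us ws; have [wu _|wu] := boolP (below w u).
  have [->|uw] := eqVneq w u; first by rewrite subrr mulr0 oppr0.
  have /belowP/(_ v)/andP[_] := wu; rewrite /= -(ler_nat R) -natr1 => h.
  apply: le_trans (_ : coord x w * -1 <= _); first by rewrite mulrN1.
  rewrite ler_wpM2l ?coord0 //; lra.
 rewrite orbF => /belowP/(_ v)/andP[h _]; rewrite oppr0 mulr_ge0 ?coord0 // subr_ge0 ler_nat //.
have := above_under us.
lra.
Qed.

Lemma interval_exists t x : 0 <= t < 1 ->
 exists2 u, u \in sface x & above x u <= t < above x u + coord x u.
Proof.
move=> /andP[t0 t1]; have [s0 chain] := sface_face x; have /fset0Pn[u0 u0s] := s0.
have above_lt u w : u \in sface x -> w \in sface x -> below u w -> w != u ->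
  (forall v, v \in sface x -> below w v -> v != w -> below u v && (v != u)) -> above x w < above x u.
 move=> us ws uw wu h; have cw : 0 < coord x w by rewrite -mem_sface.
 apply: lt_le_trans (_ : above x w + coord x w <= _); first by rewrite ltrDl.
 have -> : coord x w = \sum_(v <- sface x | v == w) coord x v by rewrite sum_pred1.
 rewrite /above (sum_cond (fun v => below w v && (v != w))) (sum_cond (fun v => v == w)) (sum_cond (fun v => below u v &&
  (v != u))) -big_split !big_seq; apply: ler_sum => v vs.
 rewrite vs /=; have [->|vw] := eqVneq v w; first by rewrite andbF add0r uw wu.
 rewrite andbT addr0; case: ifP => wv; last by case: ifP => // _; exact: coord0.
 by rewrite h.
have below_trans u w v : u \in sface x -> v \in sface x -> below u w -> below w v -> v != w ->
  below u v && (v != u).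
 move=> us vs uw wv vw; have [vu|vu] := eqVneq.
  by rewrite vu in wv vw; move: vw; rewrite (below_anti uw wv) eqxx.
 have := chain u v us vs => /orP[->//|/belowP vu']; move/belowP: uw => uw; move/belowP: wv => wv.
 case/eqP: vu; apply/val_inj/ffunP => c; apply/eqP; rewrite eqn_leq.
 have /andP[h1 _] := uw c; have /andP[h2 _] := wv c; have /andP[h3 _] := vu' c.
 by rewrite h3 (leq_trans h1 h2).
have [u1 [u1s _ u1min]] := @seq_minimum R _ (sface x) predT (above x) (ex_intro2 _ _ u0 u0s isT).
have u10 : above x u1 = 0.
 rewrite /above big_seq_cond big1 // => w /andP[ws /andP[uw wu]].
 have := u1min w ws isT; rewrite leNgt above_lt // => v vs wv vw.
 exact: below_trans vw.
have [u [us ut umax]] := @seq_minimum R _ (sface x) (fun u => above x u <= t) (fun u => - above x u)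
 (ex_intro2 _ _ u1 u1s (etrans (congr1 (fun a => a <= t) u10) t0)).
exists u => //; rewrite ut ltNge; apply/negP => tu.
have [[w0 w0s w0u]|none] := pselect (exists2 w, w \in sface x & below w u && (w != u)); last first.
 have := above_under us; rewrite [under x u]big_seq_cond big1; last first.
  by move=> w /andP[ws wu]; case: none; exists w.
 lra.
have [w [ws wu wmin]] := @seq_minimum R _ (sface x) (fun w => below w u && (w != u)) (above x)
 (ex_intro2 _ _ w0 w0s w0u).
have /andP[wu1 wu2] := wu.
have aw : above x w <= above x u + coord x u.
 have -> : coord x u = \sum_(v <- sface x | v == u) coord x v by rewrite sum_pred1.
 rewrite /above (sum_cond (fun v => below w v && (v != w))) (sum_cond (fun v => v == u)) (sum_cond (fun v => below u v &&
  (v != u))) -big_split !big_seq; apply: ler_sum => v vs.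
 rewrite vs /=; case: ifP => [/andP[wv vw]|_]; last first.
  apply: addr_ge0; case: ifP => // _; exact: coord0.
 have [->|vu] := eqVneq v u; first by rewrite andbF add0r.
 rewrite addr0; have [uv|uv] := boolP (below u v) => //.
 have vu' : below v u by have := chain u v us vs; rewrite (negPf uv).
 have := wmin v vs; rewrite vu' vu => /(_ isT); rewrite leNgt above_lt // => c cs vc cv.
 exact: below_trans cv.
have := umax w ws (le_trans aw tu); rewrite lerN2 leNgt above_lt //; first by rewrite eq_sym.
move=> v vu; exact: below_trans.
Qed.

(** The piece of the unit interval belonging to [u] consists of the times at which rounding gives
    [u], so it is determined by the image point. *)
Lemma lin_inj : injective lin.
Proof.
move=> x y xy; apply: coord_inj => u; apply/eqP; rewrite eq_le.
suff h x' y' : lin x' = lin y' -> coord x' u <= coord y' u by rewrite !h.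
move=> {}xy; rewrite leNgt; apply/negP => lt.
have us : u \in sface x' by rewrite mem_sface (le_lt_trans _ lt) ?coord0.
have a1 := above_under us; have un : 0 <= under x' u.
 apply: sumr_ge0 => w _; exact: coord0.
have a0 : 0 <= above x' u by apply: sumr_ge0 => w _; exact: coord0.
have cut_y t : above x' u <= t < above x' u + coord x' u ->
  above y' u <= t < above y' u + coord y' u.
 move=> ht; have [|w ws wt] := @interval_exists t y'.
  lra.
 have cw := cut_of_interval ws wt; have cu := cut_of_interval us ht.
 by rewrite -xy in cw; rewrite (cut_unique cu cw).
have cx : 0 < coord x' u by rewrite -mem_sface.
have /andP[h1 h2] : above y' u <= above x' u < above y' u + coord y' u.
 by apply: cut_y; rewrite lexx ltrDl.
have /andP[_] : above y' u <= above y' u + coord y' u < above y' u + coord y' u.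
 by apply: cut_y; rewrite (ltW h2) /=; apply: lt_le_trans (_ : _ < above y' u + coord x' u) _; rewrite ?ltrD2l ?lerD2r.
by rewrite ltxx.
Qed.

(** The coordinate of [u] has to be the measure of the times [t] at which rounding [z - t] up gives
    [u]; the result changes only at the fractional parts of [z]. *)
Lemma lin_surj z : cdom K z -> exists x, lin x = z.
Proof.
move=> [s Ks [z0 zs]].
pose k v := Num.truncn (weight z v); pose f v := weight z v - (k v)%:R.
have f01 v : 0 <= f v < 1.
 have := truncn_itv (z0 v); rewrite -/(k v) -natr1 /f.
 lra.
(* The maximum matters for negative [t]: off [s] the fractional part is 0 and must not count as
   exceeding [t]. *)
have Wp t : lattice_point [ffun v => (k v + (Num.max t 0 < f v))].
 by apply/asboolP; exists s => // v vs; rewrite ffunE /f /k zs // truncn0 subr0; rewrite ltNge le_max lexx orbT.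
pose W t := exist (fun u : {ffun V -> nat} => is_true (lattice_point u)) _ (Wp t).
pose ts := sort <=%R (map f (enum V)).
have mts t : t \in ts -> exists v, t = f v.
 by rewrite mem_sort => /mapP[v _ ->]; exists v.
have t01 t : t \in 0 :: ts -> 0 <= t <= 1.
 rewrite inE => /predU1P[->|/mts[v ->]]; first by rewrite lexx ler01.
 by have /andP[-> /ltW->] := f01 v.
have pts : path <=%R 0 ts.
 by rewrite path_sortedE; last exact: le_trans; rewrite sort_sorted ?andbT; last exact: le_total; apply/allP => t /mts[v
  ->]; have /andP[] := f01 v.
have ats : all (fun t => t <= 1) (0 :: ts) by apply/allP => t /t01/andP[].
pose Fs := seq_fset tt (map W (0 :: ts)).
have WF t : t \in 0 :: ts -> W t \in Fs by move=> tin; rewrite seq_fsetE; apply: map_f.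
have KF : kfaces Fs.
 split=> [|u w]; first by apply/fset0Pn; exists (W 0); apply: WF; rewrite inE eqxx.
 rewrite !seq_fsetE => /mapP[t tin ->] /mapP[t' tin' ->].
 have le_below r r' : r <= r' -> below (W r') (W r).
  move=> rr; apply/belowP => v /=; rewrite !ffunE !leq_add2l -addnS leq_add2l.
  have mm : Num.max r 0 <= Num.max r' 0 by rewrite ge_max !le_max rr lexx orbT.
  have : (Num.max r' 0 < f v) ==> (Num.max r 0 < f v).
   by apply/implyP/le_lt_trans.
  by case: (_ < _); case: (_ < _).
 by have [tt'|/ltW tt'] := leP t t'; rewrite (le_below _ _ tt') ?orbT.
pose g u := stepint (fun t => (W t == u)%:R) 0 ts.
have gF u : u \notin Fs -> g u = 0.
 by move=> uF; apply: stepint_eq0 => t tin; case: eqP => // e; rewrite -e WF in uF.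
have bg : bary kuhn g.
 exists Fs; [exact: KF|split=> // [u|]].
  apply: stepint_ge0 => //.
 have := @stepint_sum R _ Fs W (fun=> 1) 0 ts WF; rewrite stepint_cst subr0 mul1r => <-.
 by apply: eq_bigr => u _; rewrite mulr1.
pose x := mk_point (vertex_pt R kuhn (W 0)) g.
have xF : closed_face Fs x by move=> u uF; rewrite coord_mk // gF.
exists x; apply/rowP => i; rewrite -[i]enum_valK -[LHS]/(weight (lin x) (enum_val i)) -[RHS]/(weight z (enum_val i)).
move: (enum_val i) => v; rewrite (weight_lin_face v xF) coord_mk // (@stepint_sum R _ Fs W (fun u => (val u v)%:R) 0 ts WF).
transitivity (stepint (fun t => (k v)%:R + (t < f v)%R%:R) 0 ts).
 apply: eq_stepint => t /t01/andP[t0 _]; rewrite ffunE natrD (max_l t0) //.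
rewrite stepintD stepint_cst stepint_lt //; first by rewrite /f; ring.
by rewrite inE mem_sort map_f ?orbT // mem_enum.
Qed.

Definition unlin (z : E) (H : cdom K z) : T := projT1 (cid (lin_surj H)).

Lemma unlinK z (H : cdom K z) : lin (unlin H) = z.
Proof. by rewrite /unlin; case: cid. Qed.

Lemma box_finite N : finite_set [set u : lattice | forall v, (val u v <= N)%N].
Proof.
have [[u0 _]|none] := pselect (exists u, True); last first.
 by apply: sub_finite_set (@finite_set0 _) => u _; case: none.
have /choice[g gP] : forall c : {ffun V -> 'I_N.+1}, exists u, (exists u', forall v, val u' v = c v) -> forall v, val u v = c v.
 by move=> c; have [[u' uc]|n] := pselect (exists u', forall v, val u' v = c v); [exists u'|exists u0].
have : finite_set (g @` setT) by apply: finite_image.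
apply: sub_finite_set => u uN; pose c : {ffun V -> 'I_N.+1} := [ffun v => inord (val u v)].
have uc v : val u v = c v by rewrite ffunE inordK // ltnS.
exists c => //; apply/val_inj/ffunP => v; rewrite uc; apply: gP; by exists u.
Qed.

Lemma supp_le x u v : u \in sface x -> (val u v)%:R < weight (lin x) v + 1.
Proof.
move=> us; have cu : 0 < coord x u by rewrite -mem_sface.
have := @cut_of_interval (above x u) x u us; rewrite lexx ltrDl cu => /(_ isT v)/andP[h _].
have : 0 <= above x u by apply: sumr_ge0 => w _; exact: coord0.
lra.
Qed.

Lemma total_le_compact r : compact [set x | total (lin x) <= r].
Proof.
pose N := Num.bound `|r + 1|.
have [F FE] := finite_fsetP.1 (box_finite N).
have cU : compact (\bigcup_(t in [set t : {fset lattice} | t \in fpowerset F /\ kfaces t]) @closed_face R _ kuhn t).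
 by apply: compact_bigcup => [|t [_ Kt]]; last exact: closed_face_cpt; apply: sub_finite_set (finite_fset (fpowerset F)) => t [].
apply: subclosed_compact cU _.
 apply: closed_le => x; last exact: cont_cst.
 apply: (cont_comp); [exact: lin_cont|exact: cont_total].
move=> x xr; exists (sface x); last by move=> u; exact: coord_supp.
split; last exact: sface_face.
rewrite fpowersetE; apply/fsubsetP => u us.
suff : [set` F] u by []; rewrite -FE => v.
rewrite -(ler_nat R); apply: ltW; apply: lt_trans (supp_le v us) _.
have [s Ks sx] := lin_domain x; have wt := weight_le_total v sx.
apply: le_lt_trans (archi_boundP (normr_ge0 _)); apply: le_trans (ler_norm _).
by rewrite lerD2r (le_trans wt).
Qed.

Definition of_cone (c : open_cone R K) : E :=
 \row_i (val (repr c).2 * Defs.coord (repr c).1 (enum_val i)).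

Lemma weight_ofc p v : weight (of_cone (cone_pt p)) v = val p.2 * Defs.coord p.1 v.
Proof.
rewrite /weight mxE enum_rankK; have /cone_ptE := reprK (cone_pt p).
by move=> [->//|[-> ->]]; rewrite !mul0r.
Qed.

Lemma coord_cont v (y : realization R K) : cont_at (fun y : realization R K => Defs.coord y v) y.
Proof.
apply: (@real_linear_cont _ _ _ _ (fun w : V => (w == v)%:R)) => s x Ks sx.
have [vs|vs] := boolP (v \in s).
 by rewrite (big_fsetD1 _ vs) /= eqxx mulr1 big_seq big1 ?addr0 // => w; rewrite !inE => /andP[/negPf-> _]; rewrite mulr0.
rewrite sx // big_seq big1 // => w ws; case: eqP => [e|]; last by rewrite mulr0.
by rewrite -e ws in vs.
Qed.

Lemma of_cone_cont c : cont_at of_cone c.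
Proof.
apply: cont_row => i; have -> : (fun c => of_cone c 0 i) = (fun p => val p.2 * Defs.coord p.1 (enum_val i)) \o repr by
 apply/funext => c'; rewrite mxE.
apply: repr_comp_continuous.
 move=> p; suff h : cont_at (fun p : realization R K * halfline R => val p.2 * Defs.coord p.1 (enum_val i)) p by exact: h.
 apply: cont_atM.
  apply: (cont_comp); [exact: cont_snd|exact: halfline_val_cont].
 apply: (cont_comp (g := fun y : realization R K => Defs.coord y (enum_val i))); first exact: cont_fst.
 exact: coord_cont.
by move=> a b /eqP/cone_ptE[->//|[-> ->]]; rewrite !mul0r.
Qed.

Lemma of_cdom c : cdom K (of_cone c).
Proof.
have [[y r] ->] := cone_pt_surj c; have [s Ks [y0 ys _]] := coord_bary y.
exists s => //; split=> [v|v vs]; rewrite weight_ofc.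
 apply: mulr_ge0; [exact: halfline_val|exact: y0].
by rewrite [Defs.coord _ _]ys // mulr0.
Qed.

Lemma of_cone_subcone s c : subcone s c -> fcone s (of_cone c).
Proof.
move=> [[y r] sy ->]; split=> [v|v vs]; rewrite weight_ofc.
 apply: mulr_ge0; [exact: halfline_val|exact: coord0].
by rewrite [Defs.coord _ _]sy // mulr0.
Qed.

Lemma total_of_cone p : total (of_cone (cone_pt p)) = val p.2.
Proof.
rewrite /total; under eq_bigr => v do rewrite weight_ofc.
have [s Ks [y0 ys y1]] := coord_bary p.1.
by rewrite -mulr_sumr -(sum_fset (s := s)) // y1 mulr1.
Qed.

Variable p0 : realization R K.

Lemma to_coneK z : cdom K z -> of_cone (to_cone p0 z) = z.
Proof.
move=> [s Ks sz]; apply/rowP => i; rewrite -[i]enum_valK -[LHS]/(weight (of_cone (to_cone p0 z)) (enum_val i)) weight_ofc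
 /= max_l ?(total0 sz) //.
have := total0 sz; rewrite le_eqVlt => /predU1P[t0|t0].
 by rewrite -t0 mul0r; apply: le_anti; have := weight_le_total (enum_val i) sz; rewrite -t0; move: sz => [z0 _]; rewrite z0.
by rewrite coord_mk; [rewrite mulrCA divff ?mulr1 ?gt_eqF|exact: fcone_bary sz t0].
Qed.

Lemma of_coneK c : to_cone p0 (of_cone c) = c.
Proof.
have [[y r] ->] := cone_pt_surj c; apply/cone_ptE; rewrite total_of_cone /= hptK.
have := halfline_val r; rewrite le_eqVlt => /predU1P[e|r0].
 by have e' : sval r = 0 := esym e; right; rewrite e' maxxx.
left; congr (_, _); have e : (fun w : V => weight (of_cone (cone_pt (y, r))) w / val r) = Defs.coord y.
 by apply/funext => w; rewrite weight_ofc mulrAC divff ?mul1r ?gt_eqF.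
apply: coord_inj => w; rewrite e coord_mk //; exact: coord_bary.
Qed.

Definition kuhn_map x : open_cone R K := to_cone p0 (lin x).
Definition kuhn_inv c : T := unlin (of_cdom c).

Lemma lin_kuhn_inv c : lin (kuhn_inv c) = of_cone c.
Proof. exact: unlinK. Qed.

(** The inverse is continuous because [lin] is a continuous injection under which bounded totals
    have compact preimage. *)
Lemma kuhn_map_homeo : homeomorphism kuhn_map.
Proof.
split.
 move=> x U Ux; have := to_cone_cont (lin_domain x) Ux => /(lin_cont).
 suff h : nbhs x [set y | cdom K (lin y) -> U (to_cone p0 (lin y))] -> nbhs x [set y | U (kuhn_map y)].
  by [].
 apply: filterS => y h; exact/h/lin_domain.
exists kuhn_inv; split.
- move=> c U Uc; pose r := total (of_cone c) + 1.
 pose Kr := [set x | total (lin x) <= r].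
 have [B [oB Bx BU]] : exists B, [/\ open B, B (kuhn_inv c) & B `<=` U].
  by [].
 have cL : closed (lin @` (Kr `\` B)).
  apply: compact_closed => //.
  apply: continuous_compact; first by apply: continuous_subspaceT => x; exact: lin_cont.
  apply: compact_closedI; [exact: total_le_compact|exact: open_closedC].
 have n1 : nbhs (of_cone c) (~` (lin @` (Kr `\` B))).
  by apply: open_nbhs_nbhs; split; first exact: closed_openC; move=> [x [_ nB] xc]; apply: nB; have -> // : x = kuhn_inv
   c; apply: lin_inj; rewrite lin_kuhn_inv.
 have n2 : nbhs (of_cone c) [set z | total z < r].
  by apply: cont_lt; [exact: cont_total|exact: cont_cst|rewrite ltrDl].
 apply: filterS (of_cone_cont (filterI n1 n2)) => c' [h1 h2]; apply: BU.
 apply: contrapT => nB; apply: h1; exists (kuhn_inv c'); last exact: lin_kuhn_inv.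
 split=> //; rewrite /Kr /= lin_kuhn_inv; exact: ltW.
- move=> x; apply: lin_inj; rewrite lin_kuhn_inv to_coneK //; exact: lin_domain.
- by move=> c; rewrite /kuhn_map lin_kuhn_inv of_coneK.
Qed.

Lemma lin_vertex u v : weight (lin (vertex_pt R kuhn u)) v = (val u v)%:R.
Proof.
have uu : closed_face [fset u]%fset (vertex_pt R kuhn u).
 by move=> w; rewrite inE /= => /negPf->.
by rewrite (weight_lin_face v uu) big_seq_fset1 /= eqxx mul1r.
Qed.

Lemma kuhn_vertex_subcone s u v : subcone s (kuhn_map (vertex_pt R kuhn u)) -> v \notin s -> val u v = 0%N.
Proof.
move=> /of_cone_subcone; rewrite to_coneK; last exact: lin_domain.
by move=> [_ h] /h; rewrite lin_vertex => /eqP; rewrite pnatr_eq0 => /eqP.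
Qed.

Lemma kuhn_cone_triangulation : cone_triangulation kuhn_map.
Proof.
split; first exact: kuhn_map_homeo.
move=> s Ks; exists [set t | kfaces t /\ forall u, u \in t -> forall v, v \notin s -> val u v = 0].
split.
- by move=> t [].
- move=> t u [Kt h] ut u0; split; first exact: kfaces_sub ut u0.
 move=> w wu; exact/h/(fsubsetP ut).
apply/seteqP; split=> [_ [x [t [Kt ts] tx] <-]|c sc].
 apply: to_cone_subcone => //; split=> [v|v vs].
  rewrite weight_lin; apply: sumr_ge0 => u _.
  apply: mulr_ge0; [exact: coord0|exact: ler0n].
 by rewrite (weight_lin_face v tx) big_seq big1 // => u ut; rewrite ts // mulr0.
exists (kuhn_inv c); last by rewrite /kuhn_map lin_kuhn_inv of_coneK.
exists (sface (kuhn_inv c)); last by move=> u; exact: coord_supp.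
split=> [|u us v vs]; first exact: sface_face.
have := supp_le v us; rewrite lin_kuhn_inv (of_cone_subcone sc).2 // add0r.
by rewrite ltrn1 ltnS leqn0 => /eqP.
Qed.

End Kuhn.

(** * The join of three-point sets as an obstructor *)

Section JoinOfPoints.
Variables (R : realType) (n : nat).
Hypothesis n_gt0 : (0 < n)%N.
Notation V := ('I_n * 'I_3)%type.
Notation choices := {ffun 'I_n -> 'I_3}.
Implicit Types (s t : {fset V}) (f g : choices).

Definition jfaces : set {fset V} :=
 [set s | s != fset0 /\ forall i j j', (i, j) \in s -> (i, j') \in s -> j = j'].

Lemma jfaces_neq0 s : jfaces s -> s != fset0.
Proof. by case. Qed.

Lemma jfaces_sub s t : jfaces s -> (t `<=` s)%fset -> t != fset0 -> jfaces t.
Proof. move=> [_ h] /fsubsetP ts t0; split=> // i j j' /ts h1 /ts h2; exact: h h2. Qed.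

Lemma jfaces1 v : jfaces [fset v]%fset.
Proof.
split=> [|i j j']; first by apply/fset0Pn; exists v; rewrite inE.
by rewrite !inE => /eqP<- /eqP[].
Qed.

Definition join3 : scomplex V := SComplex jfaces_neq0 jfaces_sub jfaces1.

Definition facet f : {fset V} := seq_fset tt [seq (i, f i) | i <- enum 'I_n].

Lemma mem_facet f v : (v \in facet f) = (v.2 == f v.1).
Proof.
rewrite seq_fsetE; case: v => i j; apply/mapP/eqP => [[i' _ [-> ->]]//|/= ->].
by exists i => //; rewrite mem_enum.
Qed.

Lemma facet_card f : #|` facet f| = n.
Proof.
have u : uniq [seq (i, f i) | i <- enum 'I_n] by rewrite map_inj_uniq ?enum_uniq // => i i' [].
by rewrite size_seq_fset (undup_id u) size_map size_enum_ord.
Qed.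

Lemma facet_inj : injective facet.
Proof.
move=> f g fg; apply/ffunP => i; apply/eqP.
by rewrite -[_ == _](mem_facet g (i, f i)) -fg mem_facet.
Qed.

Lemma facet_face f : jfaces (facet f).
Proof.
split=> [|i j j']; first by rewrite -cardfs_gt0 facet_card.
by rewrite !mem_facet => /eqP/= -> /eqP/= ->.
Qed.

Lemma face_card s : jfaces s -> (#|` s| <= n)%N.
Proof.
move=> [_ h]; have u : uniq (map fst (enum_fset s)).
 by rewrite map_inj_in_uniq ?fset_uniq // => -[i j] [i' j'] vs ws /= e; rewrite e in vs *; rewrite (h _ _ _ vs ws).
by rewrite -(size_map fst) -(card_uniqP u) -[X in (_ <= X)%N]card_ord max_card.
Qed.

Lemma full_face s : jfaces s -> #|` s| = n -> exists f, s = facet f.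
Proof.
move=> [_ h] sn; have u : uniq (map fst (enum_fset s)).
 by rewrite map_inj_in_uniq ?fset_uniq // => -[i j] [i' j'] vs ws /= e; rewrite e in vs *; rewrite (h _ _ _ vs ws).
have all_i i : i \in map fst (enum_fset s).
 have : #|map fst (enum_fset s)| = #|'I_n| by rewrite (card_uniqP u) size_map card_ord.
 move=> c; have := subset_cardP c (subset_predT _) i; by rewrite !inE.
have /choice[f fP] : forall i, exists j, (i, j) \in s.
 by move=> i; have /mapP[[i' j] vs ->] := all_i i; exists j.
exists (finfun f); apply/esym/eqP; rewrite eqEfcard facet_card sn leqnn andbT.
by apply/fsubsetP => -[i j]; rewrite mem_facet /= ffunE => /eqP->.
Qed.

Lemma missing_block s : jfaces s -> #|` s|.+1 = n -> exists i, forall j, (i, j) \notin s.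
Proof.
move=> [_ h] sn; have u : uniq (map fst (enum_fset s)).
 by rewrite map_inj_in_uniq ?fset_uniq // => -[i j] [i' j'] vs ws /= e; rewrite e in vs *; rewrite (h _ _ _ vs ws).
have : ~~ [forall i, i \in map fst (enum_fset s)].
 apply/negP => /forallP al; have : #|map fst (enum_fset s)| = n.
  by rewrite -[RHS]card_ord; apply: eq_card => i; rewrite al.
 move=> c1; have c2 := card_uniqP u; rewrite size_map in c2.
 have /eqP : n.+1 = n := etrans (congr1 S (etrans (esym c1) c2)) sn.
 by rewrite gtn_eqF.
rewrite negb_forall => /existsP[i ni]; exists i => j; apply: contra ni => ij.
by apply/mapP; exists (i, j).
Qed.

Definition dfacets : {fset {fset {fset V}}} :=
 seq_fset tt [seq [fset facet p.1; facet p.2]%fset | p <- enum [pred p : choices * choices | [forall i, p.1 i != p.2 i]]].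

Lemma dfacetsP st : reflect (exists f g, (forall i, f i != g i) /\ st = [fset facet f; facet g]%fset)
 (st \in dfacets).
Proof.
rewrite seq_fsetE; apply: (iffP mapP) => [[[f g]]|[f [g [fg ->]]]].
 by rewrite mem_enum => /forallP fg ->; exists f, g.
by exists (f, g) => //; rewrite mem_enum; apply/forallP.
Qed.

Lemma fdisjoint f g : (forall i, f i != g i) -> [disjoint facet f & facet g]%fset.
Proof. by move=> fg; apply/fdisjointP => -[i j]; rewrite !mem_facet => /eqP->. Qed.

Let m := n.-1.*2.

Lemma facets_pair_cell p : p \in dfacets -> pair_cell join3 m p.
Proof.
move=> /dfacetsP[f [g [fg ->]]]; exists (facet f), (facet g); split=> //.
- exact: facet_face.
- exact: facet_face.
- exact: fdisjoint.
- by rewrite !facet_card addnn.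
Qed.

Lemma other_two (j : 'I_3) : size [seq k <- enum 'I_3 | k != j] = 2.
Proof.
have := cardC1 j; rewrite card_ord => h; rewrite -[RHS]h cardE.
apply/perm_size/uniq_perm; [by rewrite filter_uniq ?enum_uniq|exact: enum_uniq|].
by move=> k; rewrite mem_filter !mem_enum andbT.
Qed.

(** [a] misses exactly one block, where it can be completed by either of the two points that [b]
    does not use. *)
Lemma codim_one_facets a b : jfaces a -> jfaces b -> [disjoint a & b]%fset -> #|` a|.+1 = n -> #|` b| = n -> #|` [fset p
 in dfacets | `[< pair_facet [fset a; b]%fset p >]]%fset| = 2.
Proof.
move=> Ka Kb dab an bn; have [i ia] := missing_block Ka an; have [g gE] := full_face Kb bn.
pose P j := [fset ((i, j) |` a); b]%fset.
have KP j : jfaces ((i, j) |` a)%fset.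
 split=> [|i' j1 j2]; first by apply/fset0Pn; exists (i, j); rewrite !inE eqxx.
 have [_ h] := Ka; rewrite !inE !xpair_eqE => /orP[/andP[/eqP-> /eqP->]|h1] /orP[/andP[e /eqP->]|h2] //.
 - by move: h2; rewrite (negPf (ia _)).
 - by move: h1; rewrite (eqP e) (negPf (ia _)).
 - exact: h h2.
have cP j : #|` ((i, j) |` a)%fset| = n by rewrite cardfsU1 ia.
have Pinj : injective P.
 move=> j j' /fset2_eq[[/fsetP/(_ (i, j)) + _]|[e _]].
  by rewrite !inE !eqxx /= xpair_eqE eqxx (negPf (ia _)) orbF => /esym/eqP.
 have /fset0Pn[x xa] : a != fset0 by have [] := Ka.
 have /fdisjointP/(_ x xa) := dab.
 by rewrite -e inE xa orbT.
transitivity (size [seq P j | j <- [seq k <- enum 'I_3 | k != g i]]); last by rewrite size_map other_two.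
apply/perm_size/uniq_perm => //.
 by rewrite map_inj_uniq // filter_uniq // enum_uniq.
move=> p; rewrite !inE /=; apply/andP/mapP => [[pS /asboolP[a' [s [t [qE pE as' cs]]]]]|[j]].
 have [f1 [g1 [fg1 pE']]] := dfacetsP _ pS.
 have cst : #|` s| = n /\ #|` t| = n.
  by move: pE; rewrite pE' => /fset2_eq[[<- <-]|[<- <-]]; rewrite !facet_card.
 have [a'a tb] : a' = a /\ t = b.
  by case: (fset2_eq qE) => [[-> ->]//|[ea eb]]; have := cst.2; rewrite -ea => an'; move: an; rewrite an' => /eqP;
   rewrite gtn_eqF.
 have Ks : jfaces s.
  move: pE; rewrite pE' => /fset2_eq[[<- _]|[_ <-]]; exact: facet_face.
 have [f fE] := full_face Ks cst.1; exists (f i).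
  rewrite mem_filter mem_enum andbT; apply/eqP => e.
  have dst : [disjoint s & t]%fset.
   move: pE; rewrite pE' => /fset2_eq[[<- <-]|[<- <-]]; first exact: fdisjoint.
   rewrite fdisjoint_sym; exact: fdisjoint.
  have /fdisjointP/(_ (i, f i)) := dst; rewrite fE mem_facet eqxx => /(_ isT).
  by rewrite tb gE mem_facet e eqxx.
 by rewrite pE tb /P; congr [fset _; b]%fset; apply/esym/eqP; rewrite eqEfcard cP cst.1 leqnn andbT; apply/fsubsetP => v;
  rewrite inE in_fset1 => /orP[/eqP->|va]; [rewrite fE mem_facet|apply: (fsubsetP as'); rewrite a'a].
rewrite mem_filter => /andP[jg _] ->; have [f fE] := full_face (KP j) (cP j); split; last first.
 by apply/asboolP; exists a, ((i, j) |` a)%fset, b; split=> //; first exact: fsubsetUr; rewrite cP.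
apply/dfacetsP; exists f, g; split; last by rewrite /P fE gE.
move=> i'; apply/eqP => e; have : (i', f i') \in ((i, j) |` a)%fset by rewrite fE mem_facet.
rewrite !inE xpair_eqE => /orP[/andP[/eqP ii /eqP fj]|va].
 by move: jg; rewrite -fj -ii e eqxx.
by have /fdisjointP/(_ _ va) := dab; rewrite gE mem_facet e eqxx.
Qed.

Lemma dfacets_cycle : cellular_cycle join3 m dfacets.
Proof.
split=> [p|d q dm [a [b [Ka Kb dab -> cab]]]]; first exact: facets_pair_cell.
have a0 : (0 < #|` a|)%N by rewrite cardfs_gt0; exact: jfaces_neq0.
have b0 : (0 < #|` b|)%N by rewrite cardfs_gt0; exact: jfaces_neq0.
have := face_card Ka; have := face_card Kb.
have [an|an] := eqVneq (#|` a|) n.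
 rewrite fsetUC codim_one_facets //; first by rewrite fdisjoint_sym.
 move: b0 an cab; move: (#|` a|) (#|` b|) => x.
 lia.
move=> bn an'; rewrite codim_one_facets //.
 move: a0 an an' bn cab; move: (#|` a|) (#|` b|) => x.
 lia.
move: an an' bn cab; move: (#|` a|) (#|` b|) => x.
lia.
Qed.

(** A face of dimension [2n - 2] exists only for [n = 1]; the complex is then three points, and the
    two others are paired with [s]. *)
Lemma dfacets_top s : jfaces s -> #|` s|.-1 = m ->
 ~~ odd #|[set v : V | [fset s; [fset v]]%fset \in dfacets]|.
Proof.
move=> Ks sm; have n1 : n = 1.
 have := face_card Ks; lia.
have [f fE] : exists f, s = facet f.
 apply: full_face => //; have : s != fset0 by case: Ks.
 rewrite -cardfs_gt0; lia.
pose i0 := Ordinal n_gt0.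
have i0P i : i = i0 by apply: val_inj; case: i => i /= hi; move: hi; rewrite n1; case: i.
have fs1 g : facet g = [fset (i0, g i0)]%fset.
 by apply/fsetP => -[i j]; rewrite mem_facet inE (i0P i).
transitivity (~~ odd #|[set (i0, j) | j in [set j | j != f i0]]%SET|); last first.
 by rewrite card_imset; [rewrite cardsE cardC1 card_ord|move=> j j' []].
congr (~~ odd _); apply: eq_card => -[i j]; rewrite (i0P i).
transitivity (j != f i0); last first.
 apply/idP/imsetP => [jf|[j']]; first by exists j; rewrite ?inE.
 by rewrite inE => h [->].
apply/asboolP/idP => [/dfacetsP[f1 [g1 [fg1]]]|jf].
 rewrite fE !fs1 => /fset2_eq[[/fset1_inj[e1] /fset1_inj[e2]]|[/fset1_inj[e1] /fset1_inj[e2]]].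
  by rewrite e1 e2 eq_sym.
 by rewrite e1 e2.
apply/dfacetsP; exists f, [ffun=> j]; split.
 by move=> i'; rewrite (i0P i') ffunE eq_sym.
by rewrite fE !fs1 ffunE.
Qed.

(** Parameters on the moment curve: each block occupies three consecutive integers. *)
Definition time (v : V) : R := (3 * v.1 + v.2)%N%:R.
Definition moment (v : V) : 'rV[R]_m := \row_d time v ^+ d.+1.

Lemma time_nat_lt (v w : V) : (v.1 < w.1)%N || (v.1 == w.1) && (v.2 < w.2)%N ->
 (3 * v.1 + v.2 < 3 * w.1 + w.2)%N.
Proof.
case: v w => [i j] [i' j'] /= /orP[h|/andP[/eqP-> h]]; last lia.
have := ltn_ord j; lia.
Qed.

Lemma time_inj : injective time.
Proof.
move=> v w /eqP; rewrite eqr_nat => /eqP.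
case: v w => [i j] [i' j'] /= e; have hj := ltn_ord j; have hj' := ltn_ord j'.
have [e1 e2] : (i : nat) = i' /\ (j : nat) = j'.
 lia.
by congr (_, _); apply: val_inj.
Qed.

Lemma moment_general : general_position moment.
Proof.
move=> A cA c c0 cp v vA; pose c' w := if w \in A then c w else 0.
have sumA F : \sum_w c' w * F w = \sum_(w in A) c w * F w.
 by rewrite [RHS]big_mkcond; apply: eq_bigr => w _; rewrite /c'; case: ifP; rewrite ?mul0r.
have := @moment_indep R _ time c' m time_inj; rewrite /c' => h.
have := h _ _ v; rewrite vA; apply.
 move=> [|d] dm; rewrite (sumA (fun w => time w ^+ _)).
  by under eq_bigr => w do rewrite mulr1.
 have := congr1 (fun u : 'rV_m => u 0 (Ordinal dm)) cp; rewrite summxE mxE => e; rewrite -[RHS]e.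
 by apply: eq_bigr => w _; rewrite !mxE.
apply: leq_trans cA; apply/subset_leq_card/fintype.subsetP => w.
by apply: contraNT => /negPf->.
Qed.

(* Two points of the curve that are adjacent among the [2 n] points of a linear relation
  have coefficients of opposite signs: test against the polynomial vanishing at
  all the other points. *)
Lemma adjacent_signs f g (c : V -> R) (u w : V) : (forall i, f i != g i) ->
 (forall v, v \notin (facet f `|` facet g)%fset -> c v = 0) ->
 (forall d, (d <= m)%N -> \sum_v c v * time v ^+ d = 0) ->
 u \in (facet f `|` facet g)%fset -> w \in (facet f `|` facet g)%fset -> time u < time w ->
 (forall v, v \in (facet f `|` facet g)%fset -> v != u -> v != w -> (time v < time u) || (time w < time v)) ->
 c w != 0 -> c u * c w < 0.
Proof.
move=> fg c0 cm uU wU tuw betw cw; set U := (facet f `|` facet g)%fset in c0.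
have cU : #|` U| = n.*2.
 rewrite cardfsU (disjoint_fsetI0 (fdisjoint fg)) subn0 !facet_card addnn //.
have uw : u != w by apply: contraTneq tuw => ->; rewrite ltxx.
pose U' := (U `\ u `\ w)%fset.
pose q := \prod_(v <- map time (enum_fset U')) ('X - v%:P).
have sq : (size q <= m.+1)%N.
 rewrite size_prod_XsubC size_map.
 have h1 := cardfsD1 u U; have h2 := cardfsD1 w (U `\ u)%fset; rewrite uU in h1.
 rewrite inE in_fset1 eq_sym uw wU in h2; rewrite h1 h2 in cU.
 move: cU n_gt0; move: (#|` _|); lia.
have qs : \sum_v c v * q.[time v] = 0.
 under eq_bigr => k do rewrite (horner_coef_wide _ sq) mulr_sumr.
 rewrite exchange_big big1 // => j.
 under eq_bigr => k do rewrite mulrCA.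
 by rewrite -mulr_sumr cm ?mulr0 // -ltnS.
have q0 v : v \in U' -> q.[time v] = 0.
 by move=> vU'; apply/eqP; rewrite -[_ 0]/(root q (time v)) root_prod_XsubC map_f.
have quw : 0 < q.[time u] * q.[time w].
 rewrite !horner_prod -big_split big_map big_seq; apply: prodr_gt0 => v.
 rewrite 2!in_fsetD1 => /andP[vw /andP[vu vU]]; rewrite !hornerE.
 have := betw v vU vu vw => /orP[h|h].
  by rewrite mulr_gt0 // subr_gt0 // (lt_trans h).
 by rewrite nmulr_rgt0 subr_lt0 // (lt_trans tuw).
have two : c u * q.[time u] + c w * q.[time w] = 0.
 rewrite -qs (bigD1 u) //= (bigD1 w) /=; last by rewrite eq_sym.
 rewrite [X in _ + (_ + X)]big1 ?addr0 // => v /andP[vu vw].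
 have [vU|vU] := boolP (v \in U); last by rewrite c0 ?mul0r.
 by rewrite q0 ?mulr0 // 2!in_fsetD1 vw vu.
have : c u * q.[time u] = - (c w * q.[time w]) by apply/eqP; rewrite -addr_eq0 two.
have qw : q.[time w] != 0 by apply: contraTneq quw => ->; rewrite mulr0 ltxx.
move=> e; rewrite -(pmulr_llt0 _ quw).
have -> : c u * c w * (q.[time u] * q.[time w]) = - (c w * q.[time w]) ^+ 2.
 by rewrite mulrACA e mulNr.
by rewrite oppr_lt0 exprn_even_gt0 //= mulf_neq0.
Qed.

Lemma in_facets f g v : (v \in (facet f `|` facet g)%fset) = (v.2 == f v.1) || (v.2 == g v.1).
Proof. by rewrite inE !mem_facet. Qed.

Lemma facet_in1 f g i : (i, f i) \in (facet f `|` facet g)%fset.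
Proof. by rewrite in_facets eqxx. Qed.

Lemma facet_in2 f g i : (i, g i) \in (facet f `|` facet g)%fset.
Proof. by rewrite in_facets eqxx orbT. Qed.

Definition depend f g (c : V -> R) : Prop :=
 (forall v, v \notin (facet f `|` facet g)%fset -> c v = 0) /\
 (forall d, (d <= m)%N -> \sum_v c v * time v ^+ d = 0).

Lemma time_ltE (v w : V) : (v.1 < w.1)%N || (v.1 == w.1) && (v.2 < w.2)%N -> time v < time w.
Proof. by move=> /time_nat_lt; rewrite ltr_nat. Qed.

Lemma same_block_signs f g c i : (forall i, f i != g i) -> depend f g c -> c (i, f i) != 0 -> c (i, g i) != 0 ->
 c (i, f i) * c (i, g i) < 0.
Proof.
move=> fg [c0 cm] cf cg.
have between (j j' : 'I_3) : (j < j')%N -> (j = f i /\ j' = g i) \/ (j = g i /\ j' = f i) ->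
  forall v, v \in (facet f `|` facet g)%fset -> v != (i, j) -> v != (i, j') -> (time v < time (i, j)) || (time (i, j') < time v).
 move=> jj' jE [i1 j1]; rewrite in_facets => h n1 n2.
 have [lt|gt|e] := ltngtP i1 i.
 - by rewrite time_ltE //= lt.
 - by apply/orP; right; rewrite time_ltE //= gt.
 - have e' : i1 = i by apply: val_inj.
  by rewrite e' in h n1 n2 *; move: n1 n2; rewrite !xpair_eqE eqxx; case: jE h => -[-> ->] /orP[->|->].
have [lt|gt|e] := ltngtP (f i) (g i).
- by apply: (adjacent_signs fg) => //; [exact: facet_in1|exact: facet_in2|by rewrite time_ltE //= eqxx lt orbT|]; apply:
 between => //; left.
- by rewrite mulrC; apply: (adjacent_signs fg) => //; [exact: facet_in2|exact: facet_in1|by rewrite time_ltE //= eqxx gt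
 orbT|]; apply: between => //; right.
- by have := fg i; rewrite (val_inj e) eqxx.
Qed.

(** The larger of the two points used in block [i] and the smaller one in the next block are
    neighbors on the curve. *)
Lemma next_block_signs f g c (i i' : 'I_n) : (forall i, f i != g i) -> depend f g c ->
 i.+1 = i' -> (f i < g i)%N -> c (i, g i) != 0 ->
 ((f i' < g i')%N -> c (i', f i') != 0 -> c (i, g i) * c (i', f i') < 0) /\
 ((g i' < f i')%N -> c (i', g i') != 0 -> c (i, g i) * c (i', g i') < 0).
Proof.
move=> fg [c0 cm] ii' fgi.
have between j : (forall v, v \in (facet f `|` facet g)%fset -> v.1 = i' -> v != (i', j) -> (j < v.2)%N) ->
  forall v, v \in (facet f `|` facet g)%fset -> v != (i, g i) -> v != (i', j) ->
   (time v < time (i, g i)) || (time (i', j) < time v).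
 move=> jmin [i1 j1] vU n1 n2.
 have [lt|gt|e] := ltngtP i1 i.
 - by rewrite time_ltE //= lt.
 - apply/orP; right; apply: time_ltE => /=; move: gt; rewrite -ltnS ii' ltnS leq_eqVlt => /predU1P[e|->//].
  have e' : i' = i1 by apply: val_inj.
  rewrite e' eqxx ltnn /=; apply: (jmin (i1, j1)) => //=.
 - have e' : i1 = i by apply: val_inj.
  by rewrite e' in vU n1 *; move: vU n1; rewrite in_facets /= xpair_eqE eqxx; move=> /orP[/eqP-> _|->//]; rewrite
   time_ltE //= eqxx fgi orbT.
have tl j : time (i, g i) < time (i', j) by apply: time_ltE; rewrite -ii' ltnSn.
split=> ch; apply: (adjacent_signs fg) => //; rewrite ?facet_in1 ?facet_in2 //; apply: between => -[i1 j1]; rewrite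
 in_facets /= => /orP[]/eqP-> -> //; rewrite ?eqxx //.
Qed.

Lemma depend_sym f g c : depend f g c -> depend g f c.
Proof. move=> [c0 cm]; split=> // v; rewrite fsetUC; exact: c0. Qed.

(** Signs alternate along the curve, so the order of [f] and [g] in one block forces the same order
    in the next. *)
Lemma signs_alternate f g c : (forall i, f i != g i) -> depend f g c ->
 (forall i, 0 < c (i, f i)) -> (forall i, c (i, g i) < 0) ->
 (forall i, (f i < g i)%N) \/ (forall i, (g i < f i)%N).
Proof.
move=> fg dep cf cg; pose i0 := Ordinal n_gt0.
have tot i : (f i < g i)%N \/ (g i < f i)%N.
 by have := fg i; rewrite neq_ltn => /orP[]; [left|right].
have gf i : g i != f i by rewrite eq_sym.
have step (i i' : 'I_n) : i.+1 = i' -> ((f i < g i)%N -> (f i' < g i')%N) /\ ((g i < f i)%N -> (g i' < f i')%N).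
 move=> ii'; split=> h; case: (tot i') => // h'.
  have [_ /(_ h')] := next_block_signs fg dep ii' h (ltr0_neq0 (cg i)).
  by move=> /(_ (ltr0_neq0 (cg i'))); rewrite nmulr_rlt0 // ltNge ltW.
 have [_ /(_ h')] := next_block_signs gf (depend_sym dep) ii' h (lt0r_neq0 (cf i)).
 by move=> /(_ (lt0r_neq0 (cf i'))); rewrite pmulr_rlt0 // ltNge ltW.
have prop P : P i0 -> (forall i i' : 'I_n, i.+1 = i' -> P i -> P i') -> forall i, P i.
 move=> P0 PS [k kn]; elim: k kn => [|k IHk] kn; first by rewrite (_ : Ordinal kn = i0) //; apply: val_inj.
 by apply: (PS (Ordinal (ltnW kn)) (Ordinal kn)).
case: (tot i0) => h0; [left|right]; apply: prop => // i i' ii'; have [s1 s2] := step i i' ii'; [exact: s1|exact: s2].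
Qed.

(** There are [2n] vectors in dimension [2n - 1], hence a relation. None of its coefficients
    vanishes and the signs alternate; multiplying by the coefficient of the first point fixes the
    overall sign. *)
Lemma altern_depend f g : (forall i, (f i < g i)%N) -> exists c, [/\ depend f g c,
 forall i, 0 < c (i, f i) & forall i, c (i, g i) < 0].
Proof.
move=> fg; have fgn i : f i != g i by rewrite -val_eqE /= ltn_eqF.
pose A := [set v : V | v \in (facet f `|` facet g)%fset]%SET.
have cA : #|A| = n.*2.
 have -> : #|A| = #|` (facet f `|` facet g)%fset|.
  rewrite cardsE -(card_uniqP (fset_uniq _)); exact: eq_card.
 by rewrite cardfsU (disjoint_fsetI0 (fdisjoint fgn)) subn0 !facet_card addnn.
have [|c [[v0 cv0] c0 cF]] := @lin_rel R m.+1 V (fun v => \row_(d < m.+1) time v ^+ d) A.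
 rewrite cA; lia.
have cU v : v \notin (facet f `|` facet g)%fset -> c v = 0 by move=> vU; apply: c0; rewrite inE.
have dep : depend f g c.
 split=> // d; rewrite -ltnS => dm.
 have := congr1 (fun u : 'rV_(m.+1) => u 0 (Ordinal dm)) cF; rewrite summxE mxE => e; rewrite -[RHS]e.
 by apply: eq_bigr => w _; rewrite !mxE.
have cn v : v \in (facet f `|` facet g)%fset -> c v != 0.
 move=> vU; apply/eqP => cv; move: cv0; apply/negP; rewrite negbK; apply/eqP.
 apply: (moment_indep time_inj (D := m)) => [d dm|]; first by have [_] := dep; apply.
 rewrite -ltnS; apply: leq_trans (_ : #|A| <= _)%N; last by rewrite cA; lia.
 apply/proper_card/properP; split; last by exists v; [rewrite inE|rewrite inE cv eqxx].
 by apply/fintype.subsetP => w cw; apply: contraTT cw => wA; rewrite inE c0 ?eqxx.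
have cf i : c (i, f i) != 0 by exact/cn/facet_in1.
have cg i : c (i, g i) != 0 by exact/cn/facet_in2.
pose i0 := Ordinal n_gt0.
have same i : 0 < c (i0, f i0) * c (i, f i).
 case: i => k kn; elim: k kn => [|k IHk] kn.
  have -> : Ordinal kn = i0 by apply: val_inj.
  rewrite -expr2 exprn_even_gt0 //=.
 have h1 := IHk (ltnW kn); have h2 := same_block_signs fgn dep (cf (Ordinal (ltnW kn))) (cg (Ordinal (ltnW kn))).
 have [h3 _] := next_block_signs fgn dep (erefl : (Ordinal (ltnW kn)).+1 = Ordinal kn) (fg _) (cg _).
 have {}h3 := h3 (fg _) (cf _).
 move: h1 h2 h3; move: (c (i0, f i0)) (c (Ordinal (ltnW kn), f (Ordinal (ltnW kn))))
  (c (Ordinal (ltnW kn), g (Ordinal (ltnW kn)))) (c (Ordinal kn, f (Ordinal kn))) => x y z w h1 h2 h3.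
 have h4 : 0 < y * w * z ^+ 2.
  have -> : y * w * z ^+ 2 = (y * z) * (z * w) by ring.
  by rewrite nmulr_rgt0.
 have z2 : 0 < z ^+ 2.
  by rewrite exprn_even_gt0 //=; apply: contraTneq h2 => ->; rewrite mulr0 ltxx.
 have yw : 0 < y * w by rewrite pmulr_lgt0 in h4.
 have : 0 < x * w * y ^+ 2.
  have -> : x * w * y ^+ 2 = (x * y) * (y * w) by ring.
  exact: mulr_gt0.
 by rewrite pmulr_lgt0 // exprn_even_gt0 //=; apply: contraTneq h1 => ->; rewrite mulr0 ltxx.
have opp i : c (i0, f i0) * c (i, g i) < 0.
 have h1 := same i; have h2 := same_block_signs fgn dep (cf i) (cg i).
 move: h1 h2; move: (c (i0, f i0)) (c (i, f i)) (c (i, g i)) => x y z h1 h2.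
 have : x * z * y ^+ 2 < 0.
  have -> : x * z * y ^+ 2 = (x * y) * (y * z) by ring.
  by rewrite pmulr_rlt0.
 by rewrite pmulr_llt0 // exprn_even_gt0 //=; apply: contraTneq h1 => ->; rewrite mulr0 ltxx.
exists (fun v => c (i0, f i0) * c v); split=> //; split=> [v vU|d dm]; first by rewrite (cU _ vU) mulr0.
under eq_bigr => v do rewrite -mulrA.
by rewrite -mulr_sumr dep.2 ?mulr0.
Qed.

Lemma depend_hits f g : (forall i, f i != g i) ->
 hits (jvec moment) (plist (facet f) (facet g)) 0 <->
 exists c, [/\ depend f g c, forall i, 0 < c (i, f i) & forall i, c (i, g i) < 0].
Proof.
move=> fg; have dis i : (i, f i) \notin facet g by rewrite mem_facet /=.
split=> [[c [cp c0 /jvec_sum[c1 c2]]]|[c [[c0 cm] cg]]].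
 exists (fun v => c (enum_rank v)); split; first split=> [v vU|[|d] dm].
 - by apply: c0; rewrite plist_fst mem_filter enum_rankK (negPf vU).
 - by under eq_bigr => v do rewrite mulr1.
 - have := congr1 (fun u : 'rV_m => u 0 (Ordinal dm)) c2; rewrite summxE mxE => e; rewrite -[RHS]e.
  by apply: eq_bigr => w _; rewrite !mxE.
 - by move=> i; have := cp (enum_rank (i, f i), false); rewrite mem_plist enum_rankK facet_in1 (negPf (dis i)); rewrite
  mul1r; apply.
 - by move=> i; have := cp (enum_rank (i, g i), true); rewrite mem_plist enum_rankK facet_in2 mem_facet eqxx; rewrite
  mulN1r oppr_gt0; apply.
exists (fun i => c (enum_val i)); split.
- move=> [i b]; rewrite mem_plist => /andP[iU /eqP->]; move: iU.
 case: (enum_val i) => k j; rewrite in_facets mem_facet /=.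
 have [->|jg] := eqVneq j (g k); first by rewrite /signr expr1 mulN1r oppr_gt0.
 by rewrite orbF => /eqP->; rewrite mul1r.
- move=> i; rewrite plist_fst mem_filter mem_enum andbT; exact: c0.
apply/jvec_sum; split.
 under eq_bigr => v do rewrite enum_rankK.
 by rewrite -[RHS](cm 0 isT); apply: eq_bigr => v _; rewrite mulr1.
apply/rowP => d; rewrite summxE mxE -[RHS](cm d.+1) => //.
by apply: eq_bigr => v _; rewrite !mxE enum_rankK.
Qed.

(** With [high], the two points of a block left when [o] is omitted, in increasing order. *)
Definition low (o : 'I_3) : 'I_3 := if o == 0 :> nat then inord 1 else inord 0.
Definition high (o : 'I_3) : 'I_3 := if o == 2 :> nat then inord 1 else inord 2.

Lemma low_high o : (low o < high o)%N.
Proof. by rewrite /low /high; case: o => [[|[|[|]]]] //= _; rewrite !inordK. Qed.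

Lemma low_high_inj o o' : low o = low o' -> high o = high o' -> o = o'.
Proof.
rewrite /low /high => /(congr1 val) h1 /(congr1 val) h2; apply: val_inj.
by move: h1 h2; case: o o' => [[|[|[|]]]] //= _ [[|[|[|]]]] //= _; rewrite !inordK.
Qed.

Lemma low_high_surj (j j' : 'I_3) : (j < j')%N -> exists o, low o = j /\ high o = j'.
Proof.
move=> jj'; exists (inord (3 - j - j')); rewrite /low /high.
by case: j jj' => [[|[|[|]]]] ?; case: j' => [[|[|[|]]]] // ? _; split; apply: val_inj; rewrite /= !inordK.
Qed.

Definition altern_pair f : {fset {fset V}} :=
 [fset facet [ffun i => low (f i)]; facet [ffun i => high (f i)]]%fset.

Lemma altern_pair_inj : injective altern_pair.
Proof.
move=> f f' /fset2_eq[[/facet_inj/ffunP e1 /facet_inj/ffunP e2]|[/facet_inj/ffunP e1 /facet_inj/ffunP e2]].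
 apply/ffunP => i; have := e1 i; have := e2 i; rewrite !ffunE => h2 h1.
 exact: low_high_inj.
have := e1 (Ordinal n_gt0); have := e2 (Ordinal n_gt0); rewrite !ffunE => h2 h1.
have := low_high (f (Ordinal n_gt0)); rewrite h1 h2 => h.
by have := ltn_trans h (low_high (f' (Ordinal n_gt0))); rewrite ltnn.
Qed.

Lemma image_meet_altern st : st \in dfacets -> #|` fset_set (@image_meet R V join3 m moment st)| = (st \in map
 altern_pair (enum choices)).
Proof.
move=> /dfacetsP[f [g [fg ->]]].
rewrite (image_meet_count moment_general); last first.
- by rewrite !facet_card addnn.
- exact: fdisjoint.
- exact: facet_face.
- exact: facet_face.
congr nat_of_bool; apply/asboolP/mapP => [/(depend_hits fg)[c [dep cf cg]]|[fo _ /fset2_eq]].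
 have mk f1 g1 : (forall i, (f1 i < g1 i)%N) -> exists2 o, o \in enum choices & [fset facet f1; facet g1]%fset = altern_pair o.
  move=> h; have /choice[fo foP] : forall i, exists o, low o = f1 i /\ high o = g1 i by move=> i; exact: low_high_surj.
  exists (finfun fo); first by rewrite mem_enum.
  by congr [fset facet _; facet _]%fset; apply/ffunP => i; rewrite !ffunE; have [] := foP i.
 have [h|h] := signs_alternate fg dep cf cg; first exact: mk.
 rewrite fsetUC; exact: mk.
have alt : forall i, ([ffun i => low (fo i)] i < [ffun i => high (fo i)] i)%N by move=> i; rewrite !ffunE low_high.
have [c [dep cf cg]] := altern_depend alt.
move=> [[/facet_inj-> /facet_inj->]|[/facet_inj-> /facet_inj->]].
 by apply/depend_hits; [move=> i; rewrite -val_eqE /= ltn_eqF|exists c].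
apply/depend_hits; first by move=> i; rewrite -val_eqE /= gtn_eqF.
exists (fun v => - c v); split=> [|i|i]; rewrite ?oppr_gt0 ?oppr_lt0 //.
have [c0 cm] := depend_sym dep; split=> [v /c0->|d /cm e]; first lra.
by under eq_bigr => v do rewrite mulNr; rewrite sumrN e oppr0.
Qed.

(** Exactly the alternating pairs meet, once each, and there is one for every choice of an omitted
    point per block: [3 ^ n], an odd number. *)
Lemma join3_obstructor : obstructor R join3 m.
Proof.
split=> [s Ks|].
 have := face_card Ks; move: (#|` s|); lia.
exists dfacets; split; [exact: dfacets_cycle| |exact: dfacets_top].
exists moment; split; first exact: moment_general.
have -> : \sum_(st <- dfacets) #|` fset_set (@image_meet R V join3 m moment st)| = (3 ^ n)%N.
 rewrite big_seq; under eq_bigr => st stS do rewrite image_meet_altern //.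
 rewrite -big_seq; transitivity (\sum_(st <- dfacets | st \in map altern_pair (enum choices)) 1)%N.
  by rewrite [RHS]big_mkcond.
 rewrite sum1_count -size_filter; transitivity (size (map altern_pair (enum choices))).
  apply/perm_size/uniq_perm; first by rewrite filter_uniq.
   rewrite map_inj_uniq ?enum_uniq //; exact: altern_pair_inj.
  by move=> st; rewrite mem_filter; apply: andb_idr => /mapP[fo _ ->]; apply/dfacetsP; exists [ffun i => low (fo i)],
   [ffun i => high (fo i)]; split=> // i; rewrite !ffunE -val_eqE ltn_eqF // low_high.
 by rewrite size_map -cardE card_ffun !card_ord.
by rewrite oddX orbT.
Qed.

End JoinOfPoints.

Lemma path_dist_walk A (e : A -> A -> Prop) x y : (exists k, walk e k x y) -> walk e (path_dist e x y) x y.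
Proof.
move=> [k kP]; rewrite /path_dist; case: xgetP => [j _ []//|none].
have ex : exists k, `[< walk e k x y >] by exists k; apply/asboolP.
case: (ex_minnP ex) => m /asboolP mP mmin; case: (none m); split=> // l lP.
by apply/mmin/asboolP.
Qed.

(** * Mapping the cone over the join to a power of the free group *)

Section FreeGroupLegs.

(** The first generator, the second generator, and the inverse of the first; being distinct letters,
    they start geodesic rays that part at the identity. *)
Definition leg (j : 'I_3) : letter := (j == 1 :> nat, j == 2 :> nat).

Lemma leg_inj : injective leg.
Proof. by move=> [[|[|[|]]]] // ? [[|[|[|]]]] // ? _; apply: val_inj. Qed.

Lemma linv_neq (a : letter) : a != linv a.
Proof. by case: a => x [] /=; rewrite xpair_eqE andbF. Qed.

Lemma reduced_nseq k a : reduced (nseq k a).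
Proof. by case: k => [|k] //; elim: k => //= k; rewrite linv_neq. Qed.

Definition leg_word k j : F2 := exist (fun w => is_true (reduced w)) (nseq k (leg j)) (reduced_nseq k (leg j)).

Lemma push_nseq k l (a b : letter) : b != linv a ->
 foldr push (nseq l b) (nseq k a) = nseq k a ++ nseq l b.
Proof.
move=> ba; elim: k => //= k ->; case: k => /=; last by rewrite (negPf (linv_neq a)).
by case: l => //= l; rewrite (negPf ba).
Qed.

Lemma leg_wordD k l j : (leg_word k j * leg_word l j)%g = leg_word (k + l) j.
Proof. by apply: val_inj; rewrite /= push_nseq ?linv_neq // nseqD. Qed.

Lemma leg_word0 j : leg_word 0 j = 1%g.
Proof. exact: val_inj. Qed.

Lemma leg_word_dist k l j j' : j != j' ->
 size (val ((leg_word k j)^-1 * leg_word l j')%g) = (k + l)%N.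
Proof.
move=> jj'; have -> : val ((leg_word k j)^-1 * leg_word l j')%g = foldr push (nseq l (leg j')) (rev (map linv (nseq k
 (leg j)))) by [].
rewrite map_nseq rev_nseq push_nseq ?size_cat ?size_nseq //.
by rewrite linvK (inj_eq leg_inj) eq_sym.
Qed.

End FreeGroupLegs.

Section ObstructorMap.
Variables (R : realType) (n : nat) (S : seq (gpow F2 n)).
Hypotheses (n_gt0 : (0 < n)%N) (genS : generates S).
Notation K := (join3 n).
Notation wd := (word_dist S).
Implicit Types u w : lattice K.

Lemma lattice_leg u i : exists j k, forall j', val u (i, j') = if j' == j then k else 0%N.
Proof.
have /asboolP[s [_ Ks] us] := valP u.
have [[j uj]|none] := pselect (exists j, val u (i, j) != 0).
 exists j, (val u (i, j)) => j'; case: eqP => [->//|/eqP jj'].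
 by apply: (us); apply: contra jj' => ij'; apply/eqP; apply: Ks ij' _; apply: contraR uj => /us->.
exists ord0, 0 => j'; rewrite if_same; apply/eqP; apply: contrapT => /negP uj.
by apply: none; exists j'.
Qed.

(** In each block at most one factor is nontrivial, as a face has at most one vertex there. *)
Definition cword u : gpow F2 n :=
 [ffun i => (leg_word (val u (i, ord0)) ord0 * leg_word (val u (i, inord 1)) (inord 1) * leg_word (val u (i, inord 2))
  (inord 2))%g].

Lemma cword_leg u i j k : (forall j', val u (i, j') = if j' == j then k else 0%N) ->
 cword u i = leg_word k j.
Proof.
move=> uE; rewrite ffunE !uE.
have [e|[e|e]] : j = ord0 \/ j = inord 1 \/ j = inord 2.
 by case: j uE => [[|[|[|]]]] // ? _; [left|right; left|right; right]; apply: val_inj; rewrite /= ?inordK.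
- by rewrite e -!val_eqE /= !inordK //= !leg_word0 !mulg1.
- by rewrite e -!val_eqE /= !inordK //= !leg_word0 mulg1 mul1g.
- by rewrite e -!val_eqE /= !inordK //= !leg_word0 !mul1g.
Qed.

Lemma cword_ge u i j : (val u (i, j) <= size (val (cword u i)))%N.
Proof.
have [j0 [k uE]] := lattice_leg u i; rewrite (cword_leg uE) /= size_nseq uE.
by case: eqP.
Qed.

Lemma cword_proper : proper_discrete cword.
Proof.
move=> C fC; have [B BP] := nat_bound (fun g : gpow F2 n => \max_i size (val (g i))) fC.
apply: sub_finite_set (box_finite K B) => u /BP hu [i j].
apply: leq_trans (cword_ge u i j) _; apply: leq_trans hu; apply: leq_bigmax i.
Qed.

Definition leg_step (c : {ffun 'I_n -> option 'I_3}) : gpow F2 n :=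
 [ffun i => if c i is Some j then leg_word 1 j else 1%g].

Lemma below_step u w : below u w -> exists c, cword w = (cword u * leg_step c)%g.
Proof.
move=> /belowP uw.
have /choice[c cP] : forall i, exists c, cword w i = (cword u i * (if c is Some j then leg_word 1 j else 1))%g.
 move=> i; have [j [k uE]] := lattice_leg u i; have [j' [l wE]] := lattice_leg w i.
 rewrite (cword_leg uE) (cword_leg wE).
 have h v : (val u (i, v) <= val w (i, v) <= (val u (i, v)).+1)%N := uw (i, v).
 have [e|ne] := eqVneq j j'.
  have := h j; rewrite uE wE e eqxx => /andP[kl]; rewrite leq_eqVlt => /predU1P[lk|lk].
   by exists (Some j'); rewrite leg_wordD lk addn1.
  by exists None; rewrite mulg1; congr leg_word; apply/eqP; rewrite eqn_leq -ltnS lk.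
 have k0 : k = 0 by have := h j; rewrite uE wE eqxx (negPf ne) leqn0 => /andP[/eqP].
 have := h j'; rewrite uE wE eqxx eq_sym (negPf ne) k0 leg_word0 => /= l1.
 exists (if l == 0 then None else Some j'); move: l1; rewrite mul1g.
 by case: l {wE} => [|[|]] //= _; rewrite leg_word0.
exists (finfun c); apply/ffunP => i; rewrite cP.
by rewrite !ffunE.
Qed.

Lemma cword_step : exists L, forall u w, kfaces [fset u; w]%fset -> (wd (cword u) (cword w) <= L)%N.
Proof.
have [L LP] := @nat_bound {ffun 'I_n -> option 'I_3} setT (fun c => wd 1 (leg_step c)) finite_finset.
exists L => u w [_ uw]; have := uw u w; rewrite !inE !eqxx orbT => /(_ isT isT).
have h u' w' : below u' w' -> (wd (cword u') (cword w') <= L)%N.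
 by move=> /below_step[c ->]; have := LP c I; rewrite -(wdM genS (cword u')) mulg1.
by move=> /orP[/h//|/h]; rewrite wd_sym.
Qed.

(** Used to walk down to the origin: the vertex graph is connected, so [edge_dist] is never its
    default value. *)
Definition lattice_pred u : lattice K.
Proof.
exists [ffun v => (val u v).-1].
have /asboolP[s Ks us] := valP u; apply/asboolP; exists s => // v /us.
by rewrite ffunE => ->.
Defined.

Lemma kuhn_edge u w : below u w -> kfaces [fset u; w]%fset.
Proof.
move=> uw; split=> [|a b]; first by apply/fset0Pn; exists u; rewrite !inE eqxx.
by rewrite !inE => /orP[]/eqP-> /orP[]/eqP->; rewrite ?below_refl ?uw ?orbT.
Qed.

Lemma lattice_connected u w : exists k, walk (fun u w => faces (kuhn K) [fset u; w]%fset) k u w.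
Proof.
have es a b : faces (kuhn K) [fset a; b]%fset -> faces (kuhn K) [fset b; a]%fset.
 by rewrite fsetUC.
have down a : exists z k, walk (fun u w => faces (kuhn K) [fset u; w]%fset) k a z /\ forall v, val z v = 0.
 move: {2}(\sum_v val a v) (leqnn (\sum_v val a v)) => k; elim: k a => [|k IHk] a ak.
  exists a, 0; split=> // v; apply/eqP; rewrite -leqn0; apply: leq_trans ak.
  by rewrite (bigD1 v) //= leq_addr.
 have [[v av]|none] := pselect (exists v, val a v != 0); last first.
  exists a, 0; split=> // v; apply/eqP; apply: contrapT => /negP av.
  by apply: none; exists v.
 have [|z [l [lz z0]]] := IHk (lattice_pred a).
  rewrite -ltnS; apply: leq_trans ak; rewrite (bigD1 v) //= [X in (_ < X)%N](bigD1 v) //= -addSn.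
  apply: leq_add; first by rewrite ffunE prednK // lt0n.
  by apply: leq_sum => v' _; rewrite ffunE leq_pred.
 exists z, l.+1; split=> //; exists (lattice_pred a) => //.
 by apply/es/kuhn_edge/belowP => v' /=; rewrite ffunE leq_pred /=; case: (\val a v').
have [z [k [kz z0]]] := down u; have [z' [l [lz' z'0]]] := down w.
have zz' : z = z' by apply/val_inj/ffunP => v; rewrite z0.
exists (k + l); apply: walk_cat kz _; rewrite zz'; exact: walk_rev.
Qed.

Lemma cword_lipschitz : exists L : R, forall u w,
 (wd (cword u) (cword w))%:R <= L * (edge_dist (kuhn K) u w)%:R.
Proof.
have [L LP] := cword_step; exists L%:R => u w; rewrite -natrM ler_nat.
have := path_dist_walk (lattice_connected u w); rewrite -/(edge_dist (kuhn K) u w).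
move: (edge_dist _ _) => k; elim: k u => [|k IHk] u /=; first by move=> ->; rewrite wdxx.
move=> [z uz zw]; apply: leq_trans (wd_triangle genS (cword z) _ _) _.
rewrite mulnS; apply: leq_add; [exact: LP|exact: IHk].
Qed.

(** Disjoint faces use different legs in every block, so no cancellation occurs, and a bound on the
    distance bounds the coordinates of [u]; a finite set removed on one side is enough. *)
Lemma cword_expanding p0 : expanding S (@kuhn_map R _ K p0) cword.
Proof.
move=> s t Ks Kt /fdisjointP dst D D0.
pose cone0 s := [set u | subcone s (kuhn_map p0 (vertex_pt R (kuhn K) u))].
have [B BP] := nat_bound (fun g : gpow F2 n => \max_i size (val (g i))) (ball_finite genS 1 (Num.truncn D)).
exists (cone0 s `&` [set u : lattice K | forall v, (val u v <= B)%N]), set0; split.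
- by apply: sub_finite_set (box_finite K B) => [].
- by [].
- by [].
- by [].
move=> u w [us uB] [wt _]; rewrite ltNge; apply/negP => uwD.
apply: uB; split=> // -[i j].
have uw : (wd 1 ((cword u)^-1 * cword w) <= Num.truncn D)%N.
 by rewrite -(wdM genS (cword u)) mulg1 mulgA mulgV mul1g; rewrite -ltnS -(ltr_nat R); apply: le_lt_trans uwD _; have
  /andP[] := truncn_itv (ltW D0).
apply: leq_trans (BP _ uw); apply: leq_trans (leq_bigmax i).
rewrite [X in (_ <= size (val X))%N](_ : _ = ((cword u i)^-1 * cword w i)%g); last by rewrite !ffunE.
have [j0 [k uE]] := lattice_leg u i; have [j1 [l wE]] := lattice_leg w i.
rewrite (cword_leg uE) uE; case: eqP => [_|_] => //.
have [->//|k0] := posnP k.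
have [l0|l0] := posnP l.
 have -> : cword w i = leg_word 0 (if j0 == ord0 then inord 1 else ord0).
  by rewrite (cword_leg wE) l0 !leg_word0.
 rewrite leg_word_dist ?addn0 //; case: ifPn => // /eqP->; by rewrite -val_eqE /= inordK.
rewrite (cword_leg wE) leg_word_dist ?leq_addr //; apply/eqP => e.
have is_ : (i, j0) \in s.
 by apply: contraTT k0 => h; have := kuhn_vertex_subcone us h; rewrite uE eqxx => ->.
have it : (i, j0) \in t.
 by apply: contraTT l0 => h; have := kuhn_vertex_subcone wt h; rewrite wE e eqxx => ->.
by have := dst _ is_; rewrite it.
Qed.

Theorem free_power_obstructor : obstructor_maps_to R S n.-1.*2.
Proof.
pose p0 := vertex_pt R K (Ordinal n_gt0, ord0).
exists ('I_n * 'I_3)%type, K, (lattice K), (kuhn K), (kuhn_map p0), cword; split.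
- exact: join3_obstructor.
- exact: kuhn_cone_triangulation.
- exact: cword_proper.
- exact: cword_lipschitz.
- exact: cword_expanding.
Qed.

End ObstructorMap.

(** * Isometric actions and uniformly proper orbit maps *)

Lemma contr_sub R (X : topologicalType) (A A' B B' : set X) : A' `<=` A -> B `<=` B' -> contractible_in R A B ->
 contractible_in R A' B'.
Proof.
move=> AA BB [c [H [Bc cH HB HE]]]; exists c, H; split; first exact: BB.
- by apply: continuous_subspaceW cH => -[x t] [/AA].
- move=> x t /AA Ax t01; exact/BB/HB.
- move=> x /AA; exact: HE.
Qed.

Lemma compact_in_ball (R : realType) (W : metricType R) w0 (C : set W) : compact C -> exists p, C `<=` ball w0 p.
Proof.
move=> cC; apply: (compact_ind (P := fun A => exists p, A `<=` ball w0 p)) cC _ _ _ _.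
- by exists 0.
- by move=> A B [p Ap] [p' Bp]; exists (Num.max p p') => x; rewrite ballEmdist /= lt_max; move=> [/Ap|/Bp]; rewrite
 ballEmdist => ->; rewrite ?orbT.
- move=> A B AB [p Bp]; exists p; exact: subset_trans Bp.
- move=> x _; exists (ball x 1); first exact: nbhsx_ballx.
 exists (mdist w0 x + 1) => y; rewrite !ballEmdist => -[xy _].
 by apply: le_lt_trans (metric_triangle _ x _) _; rewrite ltrD2l.
Qed.

Section IsometricAction.
Variables (R : realType) (G : groupType) (S : seq G) (W : metricType R) (a : G -> W -> W) (d : nat).
Hypotheses (genS : generates S) (mW : manifold R d W) (cW : contractible R W).
Hypotheses (propW : proper_metric W) (pa : properly_discontinuous a).
Hypothesis iso : forall g x y, mdist (a g x) (a g y) = mdist x y.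

(** The orbit map of [w0] is the required map, and translation spreads the contractibility radii
    from [w0] to the whole orbit. *)
Lemma isometric_updim : updim_le R S d.
Proof.
have [w0 _] := cW; pose dd g := mdist w0 (a g w0).
have ddE g h : mdist (a g w0) (a h w0) = dd (g^-1 * h)%g.
 by rewrite -(iso g^-1) (actK pa) /dd; have [_ -> _] := pa.
have near r : finite_set [set g | dd g <= r].
 have [_ _ _ fa] := pa; have h := fa _ (@propW w0 `|r|); apply: (sub_finite_set _ h) => g gr.
 exists (a g w0); split; first by exists w0; rewrite //= mdistxx.
 exact: le_trans (ler_norm _).
(* The largest 1-Lipschitz function of the word length that is bounded by the displacement [dd].
   Preimages of compact sets are closed by continuity and bounded because few elements have small
   displacement. *)
pose phi t := inf [set dd g + `|t - (word_dist S 1 g)%:R| | g in setT].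
have dphi0 t : has_inf [set dd g + `|t - (word_dist S 1 g)%:R| | g in setT].
 split; first by exists (dd 1%g + `|t - (word_dist S 1 1)%:R|), 1%g.
 by exists 0 => _ [g _ <-]; rewrite addr_ge0 ?mdist_ge0.
have phi_le t g : phi t <= dd g + `|t - (word_dist S 1 g)%:R|.
 by apply: ge_inf; [exact: (dphi0 t).2|exists g].
have phi_ge0 t : 0 <= phi t.
 by apply: lb_le_inf; [exact: (dphi0 t).1|move=> _ [g _ <-]; rewrite addr_ge0 ?mdist_ge0].
have phi_lip t u : phi t <= phi u + `|t - u|.
 rewrite -lerBlDr; apply: lb_le_inf; first exact: (dphi0 u).1.
 move=> _ [g _ <-]; rewrite lerBlDr -addrA; apply: le_trans (phi_le t g) _; rewrite lerD2l addrC.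
 exact: ler_distD.
have phi_cont t : cont_at phi t.
 move=> U /nbhs_R[e e0 eU]; exists e => //= u tu; apply: eU.
 have := phi_lip t u; have := phi_lip u t; rewrite (distrC u t) ltr_distlC; move: tu; rewrite /ball /=.
 lra.
have [L LP] : exists L, forall s, s \in S -> dd s <= L.
 elim: (S) => [|s s' [L LP]]; first by exists 0.
 exists (Num.max (dd s) L) => s1; rewrite le_max => /predU1P[->|/LP ->]; rewrite ?lexx ?orbT //.
have step x y : cayley S x y -> mdist (a x w0) (a y w0) <= L.
 move=> [s sS [->|->]]; first by rewrite ddE mulgA mulVg mul1g LP.
 by rewrite metric_sym ddE mulgA mulVg mul1g LP.
exists W, (fun g => a g w0).
have /choice[rho rhoP] : forall r, exists p, 0 < r -> 0 < p /\ contractible_in R (ball w0 r) (ball w0 p).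
 move=> r; have [C [cC AC]] := contr_compact cW (@propW w0 r).
 have [p CP] := compact_in_ball w0 cC.
 exists (Num.max p 1) => r0; split; first by rewrite lt_max ltr01 orbT.
 apply: contr_sub AC; first by move=> x; rewrite ballEmdist => /ltW.
 by move=> x /CP; rewrite !ballEmdist /= lt_max => ->.
exists rho; split=> //.
- exists L => x y; have := wd_walk genS x y; move: (word_dist S x y) => k.
 elim: k x => [|k IHk] x /=; first by move=> ->; rewrite mdistxx mulr0.
 move=> [z xz zy]; apply: le_trans (metric_triangle _ (a z w0) _) _.
 rewrite -natr1 mulrDr mulr1 addrC; apply: lerD; [exact: IHk|exact: step].
- split.
  move=> C cC; have [_ _ _ fa] := pa.
  have h := fa _ (compactU cC (compact_set1 (x := w0))); apply: (sub_finite_set _ h) => g Cg.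
  by exists (a g w0); split; [exists w0 => //; right|left].
 exists phi; last first.
  by move=> x y; rewrite ddE -(wdM genS x^-1) mulVg; have := phi_le (word_dist S 1 (x^-1 * y))%:R (x^-1 * y)%g; rewrite
   subrr normr0 addr0.
 split=> // C _ cC; have [M [_ CM]] := compact_bounded cC.
 have {CM} CM c : C c -> c <= M + 1.
  move=> Cc; apply: le_trans (ler_norm c) _; apply: CM Cc; by rewrite ltrDl.
 have [D DP] := nat_bound (word_dist S 1) (near (M + 2)).
 apply: (@subclosed_compact _ _ `[0, D%:R + (M + 2)]%classic); last first.
 + move=> t [/= t0 /CM phit]; rewrite !in_itv /= in t0 *.
  have [_ [g _ <-]] := inf_adherent ltr01 (dphi0 t); rewrite -/(phi t) => gt.
  have h : dd g + `|t - (word_dist S 1 g)%:R| <= M + 2 by move: phit; lra.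
  have gM : dd g <= M + 2 by apply: le_trans h; rewrite lerDl.
  have := DP g gM; rewrite -(ler_nat R) => gD.
  have := ler_norm (t - (word_dist S 1 g)%:R); have := mdist_ge0 w0 (a g w0).
  move: h gD; rewrite /dd; lra.
 + exact: segment_compact.
 + apply: closedI; first exact: interval_closed.
  apply: preimage_closed; [move=> t _; exact: phi_cont|exact: compact_closed (@Rhausdorff R) cC].
- move=> r r0; have [rr cr] := rhoP r r0; split=> // x.
 have ballE p : a x @` ball w0 p = ball (a x w0) p.
  apply/seteqP; split=> [z [y wy <-]|y]; first by move: wy; rewrite !ballEmdist /= iso.
  by rewrite ballEmdist => xy; exists (a x^-1 y); last exact: (actKV pa); rewrite ballEmdist /= -(iso x) (actKV pa).
 rewrite -!ballE; exact: contr_translate.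
Qed.

End IsometricAction.

Section StandardGenerators.
Variables (n : nat) (S : seq (gpow F2 n)).
Hypothesis genS : generates S.
Implicit Types g : gpow F2 n.

Definition lword (b : letter) : F2 := exist (fun w => is_true (reduced w)) [:: b] isT.

Definition stdgen (i : 'I_n) (b : letter) : gpow F2 n :=
 [ffun j => if j == i then lword b else 1%g].

Lemma stdgen_bound : exists L, forall i b, (word_dist S 1%g (stdgen i b) <= L)%N.
Proof.
have [L LP] := @nat_bound ('I_n * (bool * bool)) setT (fun p => word_dist S 1 (stdgen p.1 p.2)) finite_finset.
by exists L => i b; exact: (LP (i, b)).
Qed.

(** Peeling off the first letter of one coordinate bounds the length with respect to [S] by a
    multiple of the total length of the coordinates. *)
Lemma size_ball B : finite_set [set g : gpow F2 n | forall i, (size (val (g i)) <= B)%N].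
Proof.
have [L LP] := stdgen_bound.
have bound g : (word_dist S 1 g <= L * \sum_i size (val (g i)))%N.
 move: {2}(\sum_i size (val (g i))) (erefl (\sum_i size (val (g i)))) => k.
 elim: k g => [|k IHk] g gk.
  have -> : g = 1%g; last by rewrite wdxx.
  apply/ffunP => i; rewrite ffunE; apply/val_inj/size0nil/eqP.
  by rewrite -leqn0 -gk (bigD1 i) //= leq_addr.
 have [i gi] : exists i, val (g i) != [::].
  apply: contrapT => no; move: gk; rewrite big1 // => i _; apply/eqP; rewrite size_eq0.
  by apply: contrapT => /negP gi; apply: no; exists i.
 case gE : (val (g i)) gi => [//|b w] _.
 have rw : reduced w by have := valP (g i); rewrite gE => /path_sorted.
 pose w' := exist (fun w => is_true (reduced w)) w rw.
 pose g' := [ffun j => if j == i then w' else g j].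
 have gg : g = (stdgen i b * g')%g.
  apply/ffunP => j; rewrite !ffunE; case: eqP => [->|_]; last by rewrite mul1g.
  apply: val_inj; rewrite gE /=; have := valP (g i); rewrite gE.
  by case: (w) => //= c w0 /andP[/negPf->].
 have g'k : (\sum_j size (val (g' j))) = k.
  apply/eqP; rewrite -eqSS -gk (bigD1 i) //= [X in _ == X](bigD1 i) //= gE ffunE eqxx.
  by apply/eqP; congr (_.+1 + _); apply: eq_bigr => j /negPf ji; rewrite ffunE ji.
 apply: leq_trans (wd_triangle genS (stdgen i b) _ _) _.
 rewrite gk mulnS leq_add // {1}gg -{1}[stdgen i b]mulg1 (wdM genS) -g'k.
 exact: IHk.
apply: sub_finite_set (ball_finite genS 1 (L * (n * B))) => g gB.
apply: leq_trans (bound g) _; rewrite leq_mul2l; apply/orP; right.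
apply: leq_trans (leq_sum _ (fun i _ => gB i)) _.
by rewrite sum_nat_const card_ord.
Qed.

End StandardGenerators.

(** * The free group acting on a plane of quadratic forms *)

Section QuadraticForms.
Variable R : realType.
Notation vec := (R * R)%type.
Implicit Types (v : vec) (b : letter) (x : vec).

(* The point [t + i e^(-s)] of the upper half plane, seen as a positive definite
  binary quadratic form of determinant 1. *)
Definition form x v : R := expR x.1 * (v.1 + x.2 * v.2) ^+ 2 + (expR x.1)^-1 * v.2 ^+ 2.

Lemma form_gt0 x v : v != 0 -> 0 < form x v.
Proof.
case: v => v1 v2 v0; rewrite /form /=; have e0 := expR_gt0 x.1; have i0 : 0 < (expR x.1)^-1 by rewrite invr_gt0.
have [v20|v20] := eqVneq v2 0; last first.
 by apply: ltr_wpDl; [apply: mulr_ge0; [exact: ltW|exact: sqr_ge0]|rewrite mulr_gt0 // exprn_even_gt0].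
rewrite v20 mulr0 addr0 expr0n mulr0 addr0 mulr_gt0 // exprn_even_gt0 //=.
by apply: contraNneq v0 => ->; rewrite v20.
Qed.

(** An explicit bound on the ratio of the forms at [y] and [x]; its continuity and its value 1 on
    the diagonal serve to compare topologies. *)
Definition distort x y : R :=
 expR `|y.1 - x.1| * (1 + `|(y.2 - x.2) * expR x.1| + ((y.2 - x.2) * expR x.1) ^+ 2).

Lemma form_distort x y v : form y v <= distort x y * form x v.
Proof.
rewrite /form /distort; set p := expR x.1; have p0 : 0 < p := expR_gt0 _.
set q := expR y.1; set F := expR `|_|.
have Fp : q <= F * p by rewrite -expRD ler_expR; have := ler_norm (y.1 - x.1); lra.
have Fi : q^-1 <= F * p^-1.
 by rewrite -!expRN -expRD ler_expR; have := ler_norm (x.1 - y.1); rewrite distrC; lra.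
have F0 : 0 < F := expR_gt0 _; set d := (y.2 - x.2) * p; set A := v.1 + x.2 * v.2; set B := v.2.
have -> : v.1 + y.2 * v.2 = A + d * p^-1 * B by rewrite /A mulfK ?gt_eqF //; ring.
apply: le_trans (_ : F * p * (A + d * p^-1 * B) ^+ 2 + F * p^-1 * B ^+ 2 <= _).
 by apply: lerD; apply: ler_wpM2r => //; exact: sqr_ge0.
have -> : F * p * (A + d * p^-1 * B) ^+ 2 + F * p^-1 * B ^+ 2 =
  F * (p * A ^+ 2 + 2 * (d * (A * B)) + (d ^+ 2 + 1) * (p^-1 * B ^+ 2)).
 by field; rewrite gt_eqF.
have AB : 2 * `|A * B| <= p * A ^+ 2 + p^-1 * B ^+ 2.
 rewrite -subr_ge0; have -> : p * A ^+ 2 + p^-1 * B ^+ 2 - 2 * `|A * B| = p^-1 * (p * `|A| - `|B|) ^+ 2.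
  by rewrite normrM -(real_normK (num_real A)) -(real_normK (num_real B)); field; rewrite gt_eqF.
 by apply: mulr_ge0; [rewrite invr_ge0 ltW|exact: sqr_ge0].
have dAB : d * (A * B) <= `|d| * `|A * B| by rewrite -normrM ler_norm.
have A0 : 0 <= p * A ^+ 2 by rewrite mulr_ge0 ?sqr_ge0 ?ltW.
have := ler_wpM2l (normr_ge0 d) AB; have := mulr_ge0 (sqr_ge0 d) A0.
by move: (p * A ^+ 2) (p^-1 * B ^+ 2) (d ^+ 2) `|A * B| (d * (A * B)) dAB => *; nra.
Qed.

Lemma distort_ge1 x y : 1 <= distort x y.
Proof.
rewrite /distort; have : 1 <= expR `|y.1 - x.1| by rewrite -expR0 ler_expR.
have := normr_ge0 ((y.2 - x.2) * expR x.1); have := sqr_ge0 ((y.2 - x.2) * expR x.1).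
by move: (expR `|_|) (`|_ _|) (_ 2) => *; nra.
Qed.

Definition form_gap x y v : R := `|ln (form x v) - ln (form y v)|.

Lemma form_gap_le x y v : v != 0 -> form_gap x y v <= ln (distort x y) + ln (distort y x).
Proof.
move=> v0; have h p q : ln (form q v) - ln (form p v) <= ln (distort p q).
 have d0 : 0 < distort p q by apply: lt_le_trans (distort_ge1 _ _).
 have f0 := form_gt0 p v0; rewrite lerBlDr -lnM ?posrE //.
 by rewrite ler_ln ?posrE ?form_gt0 ?(mulr_gt0 d0) // form_distort.
have l0 p q : 0 <= ln (distort p q) by rewrite ln_ge0 // distort_ge1.
rewrite ler_norml; have := h x y; have := h y x; have := l0 x y; have := l0 y x.
by move: (ln (distort x y)) (ln (distort y x)) (ln (form x v)) (ln (form y v)) => *; lra.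
Qed.

Lemma form10 x : form x (1, 0) = expR x.1.
Proof. by rewrite /form !mulr0 addr0 expr1n mulr1 expr0n mulr0 addr0. Qed.

Lemma form_diff x : x.2 = (form x (1, 1) - form x (1, 0) - form x (0, 1)) / form x (1, 0) / 2.
Proof. by rewrite /form /=; field; rewrite gt_eqF ?expR_gt0. Qed.

Lemma form_inj x y : (forall v, v != 0 -> form x v = form y v) -> x = y.
Proof.
have n0 : ((1, 0) : vec) != 0 by rewrite xpair_eqE oner_eq0.
have n1 : ((0, 1) : vec) != 0 by rewrite xpair_eqE oner_eq0 andbF.
have n2 : ((1, 1) : vec) != 0 by rewrite oner_eq0.
move=> h; have h2 : x.2 = y.2 by rewrite form_diff (form_diff y) !h.
by have := h _ n0; rewrite !form10 => /expR_inj h1; case: x y h1 h2 {h} => ? ? [? ?] /= -> ->.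
Qed.

Definition sgn (b : bool) : R := if b then -1 else 1.

(** Unipotent matrices with off-diagonal entry 3: then the coordinate just changed is at least twice
    the other one in absolute value, from the starting vector [(1, 1)] on, as the ping-pong
    requires. *)
Definition shear b v : vec :=
 if b.1 then (v.1, v.2 + 3 * sgn b.2 * v.1) else (v.1 + 3 * sgn b.2 * v.2, v.2).

(** Substitution of [shear b] into the form, written in the coordinates of the half plane. *)
Definition letter_act b x : vec :=
 if b.1 then let p := form x (1, 3 * sgn b.2) in
  (ln p, (x.2 * expR x.1 + 3 * sgn b.2 * ((expR x.1)^-1 + x.2 ^+ 2 * expR x.1)) / p)
 else (x.1, x.2 + 3 * sgn b.2).

Lemma form_letter_act b x v : form (letter_act b x) v = form x (shear b v).
Proof.
case: b => [[] e]; rewrite /letter_act /=; last first.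
 by rewrite /form /=; ring.
set p := form x (1, _); have p0 : 0 < p by apply: form_gt0; apply/eqP => -[/eqP]; rewrite oner_eq0.
rewrite {1}/form lnK //; move: p0; rewrite /p /form /=.
have := expR_gt0 x.1; move: (expR x.1) (x.2) (3 * sgn e) => P t k P0.
move=> p0; have := mulr_gt0 P0 p0; rewrite mulrDr mulVKf ?gt_eqF // => p1; field.
by rewrite (gt_eqF P0) mulrAC -mulrA gt_eqF.
Qed.

Lemma linv_shear b v : shear (linv b) (shear b v) = v.
Proof. by case: b v => [[] []] [x y]; rewrite /shear /=; congr (_, _); ring. Qed.

Lemma shear_neq0 b v : v != 0 -> shear b v != 0.
Proof.
apply: contra => /eqP sv; rewrite -(linv_shear b v) sv /shear /=.
by case: b.1; rewrite !mulr0 addr0.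
Qed.

Definition word_shear (w : seq letter) v := foldl (fun v b => shear b v) v w.
Definition word_act (w : seq letter) x := foldr letter_act x w.

Lemma form_word_act w x v : form (word_act w x) v = form x (word_shear w v).
Proof. by elim: w v => //= b w IHw v; rewrite form_letter_act. Qed.

Lemma word_shear_neq0 w v : v != 0 -> word_shear w v != 0.
Proof. by elim: w v => //= b w IHw v v0; apply/IHw/shear_neq0. Qed.

Lemma word_act_mul (g h : F2) x : word_act (val (g * h)%g) x = word_act (val g) (word_act (val h) x).
Proof.
rewrite /=; elim: (val g) => //= b u <-; move: (foldr push _ u) => [|c w] //=.
case: eqP => [->|] //=; apply: form_inj => v _; rewrite !form_letter_act.
by rewrite linv_shear.
Qed.

(* Ping-pong: the coordinate just changed dominates the other one. *)
Lemma word_shear_growth w : reduced w -> (size w)%:R <= form (0, 0) (word_shear w (1, 1)).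
Proof.
pose hi b v := if b.1 then v.2 else v.1; pose lo b v : R := if b.1 then v.1 else v.2.
pose P b v := sgn b.2 * (hi b v * lo b v).
pose inv k b v := [/\ 0 < P b v, 2 * P b v <= hi b v ^+ 2, 1 <= lo b v ^+ 2 & k%:R + 1 <= hi b v ^+ 2].
have form0 v : form (0, 0) v = v.1 ^+ 2 + v.2 ^+ 2.
 by rewrite /form expR0 invr1 mul0r addr0 !mul1r.
have hi_le b v : hi b v ^+ 2 <= form (0, 0) v.
 by rewrite form0 /hi; case: b.1; rewrite ?lerDl ?lerDr sqr_ge0.
have step k b c v : c != linv b -> inv k b v -> inv k.+1 c (shear c v).
 rewrite /inv /P /hi /lo /shear /linv -natr1; have k0 : 0 <= k%:R :> R by [].
 case: b c v => [[] []] [[] []] [p q] //= _ [] *; split; nra.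
have main k b v u : path (fun a b => b != linv a) b u -> inv k b v ->
  (k + size u)%:R <= form (0, 0) (word_shear u v).
 elim: u k b v => [|c u IHu] k b v /=.
  by move=> _ [_ _ _ kh]; apply: le_trans (hi_le b v); lra.
 by move=> /andP[cb uP] iv; rewrite addnS -addSn; apply: (IHu _ c) => //; apply: step iv.
case: w => [|b w] rw; first by rewrite form0 addr_ge0 ?sqr_ge0.
by apply: (main 1 b) => //; case: b {rw} => [[] []]; rewrite /inv /P /hi /lo /=; split; lra.
Qed.

End QuadraticForms.

Definition half_planes (R : realType) (n : nat) : Type := 'rV[R]_(n + n).
HB.instance Definition _ R n := Choice.on (half_planes R n).

Section HalfPlanes.
Variables (R : realType) (n : nat).
Notation W := (half_planes R n).
Notation vec := (R * R)%type.
Implicit Types (x y z : W) (i : 'I_n) (v : vec).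

Definition plane_pt x i : vec := (x 0 (lshift n i), x 0 (rshift n i)).

Definition gaps x y : set R :=
 [set r | r = 0 \/ exists i v, v != 0 /\ r = form_gap (plane_pt x i) (plane_pt y i) v].

(* The displacement of positive definite forms, as in Thompson's metric. *)
Definition pdist x y : R := sup (gaps x y).

Definition distorts x y : R :=
 \sum_i (ln (distort (plane_pt x i) (plane_pt y i)) + ln (distort (plane_pt y i) (plane_pt x i))).

Lemma pdist_le x y C : 0 <= C ->
 (forall i v, v != 0 -> form_gap (plane_pt x i) (plane_pt y i) v <= C) -> pdist x y <= C.
Proof.
move=> C0 xy; apply: ge_sup; first by exists 0; left.
by move=> _ [->|[i [v [v0 ->]]]]; last exact: xy.
Qed.

Lemma gap_le_distorts x y i v : v != 0 -> form_gap (plane_pt x i) (plane_pt y i) v <= distorts x y.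
Proof.
move=> v0; apply: le_trans (form_gap_le _ _ v0) _; rewrite /distorts (bigD1 i) //= lerDl.
by apply: sumr_ge0 => j _; rewrite addr_ge0 ?ln_ge0 ?distort_ge1.
Qed.

Lemma distorts_ge0 x y : 0 <= distorts x y.
Proof. by apply: sumr_ge0 => j _; rewrite addr_ge0 ?ln_ge0 ?distort_ge1. Qed.

Lemma gaps_sup x y : has_sup (gaps x y).
Proof.
split; first by exists 0; left.
exists (distorts x y) => _ [->|[i [v [v0 ->]]]]; [exact: distorts_ge0|exact: gap_le_distorts].
Qed.

Lemma gap_le_dist x y i v : v != 0 -> form_gap (plane_pt x i) (plane_pt y i) v <= pdist x y.
Proof. by move=> v0; apply: ub_le_sup; [exact: (gaps_sup x y).2|right; exists i, v]. Qed.

Lemma pdist_ge0 x y : 0 <= pdist x y.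
Proof. by apply: ub_le_sup; [exact: (gaps_sup x y).2|left]. Qed.

Lemma pdistxx x : pdist x x = 0.
Proof.
by apply/eqP; rewrite eq_le pdist_ge0 pdist_le // => i v _; rewrite /form_gap subrr normr0.
Qed.

Lemma pdist_eq0 x y : pdist x y = 0 -> x = y.
Proof.
move=> xy0; apply/rowP => j; have xy i : plane_pt x i = plane_pt y i.
 apply: form_inj => v v0; have := gap_le_dist x y i v0; rewrite xy0 normr_le0 subr_eq0 => /eqP.
 by apply: ln_inj; rewrite posrE form_gt0.
by case: (split_ordP j) => i ->; have [] := xy i.
Qed.

Lemma pdistC x y : pdist x y = pdist y x.
Proof.
suff h x' y' : pdist x' y' <= pdist y' x' by apply/eqP; rewrite eq_le !h.
apply: pdist_le (pdist_ge0 _ _) _ => i v0; rewrite /form_gap distrC.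
exact: gap_le_dist.
Qed.

Lemma pdist_triangle y x z : pdist x z <= pdist x y + pdist y z.
Proof.
apply: pdist_le => [|i v v0]; first by rewrite addr_ge0 ?pdist_ge0.
by apply: le_trans (ler_distD (ln (form (plane_pt y i) v)) _ _) _; apply: lerD; exact: gap_le_dist.
Qed.

HB.instance Definition _ :=
 isMetric.Build R W pdistxx pdist_eq0 pdistC pdist_triangle.

Definition of_row (x : 'rV[R]_(n + n)) : W := x.
Definition to_row x : 'rV[R]_(n + n) := x.

(** The metric is bounded by [distorts], which is continuous and vanishes on the diagonal. *)
Lemma of_row_cont (x : 'rV[R]_(n + n)) : cont_at of_row x.
Proof.
move=> U /nbhs_ballP[e e0 eU].
have cp : forall i, cont_at (fun y : 'rV[R]_(n + n) => plane_pt y i) x.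
 by move=> i; apply: cont_pair.
have expc (f : 'rV[R]_(n + n) -> R) : cont_at f x -> cont_at (fun y : 'rV[R]_(n + n) => expR (f y)) x.
 by move=> cf; apply: (cont_comp cf); exact: continuous_expR.
have dc (p q : 'rV[R]_(n + n) -> vec) : cont_at p x -> cont_at q x ->
  cont_at (fun y : 'rV[R]_(n + n) => ln (distort (p y) (q y))) x.
 move=> cp' cq; have c1 (f : 'rV[R]_(n + n) -> vec) : cont_at f x -> cont_at (fun y : 'rV[R]_(n + n) => (f y).1) x.
  by move=> cf; apply: (cont_comp cf).
 have c2 (f : 'rV[R]_(n + n) -> vec) : cont_at f x -> cont_at (fun y : 'rV[R]_(n + n) => (f y).2) x.
  by move=> cf; apply: (cont_comp cf).
 apply: cont_comp; last by apply: continuous_ln; apply: lt_le_trans (distort_ge1 _ _).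
 have c3 : cont_at (fun y : 'rV[R]_(n + n) => ((q y).2 - (p y).2) * expR (p y).1) x.
  by apply: cont_atM; [apply: cont_atB; exact: c2|apply/expc/c1].
 apply: cont_atM; first by apply/expc/cont_norm/cont_atB; exact: c1.
 by apply: cont_atD; [apply: cont_atD; [exact: cont_cst|exact: cont_norm]|exact: cont_atM].
have : nbhs x [set y : 'rV[R]_(n + n) | distorts (x : W) (y : W) < e].
 apply: cont_lt; [|exact: cont_cst|].
  by apply: cont_sum => i; apply: cont_atD; apply: dc => //.
 rewrite /distorts big1 // => i _; rewrite /distort !subrr mul0r normr0 expr0n expR0.
 by rewrite !addr0 mul1r ln1 addr0.
apply: filterS => y xy; apply: eU; apply: le_lt_trans xy.
by apply: pdist_le (distorts_ge0 _ _) _ => v0; exact: gap_le_distorts.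
Qed.

(** The coordinates are recovered from the values of the forms at [(1, 0)], [(0, 1)] and [(1, 1)],
    which vary continuously with the metric. *)
Lemma to_row_cont x : cont_at to_row x.
Proof.
have fc i v : v != 0 -> cont_at (fun y => form (plane_pt y i) v) x.
 move=> v0; have fE : (fun y => form (plane_pt y i) v) = fun y => expR (ln (form (plane_pt y i) v)).
  by apply/funext => y; rewrite lnK // posrE form_gt0.
 rewrite fE; apply: cont_comp; last exact: continuous_expR.
 move=> U /nbhs_R[e e0 eU]; apply/nbhs_ballP; exists e => //= y; rewrite ballEmdist => xy.
 by apply: eU; apply: le_lt_trans xy; exact: gap_le_dist.
have n0 : ((1, 0) : vec) != 0 by rewrite xpair_eqE oner_eq0.
have n1 : ((0, 1) : vec) != 0 by rewrite xpair_eqE oner_eq0 andbF.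
have n2 : ((1, 1) : vec) != 0 by rewrite oner_eq0.
apply: cont_row => j; case: (split_ordP j) => i ->.
 have -> : (fun y => to_row y 0 (lshift n i)) = fun y => ln (form (plane_pt y i) (1, 0)).
  by apply/funext => y; rewrite form10 expRK.
 by apply: cont_comp; [exact: fc|apply: continuous_ln; rewrite form_gt0].
have -> : (fun y => to_row y 0 (rshift n i)) = fun y => (form (plane_pt y i) (1, 1) - form (plane_pt y i) (1, 0) - form
 (plane_pt y i) (0, 1)) / form (plane_pt y i) (1, 0) / 2.
 by apply/funext => y; rewrite -form_diff.
apply: cont_atM; last exact: cont_cst.
apply: cont_atM; last by apply: cont_inv; [rewrite gt_eqF ?form_gt0|exact: fc].
by do 2 (apply: cont_atB; last exact: fc); exact: fc.
Qed.

Lemma plane_manifold : manifold R (n + n) W.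
Proof.
split; first exact: metric_hausdorff.
 have [B cB [oB bB]] := @rV_second_countable R (n + n).
 exists ((fun A => to_row @^-1` A) @` B); first exact: sub_countable (card_image_le _ _) cB.
 split=> [_ [A BA <-]|x U xU].
  by apply: open_comp (oB _ BA) => y _; exact: to_row_cont.
 have [A [BA Ax] AU] := bB (to_row x) _ (of_row_cont xU).
 by exists (to_row @^-1` A) => //; split=> //; exists A.
move=> x; exists setT, setT; split=> //; [exact: openT|exact: openT|].
exists (fun z : setT => exist _ (to_row (set_val z)) (mem_set I)); split.
 move=> z P /st_nbhs[V Vz VP]; apply/st_nbhs.
 by exists (to_row @^-1` V); [exact: to_row_cont|move=> z' Vz'; exact: VP].
exists (fun z : setT => exist _ (of_row (set_val z)) (mem_set I)); split; try by move=> z; apply: val_inj.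
move=> z P /st_nbhs[V Vz VP]; apply/st_nbhs.
by exists (of_row @^-1` V); [exact: of_row_cont|move=> z' Vz'; exact: VP].
Qed.

Lemma plane_contractible : contractible R W.
Proof.
exists (of_row 0), (fun p => ((1 - p.2) *: p.1)); split=> //; last first.
 by move=> x /=; rewrite subr0 scale1r subrr scale0r.
apply: continuous_subspaceT => p.
suff h : cont_at (fun p : W * R => of_row ((1 - p.2) *: to_row p.1)) p by exact: h.
apply: cont_comp; last exact: of_row_cont.
apply: cont_atZ; first by apply: cont_atB.
by apply: (cont_comp); [exact: cont_fst|exact: to_row_cont].
Qed.

(** A bound on the distance bounds the form at [(1, 0)], whose logarithm is the first coordinate,
    and the form at [(0, 1)], which then bounds the second. *)
Lemma plane_proper : proper_metric W.
Proof.
move=> x r; pose A := to_row @` [set y | mdist x y <= r].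
have -> : [set y | mdist x y <= r] = of_row @` A.
 by apply/seteqP; split=> [y xy|_ [_ [y xy <-] <-]] //; exists (to_row y) => //; exists y.
apply: continuous_compact; first by apply: continuous_subspaceT => y; exact: of_row_cont.
have mc y : cont_at (fun y : 'rV[R]_(n + n) => mdist x (of_row y)) y.
 apply: (cont_comp); first exact: of_row_cont.
 move=> U /nbhs_R[e e0 eU]; apply/nbhs_ballP; exists e => //= z; rewrite ballEmdist => yz.
 apply: eU; apply: le_lt_trans yz; have := metric_triangle x (of_row y) z.
 have := metric_triangle x z (of_row y); rewrite (metric_sym z) ler_norml.
 by move: (mdist _) (mdist z) (mdist z) => *; lra.
pose B i := `|(plane_pt x i).1| + `|r| + (1 + expR r * form (plane_pt x i) (0, 1) * expR (r - (plane_pt x i).1)).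
have n0 : ((1, 0) : vec) != 0 by rewrite xpair_eqE oner_eq0.
have n1 : ((0, 1) : vec) != 0 by rewrite xpair_eqE oner_eq0 andbF.
have B2 i : 0 <= expR r * form (plane_pt x i) (0, 1) * expR (r - (plane_pt x i).1).
 by rewrite !mulr_ge0 // ltW ?form_gt0.
have B0 i : 0 <= B i by rewrite ?addr_ge0.
apply: (@bounded_compact _ _ _ (\sum_i B i)).
 have -> : A = [set y | mdist x (of_row y) <= r].
  by apply/seteqP; split=> [_ [y xy <-] //|y xy]; exists (of_row y).
 by apply: closed_le => y.
move=> _ [y xy <-] /=; apply: norm_le_co; first by apply: sumr_ge0.
have gap i v : v != 0 -> `|ln (form (plane_pt x i) v) - ln (form (plane_pt y i) v)| <= r.
 by move=> v0; apply: le_trans xy; exact: gap_le_dist.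
have yB i : `|(plane_pt y i).1| <= B i /\ `|(plane_pt y i).2| <= B i.
 have := gap i _ n0; rewrite !form10 !expRK => g1; have := gap i _ n1; rewrite ler_norml => /andP[g2 _].
 have {g2} g2 : form (plane_pt y i) (0, 1) <= expR r * form (plane_pt x i) (0, 1).
  rewrite -ler_ln ?posrE ?mulr_gt0 ?expR_gt0 ?form_gt0 // lnM ?posrE ?expR_gt0 ?form_gt0 // expRK.
  by move: g2; lra.
 split; first by rewrite /B; have := B2 i; have := ler_norm r; have := ler_norm (plane_pt x i).1; have := ler_norm (-
  (plane_pt x i).1); move: g1; rewrite normrN !ler_norml; lra.
 have h : (plane_pt y i).2 ^+ 2 <= expR r * form (plane_pt x i) (0, 1) * expR (r - (plane_pt x i).1).
  rewrite -(ler_pM2l (expR_gt0 (plane_pt y i).1)).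
  have f1 : expR (plane_pt y i).1 * (plane_pt y i).2 ^+ 2 <= form (plane_pt y i) (0, 1).
   by rewrite /form /= add0r mulr1 lerDl.
  apply: le_trans f1 (le_trans g2 _); rewrite mulrCA ler_peMr //; first by rewrite mulr_ge0 // ltW ?form_gt0.
  by rewrite -expRD -expR0 ler_expR; move: g1; rewrite ler_norml => /andP[]; lra.
 have := normr_ge0 (plane_pt x i).1; have := normr_ge0 r; rewrite /B; move: h; rewrite -real_normK ?num_real //.
 by have := normr_ge0 (plane_pt y i).2; nra.
have BS i : B i <= \sum_i B i by rewrite (bigD1 i) //= lerDl sumr_ge0.
by move=> j; case: (split_ordP j) => i ->; apply: le_trans (BS i); have [] := yB i.
Qed.

End HalfPlanes.

Section Action.
Variables (R : realType) (n : nat).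
Notation W := (half_planes R n).
Implicit Types (g : gpow F2 n) (x y : W).

Definition pact g x : W :=
 of_row (row_mx (\row_i (word_act (val (g i)) (plane_pt x i)).1) (\row_i (word_act (val (g i)) (plane_pt x i)).2)).

Lemma plane_pt_act g x i : plane_pt (pact g x) i = word_act (val (g i)) (plane_pt x i).
Proof. by rewrite /plane_pt row_mxEl row_mxEr !mxE; case: word_act. Qed.

Lemma plane_pt_inj x y : (forall i, plane_pt x i = plane_pt y i) -> x = y.
Proof. by move=> xy; apply/rowP => j; case: (split_ordP j) => i ->; have [] := xy i. Qed.

Lemma pact1 x : pact 1%g x = x.
Proof. by apply: plane_pt_inj => i; rewrite plane_pt_act ffunE. Qed.

Lemma pactM g h x : pact (g * h)%g x = pact g (pact h x).
Proof. by apply: plane_pt_inj => i; rewrite !plane_pt_act ffunE word_act_mul. Qed.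

Lemma pact_iso g x y : mdist (pact g x) (pact g y) = mdist x y.
Proof.
have le g' x' y' : mdist (pact g' x') (pact g' y') <= mdist x' y'.
 apply: pdist_le => [|i v v0]; first exact: pdist_ge0.
 by rewrite !plane_pt_act /form_gap !form_word_act; apply/gap_le_dist/word_shear_neq0.
apply/eqP; rewrite eq_le le /=; have := le g^-1%g (pact g x) (pact g y).
by rewrite -!pactM mulVg !pact1.
Qed.

(** If a bounded point is moved to a bounded point, the form at [(1, 1)] stays bounded, hence so
    does the word length, by [word_shear_growth]. *)
Lemma pact_discontinuous (S : seq (gpow F2 n)) : generates S -> properly_discontinuous pact.
Proof.
move=> genS; split; [exact: pact1|exact: pactM|move=> g x|move=> C cC].
 move=> U /nbhs_ballP[e e0 eU]; apply/nbhs_ballP; exists e => //= y xy; apply: eU.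
 by move: xy; rewrite !ballEmdist /= pact_iso.
pose o : W := of_row 0; have [p Cp] := compact_in_ball o cC.
apply: (sub_finite_set _ (size_ball genS (Num.truncn (2 * expR (p + p))))) => g [_ [[x Cx <-] Cgx]] i.
have n2 : ((1, 1) : R * R) != 0 by rewrite oner_eq0.
have gap : form_gap (plane_pt (pact g o) i) (plane_pt o i) (1, 1) <= p + p.
 apply: le_trans (gap_le_dist _ _ _ n2) _; apply: le_trans (metric_triangle (pact g o : W) (pact g x) o) _.
 rewrite pact_iso (metric_sym _ o); apply: lerD; apply: ltW.
  by have := Cp _ Cx.
 by have := Cp _ Cgx.
have r0 := word_shear_neq0 (val (g i)) n2; have o0 : plane_pt o i = (0, 0) by rewrite /plane_pt /o /of_row !mxE.
move: gap; rewrite plane_pt_act /form_gap form_word_act o0 ler_norml => /andP[_].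
have -> : form (0, 0) (1, 1) = 2 :> R by rewrite /form expR0 invr1 mul0r addr0 !expr1n !mulr1.
rewrite lerBlDr -ler_expR expRD !lnK ?posrE ?form_gt0 // mulrC => gap.
by rewrite truncn_ge_nat ?(le_trans (word_shear_growth R (valP (g i)))).
Qed.

Lemma plane_updim (S : seq (gpow F2 n)) : generates S -> updim_le R S (n + n).
Proof.
move=> genS; apply: (isometric_updim genS (plane_manifold R n) (plane_contractible R n) (@plane_proper R n)).
 exact: pact_discontinuous genS.
exact: pact_iso.
Qed.

End Action.

(** * The tree of the free group *)

Section TreeCombinatorics.
Implicit Types (u v w y : F2) (e : F2 * bool) (a b : letter).

Notation size_of w := (size (val w)).

Definition pos (k : bool) : F2 := lword (k, false).

(** An edge [(u, k)] leads from [u] to [u * pos k]; the element [w] lies beyond it if the reduced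
    word from [u] to [w] starts with that letter. *)
Definition side w e : bool := ohead (val (e.1^-1 * w)%g) == Some (e.2, false).

Definition depth e : nat := minn (size_of e.1) (size_of (e.1 * pos e.2)%g).

Lemma val_mul_letter w a : reduced (rcons (val w) a) -> val (w * lword a)%g = rcons (val w) a.
Proof. by move=> rwa; rewrite -[RHS](foldr_push_nil rwa) foldr_rcons. Qed.

Lemma lwordV a : (lword a)^-1%g = lword (linv a).
Proof. exact: val_inj. Qed.

Lemma last_letter w w' a : val w = rcons (val w') a -> w = (w' * lword a)%g.
Proof. move=> wE; apply: val_inj; rewrite val_mul_letter // -wE; exact: valP. Qed.

Lemma wordP w : w = 1%g \/ exists w' a, val w = rcons (val w') a.
Proof.
case: w => w rw; case/lastP: w rw => [|w a] rw; first by left; apply: val_inj.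
right; have rw' : reduced w by move: rw; rewrite -cats1 => /cat_sorted2[].
by exists (exist _ w rw'), a.
Qed.

(** Multiplication by a letter on the right affects the first letter only if the word is empty or is
    cancelled entirely. *)
Lemma head_letter y a b : ohead (val (y * lword a)%g) == Some b =
 if y == 1%g then a == b else (y != lword (linv a)) && (ohead (val y) == Some b).
Proof.
have [->|y1] := eqVneq y 1%g => //.
have [->|ya] := eqVneq y (lword (linv a)); first by rewrite -lwordV mulVg.
have {}y1 : val y != [::] by apply: y1 => /eqP.
have {}ya : val y != [:: linv a] by apply: ya => /eqP.
case: y y1 ya => y ry; rewrite /= => y1 ya; elim: y b y1 ya ry => [|c z IHz] //= b _.
rewrite eqseq_cons => ca rz; case: z rz ca IHz => [|d z]; rewrite ?andbT => rz ca IHz.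
 have /= -> // : (a == linv c) = false.
 by apply: contraNF ca => /eqP->; rewrite linvK.
have /andP[dc rz'] := rz; have [dz|dz] := eqVneq (d :: z) [:: linv a].
 by move: dz => [-> ->]; rewrite /= linvK eqxx.
have /= := IHz d isT dz rz'; rewrite eqxx; case: (push d _) => [|d' z'] //= /eqP[->].
by rewrite (negPf dc).
Qed.

Lemma sideE w u j : side w (u, j) = (ohead (val (u^-1 * w)%g) == Some (j, false)).
Proof. by []. Qed.

Lemma side_self w k : side w (w, k) = false.
Proof. by rewrite /side mulVg. Qed.

Lemma side_pos w k e : side (w * pos k)%g e = (e == (w, k)) || side w e.
Proof.
case: e => u j; rewrite !sideE mulgA head_letter !xpair_eqE.
have -> : (u^-1 * w == 1)%g = (u == w) by rewrite -(inj_eq (mulgI u)) mulVKg mulg1.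
have [->|_] := eqVneq u w; first by rewrite mulVg orbF andbT eq_sym.
by have [->|//] := eqVneq (u^-1 * w)%g _; apply/esym/eqP.
Qed.

Lemma side_neg w k : side w ((w * (pos k)^-1)%g, k) = true.
Proof. by rewrite sideE invgM mulgVK eqxx. Qed.

(** The first letter of the word from [w] to [v] names the edge at [w] that separates them. *)
Lemma side_cases v w : v = w \/ exists k,
 side v (w, k) \/ side v ((w * (pos k)^-1)%g, k) = false.
Proof.
have [vw|vw] := eqVneq (w^-1 * v)%g 1%g.
 by left; rewrite -(mulVKg w v) vw mulg1.
right; case yE : (val (w^-1 * v)%g) => [|[k [] z]].
- by case/eqP: vw; apply: val_inj.
- exists k; right; rewrite sideE invgM -mulgA.
 have -> : val (pos k * (w^-1 * v))%g = push (k, false) (val (w^-1 * v)%g) by [].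
 have := valP (w^-1 * v)%g; rewrite yE /= eqxx; case: (z) => //= b z' /andP[bk _].
 by apply/eqP => -[bE]; rewrite bE eqxx in bk.
- by exists k; left; rewrite /side yE.
Qed.

Lemma side1 w w' a k : val w = rcons (val w') a -> side 1%g (w, k) = (a == (k, true)).
Proof.
move=> wE; rewrite /side mulg1 /= wE map_rcons rev_rcons.
by rewrite -[(k, false)]/(linv (k, true)) (inj_eq Some_inj) (inj_eq (can_inj linvK)).
Qed.

(* The edge crossed by the last letter of [w]. *)
Lemma last_edge w w' a : val w = rcons (val w') a ->
 let e := if a.2 then (w, a.1) else (w', a.1) in
 [/\ forall e', e' != e -> side w e' = side w' e', side 1%g e = a.2, side w' e = a.2,
   side w e = ~~ a.2 & depth e = size_of w'].
Proof.
move=> wE; have ww := last_letter wE; case: a wE ww => k [] wE ww.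
 have w'E : w' = (w * pos k)%g
  by rewrite ww /pos -[(k, false)]/(linv (k, true)) -lwordV mulgK.
 split=> [e' ne||||]; rewrite ?side_self ?(side1 _ wE) ?eqxx //.
 - by rewrite w'E side_pos (negPf ne).
 - by rewrite w'E side_pos eqxx.
 - by rewrite /depth -w'E wE size_rcons (minn_idPr _).
split=> [e' ne||||]; rewrite ?side_self //.
- by rewrite ww side_pos (negPf ne).
- by case: (wordP w') => [->|[w1 [a w'E]]] => //; rewrite (side1 _ w'E); apply/eqP => aE; have := valP w; rewrite wE w'E
 aE -cats1 -cats1 -catA; move=> /cat_sorted2[_] /=; rewrite eqxx.
- by rewrite ww side_pos eqxx.
- by rewrite /depth -[(w' * _)%g]ww wE size_rcons (minn_idPl _).
Qed.

(** The edges between the root and [w] are those crossed by its letters, and the last one has depth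
    one less than the length. *)
Lemma depth_side w e : side w e != side 1%g e -> (depth e < size_of w)%N.
Proof.
move: {2}(size_of w) (erefl (size_of w)) => l; elim: l w => [|l IHl] w wl.
 have -> : w = 1%g; last by rewrite eqxx.
 by apply/val_inj/size0nil.
case: (wordP w) => [->|[w' [a wE]]]; first by rewrite eqxx.
have [he s1 sw' sw dE] := last_edge wE; move: wl; rewrite wE size_rcons => -[wl].
set e0 := if a.2 then _ else _ in he s1 sw' sw dE; have [->|ne] := eqVneq e e0; first by rewrite dE ltnS.
by rewrite he // => /(IHl _ wl)/ltnW.
Qed.

End TreeCombinatorics.

Section Squash.
Variables (R : realType) (d : nat).
Implicit Types u s : 'rV[R]_d.

(* Mutually inverse homeomorphisms between the Euclidean and the cubical disc. *)
Definition squash u := (radius u / `|u|) *: u.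
Definition unsquash s := (`|s| / radius s) *: s.

Lemma norm_le_radius u : `|u| <= radius u.
Proof.
apply: norm_le_co => [|i]; first exact: sqrtr_ge0.
rewrite -sqrtr_sqr ler_sqrt ?sum_sq_ge0 // (bigD1 i) //= lerDl sumr_ge0 // => j _; exact: sqr_ge0.
Qed.

Lemma radius_gt0 u : u != 0 -> 0 < radius u.
Proof. by rewrite -normr_gt0 => u0; apply: lt_le_trans (norm_le_radius u). Qed.

Lemma radius0 : radius (0 : 'rV[R]_d) = 0.
Proof. by rewrite -(scale0r 0) radiusZ // mul0r. Qed.

Lemma norm_squash u : `|squash u| = radius u.
Proof.
have [->|u0] := eqVneq u 0; first by rewrite /squash scaler0 normr0 radius0.
by rewrite normrZ ger0_norm ?divr_ge0 ?sqrtr_ge0 // divfK // normr_eq0.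
Qed.

Lemma radius_unsquash s : radius (unsquash s) = `|s|.
Proof.
have [->|s0] := eqVneq s 0; first by rewrite /unsquash scaler0 normr0 radius0.
by rewrite radiusZ ?divr_ge0 ?sqrtr_ge0 // divfK // gt_eqF ?radius_gt0.
Qed.

Lemma squashK : cancel squash unsquash.
Proof.
move=> u; have [->|u0] := eqVneq u 0; first by rewrite /squash /unsquash !scaler0.
rewrite /unsquash norm_squash radiusZ ?divr_ge0 ?sqrtr_ge0 // scalerA.
have r0 := radius_gt0 u0; have n0 : `|u| != 0 by rewrite normr_eq0.
by rewrite -[RHS]scale1r; congr (_ *: _); field; rewrite n0 gt_eqF.
Qed.

Lemma unsquashK : cancel unsquash squash.
Proof.
move=> u; have [->|u0] := eqVneq u 0; first by rewrite /squash /unsquash !scaler0.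
have r0 := radius_gt0 u0; have n0 : `|u| != 0 by rewrite normr_eq0.
rewrite /squash radius_unsquash normrZ ger0_norm ?divr_ge0 ?sqrtr_ge0 // scalerA.
by rewrite -[RHS]scale1r; congr (_ *: _); field; rewrite gt_eqF.
Qed.

Lemma squash_cont u : cont_at squash u.
Proof.
have [->|u0] := eqVneq u 0; last first.
 by apply: cont_atZ; last exact: cont_id; apply: cont_atM; first exact: radius_cont; apply: cont_inv; [rewrite
  normr_eq0|apply/cont_norm/cont_id].
have s0 : squash 0 = 0 by rewrite /squash scaler0.
move=> U; rewrite s0 => /nbhs_ballP[e e0 eU]; have := @radius_cont R d 0 _ (nbhsx_ballx (radius 0) e e0).
apply: filterS => y /=; rewrite radius0 => ry; apply: eU.
by move: ry; rewrite -!ball_normE /= !sub0r !normrN norm_squash ger0_norm ?sqrtr_ge0.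
Qed.

End Squash.

Section Tree.
Variable R : realType.
Implicit Types (u v w : F2) (e : F2 * bool) (k l : bool) (f h : R) (m : F2 * bool -> R).

(* A point of the tree is encoded by its position relative to every oriented
  edge: before it (0), beyond it (1), or on it. *)
Definition edge_pt w k f e : R := if e == (w, k) then f else (side w e)%:R.

Definition tree m := exists w k f, 0 <= f <= 1 /\ m = edge_pt w k f.

(** The far end of an edge is renamed as position 0 at the next vertex, so that points have a form
    with [f < 1]. *)
Lemma edge_pt1 w k : edge_pt w k 1 = edge_pt (w * pos k)%g false 0.
Proof.
apply/funext => e; rewrite /edge_pt side_pos; case: eqVneq => [->|_] /=; last first.
 by case: eqVneq => // ->; have := side_pos w k ((w * pos k)%g, false); rewrite side_self => /esym/negbT; rewrite negb_or
  => /andP[_ /negPf ->].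
by case: eqVneq => // E; have := side_pos w k (w, k); rewrite E side_self eqxx.
Qed.

Lemma tree_base m : tree m -> exists w k f, 0 <= f < 1 /\ m = edge_pt w k f.
Proof.
move=> [w [k [f [/andP[f0]]]]]; rewrite le_eqVlt => /predU1P[->|f1] ->.
 by exists (w * pos k)%g, false, 0; rewrite lexx ltr01 edge_pt1.
by exists w, k, f; rewrite f0.
Qed.

(** The open star of the vertex [w]: not yet past any outgoing edge, and past the start of every
    incoming one. *)
Definition star w m := (forall l, m (w, l) < 1) /\ forall l, 0 < m ((w * (pos l)^-1)%g, l).

Lemma star_edge w v k f : star w (edge_pt v k f) -> v = w \/ v = (w * (pos k)^-1)%g.
Proof.
move=> [s1 s0]; have [->|[l [sl|sl]]] := side_cases v w; [by left| |].
 have := s1 l; rewrite /edge_pt sl; case: eqVneq => [[-> _]|]; first by left.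
 by rewrite ltxx.
have := s0 l; rewrite /edge_pt sl; case: eqVneq => [[<- ->]|]; first by right.
by rewrite ltxx.
Qed.

Lemma star_edge_pt w k f l : edge_pt w k f ((w * (pos l)^-1)%g, l) = 1.
Proof.
rewrite /edge_pt side_neg; case: eqVneq => // E.
by have := side_neg w l; rewrite E side_self.
Qed.

Lemma star_base w k f : f < 1 -> star w (edge_pt w k f).
Proof.
split=> l; last by rewrite star_edge_pt.
by rewrite /edge_pt side_self; case: eqP.
Qed.

(** A point lies in the open star of its base vertex. By [star_edge] this leaves two candidates, and
    the second would force position 1. *)
Lemma edge_pt_inj w v j k f h : 0 <= f < 1 -> 0 <= h < 1 -> edge_pt w j f = edge_pt v k h ->
 [/\ w = v, f = h & 0 < f -> j = k].
Proof.
move=> /andP[f0 f1] /andP[h0 h1] E; have := star_base w j f1.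
rewrite {1}E => /star_edge[wv|vw]; last first.
 by move: h1; rewrite -(star_edge_pt w j f k) E -vw /edge_pt eqxx ltxx.
subst v; have [jk|jk] := eqVneq j k.
 by subst k; have := congr1 (fun m => m (w, j)) E; rewrite /edge_pt eqxx.
have jk' : (w, j) == (w, k) = false by rewrite xpair_eqE eqxx (negPf jk).
have := congr1 (fun m => m (w, j)) E; have := congr1 (fun m => m (w, k)) E.
rewrite /edge_pt !eqxx eq_sym jk' !side_self => <- ->.
by rewrite ltxx.
Qed.

(** With [b] equal to [side 1%g e], it converts a position on [e] into the distance from the end
    nearer to the root. *)
Definition turn (b : bool) f := if b then 1 - f else f.

Lemma turnK b : involutive (turn b).
Proof. by move=> f; case: b; rewrite /turn // subKr. Qed.

(* The point at height [h] on the geodesic from the root to [w]. *)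
Definition spoke w h e : R :=
 turn (side 1%g e) ((side w e != side 1%g e)%:R * clamp (h - (depth e)%:R)).

Lemma clamp_ge1 f : 1 <= f -> clamp f = 1.
Proof. by move=> f1; rewrite /clamp min_l // max_r. Qed.

Lemma clamp_le0 f : f <= 0 -> clamp f = 0.
Proof. by move=> f0; rewrite /clamp min_r ?max_l // (le_trans f0). Qed.

Lemma spoke_edge w w' a f : val w = rcons (val w') a -> 0 <= f <= 1 -> spoke w ((size (val w'))%:R + f) = edge_pt (if a.2
 then w else w') a.1 (turn a.2 f).
Proof.
move=> wE f01; have [he s1 sw' sw dE] := last_edge wE; apply/funext => e; rewrite /spoke /edge_pt.
have -> : (if a.2 then w else w', a.1) = if a.2 then (w, a.1) else (w', a.1) by case: a.2.
set e0 := if a.2 then _ else _ in he s1 sw' sw dE *; have [->|ne] := eqVneq e e0.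
 by rewrite sw s1 dE addrC addKr clamp_id //; case: a.2; rewrite mul1r.
have -> : side (if a.2 then w else w') e = side w' e by case: a.2; rewrite ?he.
rewrite he //; have [->|sne] := eqVneq (side w' e) (side 1%g e).
 by rewrite mul0r /turn; case: side; rewrite ?subr0.
rewrite clamp_ge1 ?mul1r /turn; last by move: (depth_side sne); rewrite -(ler_nat R) -natr1; lra.
by move: sne; case: (side w' e) (side 1%g e) => [] [] //=; rewrite ?subrr.
Qed.

Lemma spoke_tree w h : h <= (size (val w))%:R -> tree (spoke w h).
Proof.
move: {2}(size _) (erefl (size (val w))) => l; elim: l w => [|l IHl] w wl.
 have -> : w = 1%g by apply/val_inj/size0nil.
 by exists 1%g, false, 0; rewrite lexx ler01; split=> //; apply/funext => e; rewrite /spoke eqxx mul0r /edge_pt; case: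
  eqVneq => [->|_] => //; case: side; rewrite /turn ?subr0.
case: (wordP w) => [w1|[w' [a wE]]]; first by rewrite w1 in wl.
have wl' : size (val w') = l by move: wl; rewrite wE size_rcons => -[].
rewrite wl -natr1 -wl' => hl; have [hw|hw] := leP (size (val w'))%:R h.
 have f01 : 0 <= h - (size (val w'))%:R <= 1 by rewrite subr_ge0 hw lerBlDl.
 rewrite -(subrK (size (val w'))%:R h) addrC (spoke_edge wE f01); do 3 eexists; split => //.
 case: a.2; rewrite /turn => *; lra.
have -> : spoke w h = spoke w' h; last by apply: IHl => //; exact: ltW.
have [he _ _ _ dE] := last_edge wE; apply/funext => e; rewrite /spoke.
set e0 := if a.2 then _ else _ in he dE; have [->|ne] := eqVneq e e0; last by rewrite he.
by rewrite dE clamp_le0 ?mulr0 // subr_le0 ltW.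
Qed.

Lemma tree_spoke m : tree m -> exists w h, h <= (size (val w))%:R /\ m = spoke w h.
Proof.
move=> [v [k [f [f01 ->]]]].
have h a w w' : val w = rcons (val w') a -> edge_pt (if a.2 then w else w') a.1 f = spoke w ((size (val w'))%:R + turn a.2 f).
 move=> wE; rewrite (spoke_edge wE) ?turnK //; case: a.2; rewrite /turn => *; lra.
have fb b : turn b f <= 1 by case: b; rewrite /turn; lra.
have bnd a w w' : val w = rcons (val w') a -> (size (val w'))%:R + turn a.2 f <= (size (val w))%:R.
 by move=> ->; rewrite size_rcons -natr1 lerD2l.
have grow : reduced (rcons (val v) (k, false)) -> exists w h, h <= (size (val w))%:R /\ edge_pt v k f = spoke w h.
 move=> /val_mul_letter vE; exists (v * pos k)%g, ((size (val v))%:R + turn false f).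
 split; [exact: bnd vE|exact: h vE].
case: (wordP v) => [v1|[v' [a vE]]]; first by apply: grow; rewrite v1.
have [ak|ak] := eqVneq a (k, true).
 exists v, ((size (val v'))%:R + turn a.2 f); split; first exact: bnd.
 by have := h _ _ _ vE; rewrite ak.
apply: grow; have := valP v; rewrite vE; case: (val v') => [|b z] /=; rewrite ?rcons_path ?last_rcons => rv.
 by rewrite andbT; apply: contra ak => /eqP kE; rewrite -[a]linvK -kE.
by rewrite rv; apply: contra ak => /eqP kE; rewrite -[a]linvK -kE.
Qed.

(** The retraction of the tree onto the ball of radius [L] around the root. *)
Definition trunc L m e : R := turn (side 1%g e) (Num.min (turn (side 1%g e) (m e)) (clamp (L - (depth e)%:R))).

Lemma trunc_tree L m : tree m -> tree (trunc L m).
Proof.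
move=> /tree_spoke[w [h [hw ->]]]; have -> : trunc L (spoke w h) = spoke w (Num.min h L).
 apply/funext => e; rewrite /trunc /spoke turnK; case: (_ != _).
  rewrite !mul1r; have cm p q : p <= q -> clamp p <= clamp q.
   by move=> pq; rewrite ge_max !le_max lexx /= le_min !ge_min lexx pq !orbT.
  by case: (leP h L) => hL; [rewrite min_l // cm // lerD2r|rewrite min_r // cm // lerD2r ltW].
 by rewrite !mul0r min_l //; have /andP[] := clamp_in (L - (depth e)%:R).
by apply: spoke_tree; rewrite ge_min hw.
Qed.

Lemma tree01 m e : tree m -> 0 <= m e <= 1.
Proof. by move=> [w [k [f [f01 ->]]]]; rewrite /edge_pt; case: eqP => _; case: side; rewrite ?lexx ?ler01. Qed.

Lemma trunc0 m e : tree m -> trunc 0 m e = (side 1%g e)%:R.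
Proof.
move=> /(tree01 e)/andP[m0 m1]; rewrite /trunc clamp_le0 // min_r; case: side; rewrite /turn ?subr0 //; lra.
Qed.

Definition shift_pt (g : F2) m e : R := m ((g^-1 * e.1)%g, e.2).

Lemma shift_edge_pt g w k f : shift_pt g (edge_pt w k f) = edge_pt (g * w)%g k f.
Proof.
have sE u j : side (g * w)%g (u, j) = side w ((g^-1 * u)%g, j) by rewrite !sideE invgM invgK mulgA.
apply/funext => -[u j]; rewrite /shift_pt /edge_pt sE.
by rewrite !xpair_eqE -(inj_eq (mulgI g)) mulVKg.
Qed.

Lemma shift_tree g m : tree m -> tree (shift_pt g m).
Proof. by move=> [w [k [f [f01 ->]]]]; exists (g * w)%g, k, f; rewrite shift_edge_pt. Qed.

End Tree.

Lemma size_mul (g h : F2) : (size (val (g * h)%g) <= size (val g) + size (val h))%N.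
Proof.
rewrite /=; elim: (sval g) => //= a u; case: (foldr push _ u) => //= b w uw; case: eqP => _ //=.
exact/ltnW/ltnW.
Qed.

Lemma size_inv (g : F2) : size (val g^-1%g) = size (val g).
Proof. by rewrite size_rev size_map. Qed.

Lemma edge_pt0 (R : realType) w k : edge_pt w k (0 : R) = fun e => (side w e)%:R.
Proof. by apply/funext => e; rewrite /edge_pt; case: eqP => // ->; rewrite side_self. Qed.

(** * The product of trees as a cell complex with action *)

Section TreePower.
Variables (R : realType) (n : nat).

Definition tpower : Type := {m : 'I_n -> F2 * bool -> R | `[< forall i, tree (m i) >]}.
HB.instance Definition _ := gen_eqMixin tpower.
HB.instance Definition _ := gen_choiceMixin tpower.
Notation X := tpower.
Implicit Types (x y z : X) (p : 'I_n * (F2 * bool)).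

Definition position x p : R := sval x p.1 p.2.

Lemma tpowerP x i : tree (sval x i).
Proof. move: i; apply/asboolP/(svalP x). Qed.

Definition mk_tree m (h : forall i, tree (m i)) : X := exist (fun m => is_true `[< forall i, tree (m i) >]) m (asboolT h).

Lemma tpower_ext x y : (forall i, sval x i = sval y i) -> x = y.
Proof. move=> xy; apply: val_inj; exact/funext. Qed.

(** The topology of pointwise convergence of positions. As the trees are locally finite, it is also
    the weak topology of the cells, see [tree_weak_topology]. *)
Definition tpower_open (U : set X) : Prop := forall x, U x -> exists (F : seq ('I_n * (F2 * bool))) (e : R),
 0 < e /\ forall y, (forall p, p \in F -> `|position x p - position y p| < e) -> U y.

Lemma tpower_openT : tpower_open setT.
Proof. by exists [::], 1. Qed.

Lemma tpower_openI A B : tpower_open A -> tpower_open B -> tpower_open (A `&` B).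
Proof.
move=> oA oB x [/oA[F [e [e0 FA]]] /oB[F' [e' [e0' FB]]]]; exists (F ++ F'), (Num.min e e').
rewrite lt_min e0 e0'; split=> // y xy; split; [apply: FA|apply: FB] => p pF.
 by have := xy p; rewrite mem_cat pF lt_min => /(_ isT)/andP[].
by have := xy p; rewrite mem_cat pF orbT lt_min => /(_ isT)/andP[].
Qed.

Lemma tpower_open_bigU I (f : I -> set X) : (forall i, tpower_open (f i)) -> tpower_open (\bigcup_i f i).
Proof.
move=> fo x [i _ /fo[F [e [e0 Ff]]]]; exists F, e; split=> // xy; exists i => //; exact: Ff.
Qed.

HB.instance Definition _ := isOpenTopological.Build X
 tpower_openT tpower_openI tpower_open_bigU.

Lemma pos_cont p x : cont_at (position^~ p) x.
Proof.
move=> U /nbhs_R[e e0 eU]; suff h : nbhs x [set y | `|position x p - position y p| < e].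
 apply: filterS h => y; exact: eU.
apply: open_nbhs_nbhs; split; last by rewrite /= subrr normr0.
move=> y xy; exists [:: p], (e - `|position x p - position y p|); rewrite subr_gt0; split=> // z /(_ p).
rewrite mem_head ltrBrDl => /(_ isT) yz; apply: le_lt_trans yz; exact: ler_distD.
Qed.

Lemma into_tpower (Y : topologicalType) (f : Y -> X) a :
 (forall p, cont_at (fun t => position (f t) p) a) -> cont_at f a.
Proof.
move=> cf U; rewrite nbhsE => -[V [oV Vx] VU]; have [F [e [e0 FV]]] := oV _ Vx.
suff h : nbhs a [set t : Y | forall p, p \in F -> `|position (f a) p - position (f t) p| < e].
 apply: filterS h => t h; exact/VU/FV.
elim: F {FV} => [|p F IHF]; first exact: filterE.
have hp := cf p _ (nbhsx_ballx (position (f a) p) e e0).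
by apply: filterS (filterI hp IHF) => t [h1 h2] q; rewrite inE => /predU1P[->//|/h2].
Qed.

Lemma tpower_hausdorff : hausdorff_space X.
Proof.
move=> x y xy; apply: tpower_ext => i; apply/funext => e.
apply: Rhausdorff => A B /(@pos_cont (i, e)) Ax /(@pos_cont (i, e)) By.
by have [z [Az Bz]] := xy _ _ Ax By; exists (position z (i, e)).
Qed.

(** Truncation at radius [(1 - t) / t], which falls from infinity to 0. *)
Lemma tpower_contractible : contractible R X.
Proof.
(* On an edge of the given depth, truncation is the identity once [t] is at most the inverse of
   [(depth e).+2]; bounding the denominator below changes nothing and removes the singularity at
   0. *)
pose s t e := clamp ((1 - t) / Num.max t (depth e).+2%:R^-1 - (depth e)%:R : R).
pose H (q : X * R) i e := turn (side 1%g e) (Num.min (turn (side 1%g e) (sval q.1 i e)) (s q.2 e)).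
have s0 e t : t <= 0 -> s t e = 1.
 move=> t0; have d0 : 0 < (depth e).+2%:R^-1 :> R by rewrite invr_gt0.
 rewrite /s max_r ?(le_trans t0) // clamp_ge1 // invrK lerBrDr -natr1 -natr1.
 have := ler0n R (depth e); nra.
have sE e t : 0 < t -> s t e = clamp ((1 - t) / t - (depth e)%:R).
 move=> t0; rewrite /s; case: (leP t) => // td.
 have d0 : 0 < (depth e).+2%:R :> R by [].
 have td' : t * (depth e).+2%:R <= 1 by move: td; rewrite -ler_pdivlMr // div1r.
 rewrite invrK !clamp_ge1 //; first rewrite lerBrDr ler_pdivlMr //; last rewrite lerBrDr.
  lra.
 nra.
have Hid q i : q.2 <= 0 -> H q i = sval q.1 i.
 move=> t0; apply/funext => e; rewrite /H s0 // min_l ?turnK //.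
 have := tree01 e (tpowerP q.1 i); case: side; rewrite /turn; lra.
have HT q i : tree (H q i).
 have [t0|t0] := leP q.2 0; first by rewrite Hid //; exact: tpowerP.
 have -> : H q i = trunc ((1 - q.2) / q.2) (sval q.1 i); last exact/trunc_tree/tpowerP.
 by apply/funext => e; rewrite /H sE.
pose h q := mk_tree (HT q).
have [x0 x0E] : exists x0, forall i e, sval x0 i e = (side 1%g e)%:R.
 have t1 : tree (fun e => (side 1%g e)%:R : R).
  exists 1%g, false, 0; rewrite lexx ler01; split=> //; apply/funext => e; rewrite /edge_pt.
  by case: eqP => // ->.
 by exists (mk_tree (fun => t1)).
exists x0, h; split=> //; last first.
 move=> x _; split; apply: tpower_ext => i; first by rewrite /= Hid.
 apply/funext => e; rewrite /= /H sE // subrr mul0r x0E -(trunc0 e (tpowerP x i)) //.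
apply: continuous_subspaceT => q.
apply: into_tpower => -[i e].
have cF b f : cont_at f q -> cont_at (fun q => turn b (f q)) q.
 case: b => //.
apply: (cF _); apply: cont_min.
 apply/cF/(cont_comp (g := position^~ (i, e))); [exact: cont_fst|exact: pos_cont].
apply: cont_max; first exact: cont_cst.
apply: cont_min; first exact: cont_cst.
apply: cont_atB; last exact: cont_cst.
apply: cont_atM; first by apply: cont_atB.
apply: cont_inv; first by rewrite gt_eqF // lt_max invr_gt0 ltr0n orbT.
by apply: cont_max.
Qed.

Definition tree_act (g : gpow F2 n) x : X := mk_tree (fun i => shift_tree (g i) (tpowerP x i)).

Lemma star_nbhs w x : (forall i, star (w i) (sval x i)) -> nbhs x [set y : X | forall i, star (w i) (sval y i)].
Proof.
move=> wP; apply: nbhs_all => i; apply: filterI; apply: nbhs_all => l; apply: cont_lt;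
 first [exact: cont_cst|exact: (@pos_cont (i, _))|by have [] := wP i].
Qed.

(** Open stars cover the product, and points of a star have base vertices within distance 1 of its
    center. *)
Lemma base_bound (C : set X) : compact C -> exists B, forall x, C x -> forall i, exists w k f,
 [/\ 0 <= f < 1, sval x i = edge_pt w k f & (size (val w) <= B)%N].
Proof.
move=> cC; apply: (compact_ind (P := fun A => exists B, forall x, A x -> forall i, exists w k f, [/\ 0 <= f < 1, sval x i
 = edge_pt w k f & (size (val w) <= B)%N])) cC _ _ _ _.
- by exists 0.
- move=> A A' [B AB] [B' AB']; exists (maxn B B') => x [/AB|/AB'] h i; have [w [k [f [? ? wB]]]] := h i;
 by exists w, k, f; rewrite leq_max wB ?orbT.
- move=> A A' AA [B AB]; exists B => x /AA; exact: AB.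
move=> x _; have /choice[w wP] i : exists w, star w (sval x i).
 have [w [k [f [/andP[_ f1] ->]]]] := tree_base (tpowerP x i); exists w; exact: star_base.
exists [set y : X | forall i, star (w i) (sval y i)]; first exact: star_nbhs.
have [B wB] := @nat_bound _ setT (fun i => size (val (w i))) finite_finset.
exists B.+1 => y [ys _] i; have [v [k [f [f01 E]]]] := tree_base (tpowerP y i).
exists v, k, f; split=> //; have := ys i; rewrite E => /star_edge[->|->]; first exact/ltnW/(wB i).
apply: leq_trans (size_mul _ _) _; rewrite addn1 ltnS; exact: (wB i).
Qed.

Lemma tree_act1 x : tree_act 1%g x = x.
Proof.
by apply: tpower_ext => i; apply/funext => -[u j]; rewrite /= ffunE /shift_pt invg1 mul1g.
Qed.

Lemma tree_actM g h x : tree_act (g * h)%g x = tree_act g (tree_act h x).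
Proof.
by apply: tpower_ext => i; apply/funext => -[u j]; rewrite /= ffunE /shift_pt invgM mulgA.
Qed.

Lemma tree_act_discontinuous (S : seq (gpow F2 n)) : generates S -> properly_discontinuous tree_act.
Proof.
move=> genS; split=> [|g x|g x|C cC]; [exact: tree_act1|exact: tree_actM| |].
- suff h : cont_at (tree_act g) x by exact: h.
 apply: into_tpower => -[i e]; exact: (@pos_cont (i, (((g i)^-1 * e.1)%g, e.2))).
have [B BP] := base_bound cC.
apply: (sub_finite_set _ (size_ball genS (B + B))) => g [_ [[x Cx <-] Cgx]] i.
have [w [k [f [f01 E wB]]]] := BP _ Cx i; have [w' [k' [f' [f01' E' wB']]]] := BP _ Cgx i.
move: E'; rewrite /= E shift_edge_pt => /(edge_pt_inj f01 f01')[gw _ _].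
rewrite -(mulgK w (g i)) gw; apply: leq_trans (size_mul _ _) _.
by rewrite size_inv leq_add.
Qed.

(** A product of vertices ([None]) and edges ([Some k]); the dimension is the number of edge
    factors. *)
Notation tcell := ('I_n -> F2 * option bool).
Implicit Types (c : tcell).

Definition edges c : pred 'I_n := fun i => isSome (c i).2.

Definition in_edge (o : option bool) (f : R) := if o is Some _ then 0 <= f <= 1 else f == 0.
Definition on_edge (o : option bool) (f : R) := if o is Some _ then 0 < f < 1 else f == 0.

Definition cell_pt c (f : 'I_n -> R) i := edge_pt (c i).1 (odflt false (c i).2) (f i).

(** Coordinates in the cube of the cell; [squash] intervenes because cells are parametrized by
    Euclidean discs. *)
Definition cfrac c (u : 'rV[R]_#|edges c|) i : R :=
 \sum_l (enum_val l == i)%:R * clamp ((1 + squash u 0 l) / 2).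

Lemma cfrac_val c u (l : 'I_#|edges c|) : cfrac u (enum_val l) = clamp ((1 + squash u 0 l) / 2).
Proof.
rewrite /cfrac (bigD1 l) //= eqxx mul1r big1 ?addr0 // => l' l'l.
by rewrite (inj_eq enum_val_inj) (negPf l'l) mul0r.
Qed.

Lemma edge_val c i : edges c i -> exists l : 'I_#|edges c|, i = enum_val l.
Proof. by move=> ci; exists (enum_rank_in ci i); rewrite enum_rankK_in. Qed.

Lemma cfrac_within c u i : in_edge (c i).2 (@cfrac c u i).
Proof.
have [ci|ci] := boolP (edges c i).
 have [l ->] := edge_val ci; rewrite cfrac_val; move: (enum_valP l).
 rewrite unfold_in /in_edge; case: (c _).2 => // b _; exact: clamp_in.
have := ci; rewrite /edges /in_edge; case: (c i).2 => // _; rewrite /cfrac big1 // => l _.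
by case: eqP => [li|]; rewrite ?mul0r //; have := enum_valP l; rewrite li => ic; case/negP: ci.
Qed.

Lemma within_in o f : in_edge o f -> 0 <= f <= 1.
Proof. by case: o => //= /eqP->; rewrite lexx ler01. Qed.

Definition tree_cell c (u : 'rV[R]_#|edges c|) : X.
Proof.
refine (@mk_tree (cell_pt c (cfrac u)) _) => i.
by do 3 eexists; split; [exact: within_in (cfrac_within u i)|].
Defined.

Lemma squash_coord d (u : 'rV[R]_d) l : `|squash u 0 l| <= radius u.
Proof. by rewrite -norm_squash norm_coord_le. Qed.

Lemma cfrac_onto c f : (forall i, in_edge (c i).2 (f i)) -> exists u : 'rV[R]_#|edges c|, [/\ cfrac u = f, @disc R _ u &
 (forall i, on_edge (c i).2 (f i)) -> @open_disc R _ u].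
Proof.
move=> fP; pose s : 'rV[R]_#|edges c| := \row_l (2 * f (enum_val l) - 1); exists (unsquash s); split.
- apply/funext => i; have [/edge_val[l ->]|ci] := boolP (edges c i).
  rewrite cfrac_val unsquashK mxE addrC subrK mulrC mulKf // clamp_id //.
  exact: within_in (fP _).
 have := cfrac_within (unsquash s) i; have := fP i; move: ci; rewrite /edges /in_edge.
 by case: (c i).2 => // _ /eqP-> /eqP->.
- apply/radius_le1; rewrite radius_unsquash; apply: norm_le_co => // l.
 rewrite mxE ler_norml; have := within_in (fP (enum_val l)) => *; lra.
- move=> f1; apply/radius_lt1; rewrite radius_unsquash; apply: norm_lt_co => // l.
 rewrite mxE ltr_norml; have := f1 (enum_val l); have := enum_valP l; rewrite unfold_in /on_edge; case: (c _).2 => // *; lra.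
Qed.

Lemma open_disc_inside c (u : 'rV[R]_#|edges c|) i : @open_disc R _ u -> on_edge (c i).2 (cfrac u i).
Proof.
move=> /radius_lt1 u1; have [ci|ci] := boolP (edges c i).
 have [l E] := edge_val ci; rewrite E cfrac_val; move: ci; rewrite E /edges /on_edge; case: (c _).2 => // b _.
 have := le_lt_trans (squash_coord u l) u1; rewrite ltr_norml => /andP[] *.
 rewrite clamp_id; lra.
have := cfrac_within u i; move: ci; rewrite /edges /on_edge /in_edge.
by case: (c i).2.
Qed.

Lemma tree_cellE c f x : (forall i, in_edge (c i).2 (f i)) -> (forall i, sval x i = cell_pt c f i) -> (@tree_cell c @`
 @disc R _) x.
Proof.
move=> /cfrac_onto[u [uf u1 _]] xf; exists u => //; apply: tpower_ext => i.
by rewrite /= uf.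
Qed.

Lemma tree_cell_openE c x : (@tree_cell c @` @open_disc R _) x <-> exists f, (forall i, on_edge (c i).2 (f i)) /\ forall
 i, sval x i = cell_pt c f i.
Proof.
split=> [[u u1 <-]|[f [fi xf]]].
 exists (cfrac u); split=> // i; exact: open_disc_inside.
have [|u [uf _ /(_ fi) u1]] := @cfrac_onto c f.
 by move=> i; have := fi i; rewrite /in_edge; case: (c i).2 => // b /andP[/ltW-> /ltW->].
by exists u => //; apply: tpower_ext => i; rewrite /= uf.
Qed.

Definition tree_face c (g : {ffun 'I_n -> option bool}) : tcell := fun i =>
 if (c i).2 is Some k then
  if g i is Some b then (if b then (c i).1 * pos k else (c i).1, None)%g else c i
 else c i.

Lemma tree_closure_finite c : exists F, [/\ finite_set F, forall f, F f -> (#|edges f| < #|edges c|)%N & @tree_cell c @`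
 @sphere R _ `<=` \bigcup_(f in F) (@tree_cell f @` @open_disc R _)].
Proof.
exists (range (tree_face c) `&` [set f | (#|edges f| < #|edges c|)%N]); split=> [|f []//|].
 apply: (sub_finite_set (@subIsetl _ _ _)); exact/finite_image/finite_finset.
move=> _ [u u1 <-]; pose fr := cfrac u.
(* Factors at coordinate 0 or 1 are replaced by the corresponding end. On the sphere there is at
   least one, since the squashed point has sup norm 1. *)
pose g := [ffun i => if fr i == 0 then Some false else if fr i == 1 then Some true else None].
have fin i : on_edge (tree_face c g i).2 (if (tree_face c g i).2 is Some _ then fr i else 0).
 have := cfrac_within u i; rewrite /tree_face ffunE -/(fr i) /in_edge.
 case cE : (c i).2 => [k|]; last by rewrite cE /=.
 by case: eqVneq => [_|f0] /= => //; case: eqVneq => [_|f1] /=; rewrite // cE /= !lt_neqAle f1 eq_sym f0.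
have sub : {subset edges (tree_face c g) <= edges c}.
 by move=> i; rewrite /in_mem /= /edges /tree_face; case cE : (c i).2 => //; rewrite cE.
exists (tree_face c g); last first.
 apply/tree_cell_openE; exists (fun i => if (tree_face c g i).2 is Some _ then fr i else 0); split=> // i.
 rewrite /= /cell_pt; have := cfrac_within u i; rewrite -/(fr i) /tree_face ffunE.
 case cE : (c i).2 => [k|]; last by rewrite cE => /eqP->.
 case: eqVneq => [->|_] /=; first by rewrite !edge_pt0.
 by case: eqVneq => [->|_] /=; rewrite ?edge_pt1 // cE.
split => //.
apply/proper_card/andP; split; first by apply/fintype.subsetP => i; exact: sub.
apply/negP => /fintype.subsetP all; have /radius_eq1 ru := u1.
have : radius u < 1; last by rewrite ru ltxx.
rewrite -norm_squash; apply: norm_lt_co => // l.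
have := all _ (enum_valP l); have := enum_valP l; rewrite /in_mem /= /edges /tree_face ffunE.
case: (c _).2 => // k _; have -> : fr (enum_val l) = clamp ((1 + squash u 0 l) / 2) by exact: cfrac_val.
have := squash_coord u l; rewrite ru ler_norml => /andP[]; move: (squash u 0 l) => t t0 t1.
rewrite clamp_id; last lra.
case: eqVneq => // n0; case: eqVneq => // n1 _; rewrite ltr_norml.
lra.
Qed.

Lemma tree_partition x : exists! c, (@tree_cell c @` @open_disc R _) x.
Proof.
have /choice[b bP] i : exists b, on_edge b.1.2 b.2 /\ sval x i = edge_pt b.1.1 (odflt false b.1.2) b.2.
 have [w [k [f [/andP[f0 f1] E]]]] := tree_base (tpowerP x i).
 have [fz|fz] := eqVneq f 0; last by exists (w, Some k, f); rewrite /= f1 lt_neqAle eq_sym fz f0.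
 exists (w, None, 0); by rewrite /= E fz !edge_pt0.
exists (fun i => (b i).1); split.
 by apply/tree_cell_openE; exists (fun i => (b i).2); split=> i; have [] := bP i.
move=> c /tree_cell_openE[f [fi xf]]; apply/funext => i; have [b1 b2] := bP i; have := fi i.
have in1 o t : on_edge o t -> 0 <= t < 1.
 by case: o => [k /andP[/ltW-> ->]|/eqP->] //; rewrite lexx ltr01.
have := xf i; rewrite b2 => /(edge_pt_inj (in1 _ _ b1) (in1 _ _ (fi i)))[]; move: b1.
case: (b i) (c i) => [[w o] t] [w' o'] /= b3 wE tE; rewrite {}wE {}tE in b3 *.
move: b3; case: o o' => [k|] [k'|] //=.
- by move=> /andP[f0 _] /(_ f0) ->.
- by move=> /andP[f0 _] _ /eqP fz; rewrite fz ltxx in f0.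
- by move=> /eqP-> _; rewrite ltxx.
Qed.

Lemma tree_cell_inj c : {in @open_disc R _ &, injective (@tree_cell c)}.
Proof.
move=> u v; rewrite !inE => ud vd E; apply: (can_inj (@squashK R _)); apply/rowP => l.
have in1 w : @open_disc R _ w -> 0 <= (1 + squash w 0 l) / 2 < 1.
 move=> /radius_lt1 w1; have := le_lt_trans (squash_coord w l) w1; rewrite ltr_norml => /andP[*].
 lra.
have cid w : open_disc w -> cfrac w (enum_val l) = (1 + squash w 0 l) / 2.
 by move=> /in1/andP[w0 /ltW w1]; rewrite cfrac_val clamp_id ?w0.
have := congr1 (fun x => sval x (enum_val l)) E.
rewrite /= /cell_pt !cid // => /(edge_pt_inj (in1 _ ud) (in1 _ vd))[_ h _]; lra.
Qed.

Lemma tree_cell_cont c u : cont_at (@tree_cell c) u.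
Proof.
apply: into_tpower => -[i e]; rewrite /= /cell_pt /edge_pt.
case: eqP => _; last exact: cont_cst.
apply: cont_sum => l; apply: cont_atM; first exact: cont_cst.
apply: cont_max; first exact: cont_cst.
apply: cont_min; first exact: cont_cst.
apply: cont_atM; last exact: cont_cst.
apply: cont_atD; first exact: cont_cst.
apply: (cont_comp (f := @squash R _) (g := fun v => v 0 l)); [exact: squash_cont|exact: cont_coord].
Qed.

(** A product of open stars meets only the closed cells built from the edges at the centers. These
    are finitely many, so the part of [A] in them is compact. *)
Lemma tree_weak_topology A : (forall c, closed (@disc R _ `&` @tree_cell c @^-1` A)) -> closed A.
Proof.
move=> cA x xA; have /choice[w wP] i : exists w, star w (sval x i).
 have [w [k [f [/andP[_ f1] ->]]]] := tree_base (tpowerP x i); exists w; exact: star_base.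
pose N := [set y : X | forall i, star (w i) (sval y i)].
have Nx : nbhs x N by exact: star_nbhs.
(* The first boolean says whether the edge at [w i] is incoming, the second which generator it
   carries. *)
pose c g := fun i => (if (g i).1 then w i * (pos (g i).2)^-1 else w i, Some (g i).2)%g.
pose D g := @tree_cell (c g) @` (@disc R _ `&` @tree_cell (c g) @^-1` A).
have cD : closed (\bigcup_(g in [set: {ffun 'I_n -> bool * bool}]) D g).
 apply: compact_closed; first exact: tpower_hausdorff.
 apply: compact_bigcup => [|g _]; first exact: finite_finset.
 apply: continuous_compact; first by apply: continuous_subspaceT => u; exact: tree_cell_cont.
 exact: subclosed_compact (cA _) (@disc_compact _ _) (@subIsetl _ _ _).
suff : (\bigcup_(g in [set: {ffun 'I_n -> bool * bool}]) D g) x by move=> [g _ [u [_ Au] <-]].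
apply: cD => U xU; have [y [Ay [Uy Ny]]] := xA _ (filterI xU Nx); exists y; split=> //.
have /choice[g gP] i : exists g, exists f, 0 <= f <= 1 /\ sval y i = edge_pt (if g.1 then w i * (pos g.2)^-1 else w i)%g g.2 f.
 have [v [k [f [/andP[f0 /ltW f1] E]]]] := tree_base (tpowerP y i).
 have := Ny i; rewrite E => /star_edge[->|->]; [exists (false, k)|exists (true, k)]; exists f; rewrite f0 f1 //.
have /choice[f fP] := gP; exists (finfun g) => //.
have [|i|u ud uy] := @tree_cellE (c (finfun g)) f y; first by move=> i; rewrite /= (fP i).1.
 by rewrite (fP i).2 /cell_pt /c ffunE.
by exists u => //; rewrite /= uy.
Qed.

Definition tree_cw : cw_structure R X := @CWStructure R X tcell (fun c => #|edges c|) tree_cell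
 tpower_hausdorff (fun c => continuous_subspaceT (@tree_cell_cont c)) tree_cell_inj tree_partition
 tree_closure_finite tree_weak_topology.

Lemma tree_act_cells g c : exists c', tree_act g @` @open_cell R X tree_cw c = @open_cell R X tree_cw c'.
Proof.
have sub h c' : tree_act h @` (@tree_cell c' @` @open_disc R _) `<=`
  @tree_cell (fun i => (h i * (c' i).1, (c' i).2)%g) @` @open_disc R _.
 by move=> _ [x /tree_cell_openE[f [fi xf]] <-]; apply/tree_cell_openE; exists f; split=> // i; rewrite /= xf shift_edge_pt.
pose c' := fun i => (g i * (c i).1, (c i).2)%g.
exists c'; apply/seteqP; split; first exact: sub.
move=> y yc; have /sub : (tree_act g^-1%g @` (@tree_cell c' @` @open_disc R _)) (tree_act g^-1%g y) by exists y.
have -> : (fun i => (g^-1 i * (c' i).1, (c' i).2)%g) = c.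
 by apply/funext => i; rewrite ffunE mulKg -surjective_pairing.
by exists (tree_act g^-1%g y) => //; rewrite -tree_actM mulgV tree_act1.
Qed.

Lemma tree_cw_dim : cw_dim tree_cw n.
Proof.
split=> [c|]; first by rewrite -[leqRHS]card_ord; exact: max_card.
by exists (fun=> (1%g, Some false)); rewrite -[RHS]card_ord.
Qed.

End TreePower.

(** * The number of ends of the group *)

Section Ends.
Variables (n : nat) (S : seq (gpow F2 n)).
Hypothesis genS : generates S.
Local Open Scope nat_scope.
Implicit Types (g h : gpow F2 n) (i j : 'I_n).
Notation wd := (word_dist S).
Notation joined := (joined_outside S).

(** Each step changes the distance from the identity by at most one. *)
Lemma joined_walk r k g h : walk (cayley S) k g h -> r + k < wd 1%g g -> joined r g h.
Proof.
elim: k g => [|k IHk] g /=; first by move=> <- _; exists 0.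
move=> [z gz zh] rg; have z1 : wd z g <= 1.
 by rewrite (wd_sym genS) (wd_le) //; exists z.
have rz : r + k < wd 1 z by have := wd_triangle genS z 1 g; lia.
have [l lP] := IHk z zh rz; exists l.+1, z => //; split=> //; rewrite /outside /=; lia.
Qed.

Lemma join_trans r g h f : joined r g h -> joined r h f -> joined r g f.
Proof. move=> [k kP] [l lP]; exists (k + l); exact: walk_cat lP. Qed.

Lemma joined_sym r g h : joined r g h -> joined r h g.
Proof.
by move=> [k kP]; exists k; apply: walk_rev kP => a b [/(cayleyC) br].
Qed.

Lemma far_word r : exists B, forall g i, B < size (val (g i)) -> r < wd 1%g g.
Proof.
have [B BP] := nat_bound (fun g => \sum_i size (val (g i))) (ball_finite genS 1 r).
exists B => g i gB; rewrite ltnNge; apply/negP => /BP; rewrite (bigD1 i) //= => h.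
by move: (leq_trans (leq_addr _ _) h); rewrite leqNgt gB.
Qed.

Definition single j (w : F2) : gpow F2 n := [ffun k => if k == j then w else 1%g].

Lemma infinite_power i : infinite_set [set: gpow F2 n].
Proof.
move=> /(nat_bound (fun g => size (val (g i))))[B BP].
by have := BP (single i (leg_word B.+1 ord0)) I; rewrite ffunE eqxx size_nseq ltnn.
Qed.

(** While one coordinate is long, another can be rewritten letter by letter without entering the
    ball; so all far elements are joined to one whose coordinates are all equal to a fixed long
    word. *)
Lemma one_ended i j : i != j -> ~ at_least_ends S 2.
Proof.
move=> ij [r [x [xP xj]]]; have [L LP] := stdgen_bound S; have [B BP] := far_word (r + L).
have step g a b w : a != b -> B < size (val (g a)) -> joined r g (g * single b w).
 move=> ab; case: w => w rw; elim: w rw g => [|c w IHw] rw g ga.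
  have -> : single b (exist _ [::] rw) = 1%g; last by rewrite mulg1; exists 0.
  apply/ffunP => k; rewrite !ffunE; case: ifP => _; exact: val_inj.
 have rw' : reduced w by exact: path_sorted rw.
 have -> : single b (exist _ (c :: w) rw) = (stdgen b c * single b (exist _ w rw'))%g.
  apply/ffunP => k; rewrite !ffunE; case: ifP => _; last by rewrite mulg1.
  by apply: val_inj => /=; case: (w) rw => [|d w0] //= /andP[/negPf->].
 have gs : joined r g (g * stdgen b c).
  apply: (joined_walk (wd_walk genS _ _)).
  have gL : wd g (g * stdgen b c) <= L by rewrite -{1}[g]mulg1 (wdM genS).
  have := BP g a ga; lia.
 by rewrite mulgA; apply: join_trans gs (IHw _ _ _); rewrite !ffunE (negPf ab) mulg1.
pose T := leg_word B.+1 ord0; have TB : B < size (val T) by rewrite /= size_nseq.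
pose fill (s : seq 'I_n) g : gpow F2 n := [ffun k => if k \in s then T else g k].
have fillP s g a : a \notin s -> B < size (val (g a)) -> joined r g (fill s g).
 move=> + ga; elim: s => [_|b s IHs]; first by exists 0; apply/ffunP => k; rewrite ffunE.
 rewrite inE negb_or => /andP[ab /[dup] as_ /IHs]; move/join_trans; apply.
 have -> : fill (b :: s) g = (fill s g * single b ((fill s g b)^-1 * T))%g.
  by apply/ffunP => k; rewrite !ffunE inE; case: eqVneq => [->|_]; rewrite ?mulVKg ?mulg1.
 by apply: step ab _; rewrite ffunE (negPf as_).
have big g a : B < size (val (g a)) -> joined r g [ffun=> T].
 move=> ga; have [b ba] : exists b, b != a by have [ia|] := eqVneq i a; [exists j; rewrite eq_sym -ia|exists i].
 (* All coordinates except [a] are filled first, shielded by [a]; then [a] itself, shielded by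
    [b]. *)
 have h1 := fillP (rem a (enum 'I_n)) g a; have h2 := fillP [:: a] (fill (rem a (enum 'I_n)) g) b.
 have mem c : (c \in rem a (enum 'I_n)) = (c != a) by rewrite mem_rem_uniq ?enum_uniq // inE mem_enum andbT.
 have -> : [ffun=> T] = fill [:: a] (fill (rem a (enum 'I_n)) g) :> gpow F2 n.
  by apply/ffunP => c; rewrite !ffunE inE mem; case: eqP.
 apply: join_trans (h1 _ ga) (h2 _ _); rewrite ?mem ?eqxx ?inE // ffunE mem ba //.
have toT k : joined r (x k) [ffun=> T].
 have [_ inf] := xP k; have [y [xy [a ya]]] : exists y, joined r (x k) y /\ exists a, B < size (val (y a)).
  by apply: contrapT => no; apply: inf; apply: sub_finite_set (size_ball genS B) => y xy a; rewrite leqNgt; apply/negP =>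
   ya; apply: no; exists y; split=> //; exists a.
 exact: join_trans (big y a ya).
apply: (xj ord0 ord_max) => //; apply: join_trans (toT _) (joined_sym (toT _)).
Qed.

(** Cancellation by a shorter word cannot reach the first letter. *)
Lemma head_keep (y s : F2) : size (val s) < size (val y) -> ohead (val (y * s)%g) = ohead (val y).
Proof.
case: s => s rs; elim: s rs y => [|c s IHs] rs y ys.
 congr ohead; exact: foldr_push_nil (valP y).
have rs' : reduced s by exact: path_sorted rs.
have -> : exist _ (c :: s) rs = (lword c * exist _ s rs')%g.
 by apply: val_inj => /=; move: (rs); case: (s) => [|d s0] //= /andP[/negPf->].
have y1 : y = (y * lword c * (lword c)^-1)%g by rewrite mulgK.
rewrite mulgA IHs; last first.
 have := size_mul (y * lword c)%g (lword c)^-1%g; rewrite -y1 size_inv -[size (val (lword c))]/1 -[size (val (exist _ s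
  rs'))]/(size s) => h.
 by have := leq_trans ys h; rewrite addn1.
case yE : (ohead (val y)) => [b|]; last by move: yE ys; case: (val y).
apply/eqP; rewrite head_letter yE eqxx andbT; case: eqP => [y0|_]; first by rewrite y0 in yE.
by apply: contraTneq ys => ->.
Qed.

(** Outside a large ball multiplication by an element of [S] keeps the first letter, so the three
    legs lie in different components; each component is infinite, as it contains all high powers. *)
Lemma three_ended i : (forall j, j = i) -> at_least_ends S 3.
Proof.
move=> all_i; have [M MP] : exists M, forall s, s \in S -> size (val (s i)) <= M.
 elim: (S) => [|s s' [M MP]]; first by exists 0.
 exists (maxn (size (val (s i))) M) => s1; rewrite leq_max => /predU1P[->|/MP->]; rewrite ?leqnn ?orbT //.
have [r rP] := nat_bound (wd 1) (size_ball genS M).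
have big g : outside S r g -> M < size (val (g i)).
 rewrite /outside => gr; rewrite ltnNge; apply/negP => gM; have : wd 1 g <= r by apply: rP => j; rewrite (all_i j).
 by rewrite leqNgt gr.
have headP g h : joined r g h -> ohead (val (g i)) = ohead (val (h i)).
 move=> [k]; elim: k g => [|k IHk] g /=; first by move=> ->.
 move=> [z [[s sS gz] /big gM /big zM] /IHk <-]; case: gz => ->; rewrite ffunE head_keep //;
 by apply: leq_ltn_trans (MP s sS) _.
pose x (j : 'I_3) k := single i (leg_word k j).
have [L LP] := @nat_bound 'I_3 setT (fun c => wd 1 (x c 1)) finite_finset.
have [B BP] := far_word (r + L).
have xsize (j : 'I_3) k : size (val (x j k i)) = k by rewrite ffunE eqxx size_nseq.
have far (j : 'I_3) k : r + L < wd 1 (x j (B.+1 + k)) by apply: (BP _ i); rewrite xsize; lia.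
have xj (j : 'I_3) k : joined r (x j B.+1) (x j (B.+1 + k)).
 elim: k => [|k IHk]; first by rewrite addn0; exists 0.
 apply: join_trans IHk (joined_walk (wd_walk genS _ _) _).
 have -> : x j (B.+1 + k.+1) = (x j (B.+1 + k) * x j 1%N)%g.
  apply/ffunP => c; rewrite !ffunE; case: eqP => _; last by rewrite mulg1.
  by rewrite leg_wordD addnS addn1.
 rewrite -{1}[x j (B.+1 + k)]mulg1 (wdM genS _ 1).
 have := far j k; have := LP j I; lia.
exists r, (fun c => x c B.+1); split=> [j|j j' jj']; last first.
 move=> /headP; rewrite !ffunE eqxx => /Some_inj/leg_inj E; by rewrite E eqxx in jj'.
split; first by have := far j 0; rewrite addn0 /outside /=; lia.
move=> /(nat_bound (fun g => size (val (g i))))[D DP].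
have := DP _ (xj j D); rewrite xsize; lia.
Qed.

(** One factor has at least three ends, and two or more factors have fewer than two. *)
Lemma not_two_ended : 0 < n -> ~ two_ended S.
Proof.
move=> n0 [e2 e3]; pose i := Ordinal n0; apply/e3/(three_ended (i := i)) => j.
apply: contrapT => /eqP ji; exact: one_ended ji e2.
Qed.

End Ends.

(** * Assembling the bounds *)

Theorem corollary17 (R : realType) (n : nat) (hn : (1 <= n)%N)
    (S : seq (gpow F2 n)) (hS : generates S) :
  [/\ obdim R S = ((2 * n)%:R)%:E,
      updim R S = ((2 * n)%:R)%:E,
      actdim R (gpow F2 n) = ((2 * n)%:R)%:E &
  [/\ obdim R S = updim R S,
      updim R S = actdim R (gpow F2 n) &
      actdim R (gpow F2 n) = (2%:R%:E * gdim R (gpow F2 n))%E]].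
Proof.
case: n hn S hS => // k _ S genS; pose dim := fun j : nat => (j%:R : R)%:E.
(* With [n = k.+1] the obstructor has dimension [2n - 2], and [obdim] adds 2. *)
have ob : obstructor_maps_to R S k.*2 by have := free_power_obstructor R (isT : (0 < k.+1)%N) genS.
have up : updim_le R S (k.+1 + k.+1) := plane_updim R genS.
have two : (2 * k.+1)%:R%:E = dim (k.*2.+2) by rewrite /dim mul2n doubleS.
have kk : (k.+1 + k.+1)%N = k.*2.+2 by rewrite addnn doubleS.
have bound d W : obstructor_maps_to R S d -> forall e, contractible R W -> controlled R (word_dist S) e W -> (d.+2 <= e)%N.
 by move=> obd e; exact: obstructor_bound genS obd.
have lb (A : set nat) : (forall j, A j -> (k.*2.+2 <= j)%N) -> A k.*2.+2 ->
  ereal_inf [set x | exists2 j, A j & x = dim j] = (2 * k.+1)%:R%:E.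
 move=> Ale Ak; apply/eqP; rewrite two eq_le; apply/andP; split; first by apply: ereal_inf_lbound; exists k.*2.+2.
 by apply: le_ereal_inf_tmp => _ [j /Ale kj ->]; rewrite lee_fin ler_nat.
have updE : updim R S = (2 * k.+1)%:R%:E.
 apply: lb; last by rewrite -kk.
 by move=> j /(updim_controlled)[W [cW] /(_ genS)]; exact: bound ob j cW.
have actE : actdim R (gpow F2 k.+1) = (2 * k.+1)%:R%:E.
 apply: lb => [j [X [a [mX cX pa]]]|]; first by apply: (bound _ X ob j cX); exact: (action_controlled genS cX pa mX).
 exists (half_planes R k.+1), (@pact R k.+1); rewrite -kk; split; [exact: plane_manifold|exact: plane_contractible|].
 exact: pact_discontinuous genS.
have gdE : gdim R (gpow F2 k.+1) = dim k.+1.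
 apply/eqP; rewrite eq_le; apply/andP; split.
  apply: ereal_inf_lbound; exists k.+1 => //; exists (tpower R k.+1), (tree_cw R k.+1), (@tree_act R k.+1).
  split; [exact: tree_cw_dim|exact: tpower_contractible|exact: tree_act_discontinuous genS|exact: tree_act_cells].
 apply: le_ereal_inf_tmp => _ [j [X [C [a [[dimC _] cX pa perm]]]] ->]; rewrite lee_fin ler_nat.
 (* A complex of dimension [j] controls with [2j + 1], so [2k + 2 <= 2j + 1], and parity improves
    this to [k + 1 <= j]. *)
 have := bound _ X ob _ cX (cellular_controlled genS cX pa perm dimC); lia.
have obE : obdim R S = (2 * k.+1)%:R%:E.
 rewrite /obdim asboolF; last exact: (infinite_power ord0).
 rewrite asboolF; last exact: not_two_ended.
 apply/eqP; rewrite two eq_le; apply/andP; split; last by apply: ereal_sup_ubound; exists k.*2.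
 apply: ge_ereal_sup => _ [m obm ->]; rewrite lee_fin ler_nat -kk.
 (* Every obstructor mapping to the group is bounded by the product of planes, of dimension
    [k.+1 + k.+1]. *)
 by have [W [cW /(_ genS)]] := updim_controlled up; exact: bound obm _ cW.
rewrite obE updE actE gdE; do !split=> //.
by rewrite /dim -EFinM -natrM.
Qed.
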